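(* For each $n\ge 1$ let $p=p_n$ and $q=q_n$ be integers with $1\le p,q\le n$. Let $\boldsymbol{\Gamma}_n$ be an $n\times n$ random orthogonal matrix distributed according to the Haar (uniform) probability measure on the orthogonal group $O(n)$, let $\mathbf Z_n$ be the $p\times q$ upper-left submatrix of $\boldsymbol{\Gamma}_n$, and let $\mathbf G_n$ be a $p\times q$ matrix whose $pq$ entries are independent $N(0,1)$ random variables. Let $d(\sqrt n\mathbf Z_n,\mathbf G_n)$ denote any one of the following three quantities between the probability distribution $\mu_n$ of $\sqrt n\mathbf Z_n$ and the distribution $\nu_n$ of $\mathbf G_n$ (both viewed as probability measures on $\mathbb R^{pq}$): the total variation distance $\|\mu_n-\nu_n\|_{\rm TV}$, the Hellinger distance $H(\mu_n,\nu_n)$, or the Kullback–Leibler distance $D_{\rm KL}(\mu_n\|\nu_n)$. Then: (i) $\lim_{n\to\infty} d(\sqrt n\mathbf Z_n,\mathbf G_n)=0$ whenever $\lim_{n\to\infty} pq/n=0$; (ii) $\liminf_{n\to\infty} d(\sqrt n\mathbf Z_n,\mathbf G_n)>0$ whenever $\lim_{n\to\infty} pq/n=\sigma\in(0,\infty)$.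
   Context: For probability measures $\mu,\nu$ on $\mathbb R^m$ with Lebesgue densities $f,g$: $\|\mu-\nu\|_{\rm TV}=2\sup_{A}|\mu(A)-\nu(A)|=\int|f-g|\,dx$; $H^2(\mu,\nu)=\frac12\int(\sqrt f-\sqrt g)^2\,dx$; $D_{\rm KL}(\mu\|\nu)=\int \frac{d\mu}{d\nu}\log\frac{d\mu}{d\nu}\,d\nu$. *)

(* Defs.v *)
From HB Require Import structures.
From mathcomp Require Import all_boot all_order all_algebra.
From mathcomp Require Import all_classical all_reals all_analysis.
Import Order.TTheory GRing.Theory Num.Theory.

Set Implicit Arguments.
Unset Strict Implicit.
Unset Printing Implicit Defensive.

Local Open Scope classical_set_scope.
Local Open Scope ring_scope.

(* R^k is represented by the type k.-tuple R equipped with the library's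
   product sigma-algebra (= Borel sigma-algebra of R^k).
   Matrices are flattened row-major: entry (i,j) of an m x k matrix is
   coordinate i*k + j.                                                 *)

Definition mx_of_tuple (R : realType) (n : nat) (t : (n * n).-tuple R)
  : 'M[R]_n := \matrix_(i < n, j < n) nth 0 (val t) (i * n + j)%N.

Definition orthogonal_mx (R : realType) (n : nat) (M : 'M[R]_n) : Prop :=
  M *m M^T = 1%:M.

(* h is the Haar (uniform) probability measure on O(n), seen as a Borel
   probability measure on R^(n*n): it is carried by O(n) and is invariant
   under left multiplication by orthogonal matrices (by uniqueness of Haar
   measure on the compact group O(n) this characterizes it). *)
Definition is_haar_On (R : realType) (n : nat)
    (h : probability ((n * n).-tuple R) R) : Prop :=
  h [set t | orthogonal_mx (mx_of_tuple t)] = 1%E /\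
  forall (g : 'M[R]_n), orthogonal_mx g ->
  forall (B : set 'M[R]_n), measurable [set t | B (mx_of_tuple t)] ->
    h [set t | B (g *m mx_of_tuple t)] = h [set t | B (mx_of_tuple t)].

(* sqrt(n) times the p x q upper-left block of the n x n matrix (encoded
   by t), flattened row-major into R^(p*q).  (For p, q <= n coordinate
   k = i*q + j of the result is sqrt(n) * Gamma_{ij}.) *)
Definition scaled_block (R : realType) (n p q : nat) (t : (n * n).-tuple R)
  : (p * q).-tuple R :=
  [tuple Num.sqrt (n%:R) * nth 0 (val t) ((k %/ q) * n + k %% q)%N
  | k < p * q].

Definition is_law_of_scaled_block (R : realType) (n p q : nat)
    (h : probability ((n * n).-tuple R) R)
    (mu : probability ((p * q).-tuple R) R) : Prop :=
  forall A : set ((p * q).-tuple R), measurable A ->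
    mu A = h [set t | A (scaled_block p q t)].

(* nu is the law of a vector of k independent N(0,1) random variables:
   the product of k copies of the standard normal law (determined by its
   values on measurable rectangles). *)
Definition is_std_gaussian (R : realType) (k : nat)
    (nu : probability (k.-tuple R) R) : Prop :=
  forall A : 'I_k -> set R, (forall i, measurable (A i)) ->
    nu [set t | forall i, A i (tnth t i)] =
    (\big[*%E/1%E]_(i < k) normal_prob 0 1 (A i))%E.

Section distances.
Context (R : realType) (d : measure_display) (T : measurableType d).
Local Open Scope ereal_scope.

Definition TV_dist (mu nu : probability T R) : \bar R :=
  2%:E * ereal_sup [set `|mu A - nu A| | A in measurable].

Definition msum2 (mu nu : probability T R) : set T -> \bar R :=
  measure_add mu nu.

HB.instance Definition _ (mu nu : probability T R) :=
  Measure.on (msum2 mu nu).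

Lemma msum2_fin (mu nu : probability T R) : fin_num_fun (msum2 mu nu).
Proof.
move=> A mA; rewrite /msum2 /measure_add /msum big_ord_recr /= big_ord_recr
  /= big_ord0 add0e.
by rewrite fin_numD !fin_num_measure.
Qed.

HB.instance Definition _ (mu nu : probability T R) :=
  @Measure_isFinite.Build _ T R (msum2 mu nu) (@msum2_fin mu nu).

Definition dens_l (mu nu : probability T R) : T -> R :=
  fun x => fine ((Radon_Nikodym (charge_of_finite_measure mu) (msum2 mu nu)) x).
Definition dens_r (mu nu : probability T R) : T -> R :=
  fun x => fine ((Radon_Nikodym (charge_of_finite_measure nu) (msum2 mu nu)) x).

(* H^2(mu,nu) = 1/2 \int (sqrt f - sqrt g)^2, f, g densities of mu, nu
   w.r.t. a common dominating measure (here mu + nu; the value does not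
   depend on this choice and agrees with the Lebesgue-density formula
   whenever Lebesgue densities exist) *)
Definition hellinger2 (mu nu : probability T R) : \bar R :=
  (1 / 2)%:E * \int[msum2 mu nu]_x
     ((Num.sqrt (dens_l mu nu x) - Num.sqrt (dens_r mu nu x)) ^+ 2)%:E.

(* Hellinger distance H = sqrt(H^2) (H^2 is in [0,1]) *)
Definition hellinger (mu nu : probability T R) : \bar R :=
  (Num.sqrt (fine (hellinger2 mu nu)))%:E.

Definition KL_div (mu nu : probability T R) : \bar R :=
  if pselect (mu `<< nu) is left _ then
    \int[nu]_x
      (let r := fine ((Radon_Nikodym (charge_of_finite_measure mu) nu) x) in
       (r * ln r)%R%:E)
  else +oo.

End distances.

Inductive dist_kind := DTV | DHellinger | DKL.

Definition prob_dist (k : dist_kind) (R : realType) (d : measure_display)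
  (T : measurableType d) (mu nu : probability T R) : \bar R :=
  match k with
  | DTV => TV_dist mu nu
  | DHellinger => hellinger mu nu
  | DKL => KL_div mu nu
  end.

(* Main.v *)
Require Import Defs.
From HB Require Import structures.
From mathcomp Require Import all_boot all_order all_algebra.
From mathcomp Require Import all_classical all_reals all_analysis.
From mathcomp Require Import measurable_realfun.
From mathcomp Require Import fingroup perm.
From mathcomp Require Import ring lra zify.
Import Order.TTheory GRing.Theory Num.Theory.
Import numFieldNormedType.Exports.
Set Implicit Arguments.
Unset Strict Implicit.
Unset Printing Implicit Defensive.
Local Open Scope classical_set_scope.
Local Open Scope ring_scope.

(* For (ii), compare the row Gram matrices of the first [a] and of the last [q - a]
   columns of the block: for the Haar law orthonormality correlates their fluctuations
   negatively, for the Gaussian law they are independent.  The resulting quartic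
   statistic separates the means by the order of the standard deviations as soon as
   [p * q / n] stays away from 0, and Chebyshev's argument bounds the total variation
   from below.

   For (i), a Haar matrix is [(1 + V) A(b) (1 + W)] with [V], [W] Haar of smaller size,
   [A(b)] a reflection of the first two coordinates and [b] the corner entry, whose law,
   identified by its moments, has density proportional to [(1 - b ^ 2) ^ ((N - 3) / 2)].
   Iterating, the [p * q] block is a function of [p * q] independent variables with an
   explicit triangular Jacobian.  Comparing densities in these coordinates bounds the
   relative entropy by [2 s ^ 2 + 2 s] with [s = p * q / N]; it dominates the other two
   distances. *)

(** * Image measures and powers of a measure *)

(** Left invariance and total mass on O(n) are all that is given about the Haar laws, so every fact
    about them is an averaging argument: right invariance comes from a double integral, negative
    correlation from exchangeable deviations with zero sum, the corner moments from an infinitesimal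
    rotation. The Haar laws of smaller size in the recursion for (i) are other members of the given
    family. The obstacle in (i) is precision: an error of order [(p + q) / N] at each of the [p * q]
    coordinates would leave [p * q * (p + q) / N], which need not tend to 0. Three facts save it.
    Once the Jacobian is divided out, the same exponent [n - p - q] is left at every coordinate.
    Bounding the logarithm by its tangent at the mean leaves a quadratic term whose expectation is
    explicit. A Wallis product gives a sharp bound on the normalising constants. The remaining
    double sum telescopes in one index and is summed by parts in the other, and its first-order
    terms cancel. The entropy estimate uses only one-sided inequalities between the densities and
    the Jacobian. *)

Section integral_map.
Context d1 d2 (X : measurableType d1) (Y : measurableType d2) (R : realType).
Variables (phi : X -> Y) (mu : {measure set X -> \bar R}).
Variables (nu : {measure set Y -> \bar R}).
Hypothesis mphi : measurable_fun setT phi.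
Hypothesis nuE : forall A, measurable A -> nu A = mu (phi @^-1` A).

Lemma ge0_integral_map (f : Y -> \bar R) : measurable_fun setT f ->
  (forall y, 0 <= f y)%E -> (\int[nu]_y f y = \int[mu]_x f (phi x))%E.
Proof.
move=> mf f0; transitivity (\int[pushforward mu phi]_(y in setT) f y)%E.
  by apply: eq_measure_integral => A mA _; exact: nuE.
by rewrite ge0_integral_pushforward.
Qed.

Lemma integral_map (f : Y -> \bar R) : measurable_fun setT f ->
  (\int[nu]_y f y = \int[mu]_x f (phi x))%E.
Proof.
move=> mf; rewrite [LHS]integralE [RHS]integralE.
rewrite !ge0_integral_map//; first by rewrite (funepos_comp f phi) (funeneg_comp f phi).
- exact: measurable_funeneg.
- exact: measurable_funepos.
Qed.

End integral_map.

Section image_measure.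
Context d1 d2 (X : measurableType d1) (Y : measurableType d2) (R : realType).
Variables (phi : X -> Y) (mphi : measurable_fun setT phi).
Variable mu : {measure set X -> \bar R}.

Definition image_measure of measurable_fun setT phi : set Y -> \bar R :=
  fun A => mu (phi @^-1` A).

Let image0 : image_measure mphi set0 = 0%E.
Proof. by rewrite /image_measure preimage_set0 measure0. Qed.

Let image_ge0 A : (0 <= image_measure mphi A)%E.
Proof. exact: measure_ge0. Qed.

Let image_sigma_additive : semi_sigma_additive (image_measure mphi).
Proof.
move=> F mF tF mUF; rewrite /image_measure preimage_bigcup.
apply: measure_semi_sigma_additive.
- by move=> k; rewrite -[X in measurable X]setTI; exact: mphi.
- apply/trivIsetP => /= i j _ _ ij; rewrite -preimage_setI.
  by move/trivIsetP : tF => /(_ _ _ _ _ ij) ->//; rewrite preimage_set0.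
- by rewrite -preimage_bigcup -[X in measurable X]setTI; exact: mphi.
Qed.

HB.instance Definition _ := isMeasure.Build _ _ _ (image_measure mphi)
  image0 image_ge0 image_sigma_additive.

End image_measure.

Section image_probability.
Context d1 d2 (X : measurableType d1) (Y : measurableType d2) (R : realType).
Variables (phi : X -> Y) (mphi : measurable_fun setT phi).
Variable P : probability X R.

Definition image_probability : set Y -> \bar R :=
  image_measure P mphi.

HB.instance Definition _ := Measure.copy image_probability
  (image_measure P mphi).

Let image_setT : image_probability setT = 1%E.
Proof.
rewrite /image_probability /image_measure preimage_setT.
exact: (@probability_setT _ _ _ P).
Qed.

HB.instance Definition _ := Measure_isProbability.Build _ _ _
  image_probability image_setT.

End image_probability.

Lemma measurable_fun_sqrtr d (T : measurableType d) (R : realType) (f : T -> R) :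
  measurable_fun setT f -> measurable_fun setT (fun x => Num.sqrt (f x)).
Proof.
move=> mf; apply: measurableT_comp => //; apply: continuous_measurable_fun.
exact: sqrt_continuous.
Qed.

Lemma ae_setT1 d (T : measurableType d) (R : realType) (P : probability T R)
    (A : set T) : measurable A -> P A = 1%E -> {ae P, forall x, A x}.
Proof.
move=> mA PA; exists (~` A); split => //; first exact: measurableC.
by rewrite probability_setC// PA subee.
Qed.

Section tuple_uniqueness.
Context d (T : measurableType d) (R : realType) (n : nat).

(** Rectangles are stable under intersection and generate the product sigma-algebra. This is what
    turns [is_std_gaussian], a condition on rectangles, into a description of the whole law. *)
Lemma tuple_measure_unique (m1 m2 : probability (n.-tuple T) R) :
  (forall A : 'I_n -> set T, (forall i, measurable (A i)) ->
    m1 [set t | forall i, A i (tnth t i)] =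
    m2 [set t | forall i, A i (tnth t i)]) ->
  forall A, measurable A -> m1 A = m2 A.
Proof.
move=> m12.
pose C : set (set (n.-tuple T)) :=
  [set C | exists2 A : 'I_n -> set T, (forall i, measurable (A i)) &
           C = [set t | forall i, A i (tnth t i)]].
have CT : C setT.
  exists (fun=> setT) => //; apply/seteqP; split => // t _ i //.
have CI : setI_closed C.
  move=> _ _ [A mA ->] [B mB ->]; exists (fun i => A i `&` B i).
    by move=> i; exact: measurableI.
  by apply/seteqP; split => [t [tA tB] i|t tAB];
    [split|split => i; have [] := tAB i].
apply: (measure_unique C (fun=> setT)) => //.
- apply/seteqP; split; last first.
    apply: smallest_sub; first exact: sigma_algebra_measurable.
    move=> _ [A mA ->].
    rewrite (_ : [set _ | _] = \bigcap_(i in setT)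
      ((fun t : n.-tuple T => tnth t i) @^-1` A i)); last first.
      by apply/seteqP; split => [t tA i _|t tA i]; [exact: tA|exact: (tA i I)].
    apply: fin_bigcap_measurable => // i _.
    by rewrite -[X in measurable X]setTI; exact: measurable_tnth.
  apply: smallest_sub; first exact: smallest_sigma_algebra.
  move=> B; rewrite -bigcup_seq => -[i _ [A mA <-]]; rewrite setTI.
  apply: sub_sigma_algebra.
  exists (fun j => if j == i then A else setT); first by move=> j; case: ifP.
  apply/seteqP; split => [t tA j|t /(_ i)]; last by rewrite eqxx.
  by case: eqVneq => // ->.
- by apply/seteqP; split => // t _; exists 0%N.
- by move=> _ [A mA ->]; exact: m12.
- by move=> k; apply: le_lt_trans (probability_le1 m1 measurableT) (ltry _).
Qed.

End tuple_uniqueness.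

Section powm.
Context d (T : measurableType d) (R : realType).

Definition tcons n (z : T * n.-tuple T) : n.+1.-tuple T :=
  [the n.+1.-tuple T of z.1 :: z.2].

Definition tbehead n (z : n.+1.-tuple T) : n.-tuple T := [tuple of behead z].

Lemma tconsK n (z : T * n.-tuple T) :
  thead (tcons z) = z.1 /\ tbehead (tcons z) = z.2.
Proof. by case: z => x y; split=> //; apply/val_inj. Qed.

Lemma tcons_eta n (z : n.+1.-tuple T) : z = tcons (thead z, tbehead z).
Proof. by rewrite [LHS](tuple_eta z); apply/val_inj. Qed.

Lemma measurable_tcons n : measurable_fun setT (@tcons n).
Proof. exact: measurable_cons. Qed.

Lemma measurable_thead n : measurable_fun setT (@thead n T).
Proof. exact: measurable_tnth. Qed.

Lemma measurable_tbehead n : measurable_fun setT (@tbehead n).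
Proof. exact: measurable_behead. Qed.

Lemma measurable_tcons2 d1 (X : measurableType d1) n (f : X -> T)
    (g : X -> n.-tuple T) : measurable_fun setT f -> measurable_fun setT g ->
  measurable_fun setT (fun x => tcons (f x, g x)).
Proof. exact: measurable_cons. Qed.

Section cons_measure.
Variables (m : {sigma_finite_measure set T -> \bar R}) (n : nat).
Variable P : {sigma_finite_measure set (n.-tuple T) -> \bar R}.

Definition cons_measure : set (n.+1.-tuple T) -> \bar R :=
  image_measure (m \x P)%E (@measurable_tcons n).

Let mcons := measurable_tcons.

HB.instance Definition _ := Measure.copy cons_measure
  (image_measure (m \x P)%E (@mcons n)).

Let cons_sigma_finite : sigma_finite setT cons_measure.
Proof.
have /sigma_finiteP[F [TF ndF Foo]] := sigma_finiteT m.
have /sigma_finiteP[G [TG ndG Goo]] := sigma_finiteT P.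
exists (fun k => [set z | F k (thead z) /\ G k (tbehead z)]).
  apply/seteqP; split => // z _.
  have : [set: T] (thead z) by [].
  have : [set: n.-tuple T] (tbehead z) by [].
  rewrite TF TG => -[k _ Gk] [j _ Fj]; exists (maxn j k) => //; split.
    by move: Fj; exact/subsetPset/ndF/leq_maxl.
  by move: Gk; exact/subsetPset/ndG/leq_maxr.
move=> k; have [mF Fk] := Foo k; have [mG Gk] := Goo k; split.
  apply: measurableI.
    by rewrite -[X in measurable X]setTI; exact: measurable_thead.
  by rewrite -[X in measurable X]setTI; exact: measurable_tbehead.
rewrite /cons_measure /image_measure (_ : _ @^-1` _ = F k `*` G k).
  suff : ((m \x P)%E (F k `*` G k) < +oo)%E by [].
  by rewrite product_measure1E// lte_mul_pinfty// ge0_fin_numE.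
by apply/seteqP; split => z /=; have [-> ->] := tconsK z; case: z.
Qed.

HB.instance Definition _ := Measure_isSigmaFinite.Build _ _ _ cons_measure
  cons_sigma_finite.

Lemma ge0_integral_cons_measure (f : n.+1.-tuple T -> \bar R) :
  measurable_fun setT f -> (forall y, 0 <= f y)%E ->
  (\int[cons_measure]_z f z = \int[m]_x \int[P]_y f (tcons (x, y)))%E.
Proof.
move=> mf f0.
rewrite (@ge0_integral_map _ _ _ _ _ (@tcons n) (m \x P)%E _ (@mcons n))//.
rewrite (fubini_tonelli1 (fun z => f (tcons z)))//.
by apply: measurableT_comp => //; exact: mcons.
Qed.

End cons_measure.

Variable m : {sigma_finite_measure set T -> \bar R}.

(** Built one head coordinate at a time, so that an integral over tuples unfolds exactly like the
    recursive coordinates of a block. Sigma-finiteness is carried along so that Tonelli applies at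
    each level. *)
Fixpoint powm n : {sigma_finite_measure set (n.-tuple T) -> \bar R} :=
  match n with
  | 0 => [the {sigma_finite_measure set (0.-tuple T) -> \bar R} of
          dirac [tuple]]
  | k.+1 => [the {sigma_finite_measure set (k.+1.-tuple T) -> \bar R} of
          cons_measure m (powm k)]
  end.

Lemma ge0_integral_powm0 (f : 0.-tuple T -> \bar R) :
  measurable_fun setT f -> (\int[powm 0]_z f z = f [tuple])%E.
Proof. by move=> mf; rewrite integral_dirac// diracT mul1e. Qed.

Lemma ge0_integral_powmS n (f : n.+1.-tuple T -> \bar R) :
  measurable_fun setT f -> (forall y, 0 <= f y)%E ->
  (\int[powm n.+1]_z f z = \int[m]_x \int[powm n]_y f (tcons (x, y)))%E.
Proof. exact: ge0_integral_cons_measure. Qed.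

Lemma measurable_tmap d2 (T2 : measurableType d2) n (phi : T -> T2) :
  measurable_fun setT phi ->
  measurable_fun setT (fun z : n.-tuple T => map_tuple phi z).
Proof.
move=> mphi; apply/measurable_fun_tnthP => i.
rewrite (_ : _ \o _ = fun z => phi (tnth z i)); last first.
  by apply/funext => z /=; rewrite tnth_map.
by apply: measurableT_comp => //; exact: measurable_tnth.
Qed.

(** A substitution that costs a factor [c] in one coordinate costs [c ^+ n] when applied to all [n].
    It serves for scalings of a column and, with columns as coordinates, for a linear map acting on
    every column. *)
Lemma ge0_integral_powm_map (phi : T -> T) (c : R) : 0 <= c ->
  measurable_fun setT phi ->
  (forall f : T -> \bar R, measurable_fun setT f -> (forall x, 0 <= f x)%E ->
    (\int[m]_x f (phi x) = c%:E * \int[m]_x f x)%E) ->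
  forall n (f : n.-tuple T -> \bar R), measurable_fun setT f ->
    (forall x, 0 <= f x)%E ->
    (\int[powm n]_z f (map_tuple phi z) = (c ^+ n)%:E * \int[powm n]_z f z)%E.
Proof.
move=> c0 mphi phiE; elim=> [|n IH] f mf f0.
  rewrite !ge0_integral_powm0//; last by apply: measurableT_comp => //;
    exact: measurable_tmap.
  by rewrite expr0 mul1e; congr f; apply/val_inj.
rewrite !ge0_integral_powmS//; last by apply: measurableT_comp => //;
    exact: measurable_tmap.
pose F x := (\int[powm n]_y f (tcons (x, y)))%E.
have mF : measurable_fun setT F.
  apply: (measurable_fun_fubini_tonelli_F (fun z => f (tcons z))) => //.
  by apply: measurableT_comp => //; exact: measurable_tcons.
have F0 x : (0 <= F x)%E by apply: integral_ge0.
transitivity (\int[m]_x ((c ^+ n)%:E * F (phi x)))%E.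
  apply: eq_integral => x _; rewrite -IH//; last first.
    by apply: measurableT_comp => //; exact: measurable_tcons2.
  by apply: eq_integral => y _; congr f; apply/val_inj.
rewrite ge0_integralZl//; last first.
  - by rewrite lee_fin exprn_ge0.
  - exact: measurableT_comp.
by rewrite phiE// muleA -EFinM -exprSr.
Qed.

End powm.

Section affine_substitution.
Context (R : realType).
Notation leb := (@lebesgue_measure R).

Lemma ge0_integral_affine (a s : R) (f : R -> \bar R) : 0 < s ->
  measurable_fun setT f -> (forall x, 0 <= f x)%E ->
  (\int[leb]_y f (a + s * y)%R = s^-1%:E * \int[leb]_y f y)%E.
Proof.
move=> s0 mf f0.
pose phi : measurableTypeR R -> measurableTypeR R := fun y => a + s * y.
have mphi : measurable_fun setT phi.
  by apply: (@measurable_funD _ (measurableTypeR R)) => //;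
    exact: (@measurable_funM _ (measurableTypeR R)).
have s0' : 0 <= s by exact: ltW.
(* Lebesgue measure is [s] times its image under [phi]: both agree on the intervals []x, y]]. *)
pose nu := mscale (NngNum s0') (image_measure leb mphi).
have nuE A : measurable A -> leb A = nu A.
  apply: (@lebesgue_measure_unique R (mscale (NngNum s0')
    (image_measure leb mphi))) => _ [[x y] _ <-] /=.
  rewrite /nu /mscale /image_measure /=.
  rewrite (_ : phi @^-1` `]x, y] = `](x - a) / s, (y - a) / s]%classic); last first.
    apply/seteqP; split => z; rewrite /phi /= !in_itv/= ltr_pdivrMr// ler_pdivlMr//;
      move=> /andP[h1 h2]; apply/andP; split; lra.
  rewrite !lebesgue_measure_itv/= !lte_fin ltr_pM2r ?invr_gt0// ltrD2r.
  case: ifP => _; last by rewrite mule0.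
  by rewrite -!EFinB -EFinM; congr EFin; field; rewrite gt_eqF.
have -> : (\int[leb]_y f y = s%:E * \int[image_measure leb mphi]_y f y)%E.
  rewrite -(ge0_integral_mscale _ measurableT (NngNum s0'))//.
  by apply: eq_measure_integral => A mA _; exact: nuE.
rewrite (@ge0_integral_map _ _ _ _ _ phi leb (image_measure leb mphi) mphi)//.
rewrite muleA -EFinM mulVf ?gt_eqF//.
by rewrite mul1e.
Qed.

End affine_substitution.

Section lebesgue_tuple.
Context (R : realType).

Let measurable_idR : measurable_fun setT (idfun : measurableTypeR R -> R).
Proof. exact: measurable_id. Qed.

(* Lebesgue measure transported to [R] with its default display, so that its
   powers live on the same measurable types as the laws of the theorem *)
Definition lebR : set R -> \bar R := image_measure lebesgue_measure measurable_idR.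

HB.instance Definition _ := Measure.copy lebR
  (image_measure lebesgue_measure measurable_idR).

Let lebR_sigma_finite : sigma_finite setT lebR.
Proof. by have [F FT Foo] := sigma_finiteT (@lebesgue_measure R); exists F. Qed.

HB.instance Definition _ := Measure_isSigmaFinite.Build _ _ _ lebR
  lebR_sigma_finite.

Lemma ge0_integral_lebR (f : R -> \bar R) : measurable_fun setT f ->
  (forall x, 0 <= f x)%E ->
  (\int[lebR]_x f x = \int[lebesgue_measure]_x f x)%E.
Proof.
by move=> mf f0; rewrite (@ge0_integral_map _ _ _ _ _ _
  lebesgue_measure lebR measurable_idR).
Qed.

Lemma ge0_integral_lebR_affine (a s : R) (f : R -> \bar R) : 0 < s ->
  measurable_fun setT f -> (forall x, 0 <= f x)%E ->
  (\int[lebR]_y f (a + s * y)%R = s^-1%:E * \int[lebR]_y f y)%E.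
Proof.
move=> s0 mf f0; rewrite !ge0_integral_lebR//; first exact: ge0_integral_affine.
by apply: measurableT_comp => //; exact: measurable_funD.
Qed.

Definition lebt n : {sigma_finite_measure set (n.-tuple R) -> \bar R} :=
  powm lebR n.

(** A block is stored by columns, since the recursion removes one column at a time. *)
Definition lebtt p q : {sigma_finite_measure set (q.-tuple (p.-tuple R)) -> \bar R} :=
  powm (lebt p) q.

End lebesgue_tuple.

(** * Comparison of the three distances *)

Section integral_ge0_add.
Context d (T : measurableType d) (R : realType).
Variable mu : {measure set T -> \bar R}.
Local Open Scope ereal_scope.

(** The integral of [a] may be infinite. If that of [a + b] were finite, [a = (a + b) - b] would be
    integrable. The entropy integrand, whose integral can be [+oo], needs this form of
    additivity. *)
Lemma integral_ge0D_EFin (a b : T -> R) : measurable_fun setT a ->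
  (forall x, 0 <= a x)%R -> mu.-integrable setT (EFin \o b) ->
  \int[mu]_x (a x + b x)%:E = \int[mu]_x (a x)%:E + \int[mu]_x (b x)%:E.
Proof.
move=> ma a0 ib.
have mb : measurable_fun setT b by apply/measurable_EFinP; exact: measurable_int ib.
have [iafin|iainf] := ltP (\int[mu]_x (a x)%:E) +oo.
  have ia : mu.-integrable setT (EFin \o a).
    apply/integrableP; split; first exact/measurable_EFinP.
    by under eq_integral do rewrite /= ger0_norm//.
  by rewrite -integralD_EFin//; apply: eq_integral => x _; rewrite EFinD.
move: iainf; rewrite leye_eq => /eqP iainf; rewrite iainf.
have ifin : \int[mu]_x (b x)%:E \is a fin_num by exact: integrable_fin_num.
rewrite addye; last by apply: contraTN ifin => /eqP ->.
pose f x := (a x + b x)%R.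
have mf : measurable_fun setT f by exact: measurable_funD.
apply/eqP; rewrite -leye_eq leNgt; apply/negP => fy.
have : mu.-integrable setT (EFin \o f).
  apply/integrableP; split; first exact/measurable_EFinP.
  have fN : \int[mu]_x (EFin \o f)^\- x < +oo.
    apply: le_lt_trans (integral_funeneg_lt_pinfty measurableT ib).
    apply: ge0_le_integral => //.
    - by apply: measurable_funeneg; exact/measurable_EFinP.
    - by apply: measurable_funeneg; exact/measurable_EFinP.
    - move=> x _; apply: (@funeneg_le _ _ setT) => [y _|]; last exact: mem_set.
      by rewrite lee_fin lerDr a0.
  have fP : \int[mu]_x (EFin \o f)^\+ x < +oo.
    move: fy; rewrite integralE -/(EFin \o f).
    have [//|] := ltP (\int[mu]_x (EFin \o f)^\+ x) +oo.
    rewrite leye_eq => /eqP ->; rewrite addye// eqe_oppLR /=.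
    by rewrite lt_eqF.
  rewrite (eq_integral ((EFin \o f)^\+ \+ (EFin \o f)^\-)); last first.
    by move=> x _; have /(congr1 (@^~ x)) := fune_abse (EFin \o f).
  rewrite ge0_integralD//; first exact: lte_add_pinfty.
  - by apply: measurable_funepos; exact/measurable_EFinP.
  - by apply: measurable_funeneg; exact/measurable_EFinP.
move=> iff; have : mu.-integrable setT (EFin \o a).
  apply: (eq_integrable measurableT ((EFin \o f) \- (EFin \o b))).
    by move=> x _; rewrite /= -EFinB /f addrK.
  exact: integrableB.
by move=> /integrable_fin_num; rewrite iainf => /(_ measurableT).
Qed.

End integral_ge0_add.

Section distances.
Context (R : realType) (d : measure_display) (T : measurableType d).
Variables mu nu : probability T R.
Local Open Scope ereal_scope.
Let S := msum2 mu nu.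

Lemma msum2E A : S A = mu A + nu A.
Proof. by rewrite /S /msum2 measure_addE. Qed.

Lemma dominates_msum2l : mu `<< S.
Proof.
apply/null_content_dominatesP => A mA SA.
have /eqP : mu A + nu A = 0 by rewrite -msum2E.
by rewrite padde_eq0 ?measure_ge0// => /andP[/eqP].
Qed.

Lemma dominates_msum2r : nu `<< S.
Proof.
apply/null_content_dominatesP => A mA SA.
have /eqP : mu A + nu A = 0 by rewrite -msum2E.
by rewrite padde_eq0 ?measure_ge0// => /andP[_ /eqP].
Qed.

(** These versions of the densities are finite and nonnegative at every point; the charge
    derivatives in the definitions agree with them almost everywhere. *)
Let l x := fine (Radon_Nikodym_SigmaFinite.f mu S x).
Let r x := fine (Radon_Nikodym_SigmaFinite.f nu S x).

Let lE x : (l x)%:E = Radon_Nikodym_SigmaFinite.f mu S x.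
Proof.
by rewrite fineK//; exact: Radon_Nikodym_SigmaFinite.f_fin_num dominates_msum2l _.
Qed.

Let rE x : (r x)%:E = Radon_Nikodym_SigmaFinite.f nu S x.
Proof.
by rewrite fineK//; exact: Radon_Nikodym_SigmaFinite.f_fin_num dominates_msum2r _.
Qed.

Let l0 x : (0 <= l x)%R.
Proof.
by rewrite -lee_fin lE; exact: Radon_Nikodym_SigmaFinite.f_ge0 dominates_msum2l _.
Qed.

Let r0 x : (0 <= r x)%R.
Proof.
by rewrite -lee_fin rE; exact: Radon_Nikodym_SigmaFinite.f_ge0 dominates_msum2r _.
Qed.

Let il : (S : set T -> _).-integrable setT (EFin \o l).
Proof.
rewrite (_ : EFin \o l = Radon_Nikodym_SigmaFinite.f mu S).
  exact: Radon_Nikodym_SigmaFinite.f_integrable dominates_msum2l.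
by apply/funext => x; exact: lE.
Qed.

Let ir : (S : set T -> _).-integrable setT (EFin \o r).
Proof.
rewrite (_ : EFin \o r = Radon_Nikodym_SigmaFinite.f nu S).
  exact: Radon_Nikodym_SigmaFinite.f_integrable dominates_msum2r.
by apply/funext => x; exact: rE.
Qed.

Let ml : measurable_fun setT l.
Proof. by apply/measurable_EFinP; exact: measurable_int il. Qed.

Let mr : measurable_fun setT r.
Proof. by apply/measurable_EFinP; exact: measurable_int ir. Qed.

Let mu_dens (f : T -> \bar R) E : measurable E -> (forall x, 0 <= f x) ->
  measurable_fun E f -> \int[mu]_(x in E) f x = \int[S]_(x in E) (f x * (l x)%:E).
Proof.
move=> mE f0 mf; rewrite -(Radon_Nikodym_SigmaFinite.change_of_variables
  dominates_msum2l f0 mE mf).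
by apply: eq_integral => x _; rewrite lE.
Qed.

Let nu_dens (f : T -> \bar R) E : measurable E -> (forall x, 0 <= f x) ->
  measurable_fun E f -> \int[nu]_(x in E) f x = \int[S]_(x in E) (f x * (r x)%:E).
Proof.
move=> mE f0 mf; rewrite -(Radon_Nikodym_SigmaFinite.change_of_variables
  dominates_msum2r f0 mE mf).
by apply: eq_integral => x _; rewrite rE.
Qed.

Let muE A : measurable A -> mu A = \int[S]_(x in A) (l x)%:E.
Proof.
move=> mA; rewrite (Radon_Nikodym_SigmaFinite.f_integral dominates_msum2l mA).
by apply: eq_integral => x _; rewrite lE.
Qed.

Let nuE A : measurable A -> nu A = \int[S]_(x in A) (r x)%:E.
Proof.
move=> mA; rewrite (Radon_Nikodym_SigmaFinite.f_integral dominates_msum2r mA).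
by apply: eq_integral => x _; rewrite rE.
Qed.

Let hellinger2E : hellinger2 mu nu =
  (1 / 2)%:E * \int[S]_x ((Num.sqrt (l x) - Num.sqrt (r x)) ^+ 2)%:E.
Proof.
congr *%E; apply: ae_eq_integral => //.
- have ml' : measurable_fun setT (dens_l mu nu).
    apply: measurableT_comp => //.
    exact: (measurable_int _ (@Radon_Nikodym_integrable _ _ _
      (charge_of_finite_measure mu) (msum2 mu nu) dominates_msum2l)).
  have mr' : measurable_fun setT (dens_r mu nu).
    apply: measurableT_comp => //.
    exact: (measurable_int _ (@Radon_Nikodym_integrable _ _ _
      (charge_of_finite_measure nu) (msum2 mu nu) dominates_msum2r)).
  by apply/measurable_EFinP; apply: measurable_funX; apply: measurable_funB;
    exact: measurable_fun_sqrtr.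
- by apply/measurable_EFinP; apply: measurable_funX; apply: measurable_funB;
    exact: measurable_fun_sqrtr.
- have hl := ae_eq_Radon_Nikodym_SigmaFinite dominates_msum2l measurableT.
  have hr := ae_eq_Radon_Nikodym_SigmaFinite dominates_msum2r measurableT.
  apply: filterS2 hl hr => x hl hr _.
  by rewrite /dens_l /dens_r -hl// -hr.
Qed.

Lemma TV_dist_ge0 : 0 <= TV_dist mu nu.
Proof.
apply: mule_ge0; first by rewrite lee_fin.
apply: ereal_sup_ubound; exists set0; first exact: measurable0.
by rewrite !measure0 subee// abse0.
Qed.

Let int_lr : \int[S]_x (l x + r x)%:E = 2%:E.
Proof.
rewrite -[RHS](_ : 1 + 1 = _); last by rewrite -EFinD.
rewrite -{1}(@probability_setT _ _ _ mu) -(@probability_setT _ _ _ nu).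
rewrite muE// nuE// -integralD_EFin//.
Qed.

Lemma TV_dist_le_L1 : TV_dist mu nu <= \int[S]_x `|l x - r x|%:E.
Proof.
have iD : (S : set T -> _).-integrable setT (EFin \o (l \- r)%R).
  rewrite (_ : EFin \o _ = (EFin \o l) \- (EFin \o r)); first exact: integrableB.
  by apply/funext => x /=; rewrite EFinB.
have half A : measurable A ->
    mu A - nu A = \int[S]_(x in A) (l x - r x)%:E.
  move=> mA; rewrite muE// nuE// -integralB_EFin//; last 2 first.
  - exact: integrableS il.
  - exact: integrableS ir.
have le A : measurable A -> `|mu A - nu A| <= \int[S]_(x in A) `|l x - r x|%:E.
  move=> mA; rewrite half//; apply: le_trans (le_abse_integral _ mA _) _ => //.
  by apply: measurable_funTS; apply/measurable_EFinP; exact: measurable_funB.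
rewrite /TV_dist -lee_pdivlMl//; apply: ub_ereal_sup => _ [A mA <-].
(* The factor 2 is spent on [A] and on its complement, where the two measures differ by the same
   amount. *)
rewrite lee_pdivlMl// -[2%:E]/((1 + 1)%R%:E) EFinD muleDl//; last first.
  by rewrite abse_fin_num fin_numB !fin_num_measure.
have mAC := measurableC mA.
have ml_r : measurable_fun setT (fun x => `|l x - r x|%:E).
  by apply/measurable_EFinP; apply: measurableT_comp => //; exact: measurable_funB.
rewrite mul1e -[in leRHS](setvU A) (ge0_integral_setU _ mAC mA)//=; last 2 first.
- exact: measurable_funTS.
- by apply/disj_setPS => x [].
apply: leeD; last exact: le.
have := le _ mAC; apply: le_trans.
rewrite !probability_setC//.
have /fineK <- : mu A \is a fin_num by rewrite fin_num_measure.
have /fineK <- : nu A \is a fin_num by rewrite fin_num_measure.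
rewrite -!EFinB !abse_EFin lee_fin; set a := fine _; set b := fine _.
by rewrite (_ : (1 - a - (1 - b))%R = - (a - b))%R ?normrN//; ring.
Qed.

Let msq (f : T -> R) : measurable_fun setT f ->
  measurable_fun setT (fun x => (f x ^+ 2)%R).
Proof. exact: measurable_funX. Qed.

Let m_l_r : measurable_fun setT (fun x => `|l x - r x|%R).
Proof. by apply: measurableT_comp => //; exact: measurable_funB. Qed.

Let m_sl_sr : measurable_fun setT (fun x => ((Num.sqrt (l x) - Num.sqrt (r x)) ^+ 2)%R).
Proof.
by apply: msq; apply: measurable_funB; exact: measurable_fun_sqrtr.
Qed.

Let hellinger_int : \int[S]_x ((Num.sqrt (l x) - Num.sqrt (r x)) ^+ 2)%:E =
  (2 * fine (hellinger2 mu nu))%:E.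
Proof.
have h2 : \int[S]_x ((Num.sqrt (l x) - Num.sqrt (r x)) ^+ 2)%:E <= 2%:E.
  rewrite -int_lr; apply: ge0_le_integral => //.
  - by move=> x _; rewrite lee_fin sqr_ge0.
  - exact/measurable_EFinP.
  - by apply/measurable_EFinP; exact: measurable_funD.
  - move=> x _; rewrite lee_fin sqrrB !sqr_sqrtr//.
    have := sqrtr_ge0 (l x); have := sqrtr_ge0 (r x); nra.
have hfin : \int[S]_x ((Num.sqrt (l x) - Num.sqrt (r x)) ^+ 2)%:E \is a fin_num.
  rewrite ge0_fin_numE; first exact: le_lt_trans h2 (ltry _).
  by apply: integral_ge0 => x _; rewrite lee_fin sqr_ge0.
rewrite hellinger2E -(fineK hfin) -EFinM /=; congr EFin.
by rewrite mulrA mul1r divff// mul1r.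
Qed.

Lemma hellinger2_ge0 : (0 <= fine (hellinger2 mu nu))%R.
Proof.
have : (0 <= (2 * fine (hellinger2 mu nu))%:E).
  by rewrite -hellinger_int; apply: integral_ge0 => x _; rewrite lee_fin sqr_ge0.
by rewrite lee_fin pmulr_rge0.
Qed.

(** Write [|l - r|] as [|sqrt l - sqrt r| * (sqrt l + sqrt r)] and split the product by the
    arithmetic-geometric inequality with weight [e]; integration gives [H2 / e + 2 * e]. The choice
    [e = H] yields 3H, and for [H = 0] one lets [e] tend to 0. *)
Lemma TV_dist_le_hellinger : TV_dist mu nu <= 3%:E * hellinger mu nu.
Proof.
rewrite /hellinger; set H2 := fine _; set H := Num.sqrt H2.
have H20 : (0 <= H2)%R := hellinger2_ge0.
have HH : (H ^+ 2 = H2)%R by rewrite sqr_sqrtr.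
have step (e : R) : (0 < e)%R -> TV_dist mu nu <= (H2 / e + 2 * e)%:E.
  move=> e0; apply: le_trans TV_dist_le_L1 _.
  have -> : (H2 / e + 2 * e)%:E =
      \int[S]_x ((e^-1 / 2)%:E * ((Num.sqrt (l x) - Num.sqrt (r x)) ^+ 2)%:E +
                 e%:E * (l x + r x)%:E).
    have e1 : (0 <= e^-1 / 2)%R by rewrite divr_ge0 ?invr_ge0 ?ltW.
    have e2 : (0 <= e)%R by exact: ltW.
    have m1 : measurable_fun setT
        (fun x => ((Num.sqrt (l x) - Num.sqrt (r x)) ^+ 2)%:E).
      exact/measurable_EFinP.
    have m2 : measurable_fun setT (fun x => (l x + r x)%:E).
      by apply/measurable_EFinP; exact: measurable_funD.
    rewrite ge0_integralD//; last 4 first.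
    - by move=> x _; rewrite -EFinM lee_fin mulr_ge0 ?sqr_ge0.
    - exact: emeasurable_funM.
    - by move=> x _; rewrite -EFinM lee_fin mulr_ge0 ?addr_ge0.
    - exact: emeasurable_funM.
    rewrite ge0_integralZl//; last by move=> x _; rewrite lee_fin sqr_ge0.
    rewrite ge0_integralZl//; last by move=> x _; rewrite lee_fin addr_ge0.
    rewrite hellinger_int -/H2 int_lr -!EFinM -EFinD; congr EFin.
    by field; rewrite gt_eqF.
  apply: ge0_le_integral => //.
  - exact/measurable_EFinP.
  - apply: emeasurable_funD; apply: emeasurable_funM => //; apply/measurable_EFinP => //.
    exact: measurable_funD.
  - move=> x _; rewrite -!EFinM -EFinD lee_fin.
    set a := Num.sqrt (l x); set b := Num.sqrt (r x).
    have -> : l x = (a ^+ 2)%R by rewrite sqr_sqrtr.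
    have -> : r x = (b ^+ 2)%R by rewrite sqr_sqrtr.
    have a0 : (0 <= a)%R := sqrtr_ge0 _.
    have b0 : (0 <= b)%R := sqrtr_ge0 _.
    rewrite subr_sqr normrM (ger0_norm (addr_ge0 a0 b0)).
    rewrite -(real_normK (num_real (a - b))).
    set c := `|a - b|%R; have c0 : (0 <= c)%R by exact: normr_ge0.
    have h1 : (0 <= (c - e * (a + b)) ^+ 2)%R := sqr_ge0 _.
    have h2 : ((a + b) ^+ 2 <= 2 * (a ^+ 2 + b ^+ 2))%R.
      by have := sqr_ge0 (a - b)%R; nra.
    rewrite -subr_ge0.
    rewrite (_ : (_ - _)%R = ((c - e * (a + b)) ^+ 2 +
      e ^+ 2 * (2 * (a ^+ 2 + b ^+ 2) - (a + b) ^+ 2)) / (2 * e))%R; last first.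
      by field; rewrite gt_eqF.
    apply: divr_ge0; last by rewrite mulr_ge0// ltW.
    by rewrite addr_ge0// mulr_ge0 ?sqr_ge0// subr_ge0.
have [H0|H0] := ltP 0%R H.
  apply: le_trans (step H H0) _; rewrite -HH -EFinM lee_fin expr2 mulfK ?gt_eqF//.
  lra.
have {H0} H0 : H = 0%R by apply/eqP; rewrite eq_le H0 sqrtr_ge0.
rewrite H0 mule0; apply/lee_addgt0Pr => e e0.
have e20 : (0 < e / 2)%R by rewrite divr_gt0.
apply: le_trans (step _ e20) _.
rewrite -HH H0 add0e lee_fin expr0n mul0r add0r.
by rewrite mulrC divfK.
Qed.

(** With [y = sqrt w], the inequality [ln y >= 1 - y^-1] gives [w * ln w - w + 1 >= (y - 1) ^+ 2]
    pointwise. The left side integrates to the divergence and, by the chain rule for densities, the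
    right side to twice the squared Hellinger distance. *)
Lemma KL_div_ge_hellinger2 : (2 * fine (hellinger2 mu nu))%:E <= KL_div mu nu.
Proof.
rewrite /KL_div; case: pselect => [munu|_]; last by rewrite leey.
pose w x := fine (Radon_Nikodym_SigmaFinite.f mu nu x).
have wE x : (w x)%:E = Radon_Nikodym_SigmaFinite.f mu nu x.
  by rewrite fineK//; exact: Radon_Nikodym_SigmaFinite.f_fin_num munu _.
have w0 x : (0 <= w x)%R.
  by rewrite -lee_fin wE; exact: Radon_Nikodym_SigmaFinite.f_ge0 munu _.
have iw : nu.-integrable setT (EFin \o w).
  rewrite (_ : EFin \o w = Radon_Nikodym_SigmaFinite.f mu nu).
    exact: Radon_Nikodym_SigmaFinite.f_integrable munu.
  by apply/funext => x; exact: wE.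
have mw : measurable_fun setT w.
  by apply/measurable_EFinP; exact: (measurable_int _ iw).
have w1 : \int[nu]_x (w x)%:E = 1.
  under eq_integral do rewrite wE.
  by rewrite -Radon_Nikodym_SigmaFinite.f_integral//; exact: (@probability_setT _ _ _ mu).
have mwln : measurable_fun setT (fun x => (w x * ln (w x))%R).
  by apply: measurable_funM => //; apply: measurableT_comp => //; exact: measurable_ln.
have -> : \int[nu]_x (let r := fine
      ((Radon_Nikodym (charge_of_finite_measure mu) nu) x) in (r * ln r)%R%:E) =
    \int[nu]_x (w x * ln (w x))%:E.
  have hw := ae_eq_Radon_Nikodym_SigmaFinite munu measurableT.
  apply: ae_eq_integral => //; last first.
    by apply: filterS hw => x hw _ /=; rewrite /w hw.
  - exact/measurable_EFinP.
  - apply/measurable_EFinP.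
    have m1 : measurable_fun setT
       (fun x => fine (Radon_Nikodym (charge_of_finite_measure mu) nu x)).
      exact: measurableT_comp.
    by apply: measurable_funM => //; exact: measurableT_comp.
have lwr : ae_eq S setT (EFin \o l) (fun x => (w x)%:E * (r x)%:E).
  have := Radon_Nikodym_SigmaFinite.chain_rule munu dominates_msum2r measurableT.
  by apply: filterS => x h _; rewrite /= lE h// wE rE.
have sq_int : \int[S]_x ((Num.sqrt (l x) - Num.sqrt (r x)) ^+ 2)%:E =
    \int[nu]_x ((Num.sqrt (w x) - 1) ^+ 2)%:E.
  have mw2 : measurable_fun setT (fun x => ((Num.sqrt (w x) - 1) ^+ 2)%:E).
    apply/measurable_EFinP; apply: msq; apply: measurable_funB => //.
    exact: measurable_fun_sqrtr.
  rewrite nu_dens//; last by move=> x; rewrite lee_fin sqr_ge0.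
  apply: ae_eq_integral => //; first exact/measurable_EFinP.
    by apply: emeasurable_funM => //; exact/measurable_EFinP.
  apply: filterS lwr => x /(_ Logic.I) /=; rewrite -EFinM => -[->] _.
  rewrite -EFinM; congr EFin; rewrite sqrtrM//.
  by rewrite -[in RHS](sqr_sqrtr (r0 x)); ring.
rewrite -hellinger_int sq_int.
have key x : (0 <= w x * ln (w x) - w x + 1 - (Num.sqrt (w x) - 1) ^+ 2)%R.
  have [w_gt0|w_le0] := ltP 0%R (w x); last first.
    have -> : w x = 0%R by apply/eqP; rewrite eq_le w_le0 w0.
    by rewrite sqrtr0 mul0r; lra.
  set y := Num.sqrt (w x); have y0 : (0 < y)%R by rewrite sqrtr_gt0.
  have wy : w x = (y ^+ 2)%R by rewrite sqr_sqrtr// ltW.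
  have -> : ln (w x) = (2 * ln y)%R by rewrite wy expr2 lnM ?posrE// mulr2n mulrDl mul1r.
  have lny : (1 - y^-1 <= ln y)%R.
    have := @le_ln1Dx R (y^-1 - 1)%R.
    rewrite ltrBrDr addrC subrr invr_gt0 => /(_ y0).
    rewrite addrC subrK lnV ?posrE//; lra.
  have -> : (w x * (2 * ln y) - w x + 1 - (y - 1) ^+ 2 =
     2 * (y ^+ 2) * (ln y - (1 - y^-1)))%R by rewrite wy; field; rewrite gt_eqF.
  by rewrite mulr_ge0 ?subr_ge0// mulr_ge0// sqr_ge0.
have key2 x : (0 <= w x * ln (w x) - w x + 1)%R.
  by have := key x; have := sqr_ge0 (Num.sqrt (w x) - 1)%R; lra.
have iw1 : nu.-integrable setT (EFin \o (fun x => w x - 1)%R).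
  rewrite (_ : EFin \o _ = (EFin \o w) \- (cst 1)); last first.
    by apply/funext => x /=; rewrite EFinB.
  by apply: integrableB => //; exact: finite_measure_integrable_cst.
have mk : measurable_fun setT (fun x => w x * ln (w x) - w x + 1)%R.
  by apply: measurable_funD => //; exact: measurable_funB.
(* Subtracting [w - 1], whose integral is 0, makes the integrand nonnegative. *)
have -> : \int[nu]_x (w x * ln (w x))%:E =
    \int[nu]_x (w x * ln (w x) - w x + 1)%:E.
  transitivity (\int[nu]_x ((w x * ln (w x) - w x + 1) + (w x - 1))%:E).
    by apply: eq_integral => x _; congr EFin; ring.
  rewrite integral_ge0D_EFin//.
  suff -> : \int[nu]_x (w x - 1)%:E = 0 by rewrite adde0.
  rewrite integralB_EFin//; last exact: finite_measure_integrable_cst.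
  rewrite w1 (_ : \int[nu]_x 1 = 1) ?subee//.
  by rewrite integral_cst// mul1e; exact: (@probability_setT _ _ _ nu).
apply: ge0_le_integral => //.
- by move=> x _; rewrite lee_fin sqr_ge0.
- apply/measurable_EFinP; apply: msq; apply: measurable_funB => //.
  exact: measurable_fun_sqrtr.
- exact/measurable_EFinP.
- by move=> x _; rewrite lee_fin -subr_ge0.
Qed.

(** The event [r <= l] is extremal: the integrals of [|l - r|] over it and over its complement are
    both [mu A - nu A]. *)
Let L1_le_TV_dist : \int[S]_x `|l x - r x|%:E <= TV_dist mu nu.
Proof.
pose A := [set x | (r x <= l x)%R].
have mA : measurable A.
  rewrite (_ : A = (fun x => r x <= l x)%R @^-1` [set true]); last first.
    by apply/seteqP; split => x.
  by rewrite -[X in measurable X]setTI; apply: measurable_fun_ler.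
have mAC := measurableC mA.
have m1 : measurable_fun setT (fun x => `|l x - r x|%:E) by exact/measurable_EFinP.
rewrite -(setvU A) (ge0_integral_setU _ mAC mA)//; last 2 first.
- exact: measurable_funTS.
- by apply/disj_setPS => x [].
have -> : \int[S]_(x in ~` A) `|l x - r x|%:E = \int[S]_(x in ~` A) (r x - l x)%:E.
  apply: eq_integral => x /set_mem; rewrite /A /= => /negP; rewrite -ltNge => lr.
  by rewrite ltr0_norm ?subr_lt0// opprB.
have -> : \int[S]_(x in A) `|l x - r x|%:E = \int[S]_(x in A) (l x - r x)%:E.
  by apply: eq_integral => x /set_mem; rewrite /A /= => lr; rewrite ger0_norm ?subr_ge0.
rewrite !integralB_EFin//; [|exact: integrableS il|exact: integrableS ir|
  exact: integrableS ir|exact: integrableS il].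
rewrite -!muE// -!nuE// !probability_setC//.
have : `|mu A - nu A| <= ereal_sup [set `|mu A - nu A| | A in measurable].
  by apply: ereal_sup_ubound; exists A.
rewrite /TV_dist; set s := ereal_sup _ => hs.
have /fineK muA : mu A \is a fin_num by rewrite fin_num_measure.
have /fineK nuA : nu A \is a fin_num by rewrite fin_num_measure.
apply: (@le_trans _ _ (2%:E * `|mu A - nu A|)); last by rewrite lee_pmul2l.
rewrite -muA -nuA -!EFinB -EFinD -EFinM lee_fin.
by have := ler_norm (fine (mu A) - fine (nu A))%R; lra.
Qed.

(** Second moment method. The gap [b - a] is at most the integral of [|f| * |l - r|], hence at most
    [e * C + V / (2 * e)] where [V] is the total variation distance, by splitting [|f|] as
    [e / 2 * f ^+ 2 + (2 * e)^-1]. *)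
Lemma TV_dist_test (f : T -> R) (C a b : R) : measurable_fun setT f ->
  (0 < C)%R -> (a < b)%R ->
  \int[mu]_x (f x ^+ 2)%:E <= C%:E -> \int[nu]_x (f x ^+ 2)%:E <= C%:E ->
  \int[mu]_x (f x)%:E = a%:E -> \int[nu]_x (f x)%:E = b%:E ->
  ((b - a) ^+ 2 / (2 * C))%:E <= TV_dist mu nu.
Proof.
move=> mf C0 ab muC nuC mua nub.
(* The signed [f] is the difference of the nonnegative functions [g] and [h], so that the comparison
   runs on nonnegative integrals only. *)
pose h x := (f x ^+ 2 + 1)%R; pose g x := (h x + f x)%R.
have h0 x : (0 <= h x)%R by rewrite addr_ge0// sqr_ge0.
have g0 x : (0 <= g x)%R.
  by rewrite /g /h; have := sqr_ge0 (f x + 2^-1)%R; nra.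
have mf2 : measurable_fun setT (fun x => (f x ^+ 2)%R) by exact: measurable_funX.
have mh : measurable_fun setT h by exact: measurable_funD.
have mg : measurable_fun setT g by exact: measurable_funD.
have hE (P : probability T R) c : \int[P]_x (f x ^+ 2)%:E <= C%:E ->
    \int[P]_x (f x)%:E = c%:E -> exists2 v : R, \int[P]_x (h x)%:E = v%:E &
      \int[P]_x (g x)%:E = (v + c)%:E.
  move=> PC Pc.
  have P1 : \int[P]_x 1 = 1.
    by rewrite integral_cst// mul1e; exact: (@probability_setT _ _ _ P).
  have hf : \int[P]_x (h x)%:E \is a fin_num.
    rewrite ge0_fin_numE; last by apply: integral_ge0 => x _; rewrite lee_fin.
    rewrite /h; under eq_integral do rewrite EFinD.
    rewrite ge0_integralD//; last 2 first.
    - by move=> x _; rewrite lee_fin sqr_ge0.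
    - exact/measurable_EFinP.
    by rewrite P1 lte_add_pinfty ?ltry// (le_lt_trans PC) ?ltry.
  exists (fine (\int[P]_x (h x)%:E)); first by rewrite fineK.
  rewrite integral_ge0D_EFin//; first by rewrite Pc EFinD fineK.
  apply/integrableP; split; first exact/measurable_EFinP.
  apply: (@le_lt_trans _ _ (\int[P]_x (h x)%:E)); last by rewrite -ge0_fin_numE//;
    apply: integral_ge0 => x _; rewrite lee_fin.
  apply: ge0_le_integral => //.
  - by apply: measurableT_comp => //; exact/measurable_EFinP.
  - exact/measurable_EFinP.
  - move=> x _; rewrite /= lee_fin /h ler_norml.
    by have := sqr_ge0 (f x - 2^-1)%R; have := sqr_ge0 (f x + 2^-1)%R;
      move=> ? ?; apply/andP; split; nra.
have [hm hmE gmE] := hE _ _ muC mua.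
have [hn hnE gnE] := hE _ _ nuC nub.
have [TVy|TVfin] := eqVneq (TV_dist mu nu) +oo; first by rewrite TVy leey.
have TVf : TV_dist mu nu \is a fin_num.
  by rewrite ge0_fin_numE ?TV_dist_ge0// lt_neqAle TVfin leey.
set V := fine (TV_dist mu nu).
have VE : TV_dist mu nu = V%:E by rewrite fineK.
(* With this [e] the term [e * C] absorbs exactly half of the gap. *)
pose e := ((b - a) / (2 * C))%R.
have ba : (0 < b - a)%R by rewrite subr_gt0.
have e0 : (0 < e)%R by rewrite divr_gt0// mulr_gt0.
have e2 : (0 <= e / 2)%R by rewrite divr_ge0// ltW.
have ie : (0 <= (2 * e)^-1)%R by rewrite invr_ge0 mulr_ge0// ltW.
have mD (u v : T -> R) : measurable_fun setT u -> measurable_fun setT v ->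
    measurable_fun setT (fun x => (u x)%:E * (v x)%:E).
  by move=> mu' mv'; apply: emeasurable_funM; exact/measurable_EFinP.
have mE (u : T -> R) : measurable_fun setT u -> measurable_fun setT (fun x => (u x)%:E).
  by move=> mu'; exact/measurable_EFinP.
have main : \int[nu]_x (g x)%:E + \int[mu]_x (h x)%:E <=
    \int[mu]_x (g x)%:E + \int[nu]_x (h x)%:E +
    ((e / 2)%:E * (\int[mu]_x (f x ^+ 2)%:E + \int[nu]_x (f x ^+ 2)%:E) +
    ((2 * e)^-1)%:E * \int[S]_x `|l x - r x|%:E).
  rewrite !mu_dens ?nu_dens//; try (by move=> x; rewrite lee_fin ?sqr_ge0); try exact: mE.
  rewrite -!ge0_integralD//; try (by move=> x _; rewrite -EFinM lee_fin mulr_ge0 ?sqr_ge0);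
    try exact: mD.
  rewrite -!ge0_integralZl//; try (by move=> x _; rewrite -?EFinM -?EFinD lee_fin ?addr_ge0 ?mulr_ge0 ?sqr_ge0);
    try exact: mE; try (by apply: emeasurable_funD; exact: mD).
  rewrite -!ge0_integralD//; try (by move=> x _; rewrite -?EFinM -?EFinD -?EFinM ?lee_fin ?addr_ge0 ?mulr_ge0 ?addr_ge0 ?mulr_ge0 ?sqr_ge0).
  all: try by apply: emeasurable_funM => //; try (apply: emeasurable_funD; exact: mD); exact: mE.
  all: try by apply: emeasurable_funD; exact: mD.
  all: try by apply: emeasurable_funD; apply: emeasurable_funM => //;
     try (apply: emeasurable_funD; exact: mD); exact: mE.
  apply: ge0_le_integral => //.
  all: try by move=> x _; rewrite -?EFinM -?EFinD lee_fin ?addr_ge0 ?mulr_ge0.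
  all: try by apply: emeasurable_funD; exact: mD.
  - apply: emeasurable_funD; first by apply: emeasurable_funD; exact: mD.
    apply: emeasurable_funD; apply: emeasurable_funM => //; last exact: mE.
    by apply: emeasurable_funD; exact: mD.
  move=> x _; do ?[rewrite -EFinM|rewrite -EFinD]; rewrite lee_fin.
  rewrite /g; set F := f x; set H := h x.
  set L := l x; set Q := r x.
  have L0 : (0 <= L)%R := l0 x. have Q0 : (0 <= Q)%R := r0 x.
  set D := `|L - Q|%R.
  have D0 : (0 <= D)%R := normr_ge0 _.
  have DLQ : (D <= L + Q)%R by rewrite ler_norml; apply/andP; split; lra.
  have k1 : (F * (Q - L) <= `|F| * D)%R.
    apply: le_trans (ler_norm _) _; rewrite normrM /D distrC; exact: lexx.
  have k2 : (`|F| * D <= e / 2 * (F ^+ 2 * D) + (2 * e)^-1 * D)%R.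
    rewrite mulrA -mulrDl ler_wpM2r// -subr_ge0 -(real_normK (num_real F)).
    rewrite (_ : (_ - _)%R = (e * `|F| - 1) ^+ 2 / (2 * e))%R; last first.
      by field; rewrite gt_eqF.
    by rewrite divr_ge0 ?sqr_ge0// mulr_ge0// ltW.
  have k3 : (e / 2 * (F ^+ 2 * D) <= e / 2 * (F ^+ 2 * (L + Q)))%R.
    by rewrite ler_wpM2l// ler_wpM2l ?sqr_ge0.
  lra.
all: try by move=> x _; do ?[rewrite -EFinM|rewrite -EFinD]; rewrite lee_fin;
  do ?[exact: e2|exact: ie|exact: l0|exact: r0|exact: sqr_ge0|exact: normr_ge0|apply: addr_ge0|
       apply: mulr_ge0].
move: main; rewrite gnE hmE gmE hnE => main.
have e2' : 0 <= (e / 2)%:E by rewrite lee_fin.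
have ie' : 0 <= ((2 * e)^-1)%:E by rewrite lee_fin.
have main2 := le_trans main (leeD (lexx _) (leeD
  (lee_wpmul2l e2' (leeD muC nuC)) (lee_wpmul2l ie' L1_le_TV_dist))).
move: main2; rewrite VE; do ?[rewrite -EFinM|rewrite -EFinD].
rewrite lee_fin => main2.
rewrite lee_fin.
have h1 : (e * C = (b - a) / 2)%R by rewrite /e; field; rewrite gt_eqF.
have h2 : (b - a <= e * C + (2 * e)^-1 * V)%R by lra.
have h3 : ((b - a) / 2 <= (2 * e)^-1 * V)%R by lra.
have h4 : (V = 2 * e * ((2 * e)^-1 * V))%R by field; rewrite gt_eqF.
rewrite h4; apply: (@le_trans _ _ (2 * e * ((b - a) / 2))%R); last first.
  by rewrite ler_pM2l// mulr_gt0.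
by rewrite le_eqVlt; apply/orP; left; apply/eqP; rewrite /e; field; rewrite gt_eqF.
Qed.

End distances.

(** * Haar measure on orthogonal matrices *)

Section matrix_tuples.
Context (R : realType).
Implicit Types n : nat.

Definition tuple_of_mx n (M : 'M[R]_n.+1) : (n.+1 * n.+1).-tuple R :=
  [tuple M (inord (k %/ n.+1)) (inord (k %% n.+1)) | k < n.+1 * n.+1].

Lemma tuple_of_mxK n : cancel (@tuple_of_mx n) (@mx_of_tuple R n.+1).
Proof.
move=> M; apply/matrixP => i j; rewrite mxE.
have ltk : (i * n.+1 + j < n.+1 * n.+1)%N.
  by rewrite -ltn_divLR// divnMDl// divn_small// addn0 ltn_ord.
rewrite (_ : (i * n.+1 + j)%N = Ordinal ltk)// nth_mktuple /=.
by rewrite divnMDl// divn_small// addn0 modnMDl modn_small// !inord_val.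
Qed.

Lemma mx_of_tupleK n : cancel (@mx_of_tuple R n.+1) (@tuple_of_mx n).
Proof.
move=> t; apply: eq_from_tnth => k; rewrite tnth_mktuple mxE.
have k0 : (k %/ n.+1 < n.+1)%N by rewrite ltn_divLR.
by rewrite !inordK ?ltn_pmod// -divn_eq (tnth_nth 0).
Qed.

(* matrices carry no sigma-algebra: measurability of matrix-valued maps is
   entrywise, and measurability on matrices goes through [mx_of_tuple] *)
Definition mxmeasurable d (X : measurableType d) n (F : X -> 'M[R]_n.+1) :=
  forall i j, measurable_fun setT (fun x => F x i j).

Definition measurable_mx d (Y : measurableType d) n (f : 'M[R]_n.+1 -> Y) :=
  measurable_fun setT (fun t => f (mx_of_tuple t)).

Lemma mxmeasurable_mx_of_tuple n : mxmeasurable (@mx_of_tuple R n.+1).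
Proof.
move=> i j.
have ltk : (i * n.+1 + j < n.+1 * n.+1)%N.
  by rewrite -ltn_divLR// divnMDl// divn_small// addn0 ltn_ord.
rewrite (_ : (fun _ => _) = (fun t => tnth t (Ordinal ltk))).
  exact: measurable_tnth.
by apply/funext => t; rewrite mxE (tnth_nth 0).
Qed.

Lemma measurable_tuple_of_mx d (X : measurableType d) n (F : X -> 'M[R]_n.+1) :
  mxmeasurable F -> measurable_fun setT (fun x => tuple_of_mx (F x)).
Proof.
move=> mF; apply/measurable_fun_tnthP => k.
rewrite (_ : _ \o _ = fun x => F x (inord (k %/ n.+1)) (inord (k %% n.+1)))//.
by apply/funext => x /=; rewrite tnth_mktuple.
Qed.

Lemma measurable_mx_comp d (X : measurableType d) d' (Y : measurableType d') n
    (f : 'M[R]_n.+1 -> Y) (F : X -> 'M[R]_n.+1) :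
  measurable_mx f -> mxmeasurable F -> measurable_fun setT (fun x => f (F x)).
Proof.
move=> mf mF; rewrite (_ : (fun _ => _) =
    (fun t => f (mx_of_tuple t)) \o (fun x => tuple_of_mx (F x))).
  by apply: measurableT_comp => //; exact: measurable_tuple_of_mx.
by apply/funext => x /=; rewrite tuple_of_mxK.
Qed.

Lemma mxmeasurable_comp d (X : measurableType d) d' (Y : measurableType d') n
    (F : Y -> 'M[R]_n.+1) (g : X -> Y) :
  mxmeasurable F -> measurable_fun setT g -> mxmeasurable (F \o g).
Proof. by move=> mF mg i j; exact: (measurableT_comp (mF i j)). Qed.

Lemma mxmeasurable_cst d (X : measurableType d) n (M : 'M[R]_n.+1) :
  mxmeasurable (fun _ : X => M).
Proof. by move=> i j; exact: measurable_cst. Qed.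

Lemma mxmeasurable_mul d (X : measurableType d) n (F G : X -> 'M[R]_n.+1) :
  mxmeasurable F -> mxmeasurable G -> mxmeasurable (fun x => F x *m G x).
Proof.
move=> mF mG i j.
rewrite (_ : (fun _ => _) = (fun x => \sum_k F x i k * G x k j)).
  by apply: measurable_sum => k; exact: measurable_funM.
by apply/funext => x; rewrite mxE.
Qed.

Lemma mxmeasurable_tr d (X : measurableType d) n (F : X -> 'M[R]_n.+1) :
  mxmeasurable F -> mxmeasurable (fun x => (F x)^T).
Proof.
move=> mF i j; rewrite (_ : (fun _ => _) = (fun x => F x j i)) //.
by apply/funext => x; rewrite mxE.
Qed.

Lemma mxmeasurable_lift0 d (X : measurableType d) n (F : X -> 'M[R]_n.+1) :
  mxmeasurable F -> mxmeasurable (fun x => lift0_mx (F x) : 'M[R]_n.+2).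
Proof.
move=> mF i j.
case: (split_ordP (i : 'I_(1 + n.+1))) => u ->;
case: (split_ordP (j : 'I_(1 + n.+1))) => v ->.
- rewrite (_ : (fun _ => _) = cst ((1%:M : 'M[R]_1) u v)); first exact: measurable_cst.
  by apply/funext => x; exact: block_mxEul.
- rewrite (_ : (fun _ => _) = cst 0); first exact: measurable_cst.
  by apply/funext => x; rewrite (block_mxEur _ _ _ _ u v : lift0_mx (F x) _ _ = _) mxE.
- rewrite (_ : (fun _ => _) = cst 0); first exact: measurable_cst.
  by apply/funext => x; rewrite (block_mxEdl _ _ _ _ u v : lift0_mx (F x) _ _ = _) mxE.
- rewrite (_ : (fun _ => _) = (fun x => F x u v))//.
  by apply/funext => x; exact: block_mxEdr.
Qed.

Lemma measurable_mx_entry n (i j : 'I_n.+1) :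
  measurable_mx (fun M : 'M[R]_n.+1 => M i j).
Proof. exact: mxmeasurable_mx_of_tuple. Qed.

End matrix_tuples.

Section orthogonal_matrices.
Context (R : realType).

Lemma orthogonal_mxC n (M : 'M[R]_n) : orthogonal_mx M -> M^T *m M = 1%:M.
Proof. exact: mulmx1C. Qed.

Lemma orthogonal_mx_tr n (M : 'M[R]_n) : orthogonal_mx M -> orthogonal_mx M^T.
Proof. by move=> /orthogonal_mxC; rewrite /orthogonal_mx trmxK. Qed.

Lemma orthogonal_mxM n (M N : 'M[R]_n) :
  orthogonal_mx M -> orthogonal_mx N -> orthogonal_mx (M *m N).
Proof.
rewrite /orthogonal_mx => hM hN.
by rewrite trmx_mul mulmxA -(mulmxA M) hN mulmx1.
Qed.

Lemma orthogonal_mx1 n : orthogonal_mx (1%:M : 'M[R]_n).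
Proof. by rewrite /orthogonal_mx trmx1 mulmx1. Qed.

Lemma orthogonal_mx_lift0 n (M : 'M[R]_n) :
  orthogonal_mx M -> orthogonal_mx (lift0_mx M : 'M[R]_(1 + n)).
Proof.
rewrite /orthogonal_mx /lift0_mx => hM.
rewrite tr_block_mx mulmx_block !trmx0 trmx1 !mulmx0 !mul0mx hM mulmx1.
by rewrite !(addr0, add0r) -scalar_mx_block.
Qed.

Lemma orthogonal_mx_rows n (M : 'M[R]_n) (i j : 'I_n) : orthogonal_mx M ->
  \sum_k M i k * M j k = (i == j)%:R.
Proof.
move=> /matrixP /(_ i j); rewrite !mxE => <-.
by apply: eq_bigr => k _; rewrite mxE.
Qed.

Lemma orthogonal_mx_cols n (M : 'M[R]_n) (i j : 'I_n) : orthogonal_mx M ->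
  \sum_k M k i * M k j = (i == j)%:R.
Proof.
move=> /orthogonal_mx_tr/orthogonal_mx_rows <-.
by apply: eq_bigr => k _; rewrite !mxE.
Qed.

Lemma orthogonal_mx_le1 n (M : 'M[R]_n) (i j : 'I_n) : orthogonal_mx M ->
  `|M i j| <= 1.
Proof.
move=> /(orthogonal_mx_rows i i); rewrite eqxx (bigD1 j)//= => h.
rewrite -(@expr_le1 _ 2)// real_normK ?num_real// expr2 -[leRHS]h lerDl.
by apply: sumr_ge0 => k _; rewrite -expr2 sqr_ge0.
Qed.

Lemma orthogonal_mx_perm n (s : 'S_n) : orthogonal_mx (perm_mx s : 'M[R]_n).
Proof. by rewrite /orthogonal_mx tr_perm_mx -perm_mxM fingroup.mulgV perm_mx1. Qed.

End orthogonal_matrices.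

Section haar_invariance.
Context (R : realType) (n : nat).
Variable h : probability ((n.+1 * n.+1).-tuple R) R.
Hypothesis Hh : is_haar_On h.
Local Open Scope ereal_scope.
Let mxt := @mx_of_tuple R n.+1.

Lemma haar_orthogonal : {ae h, forall t, orthogonal_mx (mxt t)}.
Proof.
have [h1 _] := Hh; apply: ae_setT1 => //.
have mmxt : mxmeasurable mxt := @mxmeasurable_mx_of_tuple R n.
have mm := mxmeasurable_mul mmxt (mxmeasurable_tr mmxt).
rewrite (_ : (fun _ => _) = \bigcap_(i in setT) \bigcap_(j in setT)
   ((fun t => (mxt t *m (mxt t)^T) i j) @^-1` [set (1%:M : 'M[R]_n.+1) i j])).
  apply: fin_bigcap_measurable => // i _; apply: fin_bigcap_measurable => // j _.
  rewrite -[X in measurable X]setTI.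
  exact: (mm i j measurableT _ (measurable_set1 _)).
apply/seteqP; split=> [t + i _ j _|t H]; first by move=> /= ->.
by apply/matrixP => i j; exact: H.
Qed.

Lemma haar_left (g : 'M[R]_n.+1) (f : 'M[R]_n.+1 -> \bar R) :
  orthogonal_mx g -> measurable_mx f ->
  \int[h]_t f (g *m mxt t) = \int[h]_t f (mxt t).
Proof.
move=> og mf; have [_ inv] := Hh.
have mphi : measurable_fun setT (fun t => tuple_of_mx (g *m mxt t)).
  apply: measurable_tuple_of_mx; apply: mxmeasurable_mul.
    exact: mxmeasurable_cst.
  exact: mxmeasurable_mx_of_tuple.
rewrite [RHS](@integral_map _ _ _ _ _ _ h h mphi)//.
  by apply: eq_integral => t _; rewrite /mxt tuple_of_mxK.
move=> A mA.
pose B := [set M : 'M[R]_n.+1 | A (tuple_of_mx M)].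
have BE : [set t | B (mx_of_tuple t)] = A.
  by apply/seteqP; split => t; rewrite /B /= mx_of_tupleK.
by have := inv g og B; rewrite BE => /(_ mA) hB; exact: esym hB.
Qed.

End haar_invariance.

Section haar_transpose.
Context (R : realType) (n : nat).
Variable h : probability ((n.+1 * n.+1).-tuple R) R.
Hypothesis Hh : is_haar_On h.
Local Open Scope ereal_scope.
Let mxt := @mx_of_tuple R n.+1.

(* Evaluate the double integral of f(G1^T G2) in both orders: left invariance
   in G2 gives the law of G, left invariance in G1 that of its transpose. *)
Let haar_tr_ge0 (f : 'M[R]_n.+1 -> \bar R) : measurable_mx f ->
  (forall M, 0 <= f M) -> \int[h]_t f (mxt t)^T = \int[h]_t f (mxt t).
Proof.
move=> mf f0.
pose F (z : (n.+1 * n.+1).-tuple R * (n.+1 * n.+1).-tuple R) :=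
  f ((mxt z.1)^T *m mxt z.2).
have mmxt : mxmeasurable mxt := @mxmeasurable_mx_of_tuple R n.
have mF : measurable_fun setT F.
  apply: measurable_mx_comp => //; apply: mxmeasurable_mul.
    by apply: mxmeasurable_tr; exact: mxmeasurable_comp.
  exact: mxmeasurable_comp.
have F0 z : 0 <= F z by exact: f0.
have E1 : \int[h]_x \int[h]_y F (x, y) = \int[h]_t f (mxt t).
  transitivity (\int[h]_x (cst (\int[h]_t f (mxt t)) x)); last first.
    rewrite integral_cst// [X in _ * X](_ : _ = 1) ?mule1//.
    exact: (@probability_setT _ _ _ h).
  apply: ge0_ae_eq_integral => //.
  - exact: (measurable_fun_fubini_tonelli_F F mF F0).
  - by move=> x _; apply: integral_ge0 => y _; exact: f0.
  - by move=> x _; apply: integral_ge0 => y _; exact: f0.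
  - have := haar_orthogonal Hh; apply: filterS => x ox _ /=.
    exact: (haar_left Hh (orthogonal_mx_tr ox) mf).
have E2 : \int[h]_y \int[h]_x F (x, y) = \int[h]_t f (mxt t)^T.
  transitivity (\int[h]_x (cst (\int[h]_t f (mxt t)^T) x)); last first.
    rewrite integral_cst// [X in _ * X](_ : _ = 1) ?mule1//.
    exact: (@probability_setT _ _ _ h).
  apply: ge0_ae_eq_integral => //.
  - exact: (measurable_fun_fubini_tonelli_G F mF F0).
  - by move=> x _; apply: integral_ge0 => y _; exact: f0.
  - by move=> x _; apply: integral_ge0 => y _; exact: f0.
  - have := haar_orthogonal Hh; apply: filterS => y oy _ /=.
    have mft : measurable_mx (fun M : 'M[R]_n.+1 => f M^T).
      exact: (measurable_mx_comp mf (mxmeasurable_tr mmxt)).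
    rewrite -(haar_left Hh (orthogonal_mx_tr oy) mft).
    by apply: eq_integral => x _; rewrite /F /= trmx_mul trmxK.
by rewrite -E1 -E2 (fubini_tonelli F).
Qed.

(** On indicators the nonnegative case says that transposition preserves the law; signed [f] then
    follow as for any image measure. *)
Lemma haar_tr (f : 'M[R]_n.+1 -> \bar R) : measurable_mx f ->
  \int[h]_t f (mxt t)^T = \int[h]_t f (mxt t).
Proof.
move=> mf.
have mphi : measurable_fun setT (fun t => tuple_of_mx (mxt t)^T).
  apply: measurable_tuple_of_mx; apply: mxmeasurable_tr.
  exact: mxmeasurable_mx_of_tuple.
rewrite [RHS](@integral_map _ _ _ _ _ _ h h mphi)//.
  by apply: eq_integral => t _; rewrite /mxt tuple_of_mxK.
move=> A mA.
pose B := [set M : 'M[R]_n.+1 | A (tuple_of_mx M)].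
have BE t : (mxt t \in B) = (t \in A).
  by apply/idP/idP => /set_mem hB; apply/mem_set; move: hB; rewrite /B /= mx_of_tupleK.
have := @haar_tr_ge0 (fun M => (\1_B M)%:E).
have mB : measurable_fun setT (fun t => (\1_B (mxt t) : R)%:E).
  apply: (@eq_measurable_fun _ _ _ _ _ (fun t => (\1_A t : R)%:E)).
    by move=> t _; rewrite !indicE BE.
  by apply/measurable_EFinP; exact: measurable_indic.
have hE (D : set ((n.+1 * n.+1).-tuple R)) : measurable D ->
    \int[h]_t (\1_D t : R)%:E = h D by move=> mD; rewrite integral_indic// setIT.
move=> /(_ mB) trB.
transitivity (\int[h]_t (\1_A t : R)%:E); first exact: esym (hE _ mA).
transitivity (\int[h]_t (\1_B (mxt t) : R)%:E).
  by apply: eq_integral => t _; rewrite !indicE BE.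
rewrite -trB; last by move=> M; rewrite lee_fin indicE.
apply: etrans (hE _ _); last by rewrite -[X in measurable X]setTI; exact: mphi.
by apply: eq_integral => t _; rewrite !indicE; congr (_%:R%:E).
Qed.

(** [M *m g] is the transpose of [g^T *m M^T]. *)
Lemma haar_right (g : 'M[R]_n.+1) (f : 'M[R]_n.+1 -> \bar R) :
  orthogonal_mx g -> measurable_mx f ->
  \int[h]_t f (mxt t *m g) = \int[h]_t f (mxt t).
Proof.
move=> og mf.
have mft : measurable_mx (fun M : 'M[R]_n.+1 => f M^T).
  exact: (measurable_mx_comp mf (mxmeasurable_tr (@mxmeasurable_mx_of_tuple R n))).
have mfg : measurable_mx (fun M : 'M[R]_n.+1 => f (M *m g)).
  apply: (measurable_mx_comp mf); apply: mxmeasurable_mul.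
    exact: mxmeasurable_mx_of_tuple.
  exact: mxmeasurable_cst.
rewrite -(haar_tr mfg) -[RHS](haar_tr mf).
rewrite -(haar_left Hh (orthogonal_mx_tr og) mft).
by apply: eq_integral => t _; rewrite trmx_mul trmxK.
Qed.

End haar_transpose.

Section sums_delta.
Context (R : pzRingType) (I : finType).

Lemma sum_deltar (F : I -> R) (j : I) : \sum_i F i * (i == j)%:R = F j.
Proof.
rewrite (bigD1 j)//= eqxx mulr1 big1 ?addr0// => i /negbTE ->.
by rewrite mulr0.
Qed.

End sums_delta.

Section expectation_matrix.
Context (R : realType) (n : nat).
Variable h : probability ((n.+1 * n.+1).-tuple R) R.
Hypothesis Hh : is_haar_On h.
Let mxt := @mx_of_tuple R n.+1.
Implicit Types F G : 'M[R]_n.+1 -> R.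

(** The bound is asked on O(n) only, where entries are at most 1. The class is closed under sums and
    products, so every polynomial in the entries is integrable under the Haar law. *)
Definition bounded_mx F := measurable_mx F /\
  exists C : R, forall M, orthogonal_mx M -> `|F M| <= C.

Definition haar_expect F : R := \int[h]_t F (mxt t).

Lemma bounded_mx_cst c : bounded_mx (fun=> c).
Proof. by split; [exact: measurable_cst|exists `|c|]. Qed.

Lemma bounded_mx_entry i j : bounded_mx (fun M => M i j).
Proof.
split; first exact: measurable_mx_entry.
by exists 1 => M; exact: orthogonal_mx_le1.
Qed.

Lemma bounded_mxD F G : bounded_mx F -> bounded_mx G ->
  bounded_mx (fun M => F M + G M).
Proof.
move=> [mF [C FC]] [mG [D GD]]; split; first exact: measurable_funD.
exists (C + D) => M oM; apply: le_trans (ler_normD _ _) _.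
by apply: lerD; [exact: FC|exact: GD].
Qed.

Lemma bounded_mxM F G : bounded_mx F -> bounded_mx G ->
  bounded_mx (fun M => F M * G M).
Proof.
move=> [mF [C FC]] [mG [D GD]]; split; first exact: measurable_funM.
exists (C * D) => M oM; rewrite normrM.
by apply: ler_pM => //; [exact: FC|exact: GD].
Qed.

Lemma bounded_mxZ c F : bounded_mx F -> bounded_mx (fun M => c * F M).
Proof. by move=> bF; apply: bounded_mxM => //; exact: bounded_mx_cst. Qed.

Lemma bounded_mxN F : bounded_mx F -> bounded_mx (fun M => - F M).
Proof.
move=> /(bounded_mxZ (-1)) bF.
by rewrite (_ : (fun _ => _) = (fun M => -1 * F M)) //; apply/funext => M; rewrite mulN1r.
Qed.

Lemma bounded_mxB F G : bounded_mx F -> bounded_mx G ->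
  bounded_mx (fun M => F M - G M).
Proof. by move=> bF /bounded_mxN; exact: bounded_mxD. Qed.

Lemma bounded_mxX F k : bounded_mx F -> bounded_mx (fun M => F M ^+ k).
Proof.
move=> bF; elim: k => [|k IH].
  by under eq_fun do rewrite expr0; exact: bounded_mx_cst.
by under eq_fun do rewrite exprS; exact: bounded_mxM.
Qed.

Lemma bounded_mx_sum I (r : seq I) (P : pred I) (F : I -> 'M[R]_n.+1 -> R) :
  (forall i, bounded_mx (F i)) -> bounded_mx (fun M => \sum_(i <- r | P i) F i M).
Proof.
move=> bF; elim: r => [|i r IH].
  by under eq_fun do rewrite big_nil; exact: bounded_mx_cst.
under eq_fun do rewrite big_cons.
by case: (P i) => //; exact: bounded_mxD.
Qed.

Lemma integrable_bounded_mx F : bounded_mx F ->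
  h.-integrable setT (EFin \o (fun t => F (mxt t))).
Proof.
move=> [mF [C FC]]; apply/integrableP; split; first exact/measurable_EFinP.
apply: (@le_lt_trans _ _ (\int[h]_t (cst (`|C|)%:E t))%E).
  apply: ae_ge0_le_integral => //.
  - by apply: measurableT_comp => //; exact/measurable_EFinP.
  - by move=> t _; rewrite lee_fin.
  - have := haar_orthogonal Hh; apply: filterS => t ot _ /=.
    by rewrite lee_fin (le_trans (FC _ ot))// ler_norm.
rewrite integral_cst//; apply: (@le_lt_trans _ _ (`|C|%:E * 1)%E); last by rewrite mule1 ltry.
by rewrite lee_wpmul2l ?lee_fin//; exact: (@probability_le1 _ _ _ h).
Qed.

Lemma haar_expectE F : bounded_mx F ->
  (\int[h]_t (F (mxt t))%:E)%E = (haar_expect F)%:E.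
Proof.
move=> bF; rewrite /haar_expect /Rintegral fineK//.
by apply: (integrable_fin_num measurableT); exact: integrable_bounded_mx.
Qed.

Lemma haar_expectD F G : bounded_mx F -> bounded_mx G ->
  haar_expect (fun M => F M + G M) = haar_expect F + haar_expect G.
Proof. by move=> bF bG; apply: RintegralD => //; exact: integrable_bounded_mx. Qed.

Lemma haar_expectZ c F : bounded_mx F ->
  haar_expect (fun M => c * F M) = c * haar_expect F.
Proof. by move=> bF; apply: RintegralZl => //; exact: integrable_bounded_mx. Qed.

Lemma haar_expect_cst c : haar_expect (fun=> c) = c.
Proof.
rewrite /haar_expect Rintegral_cst//.
rewrite (_ : fine _ = 1) ?mulr1//.
exact: (congr1 fine (@probability_setT _ _ _ h)).
Qed.

Lemma haar_expectB F G : bounded_mx F -> bounded_mx G ->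
  haar_expect (fun M => F M - G M) = haar_expect F - haar_expect G.
Proof. by move=> bF bG; apply: RintegralB => //; exact: integrable_bounded_mx. Qed.

Lemma haar_expect_sum I (r : seq I) (P : pred I) (F : I -> 'M[R]_n.+1 -> R) :
  (forall i, bounded_mx (F i)) ->
  haar_expect (fun M => \sum_(i <- r | P i) F i M) =
  \sum_(i <- r | P i) haar_expect (F i).
Proof.
move=> bF; elim: r => [|i r IH].
  by under [in LHS]eq_fun do rewrite big_nil; rewrite big_nil haar_expect_cst.
rewrite big_cons; under [in LHS]eq_fun do rewrite big_cons.
case: (P i) => //; rewrite haar_expectD ?IH//.
exact: bounded_mx_sum.
Qed.

Lemma le_haar_expect F G : bounded_mx F -> bounded_mx G ->
  (forall M, orthogonal_mx M -> F M <= G M) -> haar_expect F <= haar_expect G.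
Proof.
move=> bF bG FG; rewrite -subr_ge0 -haar_expectB//.
have bGF := bounded_mxB bG bF.
rewrite -lee_fin -haar_expectE//.
have [mGF _] := bGF.
rewrite (@ae_eq_integral _ _ _ _ _ (fun t => `|G (mxt t) - F (mxt t)|%:E))//.
- by apply: integral_ge0 => t _; rewrite lee_fin.
- exact/measurable_EFinP.
- by apply/measurable_EFinP; apply: measurableT_comp.
- have := haar_orthogonal Hh; apply: filterS => t ot _ /=.
  by rewrite ger0_norm// subr_ge0 FG.
Qed.

Lemma eq_haar_expect F G : bounded_mx F -> bounded_mx G ->
  (forall M, orthogonal_mx M -> F M = G M) -> haar_expect F = haar_expect G.
Proof.
move=> bF bG FG; apply/eqP; rewrite eq_le !le_haar_expect// => M oM;
by rewrite FG.
Qed.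

Lemma haar_expect_right F (g : 'M[R]_n.+1) : orthogonal_mx g -> bounded_mx F ->
  haar_expect (fun M => F (M *m g)) = haar_expect F.
Proof.
move=> og [mF _]; congr fine.
have mF' : measurable_mx (fun M => (F M)%:E) by exact/measurable_EFinP.
exact: (haar_right Hh og mF').
Qed.

Lemma haar_expect_left F (g : 'M[R]_n.+1) : orthogonal_mx g -> bounded_mx F ->
  haar_expect (fun M => F (g *m M)) = haar_expect F.
Proof.
move=> og [mF _]; congr fine.
have mF' : measurable_mx (fun M => (F M)%:E) by exact/measurable_EFinP.
exact: (haar_left Hh og mF').
Qed.

End expectation_matrix.

Section half_rotation.
Context (R : realType) (n : nat) (j l : 'I_n).
Hypothesis jl : j != l.
Let c : R := Num.sqrt (2^-1).

Let c2 : c * c = 2^-1.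
Proof. by rewrite -expr2 sqr_sqrtr// invr_ge0. Qed.

Let g : 'M[R]_n := \matrix_(m, k)
  if k == j then c * ((m == j)%:R + (m == l)%:R) else
  if k == l then c * ((m == j)%:R - (m == l)%:R) else (m == k)%:R.

(** Mixing two columns at 45 degrees turns an off-diagonal entry of a quadratic form in the columns
    into half the difference of two diagonal entries. The matrix is symmetric, so orthogonality
    means that it squares to 1. *)
Lemma ex_half_rotation : exists2 g : 'M[R]_n, orthogonal_mx g &
  forall (G : 'M[R]_n) i k, (G *m g) i k =
    if k == j then c * (G i j + G i l) else
    if k == l then c * (G i j - G i l) else G i k.
Proof.
have gE (G : 'M[R]_n) i k : (G *m g) i k =
    if k == j then c * (G i j + G i l) else
    if k == l then c * (G i j - G i l) else G i k.
  rewrite mxE; under eq_bigr do rewrite mxE.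
  case: ifP => _.
    under eq_bigr do rewrite mulrCA mulrDr; rewrite -mulr_sumr big_split/=.
    by rewrite !sum_deltar.
  case: ifP => _.
    under eq_bigr do rewrite mulrCA mulrBr; rewrite -mulr_sumr sumrB/=.
    by rewrite !sum_deltar.
  by rewrite sum_deltar.
exists g => //; rewrite /orthogonal_mx.
have lj : (l == j) = false by rewrite eq_sym; exact: negbTE.
have -> : g^T = g.
  apply/matrixP => a b; rewrite !mxE.
  have [->|aj] := eqVneq a j; have [->|bj] := eqVneq b j => //.
  - by rewrite (negbTE jl); case: (b == l) => /=; ring.
  - rewrite (negbTE jl) (eq_sym j a) (negbTE aj).
    by case: (a == l) => /=; ring.
  - have [al|al] := eqVneq a l; have [bl|bl] := eqVneq b l => //=.
    + by rewrite al eq_sym (negbTE bl) subrr mulr0.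
    + by rewrite bl eq_sym (negbTE al) subrr mulr0.
    + by rewrite eq_sym.
apply/matrixP => a b; rewrite gE !mxE !eqxx lj.
have [->|bj] := eqVneq b j => /=.
  by rewrite -mulrDr mulrA c2; lra.
have [->|bl] := eqVneq b l => /=.
  by rewrite -mulrBr mulrA c2; lra.
by [].
Qed.

End half_rotation.

(** * Second moments of quadratic forms in the columns after the first [a] *)

Section exchangeable_columns.
Context (R : realType) (n : nat).
Variable h : probability ((n.+1 * n.+1).-tuple R) R.
Hypothesis Hh : is_haar_On h.
Local Notation E := (haar_expect h).
Local Notation MX := 'M[R]_n.+1.

Implicit Types j l : 'I_n.+1.
Variables (a : nat) (Mf : MX -> MX).
Hypothesis am : (a.+1 < n.+1)%N.
Hypothesis Mf_bounded : forall i j, bounded_mx (fun G => Mf G i j).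
Hypothesis Mf_sym : forall G, (Mf G)^T = Mf G.
Hypothesis Mf_cols : forall G G' : MX,
  (forall i j : 'I_n.+1, (j < a)%N -> G i j = G' i j) -> Mf G = Mf G'.

Let m : R := (n.+1 - a)%N%:R.

(** This is the form [Mf G] expressed in the frame of the columns of [G]; for orthogonal [G] it has
    the same Frobenius norm as [Mf G]. *)
Definition quad_cols (G : MX) (j l : 'I_n.+1) : R := (G^T *m Mf G *m G) j l.

Definition quad_mean (G : MX) : R :=
  (\sum_(j < n.+1 | (a <= j)%N) quad_cols G j j) / m.

Definition quad_dev (G : MX) (j : 'I_n.+1) : R := quad_cols G j j - quad_mean G.

Let W := quad_cols.
Let v := quad_dev.

Let m_card : \sum_(j < n.+1 | (a <= j)%N) (1 : R) = m.
Proof.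
by rewrite -(big_geq_mkord _ _ predT (fun=> 1)) sumr_const_nat.
Qed.

Let m_cst (c : R) : \sum_(j < n.+1 | (a <= j)%N) c = m * c.
Proof. by rewrite -m_card mulr_suml; apply: eq_bigr => j _; rewrite mul1r. Qed.

Let m_gt1 : 1 < m.
Proof. by rewrite /m ltr1n; lia. Qed.

Lemma quad_cols_sym G j l : quad_cols G j l = quad_cols G l j.
Proof.
rewrite /quad_cols -{1}[G^T *m Mf G *m G]trmxK mxE !trmx_mul trmxK Mf_sym.
by rewrite mulmxA.
Qed.

Let W_entry G j l : W G j l = \sum_i \sum_k G k j * Mf G k i * G i l.
Proof.
rewrite /W /quad_cols mxE; apply: eq_bigr => i _.
by rewrite mxE mulr_suml; apply: eq_bigr => k _; rewrite !mxE.
Qed.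

Lemma bounded_quad_cols j l : bounded_mx (fun G => quad_cols G j l).
Proof.
under eq_fun do rewrite [quad_cols _ _ _]W_entry.
apply: bounded_mx_sum => i; apply: bounded_mx_sum => k.
by apply: bounded_mxM; [apply: bounded_mxM|] => //; exact: bounded_mx_entry.
Qed.

Lemma bounded_quad_mean : bounded_mx quad_mean.
Proof.
apply: bounded_mxM; last exact: bounded_mx_cst.
by apply: bounded_mx_sum => j; exact: bounded_quad_cols.
Qed.

Lemma bounded_quad_dev j : bounded_mx (fun G => quad_dev G j).
Proof. by apply: bounded_mxB; [exact: bounded_quad_cols|exact: bounded_quad_mean]. Qed.

Lemma sum_quad_dev G : \sum_(j < n.+1 | (a <= j)%N) quad_dev G j = 0.
Proof.
rewrite /quad_dev sumrB m_cst /quad_mean mulrC divfK ?subrr// gt_eqF//.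
exact: lt_trans m_gt1.
Qed.

(** Exchanging two columns of index at least [a] leaves [Mf] unchanged, since [Mf] sees the first
    [a] columns only. *)
Let W_swap (x y : 'I_n.+1) G j l : (a <= x)%N -> (a <= y)%N ->
  W (G *m perm_mx (tperm x y)) j l = W G (tperm x y j) (tperm x y l).
Proof.
move=> ax ay; rewrite /W /quad_cols.
have GE : G *m perm_mx (tperm x y) = xcol x y G by rewrite xcolE.
rewrite GE (Mf_cols (G' := G)); last first.
  move=> i k ka; rewrite mxE tpermD//; apply/negP => /eqP xk.
    by move: ka; rewrite -xk ltnNge ax.
  by move: ka; rewrite -xk ltnNge ay.
rewrite !mxE; apply: eq_bigr => i _; rewrite !mxE; congr (_ * _).
by apply: eq_bigr => k _; rewrite !mxE.
Qed.

Let mean_swap (x y : 'I_n.+1) G : (a <= x)%N -> (a <= y)%N ->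
  quad_mean (G *m perm_mx (tperm x y)) = quad_mean G.
Proof.
move=> ax ay; congr (_ / _).
rewrite (eq_bigr (fun j => W G (tperm x y j) (tperm x y j))); last first.
  by move=> j _; exact: W_swap.
rewrite [RHS](reindex_inj (@perm_inj _ (tperm x y))) /=.
apply: eq_bigl => j; case: tpermP => [->|->|//]; first by rewrite ax ay.
by rewrite ax ay.
Qed.

Let v_swap (x y : 'I_n.+1) G j : (a <= x)%N -> (a <= y)%N ->
  v (G *m perm_mx (tperm x y)) j = v G (tperm x y j).
Proof. by move=> ax ay; rewrite /v /quad_dev [quad_cols _ _ _]W_swap// mean_swap. Qed.

(** By exchangeability the deviations share one mean, and they add up to 0. *)
Lemma haar_quad_dev j : (a <= j)%N -> E (fun G => quad_dev G j) = 0.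
Proof.
move=> aj.
have eqE (l : 'I_n.+1) : (a <= l)%N -> E (fun G => v G l) = E (fun G => v G j).
  move=> al; rewrite -(haar_expect_right Hh (orthogonal_mx_perm R (tperm j l))).
    by under eq_fun do rewrite v_swap// tpermR.
  exact: bounded_quad_dev.
have : \sum_(l < n.+1 | (a <= l)%N) E (fun G => v G l) = 0.
  rewrite -haar_expect_sum//; last exact: bounded_quad_dev.
  by under eq_fun do rewrite sum_quad_dev; rewrite haar_expect_cst.
rewrite (eq_bigr (fun=> E (fun G => v G j))); last by move=> l al; rewrite eqE.
rewrite m_cst => /eqP; rewrite mulf_eq0 => /orP[|/eqP//].
by rewrite gt_eqF// (lt_trans _ m_gt1).
Qed.

Let vv_swap (x y j l : 'I_n.+1) : (a <= x)%N -> (a <= y)%N ->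
  E (fun G => v G (tperm x y j) * v G (tperm x y l)) = E (fun G => v G j * v G l).
Proof.
move=> ax ay; rewrite -[RHS](haar_expect_right Hh (orthogonal_mx_perm R (tperm x y))).
  by congr haar_expect; apply/funext => G; rewrite !v_swap.
by apply: bounded_mxM; exact: bounded_quad_dev.
Qed.

Let vv_diag j l : (a <= j)%N -> (a <= l)%N ->
  E (fun G => v G l * v G l) = E (fun G => v G j * v G j).
Proof. by move=> aj al; rewrite -(vv_swap l l aj al) tpermR. Qed.

Let bvv j l : bounded_mx (fun G => v G j * v G l).
Proof. by apply: bounded_mxM; exact: bounded_quad_dev. Qed.

Let vv_ge0 j : 0 <= E (fun G => v G j * v G j).
Proof.
rewrite -(haar_expect_cst h 0); apply: le_haar_expect => //.
  exact: bounded_mx_cst.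
by move=> G _; rewrite -expr2 sqr_ge0.
Qed.

(** Multiply the zero sum of the deviations by one of them and take expectations: the [m - 1] equal
    covariances compensate a variance. *)
Lemma haar_quad_dev_neq j l : (a <= j)%N -> (a <= l)%N -> j != l ->
  E (fun G => quad_dev G j * quad_dev G l) <= 0.
Proof.
move=> aj al jl.
have eqE (k : 'I_n.+1) : (a <= k)%N -> k != j ->
    E (fun G => v G j * v G k) = E (fun G => v G j * v G l).
  move=> ak kj; rewrite -(vv_swap j k al ak) tpermR.
  by rewrite tpermD// eq_sym.
have : \sum_(k < n.+1 | (a <= k)%N) E (fun G => v G j * v G k) = 0.
  rewrite -haar_expect_sum//.
  under eq_fun do rewrite -mulr_sumr sum_quad_dev mulr0.
  by rewrite haar_expect_cst.
rewrite (bigD1 j)//= (eq_bigr (fun=> E (fun G => v G j * v G l) * 1)); last first.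
  by move=> k /andP[ak kj]; rewrite mulr1 eqE.
rewrite -mulr_sumr.
have -> : \sum_(k < n.+1 | (a <= k)%N && (k != j)) (1 : R) = m - 1.
  by rewrite -m_card [in RHS](bigD1 j)//= addrC addrK.
have := vv_ge0 j; have m1 : 0 < m - 1 by rewrite subr_gt0.
rewrite -[v]/quad_dev => h1 h2.
rewrite -(pmulr_lle0 _ m1) mulrC; lra.
Qed.

Lemma haar_sum_quad_dev_sqr (J : pred 'I_n.+1) j :
  (forall l, J l -> (a <= l)%N) -> (a <= j)%N ->
  E (fun G => (\sum_(l | J l) quad_dev G l) ^+ 2) <=
  #|J|%:R * E (fun G => quad_dev G j ^+ 2).
Proof.
move=> Ja aj.
under [in leLHS]eq_fun do rewrite expr2 big_distrlr /=.
under [in leRHS]eq_fun do rewrite expr2.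
rewrite haar_expect_sum//; last by move=> l; exact: bounded_mx_sum.
rewrite -sum1_card natr_sum mulr_suml; apply: ler_sum => l Jl.
rewrite haar_expect_sum// (bigD1 l)//= mul1r -(vv_diag (Ja _ Jl) aj).
rewrite gerDl; apply: sumr_le0 => k /andP[Jk kl].
by apply: haar_quad_dev_neq; [exact: Ja|exact: Ja|rewrite eq_sym].
Qed.

(** The 45 degree mixing of columns [j] and [l] sends [W j l] to [(v j - v l) / 2]. Its second
    moment is at least half of that of [v j], again because the covariance is nonpositive. *)
Let W_rot j l : (a <= j)%N -> (a <= l)%N -> j != l ->
  E (fun G => v G j ^+ 2) <= 2 * E (fun G => W G j l ^+ 2).
Proof.
move=> aj al jl.
have [g og gE] := ex_half_rotation R jl.
have c2 : Num.sqrt (2^-1 : R) * Num.sqrt (2^-1 : R) = 2^-1.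
  by rewrite -expr2 sqr_sqrtr// invr_ge0.
have Wg G : W (G *m g) j l = (v G j - v G l) / 2.
  rewrite /W /quad_cols (Mf_cols (G' := G)); last first.
    move=> i k ka; rewrite gE.
    have -> : (k == j) = false.
      by apply/negP => /eqP kj; move: ka; rewrite kj ltnNge aj.
    have -> // : (k == l) = false.
    by apply/negP => /eqP kj; move: ka; rewrite kj ltnNge al.
  have -> : v G j - v G l = W G j j - W G l l by rewrite /v /quad_dev /W; ring.
  have -> : ((G *m g)^T *m Mf G *m (G *m g)) j l =
      \sum_i \sum_k (G *m g) k j * Mf G k i * (G *m g) i l.
    rewrite mxE; apply: eq_bigr => i _.
    by rewrite mxE mulr_suml; apply: eq_bigr => k _; rewrite !mxE.
  have lj : (l == j) = false by rewrite eq_sym; exact: negbTE.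
  (* The added term vanishes by symmetry; with it the identity holds summand by summand. *)
  have -> : W G j j - W G l l = W G j j - W G l l + (W G l j - W G j l).
    by rewrite /W quad_cols_sym; ring.
  rewrite !W_entry -!sumrB -big_split/= mulr_suml; apply: eq_bigr => i _.
  rewrite -!sumrB -big_split/= mulr_suml; apply: eq_bigr => k _.
  rewrite !gE !eqxx lj.
  set c := Num.sqrt _; rewrite -/c in c2.
  rewrite (_ : _ * _ * (c * _) = c * c * ((G k j + G k l) * Mf G k i * (G i j - G i l))).
    by rewrite c2; field.
  by ring.
have -> : E (fun G => W G j l ^+ 2) = E (fun G => ((v G j - v G l) / 2) ^+ 2).
  rewrite -(haar_expect_right Hh og); first by under eq_fun do rewrite Wg.
  by apply: bounded_mxX; exact: bounded_quad_cols.
have -> : (fun G => ((v G j - v G l) / 2) ^+ 2) =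
    (fun G => 4^-1 * (v G j * v G j + v G l * v G l + -2 * (v G j * v G l))).
  by apply/funext => G; field.
have b1 := bvv j j; have b2 := bvv l l; have b3 := bvv j l.
rewrite haar_expectZ//; last by do !apply: bounded_mxD => //; exact: bounded_mxZ.
rewrite haar_expectD//; [|exact: bounded_mxD|exact: bounded_mxZ].
rewrite haar_expectD// haar_expectZ//.
under [in leLHS]eq_fun do rewrite expr2.
rewrite (vv_diag aj al).
have := haar_quad_dev_neq aj al jl.
by rewrite -[quad_dev]/v; lra.
Qed.

(** There are [m * (m - 1)] ordered pairs of distinct indices at least [a], each contributing half
    the variance by [W_rot], and all squared entries together are the Frobenius norm of [Mf G],
    which conjugation by [G] preserves. *)
Lemma haar_quad_dev_sqr j : (a <= j)%N ->
  m * (m - 1) * E (fun G => quad_dev G j ^+ 2) <=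
  2 * E (fun G => \sum_i \sum_k Mf G i k ^+ 2).
Proof.
move=> aj; set V := E _.
have bW x y : bounded_mx (fun G => W G x y ^+ 2).
  by apply: bounded_mxX; exact: bounded_quad_cols.
have bM : bounded_mx (fun G => \sum_i \sum_k Mf G i k ^+ 2).
  by apply: bounded_mx_sum => i; apply: bounded_mx_sum => k; exact: bounded_mxX.
have frob G : orthogonal_mx G ->
    \sum_x \sum_y W G x y ^+ 2 = \sum_i \sum_k Mf G i k ^+ 2.
  move=> oG.
  have sqE (A : MX) : \sum_x \sum_y A x y ^+ 2 = \tr (A *m A^T).
    rewrite /mxtrace; apply: eq_bigr => x _; rewrite mxE; apply: eq_bigr => y _.
    by rewrite mxE expr2.
  rewrite (sqE (Mf G)) (eq_bigr (fun x => \sum_y (G^T *m Mf G *m G) x y ^+ 2))//.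
  rewrite sqE !trmx_mul trmxK !mulmxA -(mulmxA (G^T *m Mf G)) oG mulmx1.
  by rewrite mxtrace_mulC !mulmxA oG mul1mx.
have -> : E (fun G => \sum_i \sum_k Mf G i k ^+ 2) =
    E (fun G => \sum_x \sum_y W G x y ^+ 2).
  apply: (eq_haar_expect Hh) => //; last by move=> G oG; rewrite frob.
  by apply: bounded_mx_sum => x; apply: bounded_mx_sum => y.
rewrite haar_expect_sum//; last by move=> x; exact: bounded_mx_sum.
under eq_bigr do rewrite haar_expect_sum//.
have W0 x y : 0 <= E (fun G => W G x y ^+ 2).
  rewrite -(haar_expect_cst h 0); apply: le_haar_expect => //.
    exact: bounded_mx_cst.
  by move=> G _; rewrite sqr_ge0.
have Vx (x : 'I_n.+1) : (a <= x)%N -> V = E (fun G => v G x ^+ 2).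
  move=> ax; rewrite /V; under eq_fun do rewrite expr2.
  by rewrite [LHS](vv_diag ax aj); under [in RHS]eq_fun do rewrite expr2.
rewrite mulr_sumr.
apply: (@le_trans _ _ (\sum_(x < n.+1 | (a <= x)%N) (m - 1) * V)).
  rewrite -mulr_sumr (eq_bigr (fun=> V * 1)); last by move=> *; rewrite mulr1.
  by rewrite le_eqVlt -mulr_sumr m_card; apply/orP; left; apply/eqP; ring.
rewrite [leRHS](bigID (fun x : 'I_n.+1 => (a <= x)%N))/=.
rewrite -[leLHS]addr0; apply: lerD; last first.
  by apply: sumr_ge0 => x _; rewrite mulr_ge0// sumr_ge0.
apply: ler_sum => x ax; rewrite mulr_sumr.
apply: (@le_trans _ _ (\sum_(y < n.+1 | (a <= y)%N && (y != x)) V)).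
  rewrite (eq_bigr (fun=> V * 1)); last by move=> *; rewrite mulr1.
  rewrite -mulr_sumr.
  have -> : \sum_(k < n.+1 | (a <= k)%N && (k != x)) (1 : R) = m - 1.
    by rewrite -m_card [in RHS](bigD1 x)//= addrC addrK.
  by rewrite mulrC.
rewrite [leRHS](bigID (fun y : 'I_n.+1 => (a <= y)%N && (y != x)))/=.
rewrite -[leLHS]addr0; apply: lerD; last first.
  by apply: sumr_ge0 => y _; rewrite mulr_ge0.
apply: ler_sum => y /andP[ay yx]; rewrite (Vx x ax).
by apply: W_rot => //; rewrite eq_sym.
Qed.

End exchangeable_columns.

(** * The quartic statistic and its moments under the Haar law *)

Section statistic.
Context (R : realType).
Implicit Types (g : nat -> nat -> R) (a b i k p q N : nat).

Definition gram_dev g a b i k : R :=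
  \sum_(a <= j < b) (g i j * g k j - (i == k)%:R).

(* Under the Haar law of [sqrt N] times a block, [quad_stat] has mean zero; the
   second term is the correction that the Gaussian law does not need. *)
Definition quad_stat a p q N g : R :=
  \sum_(i < p) \sum_(k < p) gram_dev g 0 a i k * gram_dev g a q i k +
  (q - a)%N%:R / (N - a)%N%:R * \sum_(i < p) \sum_(k < p) gram_dev g 0 a i k ^+ 2.

End statistic.

Section haar_statistic.
Context (R : realType) (n : nat).
Variable h : probability ((n.+1 * n.+1).-tuple R) R.
Hypothesis Hh : is_haar_On h.
Local Notation E := (haar_expect h).
Local Notation MX := 'M[R]_n.+1.
Let N : R := n.+1%:R.

Let N0 : N != 0. Proof. by rewrite pnatr_eq0. Qed.

Let cols_dev a (G : MX) (i k : 'I_n.+1) : R :=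
  \sum_(j < n.+1 | (j < a)%N) G i j * G k j - a%:R / N * (i == k)%:R.

(** The previous section is applied with no fixed column and with the constant form
    [(E_ik + E_ki) / 2], whose value on column [j] is [G i j * G k j] and whose squared Frobenius
    norm is at most 1. Orthonormality of the rows makes the mean over all columns
    [(i == k)%:R / N]. *)
Let cols_dev_sqr a (i k : 'I_n.+1) : (0 < n)%N -> (a <= n.+1)%N ->
  E (fun G => cols_dev a G i k ^+ 2) <= 2 * a%:R / (N * (N - 1)).
Proof.
move=> n0 an.
pose Mf (_ : MX) : MX := 2^-1 *: (delta_mx i k + delta_mx k i).
have Mfb x y : bounded_mx (fun G => Mf G x y) by exact: bounded_mx_cst.
have Mfs G : (Mf G)^T = Mf G.
  by rewrite /Mf linearZ linearD /= !trmx_delta addrC.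
have Mfc (G G' : MX) : (forall x y : 'I_n.+1, (y < 0)%N -> G x y = G' x y) ->
    Mf G = Mf G' by [].
have am : (1 < n.+1)%N by [].
have dE (u v : 'I_n.+1) (G : MX) j l : (G^T *m delta_mx u v *m G) j l = G u j * G v l.
  rewrite mxE (bigD1 v)//= big1 ?addr0; last first.
    move=> y yv; rewrite mxE big1 ?mul0r// => x _.
    by rewrite !mxE (negbTE yv) andbF mulr0.
  rewrite mxE (bigD1 u)//= big1 ?addr0; last first.
    by move=> x xu; rewrite !mxE (negbTE xu) mulr0.
  by rewrite !mxE !eqxx mulr1.
have qE G j l : quad_cols Mf G j l = (G i j * G k l + G k j * G i l) / 2.
  rewrite /quad_cols /Mf -scalemxAr -scalemxAl mulmxDr mulmxDl mxE [X in _ * X]mxE !dE.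
  by rewrite mulrC.
have mE (G : MX) : orthogonal_mx G -> quad_mean 0 Mf G = (i == k)%:R / N.
  move=> oG; rewrite /quad_mean subn0 -(orthogonal_mx_rows i k oG).
  by congr (_ / _); apply: eq_bigr => j _; rewrite qE; field.
have cE (G : MX) : orthogonal_mx G ->
    cols_dev a G i k = \sum_(j < n.+1 | (j < a)%N) quad_dev 0 Mf G j.
  move=> oG; rewrite /cols_dev /quad_dev sumrB mE//.
  congr (_ - _); first by apply: eq_bigr => j _; rewrite qE; field.
  rewrite -(big_ord_widen n.+1 (fun=> (i == k)%:R / N) an) sumr_const card_ord.
  by rewrite -mulr_natl; ring.
have bc : bounded_mx (fun G => cols_dev a G i k ^+ 2).
  apply: bounded_mxX; apply: bounded_mxB; last exact: bounded_mx_cst.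
  by apply: bounded_mx_sum => j; apply: bounded_mxM; exact: bounded_mx_entry.
have bs : bounded_mx (fun G => (\sum_(j < n.+1 | (j < a)%N) quad_dev 0 Mf G j) ^+ 2).
  by apply: bounded_mxX; apply: bounded_mx_sum => j; exact: bounded_quad_dev.
rewrite (eq_haar_expect Hh bc bs); last by move=> G oG; rewrite cE.
have h1 := haar_sum_quad_dev_sqr Hh am Mfb Mfc
  (J := fun j : 'I_n.+1 => (j < a)%N) (j := ord0) (fun l _ => leq0n l) (leq0n _).
apply: le_trans h1 _.
have -> : #|(fun j : 'I_n.+1 => (j < a)%N)|%:R = a%:R :> R.
  by rewrite -sum1_card -(big_ord_widen n.+1 (fun=> 1%N) an) sum1_card card_ord.
have h2 := haar_quad_dev_sqr Hh am Mfb Mfs Mfc (j := ord0) (leq0n _).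
rewrite subn0 -/N in h2.
have N1 : 0 < N - 1 by rewrite subr_gt0 ltr1n.
have NN1 : 0 < N * (N - 1) by rewrite mulr_gt0// ltr0n.
rewrite (_ : 2 * a%:R / _ = a%:R * (2 / (N * (N - 1)))); last by ring.
rewrite ler_wpM2l// ler_pdivlMr// mulrC; apply: le_trans h2 _.
rewrite -[leRHS]mulr1 ler_pM2l// -(haar_expect_cst h 1).
apply: (le_haar_expect Hh).
- by apply: bounded_mx_sum => x; apply: bounded_mx_sum => y; exact: bounded_mxX.
- exact: bounded_mx_cst.
move=> G _.
have d1 (u v : 'I_n.+1) : \sum_x \sum_y (delta_mx u v : MX) x y = 1.
  rewrite (bigD1 u)//= [X in _ + X]big1 ?addr0; last first.
    by move=> x xu; rewrite big1// => y _; rewrite mxE (negbTE xu).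
  rewrite (bigD1 v)//= [X in _ + X]big1 ?addr0; last first.
    by move=> y yv; rewrite mxE (negbTE yv) andbF.
  by rewrite mxE !eqxx.
have -> : 1 = 2^-1 * (\sum_x \sum_y (delta_mx i k : MX) x y +
                     \sum_x \sum_y (delta_mx k i : MX) x y) by rewrite !d1; field.
rewrite -big_split mulr_sumr; apply: ler_sum => x _.
rewrite /= -big_split mulr_sumr; apply: ler_sum => y _.
by rewrite /Mf !mxE; do 2 case: (_ && _) => /=; lra.
Qed.

(** On O(n) the statistic is [N ^+ 2] times a sum of [q - a] deviations for the form [Mf], the
    centred Gram matrix of the first [a] columns cut to its [p * p] corner. Zero mean and the
    variance bound then come from the exchangeable columns, the Frobenius norm of [Mf] being bounded
    entry by entry. *)
Lemma haar_quad_stat a p q : (0 < n)%N -> (a < q)%N -> (a.+2 <= n.+1)%N ->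
    (q <= n.+1)%N -> (p <= n.+1)%N ->
  let X G := quad_stat a p q n.+1
               (fun i j => Num.sqrt N * (G : MX) (inord i) (inord j)) in
  [/\ bounded_mx X, E X = 0 &
   E (fun G => X G ^+ 2) <= 4 * a%:R * (q - a)%N%:R * p%:R ^+ 2 * N ^+ 4 /
     (N * (N - 1) * ((N - a%:R) * (N - a%:R - 1)))].
Proof.
move=> n0 aq am qn pn X.
have an : (a <= n.+1)%N by rewrite ltnW// ltnW.
pose Mf (G : MX) : MX := \matrix_(i, k)
  (if (i < p)%N && (k < p)%N then cols_dev a G i k else 0).
have bcd i k : bounded_mx (fun G => cols_dev a G i k).
  apply: bounded_mxB; last exact: bounded_mx_cst.
  by apply: bounded_mx_sum => j; apply: bounded_mxM; exact: bounded_mx_entry.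
have Mfb x y : bounded_mx (fun G => Mf G x y).
  under eq_fun do rewrite mxE; case: (_ && _) => //; exact: bounded_mx_cst.
have Mfs G : (Mf G)^T = Mf G.
  apply/matrixP => x y; rewrite !mxE andbC; case: (_ && _) => //.
  rewrite /cols_dev [in LHS]eq_sym; congr (_ - _).
  by apply: eq_bigr => j _; rewrite mulrC.
have Mfc (G G' : MX) : (forall x y : 'I_n.+1, (y < a)%N -> G x y = G' x y) ->
    Mf G = Mf G'.
  move=> GG; apply/matrixP => x y; rewrite !mxE; case: (_ && _) => //.
  by congr (_ - _); apply: eq_bigr => j ja; rewrite !GG.
pose J := fun j : 'I_n.+1 => (a <= j < q)%N.
pose Y G := N ^+ 2 * \sum_(j | J j) quad_dev a Mf G j.
have bqd j := bounded_quad_dev a Mfb j.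
have bY : bounded_mx Y by apply: bounded_mxZ; apply: bounded_mx_sum.
have bX : bounded_mx X.
  have bg i j : bounded_mx (fun G : MX => Num.sqrt N * G (inord i) (inord j)).
    by apply: bounded_mxZ; exact: bounded_mx_entry.
  have bgd a' b' i k : bounded_mx (fun G : MX => gram_dev
      (fun i j => Num.sqrt N * G (inord i) (inord j)) a' b' i k).
    apply: bounded_mx_sum => j; apply: bounded_mxB; last exact: bounded_mx_cst.
    exact: bounded_mxM.
  apply: bounded_mxD; last apply: bounded_mxZ;
    apply: bounded_mx_sum => i; apply: bounded_mx_sum => k.
    exact: bounded_mxM.
  exact: bounded_mxX.
have ma0 : (N - a%:R : R) != 0.
  by rewrite subr_eq0 /N eqr_nat; apply/eqP => na; move: am; rewrite na; lia.
have XY (G : MX) : orthogonal_mx G -> X G = Y G.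
  move=> oG.
  have s2 : Num.sqrt N * Num.sqrt N = N by rewrite -expr2 sqr_sqrtr// ler0n.
  have gd0 (i k : 'I_n.+1) : gram_dev (fun i j => Num.sqrt N * G (inord i) (inord j))
      0 a i k = N * cols_dev a G i k.
    rewrite /gram_dev sumrB sumr_const_nat subn0 big_mkord.
    rewrite (big_ord_widen n.+1 (fun j => (Num.sqrt N * G (inord i) (inord j)) *
      (Num.sqrt N * G (inord k) (inord j))) an).
    rewrite /cols_dev mulrBr; congr (_ - _).
      rewrite mulr_sumr; apply: eq_bigr => j _.
      by rewrite !inord_val -[in RHS]s2; ring.
    by rewrite -[in LHS]mulr_natl; field.
  have gda (i k : 'I_n.+1) : gram_dev (fun i j => Num.sqrt N * G (inord i) (inord j))
      a q i k = N * \sum_(j | J j) (G i j * G k j - (i == k)%:R / N).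
    rewrite /gram_dev big_geq_mkord.
    rewrite (big_ord_widen_cond n.+1 (fun j => (a <= j)%N) (fun j =>
      (Num.sqrt N * G (inord i) (inord j)) *
      (Num.sqrt N * G (inord k) (inord j)) - (i == k :> nat)%:R) qn).
    rewrite mulr_sumr; apply: eq_big => [j|j _]; first by rewrite /J.
    rewrite !inord_val mulrBr (mulrC N (_ / N)) divfK//; congr (_ - _).
    by rewrite -[in RHS]s2; ring.
  have wid (F : nat -> nat -> R) : \sum_(i < p) \sum_(k < p) F i k =
      \sum_(i < n.+1) \sum_(k < n.+1) (if (i < p)%N && (k < p)%N then F i k else 0).
    rewrite (big_ord_widen n.+1 (fun i => \sum_(k < p) F i k) pn) big_mkcond.
    apply: eq_bigr => i _; case: (i < p)%N => /=; last by rewrite big1.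
    by rewrite (big_ord_widen n.+1 (F i) pn) big_mkcond.
  pose S2 := \sum_i \sum_k Mf G i k ^+ 2.
  have XE : X G = N ^+ 2 * \sum_i \sum_k Mf G i k *
      (\sum_(j | J j) (G i j * G k j - (i == k)%:R / N)) +
      (q - a)%N%:R / (n.+1 - a)%N%:R * (N ^+ 2 * S2).
    rewrite /X /quad_stat; congr (_ + _ * _).
      rewrite (wid (fun i k => gram_dev _ 0 a i k * gram_dev _ a q i k)).
      rewrite mulr_sumr; apply: eq_bigr => i _.
      rewrite mulr_sumr; apply: eq_bigr => k _; rewrite mxE.
      case: (_ && _); last by ring.
      by rewrite gd0 gda; ring.
    rewrite (wid (fun i k => gram_dev _ 0 a i k ^+ 2)) /S2.
    rewrite mulr_sumr; apply: eq_bigr => i _.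
    rewrite mulr_sumr; apply: eq_bigr => k _; rewrite mxE.
    case: (_ && _); last by ring.
    by rewrite gd0; ring.
  have WE j : quad_cols Mf G j j = \sum_i \sum_k Mf G i k * (G i j * G k j).
    rewrite /quad_cols mxE exchange_big; apply: eq_bigr => i _.
    rewrite mxE mulr_suml; apply: eq_bigr => k _; rewrite !mxE.
    by ring.
  (* Row orthonormality expresses the Gram matrix of the last columns through that of the first
     ones, hence the negative term [S2 / (N - a)]. The second term of [quad_stat] is made to cancel
     it. *)
  have meanE : quad_mean a Mf G = (\sum_i Mf G i i) / N - S2 / (N - a%:R).
    rewrite /quad_mean natrB//.
    have -> : \sum_(j < n.+1 | (a <= j)%N) quad_cols Mf G j j =
        \sum_i \sum_k Mf G i k * \sum_(j < n.+1 | (a <= j)%N) (G i j * G k j).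
      under eq_bigr do rewrite WE.
      rewrite exchange_big; apply: eq_bigr => i _.
      by rewrite exchange_big; apply: eq_bigr => k _; rewrite mulr_sumr.
    have sE (i k : 'I_n.+1) : Mf G i k * (\sum_(j < n.+1 | (a <= j)%N) (G i j * G k j)) =
        Mf G i k * ((1 - a%:R / N) * (i == k)%:R) - Mf G i k ^+ 2.
      rewrite mxE; case: (_ && _); last by ring.
      have := orthogonal_mx_rows i k oG.
      rewrite (bigID (fun j : 'I_n.+1 => (j < a)%N))/=.
      have -> : \sum_(j < n.+1 | ~~ (j < a)%N) G i j * G k j =
          \sum_(j < n.+1 | (a <= j)%N) G i j * G k j.
        by apply: eq_bigl => j; rewrite -leqNgt.
      rewrite /cols_dev; set t1 := \sum_(_ < _ | (_ < a)%N) _.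
      set t2 := \sum_(_ < _ | (a <= _)%N) _ => t12.
      have -> : t2 = (i == k)%:R - t1 by rewrite -t12; ring.
      by ring.
    under eq_bigr => i _ do under eq_bigr => k _ do rewrite sE.
    under eq_bigr do rewrite sumrB; rewrite sumrB -/S2.
    have -> : \sum_i \sum_k Mf G i k * ((1 - a%:R / N) * (i == k)%:R) =
        (1 - a%:R / N) * \sum_i Mf G i i.
      rewrite mulr_sumr; apply: eq_bigr => i _.
      under eq_bigr do rewrite mulrA eq_sym; rewrite sum_deltar mulrC.
      by [].
    have fE (x y u w : R) : x != 0 -> x - y != 0 ->
        ((1 - y / x) * u - w) / (x - y) = u / x - w / (x - y).
      by move=> x0 xy; field; rewrite x0 xy.
    exact: fE.
  rewrite XE /Y /quad_dev (natrB _ an) -/N.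
  have Jq : \sum_(j | J j) (1 : R) = (q - a)%N%:R.
    rewrite -(big_ord_widen_cond n.+1 (fun j => (a <= j)%N) (fun=> 1) qn).
    by rewrite -(big_geq_mkord _ _ predT (fun=> 1)) sumr_const_nat.
  have -> : \sum_(j | J j) (quad_cols Mf G j j - quad_mean a Mf G) =
      \sum_(j | J j) (quad_cols Mf G j j - (\sum_i Mf G i i) / N) +
      (q - a)%N%:R * (S2 / (N - a%:R)).
    rewrite (eq_bigr (fun j => (quad_cols Mf G j j - (\sum_i Mf G i i) / N) +
      S2 / (N - a%:R) * 1)); last by move=> j _; rewrite meanE; ring.
    by rewrite big_split /= -mulr_sumr Jq [_ * (q - a)%:R]mulrC.
  rewrite mulrDr; congr (_ + _); last by ring.
  congr (_ * _).
  under [RHS]eq_bigr do rewrite WE.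
  have trE : (\sum_i Mf G i i) / N = \sum_i \sum_k Mf G i k * ((i == k)%:R / N).
    rewrite mulr_suml; apply: eq_bigr => i _.
    under [RHS]eq_bigr => k _ do rewrite (mulrC _ N^-1) mulrA eq_sym.
    by rewrite sum_deltar.
  under [RHS]eq_bigr do rewrite trE -sumrB.
  rewrite [RHS]exchange_big; apply: eq_bigr => i _.
  under [RHS]eq_bigr do rewrite -sumrB.
  rewrite [RHS]exchange_big; apply: eq_bigr => k _.
  by rewrite mulr_sumr; apply: eq_bigr => j _; rewrite mulrBr.
have Ja l : J l -> (a <= l)%N by case/andP.
have qa : (a < n.+1)%N by exact: leq_trans aq qn.
split=> //.
  rewrite (eq_haar_expect Hh bX bY XY) /Y haar_expectZ//; last exact: bounded_mx_sum.
  rewrite haar_expect_sum// big1 ?mulr0// => j Jj.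
  by apply: haar_quad_dev => //; exact: Ja.
have bX2 := bounded_mxX 2 bX; have bY2 := bounded_mxX 2 bY.
rewrite (eq_haar_expect Hh bX2 bY2); last by move=> G oG; rewrite XY.
have -> : (fun G => Y G ^+ 2) = (fun G => N ^+ 4 * (\sum_(j | J j) quad_dev a Mf G j) ^+ 2).
  by apply/funext => G; rewrite /Y; ring.
rewrite haar_expectZ//; last by apply: bounded_mxX; exact: bounded_mx_sum.
pose j0 : 'I_n.+1 := Ordinal qa.
have h1 := haar_sum_quad_dev_sqr Hh am Mfb Mfc (J := J) (j := j0) Ja (leqnn _).
have h2 := haar_quad_dev_sqr Hh am Mfb Mfs Mfc (j := j0) (leqnn _).
rewrite natrB// -/N in h2.
have Jcard : #|J|%:R = (q - a)%N%:R :> R.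
  rewrite -sum1_card -(big_ord_widen_cond n.+1 (fun j => (a <= j)%N) (fun=> 1%N) qn).
  by rewrite -(big_geq_mkord _ _ predT (fun=> 1%N)) sum_nat_const_nat muln1.
rewrite Jcard in h1.
have h3 : E (fun G => \sum_i \sum_k Mf G i k ^+ 2) <=
    p%:R ^+ 2 * (2 * a%:R / (N * (N - 1))).
  have bm i k : bounded_mx (fun G => Mf G i k ^+ 2) by exact: bounded_mxX.
  rewrite haar_expect_sum//; last by move=> i; exact: bounded_mx_sum.
  under eq_bigr do rewrite haar_expect_sum//.
  have -> : p%:R ^+ 2 * (2 * a%:R / (N * (N - 1))) =
      \sum_(i < n.+1) \sum_(k < n.+1)
        (if (i < p)%N && (k < p)%N then 2 * a%:R / (N * (N - 1)) else 0).
    set c := _ / _.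
    have wid1 : \sum_(k < n.+1) (if (k < p)%N then c else 0) = p%:R * c.
      by rewrite -big_mkcond -(big_ord_widen n.+1 (fun=> c) pn) sumr_const card_ord mulr_natl.
    rewrite (eq_bigr (fun i : 'I_n.+1 => if (i < p)%N then p%:R * c else 0)).
      rewrite -big_mkcond -(big_ord_widen n.+1 (fun=> p%:R * c) pn) sumr_const card_ord.
      by rewrite -mulr_natl; ring.
    by move=> i _; case: (i < p)%N => /=; [exact: wid1|rewrite big1].
  apply: ler_sum => i _; apply: ler_sum => k _.
  under eq_fun do rewrite mxE.
  case: (_ && _); first exact: cols_dev_sqr.
  by under eq_fun do rewrite expr0n; rewrite haar_expect_cst.
have Na1 : 0 < N - a%:R - 1.
  have : (a.+1%:R : R) < N by rewrite ltr_nat.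
  by rewrite -natr1; lra.
have Na : 0 < N - a%:R by lra.
have N1 : 0 < N - 1 by rewrite subr_gt0 ltr1n.
have NN : 0 < N by rewrite ltr0n.
have k0 : 0 <= (q - a)%N%:R :> R by exact: ler0n.
have P1 : 0 < (N - a%:R) * (N - a%:R - 1) by exact: mulr_gt0.
have P2 : 0 < N * (N - 1) by exact: mulr_gt0.
rewrite (_ : 4 * _ * _ * _ * _ / _ = N ^+ 4 * ((q - a)%N%:R *
   (2 * (p%:R ^+ 2 * (2 * a%:R / (N * (N - 1)))) / ((N - a%:R) * (N - a%:R - 1)))));
  last by rewrite !invfM; ring.
rewrite ler_wpM2l ?exprn_ge0 ?(ltW NN)//; apply: le_trans h1 _.
rewrite ler_wpM2l// ler_pdivlMr// mulrC; apply: le_trans h2 _.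
by rewrite ler_pM2l.
Qed.

End haar_statistic.

(** * Gaussian moments *)

Section density.
Context d (T : measurableType d) (R : realType).
Variables (P : {finite_measure set T -> \bar R}).
Variables (m : {sigma_finite_measure set T -> \bar R}) (g : T -> R).
Hypotheses (mg : measurable_fun setT g) (g0 : forall x, 0 <= g x).
Hypothesis PE : forall A, measurable A -> P A = (\int[m]_(x in A) (g x)%:E)%E.
Local Open Scope ereal_scope.

Lemma dominates_density : P `<< m.
Proof.
apply/null_content_dominatesP => A mA A0; rewrite PE//.
apply: null_set_integral => //.
by apply: measurable_funTS; exact/measurable_EFinP.
Qed.

Lemma ae_eq_density : ae_eq m setT (Radon_Nikodym_SigmaFinite.f P m) (EFin \o g).
Proof.
apply: integral_ae_eq => //.
- exact: Radon_Nikodym_SigmaFinite.f_integrable dominates_density.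
- exact/measurable_EFinP.
- move=> A _ mA.
  by rewrite -(Radon_Nikodym_SigmaFinite.f_integral dominates_density mA) PE.
Qed.

Lemma ge0_integral_density (f : T -> \bar R) : measurable_fun setT f ->
  (forall x, 0 <= f x) -> \int[P]_x f x = \int[m]_x (f x * (g x)%:E).
Proof.
move=> mf f0.
rewrite -(Radon_Nikodym_SigmaFinite.change_of_variables dominates_density f0)//.
apply: ge0_ae_eq_integral => //.
- apply: emeasurable_funM => //.
  exact: (measurable_int _ (Radon_Nikodym_SigmaFinite.f_integrable dominates_density)).
- by apply: emeasurable_funM => //; exact/measurable_EFinP.
- by move=> x _; rewrite mule_ge0//; exact: Radon_Nikodym_SigmaFinite.f_ge0 dominates_density _.
- by move=> x _; rewrite mule_ge0// lee_fin.
- by have := ae_eq_density; apply: filterS => x h _; rewrite h.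
Qed.

End density.

Section normal_moments.
Context (R : realType).
Local Open Scope ereal_scope.
Notation leb := (@lebesgue_measure R).
Notation phi := (normal_pdf (0 : R) 1).
Notation gauss := (normal_prob (0 : R) 1).

Lemma std_normal_pdfE (x : R) : phi x = (normal_peak 1 * expR (- (x ^+ 2 / 2)))%R.
Proof.
rewrite normal_pdfE ?oner_neq0//; congr (_ * expR _)%R.
by rewrite subr0 expr1n mulNr.
Qed.

Lemma std_normal_pdf_gt0 (x : R) : (0 < phi x)%R.
Proof.
by rewrite std_normal_pdfE mulr_gt0 ?expR_gt0// normal_peak_gt0 ?oner_neq0.
Qed.

Lemma ge0_integral_normal (f : R -> \bar R) : measurable_fun setT f ->
  (forall x, 0 <= f x) -> \int[gauss]_x f x = \int[leb]_x (f x * (phi x)%:E).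
Proof.
move=> mf f0; apply: (@ge0_integral_density _ _ R gauss leb phi) => //.
- exact: measurable_normal_pdf.
- by move=> x; exact: normal_pdf_ge0.
Qed.

Let integral_if (D : set R) (b : R -> bool) (f : R -> \bar R) :
  (forall x, D x <-> b x) ->
  \int[leb]_x (if b x then f x else 0) = \int[leb]_(x in D) f x.
Proof.
move=> Db; rewrite [RHS]integral_mkcond; apply: eq_integral => x _.
rewrite /patch; case: ifPn => bx; first by rewrite mem_set//; apply/Db.
by case: ifPn => // /set_mem /Db; rewrite (negbTE bx).
Qed.

Let in_itvcy (a x : R) : `[a, +oo[%classic x <-> (a <= x)%R.
Proof. by rewrite /= in_itv/= andbT. Qed.

Let in_itv0c (b x : R) : `[0%R, b]%classic x <-> ((0 <= x)%R && (x <= b)%R).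
Proof. by rewrite /= in_itv. Qed.

Let half k := \int[leb]_(x in `[0%R, +oo[) (x ^+ (2 * k) * phi x)%:E.

Let cphi : continuous phi.
Proof. by apply: continuous_normal_pdf; exact: oner_neq0. Qed.

Let phi_tail (x : R) : (0 <= x)%R ->
  \int[leb]_(y in `[x, +oo[) (y * phi y)%:E = (phi x)%:E.
Proof.
move=> x0.
have dF (y : R) : is_derive y 1%R (fun z => - phi z)%R (y * phi y)%R.
  rewrite (_ : (fun z => - phi z)%R =
     (fun z => (- normal_peak 1) * expR (- (z ^+ 2 / 2)))%R); last first.
    by apply/funext => z; rewrite std_normal_pdfE mulNr.
  apply: is_derive_eq.
  rewrite std_normal_pdfE /GRing.scale/=; lra.
rewrite (@ge0_continuous_FTC2y _ (fun y => y * phi y)%R (fun z => - phi z)%R x 0%R).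
- by rewrite -EFinB sub0r opprK.
- by move=> y xy; rewrite mulr_ge0 ?normal_pdf_ge0 ?(le_trans x0).
- apply: continuous_subspaceT => y; apply: cvgM; first exact: cvg_id.
  exact: cphi.
- rewrite (_ : (fun z => - phi z)%R =
     (fun z => (- normal_peak 1) * expR (- (z ^+ 2 / 2)))%R); last first.
    by apply/funext => z; rewrite std_normal_pdfE mulNr.
  rewrite -[X in _ --> X](mulr0 (- normal_peak 1)%R); apply: cvgMr.
  apply: (cvg_comp (fun z => z ^+ 2 / 2)%R (fun z => expR (- z))); last exact: cvgr_expR.
  by apply: gt0_cvgMly => //; exact: cvgr_expr2.
- by move=> y _; exact: ex_derive.
- by apply: cvg_at_right_filter; apply: cvgN; exact: cphi.
- by move=> y _; rewrite derive1E; apply: derive_val.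
Qed.

Let power_int k (y : R) : (0 <= y)%R ->
  \int[leb]_(x in `[0%R, y]) (x ^+ (2 * k))%:E = (y ^+ (2 * k).+1 / (2 * k).+1%:R)%:E.
Proof.
rewrite le_eqVlt => /predU1P[<-|y0].
  rewrite set_itv1 integral_set1 expr0n mul0r//.
have dF (x : R) : is_derive x 1%R (fun z => (2 * k).+1%:R^-1 * z ^+ (2 * k).+1)%R (x ^+ (2 * k))%R.
  have h := @is_deriveX R _ id (2 * k).+1 x 1%R 1%R (is_derive_id x 1%R).
  have /= := is_deriveM (is_derive_cst (((2 * k).+1%:R)^-1 : R)%R x 1%R) h.
  rewrite exprfctE => {}h; apply: is_derive_eq.
  rewrite /GRing.scale/= mulr0 addr0 mulr1 mulrA mulVf ?mul1r//.
rewrite (@continuous_FTC2 _ (fun x => x ^+ (2 * k))%R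
  (fun z => (2 * k).+1%:R^-1 * z ^+ (2 * k).+1)%R)//.
- by rewrite expr0n mulr0 sube0 mulrC.
- by apply: continuous_subspaceT => x; exact: exprn_continuous.
- split; first by move=> x _; exact: ex_derive.
    by apply: cvg_at_right_filter; apply: cvgMr; exact: exprn_continuous.
  by apply: cvg_at_left_filter; apply: cvgMr; exact: exprn_continuous.
- by move=> x _; rewrite derive1E; apply: derive_val.
Qed.

Let inner_tail k (x : R) : (0 <= x)%R ->
  \int[leb]_(y in `[x, +oo[) (x ^+ (2 * k) * (y * phi y))%:E =
  (x ^+ (2 * k) * phi x)%:E.
Proof.
move=> x0; under eq_integral do rewrite EFinM.
rewrite ge0_integralZl.
- by rewrite phi_tail// EFinM.
- by [].
- apply/measurable_EFinP; apply: measurable_funTS; apply: measurable_funM => //.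
  exact: measurable_normal_pdf.
- move=> y /in_itvcy xy.
  by rewrite lee_fin mulr_ge0 ?normal_pdf_ge0 ?(le_trans x0).
- by rewrite lee_fin exprn_ge0.
Qed.

Let inner_power k (y : R) : (0 <= y)%R ->
  \int[leb]_(x in `[0%R, y]) (x ^+ (2 * k) * (y * phi y))%:E =
  ((2 * k).+1%:R^-1)%:E * (y ^+ (2 * k.+1) * phi y)%:E.
Proof.
move=> y0; under eq_integral do rewrite EFinM.
rewrite ge0_integralZr.
- rewrite power_int// -!EFinM; congr EFin.
  by rewrite mulnS !exprS; ring.
- exact: measurable_itv.
- by apply/measurable_EFinP; apply: measurable_funTS.
- by move=> x /in_itv0c /andP[x0 _]; rewrite lee_fin exprn_ge0.
- by rewrite lee_fin mulr_ge0 ?normal_pdf_ge0.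
Qed.

Let halfE k :
  half k = \int[leb]_x (if (0 <= x)%R then (x ^+ (2 * k) * phi x)%:E else 0).
Proof. by rewrite /half -(integral_if (b := fun x => (0 <= x)%R) (fun x => (x ^+ (2 * k) * phi x)%:E) (in_itvcy 0%R)). Qed.

Let halfZ (c : R) k : (0 <= c)%R -> c%:E * half k =
  \int[leb]_x (c%:E * (if (0 <= x)%R then (x ^+ (2 * k) * phi x)%:E else 0)).
Proof.
move=> c0; rewrite halfE ge0_integralZl//.
- apply: measurable_fun_ifT => //; first exact: measurable_fun_ler.
  apply/measurable_EFinP; apply: measurable_funM => //.
  exact: measurable_normal_pdf.
- move=> x _; case: ifPn => // x0.
  by rewrite lee_fin mulr_ge0 ?exprn_ge0 ?normal_pdf_ge0.
Qed.

Let wedge k (x y : R) : \bar R :=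
  if (0 <= x)%R && (x <= y)%R then (x ^+ (2 * k) * (y * phi y))%:E else 0.

Let measurable_wedge k : measurable_fun setT (fun z : measurableTypeR R * measurableTypeR R => wedge k z.1 z.2).
Proof.
apply: measurable_fun_ifT => //.
  by apply: measurable_and; apply: measurable_fun_ler.
apply/measurable_EFinP; apply: measurable_funM; first exact: measurable_funX.
apply: measurable_funM => //.
by apply: measurableT_comp => //; exact: measurable_normal_pdf.
Qed.

Let wedge_ge0 k x y : 0 <= wedge k x y.
Proof.
rewrite /wedge; case: ifPn => // /andP[x0 xy]; rewrite lee_fin.
by rewrite mulr_ge0 ?exprn_ge0// mulr_ge0 ?normal_pdf_ge0 ?(le_trans x0).
Qed.

Let int_wedgel k (x : R) : \int[leb]_y wedge k x y =
  if (0 <= x)%R then (x ^+ (2 * k) * phi x)%:E else 0.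
Proof.
rewrite /wedge; case: (leP 0%R x) => x0 /=; last by rewrite integral0.
by rewrite (integral_if (fun y => (x ^+ (2 * k) * (y * phi y))%:E) (in_itvcy x)) inner_tail.
Qed.

Let int_wedger k (y : R) : \int[leb]_x wedge k x y =
  ((2 * k).+1%:R^-1)%:E * (if (0 <= y)%R then (y ^+ (2 * k.+1) * phi y)%:E else 0).
Proof.
rewrite /wedge; case: (leP 0%R y) => y0; last first.
  rewrite mule0; under eq_integral => x _.
    rewrite (_ : _ && _ = false); last first.
      by apply/negbTE/negP => /andP[x0 xy]; move: y0; rewrite ltNge (le_trans x0).
    over.
  by rewrite integral0.
by rewrite (integral_if (b := fun x => (0 <= x)%R && (x <= y)%R)
  (fun x => (x ^+ (2 * k) * (y * phi y))%:E) (in_itv0c y)) inner_power.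
Qed.

(* [phi x] is the integral of [y * phi y] over [y >= x]; Tonelli then raises the
   power by two without any boundary term. *)
Let half_rec k : half k = ((2 * k).+1%:R^-1)%:E * half k.+1.
Proof.
rewrite halfE halfZ ?invr_ge0//.
transitivity (\int[leb]_x \int[leb]_y wedge k x y).
  by apply: eq_integral => x _; rewrite int_wedgel.
transitivity (\int[leb]_y \int[leb]_x wedge k x y); last first.
  by apply: eq_integral => y _; rewrite int_wedger.
exact: (fubini_tonelli (m1 := leb) (m2 := leb) (fun z => wedge k z.1 z.2) (measurable_wedge k)
  (fun z => wedge_ge0 k z.1 z.2)).
Qed.

Definition normal_moment k : \bar R := \int[gauss]_x (x ^+ (2 * k))%:E.

Let normal_momentE k : normal_moment k = 2%:E * half k.
Proof.
have x2k (x : R) : (0 <= x ^+ (2 * k))%R by rewrite exprM exprn_ge0 ?sqr_ge0.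
rewrite /normal_moment ge0_integral_normal//; last first.
  exact/measurable_EFinP.
under eq_integral do rewrite -EFinM.
rewrite ge0_symfun_integralT//.
- by rewrite -set_itvcy.
- by move=> x; rewrite mulr_ge0 ?normal_pdf_ge0.
- by move=> x; apply: cvgM; [exact: exprn_continuous|exact: cphi].
- by move=> x /=; rewrite !std_normal_pdfE !exprM sqrrN.
Qed.

Lemma normal_moment0 : normal_moment 0 = 1.
Proof.
rewrite /normal_moment; under eq_integral do rewrite muln0 expr0.
by rewrite integral_cst// mul1e; exact: (@probability_setT _ _ _ gauss).
Qed.

Lemma normal_momentS k : normal_moment k.+1 = (2 * k).+1%:R%:E * normal_moment k.
Proof.
rewrite !normal_momentE (half_rec k) muleCA; congr (_ * _).
by rewrite muleA -EFinM divff ?mul1e// pnatr_eq0.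
Qed.

Lemma normal_moment1 : normal_moment 1 = 1.
Proof. by rewrite normal_momentS normal_moment0 mule1. Qed.

Lemma normal_moment2 : normal_moment 2 = 3%:E.
Proof. by rewrite normal_momentS normal_moment1 mule1. Qed.

Lemma normal_moment_fin k : normal_moment k \is a fin_num.
Proof.
by elim: k => [|k IH]; rewrite ?normal_moment0// normal_momentS fin_numM.
Qed.

End normal_moments.

Section normal_centered.
Context (R : realType).
Notation gauss := (normal_prob (0 : R) 1).

Lemma integrable_normalX k : gauss.-integrable setT (EFin \o (fun x : R => x ^+ k)).
Proof.
apply/integrableP; split; first by apply/measurable_EFinP; exact: measurable_funX.
apply: (@le_lt_trans _ _ (\int[gauss]_x ((x ^+ (2 * 0))%:E + (x ^+ (2 * k))%:E))%E).
  apply: ge0_le_integral => //.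
  - by apply/measurable_EFinP; apply: measurableT_comp => //; exact: measurable_funX.
  - by apply: emeasurable_funD; apply/measurable_EFinP; exact: measurable_funX.
  - move=> x _; rewrite -EFinD lee_fin muln0 expr0 mulnC exprM.
    by rewrite ler_norml; apply/andP; split; nra.
rewrite ge0_integralD//.
- rewrite -/(normal_moment R 0) -/(normal_moment R k).
  by rewrite lte_add_pinfty// ltey_eq normal_moment_fin.
- by apply/measurable_EFinP; exact: measurable_funX.
- by move=> x _; rewrite lee_fin exprM exprn_ge0// sqr_ge0.
- by apply/measurable_EFinP; exact: measurable_funX.
Qed.

Let integral_lebN (f : R -> R) : continuous f -> (forall x, 0 <= f x) ->
  (\int[@lebesgue_measure R]_x (f x)%:E = \int[@lebesgue_measure R]_x (f (- x))%:E)%E.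
Proof.
move=> cf f0.
have cN : continuous (fun x => f (- x)).
  by move=> x; apply: continuous_comp; [exact: opp_continuous|exact: cf].
have split_half (u : R -> R) : continuous u -> (forall x, 0 <= u x) ->
    (\int[@lebesgue_measure R]_x (u x)%:E =
     \int[@lebesgue_measure R]_(x in `[0%R, +oo[) (u (- x))%:E +
     \int[@lebesgue_measure R]_(x in `[0%R, +oo[) (u x)%:E)%E.
  move=> cu u0; have mu : measurable_fun setT u by exact: continuous_measurable_fun.
  rewrite -(setvU `[0%R, +oo[%classic) ge0_integral_setU//=.
  - rewrite setCitvr integral_itv_bndo_bndc; last exact/measurable_EFinP/measurable_funTS.
    rewrite -{1}oppr0 ge0_integration_by_substitutionNy//.
    exact: continuous_subspaceT.
  - exact: measurableC.
  - by apply/measurable_EFinP; rewrite setvU.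
  - by move=> x _; rewrite lee_fin.
  - by rewrite disj_set2E setICl.
rewrite (split_half f)// (split_half (fun x => f (- x)))// addeC.
by congr (_ + _)%E; apply: eq_integral => x _; rewrite opprK.
Qed.

(** The reflection of the line exchanges positive and negative part, and both are finite. *)
Lemma integral_normal_id : (\int[gauss]_x (x : R)%:E = 0)%E.
Proof.
have mid : measurable_fun setT (EFin : R -> \bar R) by apply/measurable_EFinP.
rewrite integralE ge0_integral_normal//; last exact: measurable_funepos.
rewrite ge0_integral_normal//; last exact: measurable_funeneg.
have cphi : continuous (normal_pdf (0 : R) 1) by apply: continuous_normal_pdf; exact: oner_neq0.
have -> : (\int[@lebesgue_measure R]_x ((EFin : R -> \bar R)^\+ x * (normal_pdf 0 1 x)%:E) =
   \int[@lebesgue_measure R]_x (Num.max x 0 * normal_pdf 0 1 x)%:E)%E.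
  by apply: eq_integral => x _; rewrite funeposE EFinM EFin_max.
have -> : (\int[@lebesgue_measure R]_x ((EFin : R -> \bar R)^\- x * (normal_pdf 0 1 x)%:E) =
   \int[@lebesgue_measure R]_x (Num.max (- x) 0 * normal_pdf 0 1 (- x))%:E)%E.
  apply: eq_integral => x _; rewrite funenegE EFinM EFin_max.
  by rewrite !std_normal_pdfE sqrrN.
have max0 (x : R) : 0 <= Num.max x 0 by rewrite le_max lexx orbT.
rewrite -(integral_lebN (f := fun x => Num.max x 0 * normal_pdf 0 1 x)).
- rewrite subee// ge0_fin_numE; last first.
    by apply: integral_ge0 => x _; rewrite lee_fin mulr_ge0 ?normal_pdf_ge0.
  have /integrableP[_] := integrable_normalX 1.
  apply: le_lt_trans.
  rewrite [leRHS]ge0_integral_normal//; last by apply: measurableT_comp.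
  apply: ge0_le_integral => //.
  + by move=> x _; rewrite lee_fin mulr_ge0 ?normal_pdf_ge0.
  + apply/measurable_EFinP; apply: measurable_funM; last exact: measurable_normal_pdf.
    exact: measurable_maxr.
  + apply: emeasurable_funM; first exact: measurableT_comp.
    by apply/measurable_EFinP; exact: measurable_normal_pdf.
  + move=> x _; rewrite -EFinM lee_fin ler_wpM2r ?normal_pdf_ge0//= expr1.
    by rewrite ge_max ler_norm normr_ge0.
- move=> x; apply: cvgM; last exact: cphi.
  apply: (@continuous_max _ _ idfun (cst 0)); [exact: cvg_id|exact: cvg_cst].
- by move=> x; rewrite mulr_ge0 ?normal_pdf_ge0.
Qed.

End normal_centered.

(** * Independence and polynomial expectations under the standard Gaussian law *)

Section product_law.
Context (R : realType) (k : nat) (nu : probability (k.-tuple R) R).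
Hypothesis Hnu : is_std_gaussian nu.
Notation gauss := (normal_prob (0 : R) 1).
Notation T := (k.-tuple R).

Definition merge (b : pred 'I_k) (z : T * T) : T :=
  [tuple if b c then tnth z.1 c else tnth z.2 c | c < k].

Lemma measurable_merge b : measurable_fun setT (merge b).
Proof.
apply/measurable_fun_tnthP => c.
apply: (@eq_measurable_fun _ _ _ _ _
  (fun z => if b c then tnth z.1 c else tnth z.2 c)).
  by move=> z _ /=; rewrite tnth_mktuple.
by case: (b c); apply: (measurableT_comp (measurable_tnth c)).
Qed.

Lemma gauss_rect1 (c : 'I_k) (A : set R) : measurable A ->
  nu [set t | A (tnth t c)] = gauss A.
Proof.
move=> mA; pose B (i : 'I_k) := if i == c then A else setT.
have mB i : measurable (B i) by rewrite /B; case: ifP.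
transitivity (nu [set t | forall i, B i (tnth t i)]).
  congr (nu _); apply/seteqP; split => t /=.
    by move=> At i; rewrite /B; case: eqP => // ->.
  by move=> /(_ c); rewrite /B eqxx.
rewrite Hnu// (bigD1 c)//= /B eqxx big1 ?mule1// => i /negbTE ->.
exact: (@probability_setT _ _ _ gauss).
Qed.

(** Independence in the form used below: replacing the coordinates outside [b] by those of an
    independent copy does not change the law. *)
Lemma gauss_merge (b : pred 'I_k) (A : set T) : measurable A ->
  nu A = (nu \x nu)%E (merge b @^-1` A).
Proof.
pose nu2 : probability T R := 
  image_probability (measurable_merge b) (nu \x nu)%E.
move=> mA; suff : nu A = nu2 A by [].
apply: tuple_measure_unique mA => {}A mA.
rewrite (_ : nu2 _ = (nu \x nu)%E (merge b @^-1` [set t | forall i, A i (tnth t i)])) //.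
pose Al i := if b i then A i else setT.
pose Ar i := if b i then setT else A i.
have mAl i : measurable (Al i) by rewrite /Al; case: ifP.
have mAr i : measurable (Ar i) by rewrite /Ar; case: ifP.
have mrect (B : 'I_k -> set R) : (forall i, measurable (B i)) ->
    measurable [set t : T | forall i, B i (tnth t i)].
  move=> mB; rewrite (_ : [set _ | _] =
      \bigcap_(i in [set: 'I_k]) ((fun t : T => tnth t i) @^-1` B i)).
    apply: fin_bigcap_measurable => // i _.
    by rewrite -[X in measurable X]setTI; apply: measurable_tnth.
  by apply/seteqP; split => t /= Bt i; [move=> _|]; apply: Bt.
rewrite (_ : _ @^-1` _ = [set t | forall i, Al i (tnth t i)] `*`
                        [set t | forall i, Ar i (tnth t i)]); last first.
  apply/seteqP; split => z /=.
    move=> Az; split => i; move: (Az i); rewrite tnth_mktuple /Al /Ar; by case: (b i).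
  by move=> [Bl Br] i; move: (Bl i) (Br i); rewrite tnth_mktuple /Al /Ar; case: (b i).
rewrite product_measure1E//; [|exact: mrect|exact: mrect].
apply: (etrans (Hnu mA)); apply: etrans (esym (congr2 mule (Hnu mAl) (Hnu mAr))).
apply: (big_ind3 (fun x y z => x = (y * z)%E)); first by rewrite mul1e.
- by move=> x1 x2 x3 y1 y2 y3 -> ->; rewrite muleACA.
- have g1 : gauss setT = 1%E by exact: (@probability_setT _ _ _ gauss).
  by move=> i _; rewrite /Al /Ar; case: (b i); rewrite g1 ?mule1 ?mul1e.
Qed.

(** Finiteness of all even moments is preserved by sums and products, so every polynomial in the
    coordinates is integrable. *)
Definition has_moments (F : T -> R) := measurable_fun setT F /\
  forall n, (\int[nu]_t (F t ^+ (2 * n))%:E < +oo)%E.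

Definition gauss_expect (F : T -> R) : R := \int[nu]_t F t.

Lemma integrable_has_moments F : has_moments F -> nu.-integrable setT (EFin \o F).
Proof.
move=> [mF Ffin]; apply/integrableP; split; first exact/measurable_EFinP.
apply: (@le_lt_trans _ _ (\int[nu]_t ((F t ^+ (2 * 0))%:E + (F t ^+ (2 * 1))%:E))%E).
  apply: ge0_le_integral => //.
  - by apply/measurable_EFinP; exact: measurableT_comp.
  - by apply: emeasurable_funD; apply/measurable_EFinP; exact: measurable_funX.
  - move=> x _; rewrite -EFinD lee_fin muln0 expr0 muln1.
    by rewrite ler_norml; apply/andP; split; nra.
rewrite ge0_integralD//.
- exact: lte_add_pinfty.
- by apply/measurable_EFinP; exact: measurable_funX.
- by move=> x _; rewrite lee_fin exprM exprn_ge0// sqr_ge0.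
- by apply/measurable_EFinP; exact: measurable_funX.
Qed.

Lemma has_moments_le (F : T -> R) (G : nat -> T -> R) : measurable_fun setT F ->
  (forall n, measurable_fun setT (G n)) ->
  (forall n t, F t ^+ (2 * n) <= G n t) ->
  (forall n, (\int[nu]_t (G n t)%:E < +oo)%E) -> has_moments F.
Proof.
move=> mF mG FG Gfin; split => // n; apply: le_lt_trans (Gfin n).
apply: ge0_le_integral => //.
- by move=> t _; rewrite lee_fin exprM exprn_ge0// sqr_ge0.
- by apply/measurable_EFinP; exact: measurable_funX.
- by apply/measurable_EFinP.
- by move=> t _; rewrite lee_fin.
Qed.

Let powers_lty (F G : T -> R) (c : R) n m : has_moments F -> has_moments G -> 0 <= c ->
  (\int[nu]_t (c * (F t ^+ (2 * n) + G t ^+ (2 * m)))%:E < +oo)%E.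
Proof.
move=> [mF Ffin] [mG Gfin] c0.
under eq_integral do rewrite EFinM EFinD.
rewrite ge0_integralZl//.
- rewrite ge0_integralD//.
  + by rewrite lte_mul_pinfty// ?lee_fin// lte_add_pinfty.
  + by move=> x _; rewrite lee_fin exprM exprn_ge0// sqr_ge0.
  + by apply/measurable_EFinP; exact: measurable_funX.
  + by move=> x _; rewrite lee_fin exprM exprn_ge0// sqr_ge0.
  + by apply/measurable_EFinP; exact: measurable_funX.
- by apply: emeasurable_funD; apply/measurable_EFinP; exact: measurable_funX.
- by move=> x _; rewrite adde_ge0// lee_fin exprM exprn_ge0// sqr_ge0.
Qed.

Lemma has_momentsD F G : has_moments F -> has_moments G ->
  has_moments (fun t => F t + G t).
Proof.
move=> hF hG; have [[mF _] [mG _]] := (hF, hG).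
apply: (has_moments_le (G := fun n t => 4 ^+ n * (F t ^+ (2 * n) + G t ^+ (2 * n)))).
- exact: measurable_funD.
- move=> n; apply: measurable_funM => //.
  by apply: measurable_funD; exact: measurable_funX.
- move=> n t; rewrite !exprM.
  set a := F t ^+ 2; set b := G t ^+ 2.
  have a0 : 0 <= a by exact: sqr_ge0.
  have b0 : 0 <= b by exact: sqr_ge0.
  (* [(F + G) ^+ 2] is at most 4 times the larger of the two squares. *)
  have [ab|ba] := leP a b.
    apply: (@le_trans _ _ (4 ^+ n * b ^+ n)); last first.
      by rewrite ler_wpM2l ?exprn_ge0// lerDr exprn_ge0.
    rewrite -exprMn; apply: lerXn2r; rewrite ?nnegrE ?sqr_ge0 ?(mulr_ge0 _ b0)//.
    by have := sqr_ge0 (F t - G t); move: ab; rewrite /a /b; nra.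
  apply: (@le_trans _ _ (4 ^+ n * a ^+ n)); last first.
    by rewrite ler_wpM2l ?exprn_ge0// lerDl exprn_ge0.
  rewrite -exprMn; apply: lerXn2r; rewrite ?nnegrE ?sqr_ge0 ?(mulr_ge0 _ a0)//.
  by have := sqr_ge0 (F t - G t); move: ba; rewrite /a /b; nra.
- by move=> n; apply: powers_lty => //; rewrite exprn_ge0.
Qed.

Lemma has_momentsM F G : has_moments F -> has_moments G ->
  has_moments (fun t => F t * G t).
Proof.
move=> hF hG; have [[mF _] [mG _]] := (hF, hG).
apply: (has_moments_le (G := fun n t => 1 * (F t ^+ (2 * (2 * n)) + G t ^+ (2 * (2 * n))))).
- exact: measurable_funM.
- move=> n; apply: measurable_funM => //.
  by apply: measurable_funD; exact: measurable_funX.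
- move=> n t; rewrite mul1r exprMn !(mulnC 2%N (2 * n)%N) !(exprM _ (2 * n)).
  set a := F t ^+ (2 * n); set b := G t ^+ (2 * n).
  by have := sqr_ge0 (a - b); have := sqr_ge0 a; have := sqr_ge0 b; nra.
- by move=> n; apply: powers_lty.
Qed.

Lemma has_moments_cst c : has_moments (fun=> c).
Proof.
split; first exact: measurable_cst.
move=> n; rewrite integral_cst//.
apply: (@le_lt_trans _ _ ((c ^+ (2 * n))%:E * 1)%E); last by rewrite mule1 ltry.
rewrite lee_wpmul2l//; first by rewrite lee_fin exprM exprn_ge0 ?sqr_ge0.
exact: (@probability_le1 _ _ _ nu).
Qed.

Lemma has_momentsZ c F : has_moments F -> has_moments (fun t => c * F t).
Proof. by move=> hF; apply: has_momentsM => //; exact: has_moments_cst. Qed.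

Lemma has_momentsB F G : has_moments F -> has_moments G ->
  has_moments (fun t => F t - G t).
Proof.
move=> hF hG; under eq_fun do rewrite -mulN1r.
by apply: has_momentsD => //; exact: has_momentsZ.
Qed.

Lemma has_momentsX F n : has_moments F -> has_moments (fun t => F t ^+ n).
Proof.
move=> hF; elim: n => [|n IH].
  by under eq_fun do rewrite expr0; exact: has_moments_cst.
by under eq_fun do rewrite exprS; exact: has_momentsM.
Qed.

Lemma has_moments_sum I (r : seq I) (P : pred I) (F : I -> T -> R) :
  (forall i, has_moments (F i)) ->
  has_moments (fun t => \sum_(i <- r | P i) F i t).
Proof.
move=> hF; elim: r => [|i r IH].
  by under eq_fun do rewrite big_nil; exact: has_moments_cst.
under eq_fun do rewrite big_cons.
by case: (P i) => //; exact: has_momentsD.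
Qed.

Lemma integral_coord (c : 'I_k) (f : measurableTypeR R -> \bar R) : measurable_fun setT f ->
  (\int[nu]_t f (tnth t c) = \int[gauss]_x f x)%E.
Proof.
move=> mf; apply/esym.
apply: (@integral_map _ _ _ _ R (fun t : T => tnth t c : measurableTypeR R) nu gauss) => //.
- exact: measurable_tnth.
- by move=> A mA; exact: (esym (gauss_rect1 c mA)).
Qed.

Lemma has_moments_coord c : has_moments (fun t => tnth t c).
Proof.
split; first exact: measurable_tnth.
move=> n; rewrite (integral_coord c (f := fun x => (x ^+ (2 * n))%:E)).
  by rewrite -/(normal_moment R n) ltey_eq normal_moment_fin.
by apply/measurable_EFinP; exact: measurable_funX.
Qed.

Lemma gauss_expectE F : has_moments F ->
  (\int[nu]_t (F t)%:E)%E = (gauss_expect F)%:E.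
Proof.
move=> hF; rewrite /gauss_expect /Rintegral fineK//.
by apply: (integrable_fin_num measurableT); exact: integrable_has_moments.
Qed.

Lemma gauss_expectD F G : has_moments F -> has_moments G ->
  gauss_expect (fun t => F t + G t) = gauss_expect F + gauss_expect G.
Proof. by move=> hF hG; apply: RintegralD => //; exact: integrable_has_moments. Qed.

Lemma gauss_expectB F G : has_moments F -> has_moments G ->
  gauss_expect (fun t => F t - G t) = gauss_expect F - gauss_expect G.
Proof. by move=> hF hG; apply: RintegralB => //; exact: integrable_has_moments. Qed.

Lemma gauss_expectZ c F : has_moments F ->
  gauss_expect (fun t => c * F t) = c * gauss_expect F.
Proof. by move=> hF; apply: RintegralZl => //; exact: integrable_has_moments. Qed.

Lemma gauss_expect_cst c : gauss_expect (fun=> c) = c.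
Proof.
rewrite /gauss_expect Rintegral_cst//.
rewrite (_ : fine _ = 1) ?mulr1//.
exact: (congr1 fine (@probability_setT _ _ _ nu)).
Qed.

Lemma gauss_expect_sum I (r : seq I) (P : pred I) (F : I -> T -> R) :
  (forall i, has_moments (F i)) ->
  gauss_expect (fun t => \sum_(i <- r | P i) F i t) =
  \sum_(i <- r | P i) gauss_expect (F i).
Proof.
move=> hF; elim: r => [|i r IH].
  by under [in LHS]eq_fun do rewrite big_nil; rewrite big_nil gauss_expect_cst.
rewrite big_cons; under [in LHS]eq_fun do rewrite big_cons.
case: (P i) => //; rewrite gauss_expectD ?IH//.
exact: has_moments_sum.
Qed.

Lemma le_gauss_expect F G : has_moments F -> has_moments G ->
  (forall t, F t <= G t) -> gauss_expect F <= gauss_expect G.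
Proof.
move=> hF hG FG; rewrite -subr_ge0 -gauss_expectB//.
by apply: Rintegral_ge0 => t _; rewrite subr_ge0.
Qed.

Definition depends_on (b : pred 'I_k) (F : T -> R) :=
  forall t u, (forall c, b c -> tnth t c = tnth u c) -> F t = F u.

(** After merging, [F] reads only the first copy and [G] only the second, and Fubini factors the
    integral. *)
Lemma gauss_expect_indep (b : pred 'I_k) F G : has_moments F -> has_moments G ->
  depends_on b F -> depends_on (predC b) G ->
  gauss_expect (fun t => F t * G t) = gauss_expect F * gauss_expect G.
Proof.
move=> hF hG bF bG; apply: EFin_inj.
have hFG := has_momentsM hF hG.
have [[mF _] [mG _]] := (hF, hG).
rewrite -gauss_expectE//.
have FGm z : F (merge b z) * G (merge b z) = F z.1 * G z.2.
  congr (_ * _); first by apply: bF => c bc; rewrite tnth_mktuple bc.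
  by apply: bG => c /negbTE bc; rewrite tnth_mktuple bc.
have nuE := @gauss_merge b.
have mFG : measurable_fun setT (EFin \o (fun t => F t * G t)).
  by apply/measurable_EFinP; exact: measurable_funM.
rewrite (integral_map (measurable_merge b) nuE mFG).
under eq_integral do rewrite /= FGm.
have mz : measurable_fun setT (fun z : T * T => (F z.1 * G z.2)%:E).
  by apply/measurable_EFinP; apply: measurable_funM; apply: measurableT_comp.
have int2 : (nu \x nu)%E.-integrable setT (fun z => (F z.1 * G z.2)%:E).
  have := integrable_has_moments hFG => /integrableP[_ fin2].
  apply/integrableP; split => //; move: fin2.
  rewrite (ge0_integral_map (measurable_merge b) nuE)//; last first.
    exact: measurableT_comp.
  by under eq_integral do rewrite /= FGm.
rewrite -(integral12_prod_meas1 int2)/=.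
transitivity (\int[nu]_x ((F x)%:E * (gauss_expect G)%:E))%E.
  apply: eq_integral => x _; rewrite /fubini_F/=.
  under eq_integral do rewrite EFinM.
  rewrite integralZl//; last exact: integrable_has_moments.
  by rewrite gauss_expectE.
rewrite integralZr//; last exact: integrable_has_moments.
by rewrite gauss_expectE.
Qed.

End product_law.

Lemma sum_sqr_le (R : realDomainType) (I : finType) (F : I -> R) :
  (\sum_i F i) ^+ 2 <= #|I|%:R * \sum_i F i ^+ 2.
Proof.
have -> : #|I|%:R * \sum_i F i ^+ 2 = \sum_(i : I) \sum_j F j ^+ 2.
  by rewrite sumr_const mulr_natl.
rewrite -(@ler_pM2l _ 2)//.
have -> : 2 * \sum_(i : I) \sum_j F j ^+ 2 = \sum_i \sum_j (F i ^+ 2 + F j ^+ 2).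
  under [RHS]eq_bigr do rewrite big_split/=.
  by rewrite big_split/= [X in _ = X + _]exchange_big/= mulr_natl mulr2n.
rewrite expr2 big_distrlr/= mulr_sumr; apply: ler_sum => i _.
rewrite mulr_sumr; apply: ler_sum => j _.
by have := sqr_ge0 (F i - F j); nra.
Qed.

Section gauss_coordinates.
Context (R : realType) (m : nat) (nu : probability (m.-tuple R) R).
Hypothesis Hnu : is_std_gaussian nu.
Notation T := (m.-tuple R).
Notation E := (gauss_expect nu).
Implicit Types c d : 'I_m.

Let hX c : has_moments nu (fun t => tnth t c) := has_moments_coord Hnu c.

Lemma gauss_expect_coordX c n :
  (E (fun t => tnth t c ^+ n))%:E = (\int[normal_prob (0 : R) 1]_x (x ^+ n)%:E)%E.
Proof.
rewrite -gauss_expectE; last exact: has_momentsX.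
by apply: (integral_coord Hnu c (f := fun x => (x ^+ n)%:E)); apply/measurable_EFinP; exact: measurable_funX.
Qed.

Lemma gauss_expect_coord1 c : E (fun t => tnth t c) = 0.
Proof.
have := gauss_expect_coordX c 1.
under eq_fun do rewrite expr1; under eq_integral do rewrite expr1.
by rewrite integral_normal_id => -[].
Qed.

Lemma gauss_expect_coord2 c : E (fun t => tnth t c ^+ 2) = 1.
Proof.
by have := gauss_expect_coordX c 2; rewrite -/(normal_moment R 1) normal_moment1 => -[].
Qed.

Lemma gauss_expect_coord4 c : E (fun t => tnth t c ^+ 4) = 3.
Proof.
by have := gauss_expect_coordX c 4; rewrite -/(normal_moment R 2) normal_moment2 => -[].
Qed.

Lemma gauss_expect_coord8 c : E (fun t => tnth t c ^+ 8) = 105.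
Proof.
have := gauss_expect_coordX c 8.
rewrite -/(normal_moment R 4) 2!normal_momentS normal_moment2 -!EFinM => -[->].
by rewrite -!natrM.
Qed.

Lemma gauss_expect_isolated c F : has_moments nu F -> depends_on (predC1 c) F ->
  E (fun t => tnth t c * F t) = 0.
Proof.
move=> hF dF; rewrite (gauss_expect_indep Hnu (b := pred1 c))//.
- by rewrite gauss_expect_coord1 mul0r.
- by move=> t u; apply; rewrite /= eqxx.
Qed.

Let isolated3 c c1 c2 c3 : c != c1 -> c != c2 -> c != c3 ->
  E (fun t => tnth t c * (tnth t c1 * tnth t c2 * tnth t c3)) = 0.
Proof.
move=> n1 n2 n3; apply: gauss_expect_isolated.
  by do !apply: has_momentsM.
by move=> t u tu; rewrite !tu//= eq_sym.
Qed.

Lemma gauss_expect_pair c d : E (fun t => tnth t c * tnth t d) = (c == d)%:R.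
Proof.
have [<-|cd] := eqVneq c d.
  by rewrite -(gauss_expect_coord2 c); congr gauss_expect; apply/funext => t; rewrite expr2.
rewrite gauss_expect_isolated//.
by move=> t u; apply; rewrite /= eq_sym.
Qed.

Let pairs c d : c != d -> E (fun t => tnth t c ^+ 2 * tnth t d ^+ 2) = 1.
Proof.
move=> cd; rewrite (gauss_expect_indep Hnu (b := pred1 c)).
- by rewrite gauss_expect_coord2 gauss_expect_coord2 mulr1.
- exact: has_momentsX.
- exact: has_momentsX.
- by move=> t u tu; rewrite tu//= eqxx.
- by move=> t u tu; rewrite tu//= eq_sym.
Qed.

(** Isserlis formula for four coordinates. An index that occurs once makes the expectation vanish;
    otherwise the indices form two pairs or all coincide. *)
Lemma gauss_expect_quad c1 c2 c3 c4 :
  E (fun t => (tnth t c1 * tnth t c2) * (tnth t c3 * tnth t c4)) =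
  (c1 == c2)%:R * (c3 == c4)%:R + (c1 == c3)%:R * (c2 == c4)%:R +
  (c1 == c4)%:R * (c2 == c3)%:R.
Proof.
have iso d1 d2 d3 d4 : (d1 != d2) && (d1 != d3) && (d1 != d4) ->
    (forall t : T, tnth t d1 * (tnth t d2 * tnth t d3 * tnth t d4) =
      (tnth t c1 * tnth t c2) * (tnth t c3 * tnth t c4)) ->
    E (fun t => (tnth t c1 * tnth t c2) * (tnth t c3 * tnth t c4)) = 0.
  move=> /andP[/andP[n1 n2] n3] tE.
  by rewrite -(isolated3 n1 n2 n3); congr gauss_expect; apply/funext => t; rewrite tE.
have prs d1 d2 : d1 != d2 ->
    (forall t : T, tnth t d1 ^+ 2 * tnth t d2 ^+ 2 =
      (tnth t c1 * tnth t c2) * (tnth t c3 * tnth t c4)) ->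
    E (fun t => (tnth t c1 * tnth t c2) * (tnth t c3 * tnth t c4)) = 1.
  by move=> d12 tE; rewrite -(pairs d12); congr gauss_expect; apply/funext => t; rewrite tE.
have [e12|n12] := eqVneq c1 c2; have [e13|n13] := eqVneq c1 c3;
  have [e14|n14] := eqVneq c1 c4.
- rewrite -e12 -e13 -e14 !eqxx/= !mulr1.
  rewrite (_ : (fun _ => _) = (fun t => tnth t c1 ^+ 4)).
    by rewrite gauss_expect_coord4; ring.
  by apply/funext => t; ring.
- rewrite -[in RHS]e12 -[in RHS]e13 (negbTE n14)/= !(mul0r, mulr0, addr0).
  by apply: (iso c4 c1 c1 c1); rewrite ?(eq_sym c4) ?n14// => t; rewrite -e12 -e13; ring.
- rewrite -[in RHS]e12 -[in RHS]e14 (eq_sym c3) (negbTE n13)/= !(mul0r, mulr0, addr0).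
  by apply: (iso c3 c1 c1 c1); rewrite ?(eq_sym c3) ?n13// => t; rewrite -e12 -e14; ring.
- rewrite mul1r !mul0r !addr0.
  have [e34|n34] := eqVneq c3 c4.
    by apply: (prs c1 c3) => // t; rewrite -e12 -e34; ring.
  by apply: (iso c3 c1 c1 c4); rewrite ?(eq_sym c3 c1) ?n13 ?n34// => t; rewrite -e12; ring.
- rewrite -[in RHS]e13 -[in RHS]e14 (eq_sym c2) (negbTE n12)/= !(mul0r, mulr0, addr0).
  by apply: (iso c2 c1 c1 c1); rewrite ?(eq_sym c2) ?n12// => t; rewrite -e13 -e14; ring.
- rewrite !mul0r mul1r add0r addr0.
  have [e24|n24] := eqVneq c2 c4.
    by apply: (prs c1 c2) => // t; rewrite -e13 -e24; ring.
  by apply: (iso c2 c1 c1 c4); rewrite ?(eq_sym c2 c1) ?n12 ?n24// => t; rewrite -e13; ring.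
- rewrite !mul0r mul1r !add0r.
  have [e23|n23] := eqVneq c2 c3.
    by apply: (prs c1 c2) => // t; rewrite -e14 -e23; ring.
  by apply: (iso c2 c1 c1 c3); rewrite ?(eq_sym c2 c1) ?n12 ?n23// => t; rewrite -e14; ring.
- rewrite !mul0r !addr0.
  by apply: (iso c1 c2 c3 c4); rewrite ?n12 ?n13 ?n14// => t; ring.
Qed.

(** The value is [8 * (105 + 1)]: [(u - v) ^+ 4 <= 8 * (u ^+ 4 + v ^+ 4)] with [v] equal to 0 or 1,
    then [x ^+ 4 * y ^+ 4 <= (x ^+ 8 + y ^+ 8) / 2], and the eighth Gaussian moment is 105. *)
Lemma gauss_expect_pair4 c d :
  E (fun t => (tnth t c * tnth t d - (c == d)%:R) ^+ 4) <= 848.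
Proof.
apply: (@le_trans _ _ (E (fun t => 8 * (((tnth t c ^+ 8 + tnth t d ^+ 8)) * 2^-1 + 1)))).
  apply: le_gauss_expect.
  - apply: has_momentsX; apply: has_momentsB; last exact: has_moments_cst.
    exact: has_momentsM.
  - apply: has_momentsZ; apply: has_momentsD; last exact: has_moments_cst.
    apply: has_momentsM; last exact: has_moments_cst.
    by apply: has_momentsD; exact: has_momentsX.
  - move=> t; set x := tnth t c; set y := tnth t d.
    have x8 : x ^+ 4 * y ^+ 4 <= (x ^+ 8 + y ^+ 8) * 2^-1.
      rewrite (_ : 8 = 4 * 2)%N// !exprM.
      by have := sqr_ge0 (x ^+ 4 - y ^+ 4); nra.
    have key (u v : R) : (u - v) ^+ 4 <= 8 * (u ^+ 4 + v ^+ 4).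
      have h1 : (u - v) ^+ 2 <= 2 * (u ^+ 2 + v ^+ 2).
        by have := sqr_ge0 (u + v); nra.
      have h2 : (u ^+ 2 + v ^+ 2) ^+ 2 <= 2 * (u ^+ 4 + v ^+ 4).
        rewrite (_ : 4 = 2 * 2)%N// !exprM.
        by have := sqr_ge0 (u ^+ 2 - v ^+ 2); nra.
      rewrite (_ : 4 = 2 * 2)%N// exprM; rewrite -[(2*2)%N]/4%N.
      apply: (@le_trans _ _ ((2 * (u ^+ 2 + v ^+ 2)) ^+ 2)); last by nra.
      apply: lerXn2r; rewrite ?nnegrE ?sqr_ge0//.
      by rewrite mulr_ge0// addr_ge0 ?sqr_ge0.
    apply: le_trans (key _ _) _; rewrite ler_pM2l// exprMn lerD//.
    by case: (c == d); rewrite ?expr0n ?expr1n.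
have h8 e : has_moments nu (fun t => tnth t e ^+ 8) by exact: has_momentsX.
rewrite gauss_expectZ; last first.
  apply: has_momentsD; last exact: has_moments_cst.
  apply: has_momentsM; last exact: has_moments_cst.
  exact: has_momentsD.
rewrite gauss_expectD; [|by apply: has_momentsM; [exact: has_momentsD|exact: has_moments_cst]|exact: has_moments_cst].
rewrite gauss_expect_cst.
rewrite (_ : (fun t => _ * _) = (fun t => 2^-1 * (tnth t c ^+ 8 + tnth t d ^+ 8))); last first.
  by apply/funext => t; rewrite mulrC.
rewrite gauss_expectZ; last exact: has_momentsD.
rewrite gauss_expectD// !gauss_expect_coord8.
by lra.
Qed.

(** In the binomial expansion the two cross terms with a first power vanish. *)
Lemma gauss_expect_indep4 b F G : has_moments nu F -> has_moments nu G ->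
  depends_on b F -> depends_on (predC b) G -> E F = 0 -> E G = 0 ->
  E (fun t => (F t + G t) ^+ 4) = E (fun t => F t ^+ 4) +
    6 * (E (fun t => F t ^+ 2) * E (fun t => G t ^+ 2)) + E (fun t => G t ^+ 4).
Proof.
move=> hF hG dF dG F0 G0.
have hFX n : has_moments nu (fun t => F t ^+ n) by exact: has_momentsX.
have hGX n : has_moments nu (fun t => G t ^+ n) by exact: has_momentsX.
have hFG (c : R) n l : has_moments nu (fun t => c * (F t ^+ n * G t ^+ l)).
  by apply: has_momentsZ; exact: has_momentsM.
have EFG (c : R) n l : E (fun t => c * (F t ^+ n * G t ^+ l)) =
    c * (E (fun t => F t ^+ n) * E (fun t => G t ^+ l)).
  rewrite gauss_expectZ; last exact: has_momentsM.
  rewrite (gauss_expect_indep Hnu (b := b))//.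
  - by move=> t u tu; rewrite (dF t u).
  - by move=> t u tu; rewrite (dG t u).
have X1 H : (fun t : T => H t ^+ 1 : R) = H by apply/funext => t; rewrite expr1.
rewrite (_ : (fun t => _) = (fun t => (F t ^+ 4 + 6 * (F t ^+ 2 * G t ^+ 2)) +
   G t ^+ 4 + (4 * (F t ^+ 3 * G t ^+ 1) + 4 * (F t ^+ 1 * G t ^+ 3)))); last first.
  by apply/funext => t; ring.
have h2 := hFG 6 2%N 2%N; have h3 := hFG 4 3%N 1%N; have h1 := hFG 4 1%N 3%N.
have h42 := has_momentsD (hFX 4%N) h2.
rewrite (gauss_expectD (has_momentsD h42 (hGX 4%N)) (has_momentsD h3 h1)).
rewrite (gauss_expectD h42 (hGX 4%N)) (gauss_expectD (hFX 4%N) h2).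
by rewrite (gauss_expectD h3 h1) !EFG !X1 F0 G0; ring.
Qed.

End gauss_coordinates.

(** * The quartic statistic under the Gaussian law *)

Section gauss_statistic.
Context (R : realType) (m : nat) (nu : probability (m.-tuple R) R).
Hypothesis Hnu : is_std_gaussian nu.
Notation T := (m.-tuple R).
Notation E := (gauss_expect nu).
Variables (p q : nat) (io : nat -> nat -> 'I_m).
Hypothesis io_inj : forall i j k l, (i < p)%N -> (j < q)%N -> (k < p)%N ->
  (l < q)%N -> io i j = io k l -> (i = k) /\ (j = l).
Implicit Types (t : T) (i j k : nat).

Let g t i j := tnth t (io i j).
Let y i k j t := g t i j * g t k j - (i == k)%:R.
Let S a b i k t := gram_dev (g t) a b i k.

Let io_eq i k j : (i < p)%N -> (k < p)%N -> (j < q)%N ->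
  (io i j == io k j) = (i == k).
Proof. by move=> ip kp jq; apply/eqP/eqP => [/io_inj[]//|->]. Qed.

Let hg i j : has_moments nu (fun t => g t i j).
Proof. exact: has_moments_coord. Qed.

Let hy i k j : has_moments nu (y i k j).
Proof. by apply: has_momentsB; [exact: has_momentsM|exact: has_moments_cst]. Qed.

Let hS a b i k : has_moments nu (S a b i k).
Proof. by apply: has_moments_sum => j; exact: hy. Qed.

Let Ey i k j : (i < p)%N -> (k < p)%N -> (j < q)%N -> E (y i k j) = 0.
Proof.
move=> ip kp jq; rewrite gauss_expectB; [|exact: has_momentsM|exact: has_moments_cst].
by rewrite gauss_expect_cst gauss_expect_pair// io_eq// subrr.
Qed.

(** By the Isserlis formula this is the covariance of two centred Gram products taken in the same
    column. *)
Let cov (i k i' k' : nat) : R :=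
  (i == i')%:R * (k == k')%:R + (i == k')%:R * (k == i')%:R.

Let Eyy i k i' k' j : (i < p)%N -> (k < p)%N -> (i' < p)%N -> (k' < p)%N ->
  (j < q)%N -> E (fun t => y i k j t * y i' k' j t) = cov i k i' k'.
Proof.
move=> ip kp ip' kp' jq.
have h2 u v : has_moments nu (fun t => g t u j * g t v j) by exact: has_momentsM.
rewrite (_ : (fun t => _) = (fun t => ((g t i j * g t k j) * (g t i' j * g t k' j) +
   (i == k)%:R * (i' == k')%:R) - ((i' == k')%:R * (g t i j * g t k j) +
   (i == k)%:R * (g t i' j * g t k' j)))); last by apply/funext => t; rewrite /y; ring.
rewrite gauss_expectB; last 2 first.
- by apply: has_momentsD; [exact: has_momentsM|exact: has_moments_cst].
- by apply: has_momentsD; exact: has_momentsZ.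
rewrite gauss_expectD; [|exact: has_momentsM|exact: has_moments_cst].
rewrite gauss_expectD; [|exact: has_momentsZ|exact: has_momentsZ].
rewrite [X in _ + X - _]gauss_expect_cst !gauss_expectZ// gauss_expect_quad// !gauss_expect_pair//.
by rewrite !io_eq// /cov; ring.
Qed.

Let cols a b : pred 'I_m := fun c =>
  [exists i : 'I_p, exists j : 'I_q, (a <= j < b)%N && (c == io i j)].

Let colsP a b i j : (i < p)%N -> (j < q)%N -> (a <= j < b)%N -> cols a b (io i j).
Proof.
move=> ip jq jab; apply/existsP; exists (Ordinal ip); apply/existsP.
by exists (Ordinal jq); rewrite /= jab eqxx.
Qed.

Let cols_disj a b c d : (b <= c)%N -> depends_on (cols c d) `<=` @depends_on R m (predC (cols a b)).
Proof.
move=> bc F dF t u tu; apply: dF => e /existsP[i /existsP[j /andP[/andP[cj jd] /eqP ->]]].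
apply: tu => /=; apply/negP => /existsP[i' /existsP[j' /andP[/andP[aj jb] /eqP]]].
by move=> /io_inj[]// _ jj; move: jb; rewrite -jj ltnNge (leq_trans bc).
Qed.

Let depS a b i k : (i < p)%N -> (k < p)%N -> (b <= q)%N ->
  depends_on (cols a b) (S a b i k).
Proof.
move=> ip kp bq t u tu; rewrite /S /gram_dev; apply: eq_big_nat => j jab.
have jq : (j < q)%N by case/andP: jab => _ jb; exact: leq_trans bq.
by rewrite /g !tu//; exact: colsP.
Qed.

Let S1 j i k t : S j j.+1 i k t = y i k j t.
Proof. by rewrite /S /gram_dev big_nat1. Qed.

Let Sr a b i k t : (a <= b)%N -> S a b.+1 i k t = S a b i k t + y i k b t.
Proof. by move=> ab; rewrite /S /gram_dev big_nat_recr. Qed.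

Let depy i k j : (i < p)%N -> (k < p)%N -> (j < q)%N ->
  depends_on (cols j j.+1) (y i k j).
Proof.
move=> ip kp jq; rewrite (_ : y i k j = S j j.+1 i k); first exact: depS.
by apply/funext => t; rewrite S1.
Qed.

Let ES a b i k : (i < p)%N -> (k < p)%N -> (b <= q)%N -> E (S a b i k) = 0.
Proof.
move=> ip kp bq; rewrite /S /gram_dev gauss_expect_sum; last by move=> j; exact: hy.
by rewrite big_nat big1// => j /andP[_ jb]; apply: Ey => //; exact: leq_trans bq.
Qed.

(** Distinct columns are independent and centred, so covariances add up column by column. *)
Let ESS a b i k i' k' : (i < p)%N -> (k < p)%N -> (i' < p)%N -> (k' < p)%N ->
  (a <= b)%N -> (b <= q)%N ->
  E (fun t => S a b i k t * S a b i' k' t) = (b - a)%N%:R * cov i k i' k'.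
Proof.
move=> ip kp ip' kp' ab; rewrite -{1 2 3}(subnKC ab); move: (b - a)%N => r {b ab}.
elim: r => [|r IH].
  rewrite addn0 mul0r => _; rewrite -[RHS](gauss_expect_cst nu 0); congr gauss_expect.
  by apply/funext => t; rewrite /S /gram_dev big_geq// mul0r.
rewrite addnS => rq.
rewrite (_ : (fun t => _) = (fun t => (S a (a + r) i k t * S a (a + r) i' k' t +
   y i k (a + r) t * y i' k' (a + r) t) + (S a (a + r) i k t * y i' k' (a + r) t +
   S a (a + r) i' k' t * y i k (a + r) t))); last first.
  by apply/funext => t; rewrite !Sr ?leq_addr//; ring.
have SM u v u' v' : has_moments nu (fun t => S a (a + r) u v t * y u' v' (a + r) t).
  exact: has_momentsM.
have ESy u v u' v' : (u < p)%N -> (v < p)%N -> (u' < p)%N -> (v' < p)%N ->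
    E (fun t => S a (a + r) u v t * y u' v' (a + r) t) = 0.
  move=> up vp up' vp'; rewrite (gauss_expect_indep Hnu (b := cols a (a + r)))//.
  - by rewrite Ey// mulr0.
  - by apply: depS => //; exact: ltnW.
  - by apply: (cols_disj (leqnn _)); exact: depy.
rewrite gauss_expectD; [|by apply: has_momentsD; exact: has_momentsM|exact: has_momentsD].
rewrite gauss_expectD; [|exact: has_momentsM|exact: has_momentsM].
rewrite gauss_expectD// !ESy// addr0 addr0 IH; last exact: ltnW.
by rewrite Eyy// -natr1 mulrDl mul1r.
Qed.

Let cov_le (i k : nat) : cov i k i k <= 2.
Proof. by rewrite /cov !eqxx (eq_sym k); case: (i == k) => /=; lra. Qed.

(** Each new column adds at most [6 * b * 4] from the product of variances and 848 from its own
    fourth moment, which the growth of [848 * b ^+ 2] absorbs. *)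
Let ES4 b i k : (i < p)%N -> (k < p)%N -> (b <= q)%N ->
  E (fun t => S 0 b i k t ^+ 4) <= 848 * b%:R ^+ 2.
Proof.
move=> ip kp; elim: b => [|b IH] bq.
  rewrite expr0n/= mulr0 -(gauss_expect_cst nu 0); apply: le_gauss_expect.
  - exact: has_momentsX.
  - exact: has_moments_cst.
  - by move=> t; rewrite /S /gram_dev big_geq// expr0n.
rewrite (_ : (fun t => _) = (fun t => (S 0 b i k t + y i k b t) ^+ 4)); last first.
  by apply/funext => t; rewrite Sr.
rewrite (gauss_expect_indep4 Hnu (b := cols 0 b))//; last 4 first.
- by apply: depS => //; exact: ltnW.
- by apply: (cols_disj (leqnn _)); exact: depy.
- by apply: ES => //; exact: ltnW.
- exact: Ey.
have -> : E (fun t => S 0 b i k t ^+ 2) = b%:R * cov i k i k.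
  by rewrite -[in RHS](subn0 b) -ESS//; exact: ltnW.
have -> : E (fun t => y i k b t ^+ 2) = cov i k i k by rewrite -(@Eyy i k i k b).
have y4 : E (fun t => y i k b t ^+ 4) <= 848.
  by have := gauss_expect_pair4 Hnu (io i b) (io k b); rewrite io_eq.
have c2 := cov_le i k.
have c0 : 0 <= cov i k i k by rewrite addr_ge0// mulr_ge0.
have cc : cov i k i k * cov i k i k <= 4 by nra.
have b0 : 0 <= b%:R :> R by [].
have bcc : b%:R * (cov i k i k * cov i k i k) <= b%:R * 4 :> R by rewrite ler_wpM2l.
have := IH (ltnW bq); rewrite -natr1; nra.
Qed.

Let sum_eq (i : 'I_p) : \sum_(v < p) (nat_of_ord i == v)%:R = 1 :> R.
Proof.
rewrite (bigD1 i)//= eqxx big1 ?addr0// => v vi.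
by rewrite (_ : (_ == _) = false)//; apply/negbTE; rewrite eq_sym.
Qed.

Let sum_cov : \sum_(u : 'I_p * 'I_p) \sum_(v : 'I_p * 'I_p) cov u.1 u.2 v.1 v.2 =
  2 * p%:R ^+ 2.
Proof.
transitivity (\sum_(u : 'I_p * 'I_p) (2 : R)); last first.
  by rewrite sumr_const card_prod !card_ord expr2 -natrM mulr_natr.
apply: eq_bigr => u _; rewrite big_split/=.
rewrite -(pair_bigA _ (fun v w : 'I_p => (nat_of_ord u.1 == v)%:R * (nat_of_ord u.2 == w)%:R : R))/=.
rewrite -(pair_bigA _ (fun v w : 'I_p => (nat_of_ord u.1 == w)%:R * (nat_of_ord u.2 == v)%:R : R))/=.
rewrite [X in _ + X]exchange_big/= -big_distrlr/=.
by rewrite !sum_eq mulr1.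
Qed.

Let sum_cov_diag : \sum_(u : 'I_p * 'I_p) cov u.1 u.2 u.1 u.2 = p%:R ^+ 2 + p%:R.
Proof.
transitivity (\sum_(i < p) \sum_(k < p) (1 + (nat_of_ord i == k)%:R : R)).
  rewrite pair_bigA/=; apply: eq_bigr => u _; rewrite /cov !eqxx mulr1 (eq_sym (nat_of_ord u.2)).
  by case: (_ == _); rewrite ?mulr1 ?mulr0.
under eq_bigr do rewrite big_split/= sum_eq sumr_const card_ord.
by rewrite sumr_const card_ord -[_ *+ p]mulr_natr mulrDl mul1r expr2.
Qed.

(** The cross term [A] is centred because its two column groups are independent, so the whole mean
    comes from the correction term [c * B]. The second moment is bounded by
    [2 * A ^+ 2 + 2 * c ^+ 2 * B ^+ 2]. The labelling [io] of the entries stays abstract so that a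
    block can be read either directly or transposed. *)
Lemma gauss_quad_stat a N : (a < q)%N -> (q <= N)%N ->
  let X t := quad_stat a p q N (fun i j => tnth t (io i j)) in
  [/\ has_moments nu X,
   E X = (q - a)%N%:R / (N - a)%N%:R * (a%:R * (p%:R ^+ 2 + p%:R)) &
   E (fun t => X t ^+ 2) <= 8 * a%:R * (q - a)%N%:R * p%:R ^+ 2 +
     2 * ((q - a)%N%:R / (N - a)%N%:R) ^+ 2 * (848 * a%:R ^+ 2 * p%:R ^+ 4)].
Proof.
move=> aq qN X.
pose c : R := (q - a)%N%:R / (N - a)%N%:R.
pose S0 (u : 'I_p * 'I_p) := S 0 a u.1 u.2.
pose Sa (u : 'I_p * 'I_p) := S a q u.1 u.2.
pose A t := \sum_u S0 u t * Sa u t; pose B t := \sum_u S0 u t ^+ 2.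
have XE : X = fun t => A t + c * B t.
  by apply/funext => t; rewrite /X /quad_stat !pair_bigA.
have aq' := ltnW aq.
have hS0 u : has_moments nu (S0 u) by exact: hS.
have hSa u : has_moments nu (Sa u) by exact: hS.
have hA : has_moments nu A by apply: has_moments_sum => u; exact: has_momentsM.
have hB : has_moments nu B by apply: has_moments_sum => u; exact: has_momentsX.
have hX : has_moments nu X by rewrite XE; apply: has_momentsD => //; exact: has_momentsZ.
have dep0 u : depends_on (cols 0 a) (S0 u) by exact: depS.
have depa u : depends_on (predC (cols 0 a)) (Sa u).
  by apply: (cols_disj (leqnn a)); exact: depS.
have EA : E A = 0.
  rewrite gauss_expect_sum; last by move=> u; exact: has_momentsM.
  rewrite big1// => u _; rewrite (gauss_expect_indep Hnu (b := cols 0 a))//.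
  by rewrite ES// mul0r.
have EB : E B = a%:R * (p%:R ^+ 2 + p%:R).
  rewrite gauss_expect_sum; last by move=> u; exact: has_momentsX.
  rewrite -sum_cov_diag mulr_sumr; apply: eq_bigr => u _.
  rewrite -[in RHS](subn0 a) -ESS//.
have EA2 : E (fun t => A t ^+ 2) <= 4 * a%:R * (q - a)%N%:R * p%:R ^+ 2.
  have -> : (fun t => A t ^+ 2) = fun t => \sum_u \sum_v (S0 u t * S0 v t) * (Sa u t * Sa v t).
    apply/funext => t; rewrite /A expr2 big_distrlr/=.
    by apply: eq_bigr => u _; apply: eq_bigr => v _; rewrite mulrACA.
  have h4 u v : has_moments nu (fun t => (S0 u t * S0 v t) * (Sa u t * Sa v t)).
    by apply: has_momentsM; exact: has_momentsM.
  rewrite gauss_expect_sum; last by move=> u; exact: has_moments_sum.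
  have -> : 4 * a%:R * (q - a)%N%:R * p%:R ^+ 2 =
      \sum_(u : 'I_p * 'I_p) \sum_(v : 'I_p * 'I_p) a%:R * (q - a)%N%:R * (2 * cov u.1 u.2 v.1 v.2).
    under [RHS]eq_bigr do under eq_bigr do rewrite mulrA.
    under [RHS]eq_bigr do rewrite -mulr_sumr.
    by rewrite -mulr_sumr sum_cov; ring.
  apply: ler_sum => u _; rewrite gauss_expect_sum//.
  apply: ler_sum => v _; rewrite (gauss_expect_indep Hnu (b := cols 0 a)).
  - rewrite !ESS// subn0 mulrACA ler_wpM2l//.
    (* [cov] takes the values 0, 1, 2 only, so its square is at most [2 * cov], whose double sum is
       known. *)
    by rewrite /cov; do !case: (_ == _) => /=; lra.
  - exact: has_momentsM.
  - exact: has_momentsM.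
  - by move=> t w tw; rewrite (dep0 u t w)// (dep0 v t w).
  - by move=> t w tw; rewrite (depa u t w)// (depa v t w).
have EB2 : E (fun t => B t ^+ 2) <= 848 * a%:R ^+ 2 * p%:R ^+ 4.
  apply: (@le_trans _ _ (E (fun t => (p * p)%N%:R * \sum_u S0 u t ^+ 4))).
    apply: le_gauss_expect; first exact: has_momentsX.
      by apply: has_momentsZ; apply: has_moments_sum => u; exact: has_momentsX.
    move=> t; apply: (le_trans (sum_sqr_le _)).
    rewrite card_prod !card_ord ler_wpM2l//.
    by apply: ler_sum => u _; rewrite -exprM.
  rewrite gauss_expectZ; last by apply: has_moments_sum => u; exact: has_momentsX.
  rewrite gauss_expect_sum; last by move=> u; exact: has_momentsX.
  apply: (@le_trans _ _ ((p * p)%N%:R * \sum_(u : 'I_p * 'I_p) (848 * a%:R ^+ 2))).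
    by rewrite ler_wpM2l//; apply: ler_sum => u _; exact: ES4.
  rewrite sumr_const card_prod !card_ord -[_ *+ (p * p)]mulr_natr natrM.
  by rewrite (_ : p%:R ^+ 4 = p%:R ^+ 2 ^+ 2) -?exprM// !expr2; lra.
split => //.
  rewrite XE gauss_expectD//; last exact: has_momentsZ.
  by rewrite EA gauss_expectZ// EB add0r.
have hA2 : has_moments nu (fun t => 2 * A t ^+ 2).
  by apply: has_momentsZ; exact: has_momentsX.
have hB2 : has_moments nu (fun t => 2 * c ^+ 2 * B t ^+ 2).
  by apply: has_momentsZ; exact: has_momentsX.
apply: (@le_trans _ _ (E (fun t => 2 * A t ^+ 2 + 2 * c ^+ 2 * B t ^+ 2))).
  apply: le_gauss_expect; first exact: has_momentsX.
    exact: has_momentsD.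
  move=> t; rewrite XE.
  by have := sqr_ge0 (A t - c * B t); nra.
rewrite gauss_expectD// !gauss_expectZ; [|exact: has_momentsX|exact: has_momentsX].
rewrite lerD//; first lra.
by rewrite ler_wpM2l// mulr_ge0// sqr_ge0.
Qed.

End gauss_statistic.

(** * The lower bound *)

Section tv_lower.
Context (R : realType).

(** The quotient [(b - a) ^+ 2 / (2 * C)] of [TV_dist_test] with [C = A * (Q - A) * P ^+ 2 * (64 + 8
    * 848 * s ^+ 2)]. The 64 covers the Haar variance, 848 is the Gaussian fourth moment bound, and
    16 is 2 times the 8 of [Q ^+ 2 <= 8 * A * (Q - A)]. *)
Definition tv_rate (s : R) : R := s ^+ 2 / (16 * (64 + 8 * 848 * s ^+ 2)).

(** [A] stands for half of the [Q] columns, rounded down, and the common second-moment bound [C]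
    must dominate both laws. The mean gap is at least [(Q - A) / N * (A * P ^+ 2)], the Haar mean
    being 0. *)
Let rate_bounds (N A Q P M : R) : 0 < A -> 2 * A <= Q -> Q <= 3 * A ->
  Q <= N -> 1 <= P -> 4 <= N -> 0 < M ->
  let s := P * Q / N in let c := (Q - A) / (N - A) in
  let b := c * (A * (P ^+ 2 + P)) in
  let C := A * (Q - A) * P ^+ 2 * (64 + 8 * M * s ^+ 2) in
  [/\ 0 < C, 0 < b,
    s ^+ 2 / (16 * (64 + 8 * M * s ^+ 2)) <= (b - 0) ^+ 2 / (2 * C),
    4 * A * (Q - A) * P ^+ 2 * N ^+ 4 /
     (N * (N - 1) * ((N - A) * (N - A - 1))) <= C &
    8 * A * (Q - A) * P ^+ 2 + 2 * c ^+ 2 * (M * A ^+ 2 * P ^+ 4) <= C].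
Proof.
move=> A0 A2 A3 QN P1 N4 M0 s c b C.
have P0 : 0 < P by lra.
have QA0 : 0 < Q - A by lra.
have N0 : 0 < N by lra.
have NA0 : 0 < N - A by lra.
have AQP : 0 < A * (Q - A) * P ^+ 2 by rewrite !mulr_gt0 ?exprn_gt0.
have s2 : 0 <= s ^+ 2 by exact: sqr_ge0.
have Ms2 : 0 <= 8 * M * s ^+ 2 by rewrite mulr_ge0// mulr_ge0// ltW.
have D0 : 0 < 64 + 8 * M * s ^+ 2 by lra.
have C0 : 0 < C by rewrite mulr_gt0.
have c0 : 0 < c by rewrite divr_gt0.
have cN : (Q - A) / N <= c.
  by rewrite ler_pM2l// lef_pV2 ?posrE//; lra.
have cN2 : c <= 2 * (Q - A) / N.
  rewrite ler_pdivlMr// mulrAC ler_pdivrMr//.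
  by nra.
have b_ge : (Q - A) / N * (A * P ^+ 2) <= b.
  apply: ler_pM => //.
  - by rewrite divr_ge0// ltW.
  - by rewrite mulr_ge0 ?sqr_ge0// ltW.
  - by rewrite ler_pM2l// lerDl ltW.
have b_gt : 0 < (Q - A) / N * (A * P ^+ 2).
  by rewrite mulr_gt0 ?divr_gt0// mulr_gt0// exprn_gt0.
split => //; first exact: lt_le_trans b_ge.
- rewrite subr0.
  apply: (@le_trans _ _ (((Q - A) / N * (A * P ^+ 2)) ^+ 2 / (2 * C))); last first.
    rewrite ler_pM2r ?invr_gt0 ?mulr_gt0//.
    by apply: lerXn2r; rewrite ?nnegrE ?(ltW b_gt)// (le_trans (ltW b_gt)).
  have step (D : R) : 0 < D -> (P * Q / N) ^+ 2 / (16 * D) <=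
      ((Q - A) / N * (A * P ^+ 2)) ^+ 2 / (2 * (A * (Q - A) * P ^+ 2 * D)).
    move=> {}D0.
    rewrite [leRHS](_ : _ = (P ^+ 2 * (8 * (A * (Q - A)))) / N ^+ 2 / (16 * D)); last first.
      by field; rewrite !gt_eqF//; lra.
    rewrite ler_pM2r; last by rewrite invr_gt0; lra.
    rewrite expr_div_n ler_pM2r ?invr_gt0 ?exprn_gt0//.
    rewrite exprMn ler_pM2l ?exprn_gt0//.
    by nra.
  exact: step.
- apply: (@le_trans _ _ (A * (Q - A) * P ^+ 2 * 64)); last first.
    by rewrite ler_pM2l//; lra.
  rewrite [leLHS](_ : _ = A * (Q - A) * P ^+ 2 * (4 * N ^+ 3 / ((N - 1) * ((N - A) * (N - A - 1))))); last first.
    by field; rewrite !gt_eqF//; lra.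
  rewrite ler_pM2l//.
  have E0 : 0 < (N - 1) * ((N - A) * (N - A - 1)).
    by rewrite !mulr_gt0//; lra.
  rewrite ler_pdivrMr//.
  (* Here [N - 1] and [N - A] are at least [N / 2], and [N - A - 1] is at least [N / 4]. *)
  apply: (@le_trans _ _ (64 * (N / 2 * (N / 2 * (N / 4))))).
    by rewrite le_eqVlt; apply/orP; left; apply/eqP; field.
  rewrite ler_pM2l//; apply: ler_pM; [lra| |lra|].
    by rewrite !mulr_ge0//; lra.
  by apply: ler_pM; lra.
- have c2 : c ^+ 2 <= 4 * (Q - A) ^+ 2 / N ^+ 2.
    rewrite (_ : _ / _ = (2 * (Q - A) / N) ^+ 2); last by field; rewrite gt_eqF.
    by apply: lerXn2r; rewrite ?nnegrE ?(ltW c0)// (le_trans (ltW c0)).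
  have key : 2 * c ^+ 2 * (M * A ^+ 2 * P ^+ 4) <= A * (Q - A) * P ^+ 2 * (8 * M * s ^+ 2).
    apply: (@le_trans _ _ (2 * (4 * (Q - A) ^+ 2 / N ^+ 2) * (M * A ^+ 2 * P ^+ 4))).
      rewrite ler_wpM2r ?ler_pM2l//.
      by rewrite !mulr_ge0 ?exprn_ge0// ltW.
    rewrite [leLHS](_ : _ = A * (Q - A) * P ^+ 2 * (8 * M * (P ^+ 2 * (A * (Q - A)) / N ^+ 2))); last first.
      by field; rewrite gt_eqF.
    rewrite ler_pM2l// ler_pM2l ?mulr_gt0// /s expr_div_n ler_pM2r ?invr_gt0 ?exprn_gt0//.
    rewrite exprMn ler_pM2l ?exprn_gt0//.
    by nra.
  rewrite /C [leRHS]mulrDr; apply: lerD => //.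
  rewrite [leLHS](_ : _ = A * (Q - A) * P ^+ 2 * 8); last by ring.
  by rewrite ler_pM2l//; lra.
Qed.

Lemma TV_dist_quad_stat m (mu nu : probability (m.-tuple R) R) (p q n : nat)
    (io : nat -> nat -> 'I_m) :
  is_std_gaussian nu ->
  (forall i j k l, (i < p)%N -> (j < q)%N -> (k < p)%N -> (l < q)%N ->
    io i j = io k l -> (i = k) /\ (j = l)) ->
  (3 <= n)%N -> (0 < p)%N -> (1 < q)%N -> (q <= n.+1)%N ->
  let N : R := n.+1%:R in let a := q./2 in
  let X t := quad_stat a p q n.+1 (fun i j => tnth t (io i j)) in
  (\int[mu]_t (X t)%:E = 0)%E ->
  (\int[mu]_t (X t ^+ 2)%:E <= (4 * a%:R * (q - a)%N%:R * p%:R ^+ 2 * N ^+ 4 /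
     (N * (N - 1) * ((N - a%:R) * (N - a%:R - 1))))%:E)%E ->
  ((tv_rate ((p * q)%:R / N))%:E <= TV_dist mu nu)%E.
Proof.
move=> Hnu ioinj n3 p0 q1 qn N a X mu1 mu2.
have aq : (a < q)%N by rewrite /a; lia.
have a0 : (0 < a)%N by rewrite /a; lia.
have [hX EX EX2] := gauss_quad_stat Hnu ioinj (a := a) (N := n.+1) aq qn.
have aR0 : 0 < a%:R :> R by rewrite ltr0n.
have pR0 : 0 < p%:R :> R by rewrite ltr0n.
have p1 : 1 <= p%:R :> R by rewrite ler1n.
have aN : (a <= n.+1)%N by rewrite ltnW// (leq_trans aq).
have qaR : (q - a)%N%:R = q%:R - a%:R :> R by rewrite natrB// ltnW.
have NaR : (n.+1 - a)%N%:R = N - a%:R :> R by rewrite natrB.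
have a2 : 2 * a%:R <= q%:R :> R.
  by rewrite -natrM ler_nat /a; lia.
have a3 : q%:R <= 3 * a%:R :> R.
  by rewrite -natrM ler_nat /a; lia.
have qN : q%:R <= N by rewrite ler_nat.
have N4 : 4 <= N by rewrite (ler_nat R 4).
rewrite qaR NaR in EX EX2 *; rewrite qaR in mu2.
move: EX EX2 mu2 aR0 a2 a3 qN pR0 p1 N4.
rewrite natrM /tv_rate.
set A : R := a%:R; set Q : R := q%:R; set P : R := p%:R.
move=> EX EX2 mu2 A0 A2 A3 QN P0 P1 N4.
have [] := @rate_bounds N A Q P 848 A0 A2 A3 QN P1 N4 (ltr0Sn _ _).
set C := _ * (64 + _) => C0 b0 rate muC nuC.
apply: le_trans (TV_dist_test (f := X) _ C0 b0 _ _ mu1 _).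
- by rewrite lee_fin.
- by case: hX.
- by apply: (le_trans mu2); rewrite lee_fin.
- rewrite (gauss_expectE (has_momentsX 2 hX)) lee_fin; exact: le_trans EX2 nuC.
- by rewrite (gauss_expectE hX) EX.
Qed.

Lemma measurable_scaled_block n p q :
  measurable_fun setT (@scaled_block R n.+1 p q).
Proof.
apply/measurable_fun_tnthP => k.
have [kn|kn] := ltnP ((k %/ q) * n.+1 + k %% q)%N (n.+1 * n.+1)%N; last first.
  apply: (@eq_measurable_fun _ _ _ _ _ (fun=> 0 : R)); last exact: measurable_cst.
  by move=> t _ /=; rewrite tnth_mktuple nth_default ?mulr0// size_tuple.
apply: (@eq_measurable_fun _ _ _ _ _
  (fun t : (n.+1 * n.+1).-tuple R => Num.sqrt n.+1%:R * tnth t (Ordinal kn) : R)).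
  by move=> t _ /=; rewrite tnth_mktuple (tnth_nth 0).
by apply: measurable_funM => //; exact: measurable_tnth.
Qed.

Variables (n p q : nat) (h : probability ((n.+1 * n.+1).-tuple R) R).
Hypothesis Hh : is_haar_On h.
Variables (mu nu : probability ((p * q).-tuple R) R).
Hypotheses (Hmu : is_law_of_scaled_block h mu) (Hnu : is_std_gaussian nu).
Hypotheses (p0 : (0 < p)%N) (q0 : (0 < q)%N).
Hypotheses (pn : (p <= n.+1)%N) (qn : (q <= n.+1)%N).

Lemma integral_scaled_block (f : (p * q).-tuple R -> \bar R) :
  measurable_fun setT f ->
  (\int[mu]_t f t = \int[h]_t f (scaled_block p q t))%E.
Proof.
by move=> mf; apply: integral_map => //; exact: measurable_scaled_block.
Qed.

Let pq0 : (0 < p * q)%N. Proof. by rewrite muln_gt0 p0. Qed.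

Let io i j : 'I_(p * q) := insubd (Ordinal pq0) (i * q + j)%N.

Let ioE i j : (i < p)%N -> (j < q)%N -> val (io i j) = (i * q + j)%N.
Proof.
move=> ip jq; rewrite val_insubd ifT//.
by rewrite (@leq_trans (i.+1 * q))// ?leq_mul2r ?ip ?orbT// mulSn addnC ltn_add2r.
Qed.

Let io_inj i j k l : (i < p)%N -> (j < q)%N -> (k < p)%N -> (l < q)%N ->
  io i j = io k l -> (i = k) /\ (j = l).
Proof.
move=> ip jq kp lq /(congr1 val); rewrite !ioE// => e.
have := congr1 (divn^~ q) e; have := congr1 (modn^~ q) e.
by rewrite !modnMDl !modn_small// !divnMDl// !divn_small// !addn0.
Qed.

Let tnth_block t i j : (i < p)%N -> (j < q)%N -> tnth (scaled_block p q t) (io i j) =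
  Num.sqrt n.+1%:R * (mx_of_tuple t : 'M[R]_n.+1) (inord i) (inord j).
Proof.
move=> ip jq; rewrite tnth_mktuple mxE ioE//.
rewrite !inordK ?(leq_trans ip)// ?(leq_trans jq)//.
by rewrite divnMDl// divn_small// addn0 modnMDl modn_small.
Qed.

Lemma gram_dev_ext (g g' : nat -> nat -> R) a b i k :
  (forall j, (j < b)%N -> g i j = g' i j) -> (forall j, (j < b)%N -> g k j = g' k j) ->
  gram_dev g a b i k = gram_dev g' a b i k.
Proof. by move=> gi gk; apply: eq_big_nat => j /andP[_ jb]; rewrite gi// gk. Qed.

Lemma quad_stat_ext (g g' : nat -> nat -> R) a r s N : (a <= s)%N ->
  (forall i j, (i < r)%N -> (j < s)%N -> g i j = g' i j) ->
  quad_stat a r s N g = quad_stat a r s N g'.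
Proof.
move=> as_ gg; have gg0 (i k : 'I_r) : gram_dev g 0 a i k = gram_dev g' 0 a i k.
  by apply: gram_dev_ext => j ja; apply: gg => //; exact: leq_trans as_.
have gga (i k : 'I_r) : gram_dev g a s i k = gram_dev g' a s i k.
  by apply: gram_dev_ext => j js; exact: gg.
by congr (_ + _ * _); apply: eq_bigr => i _; apply: eq_bigr => k _; rewrite ?gg0 ?gga.
Qed.

(** The columns can be cut into two nonempty groups only if [q > 1]. For [q = 1] the rows are cut
    instead: invariance of the Haar law under transposition reduces this to the same estimate with
    [p] and [q] exchanged. *)
Lemma TV_dist_scaled_block_ge : (3 <= n)%N -> (1 < p * q)%N ->
  ((tv_rate ((p * q)%:R / n.+1%:R))%:E <= TV_dist mu nu)%E.
Proof.
move=> n3 pq1.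
have n0 : (0 < n)%N by exact: leq_trans n3.
have half_lt r : (0 < r)%N -> (r./2 < r)%N by lia.
have half_N r : (r <= n.+1)%N -> (r./2.+2 <= n.+1)%N by lia.
have hE (F : 'M[R]_n.+1 -> R) : bounded_mx F ->
    (\int[h]_t (F (mx_of_tuple t))%:E)%E = (haar_expect h F)%:E.
  exact: haar_expectE.
have [q1|q1] := ltnP 1 q.
  have [bX X0 X2] := haar_quad_stat Hh n0 (half_lt q q0) (half_N q qn) qn pn.
  have [[mX _] _ _] := gauss_quad_stat Hnu io_inj (N := n.+1) (half_lt q q0) qn.
  have XE t : quad_stat q./2 p q n.+1 (fun i j => tnth (scaled_block p q t) (io i j)) =
      quad_stat q./2 p q n.+1 (fun i j =>
        Num.sqrt n.+1%:R * (mx_of_tuple t : 'M[R]_n.+1) (inord i) (inord j)).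
    by apply: quad_stat_ext; [lia|move=> i j; exact: tnth_block].
  apply: (TV_dist_quad_stat Hnu io_inj) => //.
    rewrite integral_scaled_block; last exact/measurable_EFinP.
    under eq_integral do rewrite XE.
    by rewrite (hE _ bX) X0.
  rewrite integral_scaled_block; last by apply/measurable_EFinP; exact: measurable_funX.
  under eq_integral do rewrite XE.
  by rewrite (hE _ (bounded_mxX 2 bX)) lee_fin.
have p1 : (1 < p)%N by move: q1 q0 pq1; case: q => [|[|]]//; rewrite muln1.
have io_inj' i j k l : (i < q)%N -> (j < p)%N -> (k < q)%N -> (l < p)%N ->
    io j i = io l k -> (i = k) /\ (j = l).
  by move=> iq jp kq lp /io_inj[].
have [bX X0 X2] := haar_quad_stat Hh n0 (half_lt p p0) (half_N p pn) pn qn.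
have [[mX _] _ _] := gauss_quad_stat Hnu io_inj' (N := n.+1) (half_lt p p0) pn.
have XE t : quad_stat p./2 q p n.+1 (fun i j => tnth (scaled_block p q t) (io j i)) =
    quad_stat p./2 q p n.+1 (fun i j =>
      Num.sqrt n.+1%:R * (mx_of_tuple t : 'M[R]_n.+1)^T (inord i) (inord j)).
  by apply: quad_stat_ext => [|i j iq jp]; [lia|rewrite mxE; exact: tnth_block].
rewrite (_ : (p * q)%:R = (q * p)%:R :> R); last by rewrite mulnC.
apply: (TV_dist_quad_stat Hnu io_inj') => //.
  rewrite integral_scaled_block; last exact/measurable_EFinP.
  under eq_integral do rewrite XE.
  rewrite (haar_tr Hh (f := fun G => (quad_stat p./2 q p n.+1 (fun i j =>
    Num.sqrt n.+1%:R * G (inord i) (inord j)))%:E)); first by rewrite (hE _ bX) X0.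
  by apply/measurable_EFinP; case: bX.
rewrite integral_scaled_block; last by apply/measurable_EFinP; exact: measurable_funX.
under eq_integral do rewrite XE.
rewrite (haar_tr Hh (f := fun G => (quad_stat p./2 q p n.+1 (fun i j =>
  Num.sqrt n.+1%:R * G (inord i) (inord j)) ^+ 2)%:E)).
  by rewrite (hE _ (bounded_mxX 2 bX)) lee_fin.
by apply/measurable_EFinP; case: (bounded_mxX 2 bX).
Qed.

End tv_lower.

Section compare_distances.
Context (R : realType) (d : measure_display) (T : measurableType d).
Variables mu nu : probability T R.
Local Open Scope ereal_scope.

(** Transfers a lower bound on total variation through [TV <= 3 * H] and [2 * H ^+ 2 <= KL]. *)
Definition dist_lower (k : dist_kind) (r : R) : R :=
  match k with
  | DTV => r
  | DHellinger => r / 3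
  | DKL => 2 * (r / 3) ^+ 2
  end.

Lemma prob_dist_ge k (r : R) : (0 <= r)%R -> r%:E <= TV_dist mu nu ->
  (dist_lower k r)%:E <= prob_dist k mu nu.
Proof.
move=> r0 rTV; case: k => //=.
all: have H0 := hellinger2_ge0 mu nu.
all: have := le_trans rTV (TV_dist_le_hellinger mu nu).
all: rewrite /hellinger -EFinM lee_fin => rH.
  by rewrite lee_fin ler_pdivrMr// mulrC.
apply: le_trans (KL_div_ge_hellinger2 mu nu).
rewrite lee_fin ler_pM2l// -[leRHS]sqr_sqrtr//.
by apply: lerXn2r; rewrite ?nnegrE ?divr_ge0 ?sqrtr_ge0// ler_pdivrMr// mulrC.
Qed.

(** The same two inequalities, read from the divergence towards the other distances. *)
Definition dist_upper (k : dist_kind) (r : R) : R :=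
  match k with
  | DTV => 3 * Num.sqrt (r / 2)
  | DHellinger => Num.sqrt (r / 2)
  | DKL => r
  end.

Lemma prob_dist_ge0 k : 0 <= prob_dist k mu nu.
Proof.
case: k => /=; first exact: TV_dist_ge0.
  by rewrite lee_fin sqrtr_ge0.
apply: le_trans (KL_div_ge_hellinger2 mu nu).
by rewrite lee_fin mulr_ge0// hellinger2_ge0.
Qed.

Lemma prob_dist_le k (r : R) : KL_div mu nu <= r%:E ->
  prob_dist k mu nu <= (dist_upper k r)%:E.
Proof.
move=> KLr.
have := le_trans (KL_div_ge_hellinger2 mu nu) KLr; rewrite lee_fin => Hr.
have sH : (Num.sqrt (fine (hellinger2 mu nu)) <= Num.sqrt (r / 2))%R.
  by rewrite ler_wsqrtr// ler_pdivlMr// mulrC.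
case: k => //=.
apply: (le_trans (TV_dist_le_hellinger mu nu)).
by rewrite /hellinger -EFinM lee_fin ler_pM2l.
Qed.

End compare_distances.

Lemma dist_lower_gt0 (R : realType) k (r : R) : 0 < r -> 0 < dist_lower k r.
Proof. by case: k => r0 //=; rewrite ?mulr_gt0 ?exprn_gt0 ?divr_gt0. Qed.

Lemma dist_upper_cvg0 (R : realType) k (u : nat -> R) : u @ \oo --> 0 ->
  (fun n => dist_upper k (u n)) @ \oo --> 0.
Proof.
move=> u0; have h : (fun n => Num.sqrt (u n / 2)) @ \oo --> (0 : R).
  rewrite -[X in _ --> X]sqrtr0.
  apply: (@cvg_comp _ _ _ (fun n => u n / 2) Num.sqrt); last exact: sqrt_continuous.
  suff : (fun n => u n / 2) @ \oo --> (0 : R) by [].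
  by rewrite -[X in _ --> X](mul0r (2^-1 : R)); apply: cvgMl.
case: k => //=.
by rewrite -[X in _ --> X](mulr0 (3 : R)); apply: cvgMr.
Qed.

Lemma limn_einf_ge (R : realType) (u : (\bar R)^nat) (r : \bar R) :
  (\forall n \near \oo, r <= u n)%E -> (r <= limn_einf u)%E.
Proof.
move=> [N _ ru]; rewrite limn_einf_lim.
rewrite (cvg_lim _ (@cvg_einfs_sup _ u))//.
apply: (@le_trans _ _ (einfs u N)); last by apply: ereal_sup_ubound; exists N.
by apply: le_ereal_inf_tmp => _ [n /= Nn] <-; exact: ru.
Qed.

(** The numerator is bounded below at [sigma / 2] and the denominator above at [2 * sigma]. *)
Lemma near_tv_rate (R : realType) (s : nat -> R) (sigma : R) : 0 < sigma ->
  s @ \oo --> (sigma : R^o) ->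
  exists2 delta : R, 0 < delta & \forall n \near \oo, delta <= tv_rate (s n).
Proof.
move=> sigma0 ssigma.
rewrite /tv_rate; have : 0 <= 8 * 848 :> R by rewrite mulr_ge0 ?ler0n.
move: (8 * 848) => K K0; pose D (x : R) := 16 * (64 + K * x ^+ 2).
have D0 x : 0 < D x by rewrite mulr_gt0// ltr_wpDr// mulr_ge0// sqr_ge0.
exists ((sigma / 2) ^+ 2 / D (2 * sigma)).
  by rewrite divr_gt0// exprn_gt0// divr_gt0.
have lo : \forall n \near \oo, sigma / 2 <= s n.
  by apply: (cvgr_ge _ ssigma); lra.
have hi : \forall n \near \oo, s n <= 2 * sigma.
  by apply: (cvgr_le _ ssigma); lra.
near=> n.
have l : sigma / 2 <= s n by near: n.
have u : s n <= 2 * sigma by near: n.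
have s0 : 0 <= s n by apply: le_trans l; rewrite divr_ge0// ltW.
apply: ler_pM.
- exact: sqr_ge0.
- by rewrite invr_ge0 ltW.
- by apply: lerXn2r; rewrite ?nnegrE ?divr_ge0// ltW.
- rewrite lef_pV2 ?posrE ?D0// ler_pM2l// lerD2l ler_wpM2l//.
  by apply: lerXn2r; rewrite ?nnegrE// mulr_ge0// ltW.
Unshelve. all: by end_near. Qed.

Lemma liminf_prob_dist_gt0 (R : realType) (p q : nat -> nat)
  (Hpq : forall n : nat, (0 < n)%N -> (1 <= p n <= n)%N /\ (1 <= q n <= n)%N)
  (h : forall n : nat, probability ((n * n).-tuple R) R)
  (Hh : forall n : nat, (0 < n)%N -> is_haar_On (h n))
  (mu : forall n : nat, probability ((p n * q n).-tuple R) R)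
  (Hmu : forall n : nat, (0 < n)%N -> is_law_of_scaled_block (h n) (mu n))
  (nu : forall n : nat, probability ((p n * q n).-tuple R) R)
  (Hnu : forall n : nat, (0 < n)%N -> is_std_gaussian (nu n))
  (k : dist_kind) (sigma : R) : 0 < sigma ->
  (fun n : nat => ((p n * q n)%:R / n%:R : R)) @ \oo --> (sigma : R^o) ->
  (0 < limn_einf (fun n : nat => prob_dist k (mu n) (nu n)))%E.
Proof.
move=> sigma0 ssigma.
(* The size is a free variable here so that it can be split into a successor; the types of the laws
   depend on it. *)
have TV_ge N r s (hN : probability ((N * N).-tuple R) R)
    (mu0 nu0 : probability ((r * s).-tuple R) R) : is_haar_On hN ->
    is_law_of_scaled_block hN mu0 -> is_std_gaussian nu0 -> (3 < N)%N ->
    (0 < r)%N -> (0 < s)%N -> (r <= N)%N -> (s <= N)%N -> (1 < r * s)%N ->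
    ((tv_rate ((r * s)%:R / N%:R))%:E <= TV_dist mu0 nu0)%E.
  case: N hN => // N hN HhN Hmu0 Hnu0 N3 r0 s0 rN sN rs1.
  exact: (TV_dist_scaled_block_ge HhN).
have [delta delta0 rate] := near_tv_rate sigma0 ssigma.
apply: (@lt_le_trans _ _ (dist_lower k delta)%:E).
  by rewrite lte_fin; exact: dist_lower_gt0.
apply: limn_einf_ge.
have lo : \forall n \near \oo, sigma / 2 <= (p n * q n)%:R / n%:R.
  by apply: (cvgr_ge _ ssigma); lra.
near=> n.
have n4 : (4 <= n)%N by near: n; exists 4%N.
have nbig : 2 / sigma < n%:R by near: n; exact: nbhs_infty_gtr.
have l : sigma / 2 <= (p n * q n)%:R / n%:R by near: n.
have dr : delta <= tv_rate ((p n * q n)%:R / n%:R) by near: n.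
have n0 : (0 < n)%N by apply: leq_trans n4.
have pq1 : (1 < p n * q n)%N.
  rewrite -(ltr_nat R); move: l; rewrite ler_pdivlMr ?ltr0n//.
  apply: lt_le_trans.
  by move: nbig; rewrite ltr_pdivrMr//; lra.
apply: prob_dist_ge; first exact: ltW.
apply: (@le_trans _ _ (tv_rate ((p n * q n)%:R / n%:R))%:E); first by rewrite lee_fin.
have [/andP[p0 pn] /andP[q0 qn]] := Hpq _ n0.
exact: TV_ge (Hh _ n0) (Hmu _ n0) (Hnu _ n0) n4 p0 q0 pn qn pq1.
Unshelve. all: by end_near. Qed.

(** * The law of a corner entry *)

Section semicircle_weight.
Context (R : realType).
Notation leb := (@lebesgue_measure R).
Notation I := `[(-1 : R)%R, 1%R]%classic.

Definition cocos (t : R) : R := Num.sqrt (1 - t ^+ 2).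

Lemma cocos_ge0 t : 0 <= cocos t. Proof. exact: sqrtr_ge0. Qed.

Lemma sqr_cocos t : `|t| <= 1 -> cocos t ^+ 2 = 1 - t ^+ 2.
Proof.
move=> t1; rewrite sqr_sqrtr// subr_ge0 -[t ^+ 2]ger0_norm ?sqr_ge0//.
by rewrite normrX exprn_ile1.
Qed.

Lemma cocos_gt0 t : `|t| < 1 -> 0 < cocos t.
Proof.
move=> t1; rewrite sqrtr_gt0 subr_gt0 -[t ^+ 2]ger0_norm ?sqr_ge0//.
by rewrite normrX exprn_ilt1.
Qed.

Lemma cocos_le1 t : cocos t <= 1.
Proof. by rewrite -[leRHS]sqrtr1 ler_wsqrtr// lerBlDr lerDl sqr_ge0. Qed.

Lemma continuous_cocos : continuous cocos.
Proof.
move=> t; apply: (@continuous_comp _ _ _ (fun t : R => 1 - t ^+ 2) Num.sqrt).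
  by apply: cvgB; [exact: cvg_cst|exact: exprn_continuous].
exact: sqrt_continuous.
Qed.

Lemma measurable_cocos : measurable_fun setT cocos.
Proof. by apply: continuous_measurable_fun; exact: continuous_cocos. Qed.

Let f m k (t : R) : R := t ^+ m * cocos t ^+ k.

Let cf m k : continuous (f m k).
Proof.
move=> t; apply: cvgM; first exact: exprn_continuous.
apply: (@continuous_comp _ _ _ cocos (fun x => x ^+ k)); first exact: continuous_cocos.
exact: exprn_continuous.
Qed.

Let integrable_cont (u : R -> R) : continuous u -> leb.-integrable I (EFin \o u).
Proof.
move=> cu; apply: continuous_compact_integrable; first exact: segment_compact.
exact: continuous_subspaceT.
Qed.

(** The Beta integral of [t ^+ m * (1 - t ^+ 2) ^ (k / 2)] over [-1, 1]. *)
Definition cocos_moment m k : R := \int[leb]_(t in I) (f m k t).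

Let is_derive_cocos (t : R) : `|t| < 1 -> is_derive t 1 cocos (- t / cocos t).
Proof.
move=> t1; have c0 := cocos_gt0 t1.
have h0 : is_derive t 1 (fun x : R => 1 - x ^+ 2) (- (2 * t)).
  by apply: is_derive_eq; rewrite /GRing.scale/=; ring.
have hs : is_derive (1 - t ^+ 2) 1 Num.sqrt (2 * cocos t)^-1.
  by apply: is_derive1_sqrt; rewrite -sqr_cocos ?ltW// exprn_gt0.
have h := @is_derive1_comp R Num.sqrt (fun x => 1 - x ^+ 2) t _ _ hs h0.
apply: is_derive_eq.
by field; rewrite gt_eqF.
Qed.

Let is_derive_f m k (t : R) : `|t| < 1 ->
  is_derive t 1 (f m k.+2) (m%:R * f m.-1 k t - (m + k + 2)%:R * f m.+1 k t).
Proof.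
move=> t1; have c0 := cocos_gt0 t1.
have h1 := is_derive_cocos t1.
have h2 := @is_deriveX R _ cocos k.+2 t 1 _ h1.
have h3 := @is_deriveX R _ id m t 1 _ (is_derive_id t 1).
have := is_deriveM h3 h2; rewrite !exprfctE => h.
apply: is_derive_eq.
rewrite /GRing.scale/= /f mulr1.
have cE : cocos t ^+ k.+2 = (1 - t ^+ 2) * cocos t ^+ k.
  by rewrite -sqr_cocos ?ltW// -exprD.
rewrite cE exprS !natrD.
case: m {h3 h} => [|m] /=; rewrite ?expr0 ?mul0r ?mul1r ?mulr0 ?addr0 ?add0r ?sub0r -?natr1.
  by rewrite expr1; field; rewrite gt_eqF.
rewrite !exprS; field; by rewrite gt_eqF.
Qed.

(** Integrate the derivative of [t ^+ m * cocos t ^+ k.+2]: the factor [cocos] kills both boundary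
    terms, and the exponent [k.+2] keeps the derivative continuous up to the endpoints. *)
Lemma cocos_moment_rec m k :
  m%:R * cocos_moment m.-1 k = (m + k + 2)%:R * cocos_moment m.+1 k.
Proof.
pose u t := m%:R * f m.-1 k t - (m + k + 2)%:R * f m.+1 k t.
have cu : continuous u.
  by move=> t; apply: cvgB; apply: cvgMr; exact: cf.
have f10 : f m k.+2 1 = 0 by rewrite /f /cocos !expr1n subrr sqrtr0 exprS mul0r mulr0.
have fN10 : f m k.+2 (-1) = 0.
  by rewrite /f /cocos sqrrN expr1n subrr sqrtr0 exprS mul0r mulr0.
have : (\int[leb]_(t in I) (u t)%:E = 0)%E.
  rewrite (@continuous_FTC2 _ u (f m k.+2)).
  - by rewrite f10 fN10 sube0.
  - lra.
  - exact: continuous_subspaceT.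
  - split.
    + move=> t; rewrite in_itv/= -ltr_norml => t1.
      by have h := is_derive_f m k t1; exact: ex_derive.
    + by apply: cvg_at_right_filter; exact: cf.
    + by apply: cvg_at_left_filter; exact: cf.
  - move=> t; rewrite in_itv/= -ltr_norml => t1.
    by have h := is_derive_f m k t1; rewrite derive1E; apply: derive_val.
move=> /(congr1 fine)/= => u0.
apply/eqP; rewrite -subr_eq0; apply/eqP; rewrite -[RHS]u0 -/(Rintegral _ _ _).
rewrite RintegralB ?RintegralZl//; try by apply: integrable_cont => t; apply: cvgMr; exact: cf.
all: by apply: integrable_cont; exact: cf.
Qed.

Lemma cocos_moment_S2 k : cocos_moment 0 k.+2 = cocos_moment 0 k - cocos_moment 2 k.
Proof.
transitivity (\int[leb]_(t in I) (f 0 k t - f 2 k t)); last first.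
  by apply: RintegralB => //; exact: integrable_cont.
apply: eq_Rintegral => t /set_mem; rewrite /= in_itv/= => t1.
by rewrite /f !expr0 !mul1r exprS exprS mulrA -expr2 sqr_cocos ?ler_norml// mulrBl mul1r.
Qed.

Lemma cocos_moment_wallis k :
  (k + 3)%:R * cocos_moment 0 k.+2 = (k + 2)%:R * cocos_moment 0 k.
Proof.
have := cocos_moment_rec 1 k; rewrite mul1r /= addnAC => M2.
rewrite cocos_moment_S2 mulrBr (_ : (k + 3)%:R = (1 + 2 + k)%:R :> R) -?M2.
  by rewrite -natr1 mulrDl mul1r addrK -addn1; congr (_%:R * _); lia.
by congr _%:R; lia.
Qed.

Lemma cocos_moment_ge0 k : 0 <= cocos_moment 0 k.
Proof.
by apply: Rintegral_ge0 => t _; rewrite /f mul1r exprn_ge0// cocos_ge0.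
Qed.

Lemma cocos_moment_decr k : cocos_moment 0 k.+1 <= cocos_moment 0 k.
Proof.
apply: le_Rintegral; [exact: measurable_itv|apply: integrable_cont; exact: cf|apply: integrable_cont; exact: cf|].
move=> t _; rewrite /f !mul1r exprS ler_piMl ?exprn_ge0 ?cocos_ge0//.
exact: cocos_le1.
Qed.

Lemma cocos_moment0 : cocos_moment 0 0 = 2.
Proof.
rewrite /cocos_moment /f; under eq_Rintegral do rewrite !expr0 mulr1.
rewrite Rintegral_cst ?mul1r//.
have /= := @lebesgue_measure_itv R `[(-1), 1]%R.
rewrite lte_fin ifT; last lra.
by move=> /(congr1 fine)/= ->; rewrite opprK.
Qed.

(** The integral is the area of a half disc. As [cocos] is not differentiable at the endpoints, the
    primitive [(t * cocos t + asin t) / 2] is used on [[- sin th, sin th]] with [th < pi / 2], where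
    it gives at least [th]. *)
Lemma cocos_moment1_ge : pi / 2 <= cocos_moment 0 1.
Proof.
rewrite leNgt; apply/negP => Zpi.
have Z0 := cocos_moment_ge0 1.
(* A midpoint: the inner integral is at least [th], which would exceed the full integral. *)
pose th := (cocos_moment 0 1 + pi / 2) / 2.
have th0 : 0 < th by rewrite /th; lra.
have thp : th < pi / 2 by rewrite /th; lra.
pose a := sin th.
have a0 : 0 < a by apply: sin_gt0_pi; have := pi_ge0 R; lra.
have a1 : a < 1.
  rewrite -sin_pihalf; rewrite ltr_sin// in_itv/=; lra.
pose F t := 2^-1 * (t * cocos t + asin t).
have dF (t : R) : `|t| < 1 -> is_derive t 1 F (cocos t).
  move=> t1; have c0 := cocos_gt0 t1.
  have hc := is_derive_cocos t1.
  have hi := is_derive_id t (1 : R).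
  have ha : is_derive t 1 asin (cocos t)^-1 by apply: is_derive1_asin; rewrite -ltr_norml.
  have hm := is_deriveM hi hc.
  have hd := is_deriveD hm ha.
  have := is_deriveM (is_derive_cst (2^-1 : R) t 1) hd => h.
  apply: is_derive_eq.
  rewrite /GRing.scale/= mulr0 addr0 mulr1.
  have c2 := sqr_cocos (ltW t1).
  apply/eqP; rewrite -(inj_eq (mulfI (_ : 2 * cocos t != 0))); last by rewrite mulf_neq0 ?gt_eqF.
  apply/eqP; transitivity (cocos t ^+ 2 + (1 - t ^+ 2)); first by field; rewrite gt_eqF.
  by rewrite -c2; ring.
have cF t : `|t| < 1 -> {for t, continuous F}.
  move=> t1; apply: differentiable_continuous; apply/derivable1_diffP.
  by have h := dF t t1; exact: ex_derive.
have aa : - a < a by lra.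
have int : (\int[leb]_(t in `[(- a)%R, a]) (cocos t)%:E = (F a - F (- a))%:E)%E.
  rewrite (@continuous_FTC2 _ cocos F)//.
  - exact: continuous_subspaceT continuous_cocos.
  - split.
    + move=> t; rewrite in_itv/= => /andP[ta tb].
      have h := dF t; apply: ex_derive; apply: h; rewrite ltr_norml; lra.
    + by apply: cvg_at_right_filter; apply: cF; rewrite normrN gtr0_norm.
    + by apply: cvg_at_left_filter; apply: cF; rewrite gtr0_norm.
  - move=> t; rewrite in_itv/= => /andP[ta tb].
    have h := dF t; rewrite derive1E; apply: derive_val; apply: h; rewrite ltr_norml; lra.
have thI : th \in `[(- (pi / 2)), pi / 2] by rewrite in_itv/=; lra.
have thIN : - th \in `[(- (pi / 2)), pi / 2] by rewrite in_itv/=; lra.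
have Fa : F a - F (- a) = a * cocos a + th.
  have asa : asin a = th by rewrite /a sinK.
  have asNa : asin (- a) = - th by rewrite /a -sinN sinK.
  have cN : cocos (- a) = cocos a by rewrite /cocos sqrrN.
  by rewrite /F asa asNa cN; field.
have : (\int[leb]_(t in `[(- a)%R, a]) (cocos t)%:E <= (cocos_moment 0 1)%:E)%E.
  rewrite /cocos_moment /Rintegral fineK; last first.
    by apply: integrable_fin_num => //; exact: integrable_cont.
  apply: (@le_trans _ _ (\int[leb]_(t in I) (cocos t)%:E)%E); last first.
    rewrite le_eqVlt; apply/orP; left; apply/eqP; apply: eq_integral => t _.
    by rewrite /f expr0 mul1r expr1.
  apply: ge0_subset_integral => //.
  - by apply/measurable_EFinP; apply: measurable_funTS; exact: measurable_cocos.
  - by move=> t _; rewrite lee_fin cocos_ge0.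
  - move=> t /=; rewrite !in_itv/= => /andP[ta tb]; lra.
rewrite int lee_fin Fa; have : 0 <= a * cocos a by rewrite mulr_ge0 ?cocos_ge0// ltW.
by rewrite /th; lra.
Qed.

(** By the Wallis recursion the right-hand side does not depend on [k], so the case [k = 0]
    decides. *)
Lemma cocos_momentM k :
  2 * pi <= (k + 2)%:R * (cocos_moment 0 k * cocos_moment 0 k.+1).
Proof.
elim: k => [|k IH].
  by rewrite cocos_moment0; have := cocos_moment1_ge; lra.
apply: (le_trans IH).
rewrite mulrA -cocos_moment_wallis addSnnS.
by rewrite [cocos_moment 0 k.+1 * _]mulrC mulrA.
Qed.

(** Two consecutive moments have a known product and decrease. The result bounds the normalising
    constants with the exact leading factor, without Stirling. *)
Lemma cocos_moment_sqr_ge k : 2 * pi / (k + 2)%:R <= cocos_moment 0 k ^+ 2.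
Proof.
rewrite ler_pdivrMr ?ltr0n ?addn_gt0 ?orbT//.
apply: (le_trans (cocos_momentM k)).
rewrite mulrC ler_wpM2r// expr2 ler_wpM2l ?cocos_moment_ge0//.
exact: cocos_moment_decr.
Qed.

End semicircle_weight.

Section bernoulli_bounds.
Context (R : realFieldType).
Implicit Types t r : R.

Lemma bernoulli_ge t m : 0 <= t <= 1 -> 1 - m%:R * t <= (1 - t) ^+ m.
Proof.
move=> /andP[t0 t1]; elim: m => [|m IH]; first by rewrite mul0r subr0 expr0.
rewrite exprS -natr1.
have h : (1 - t) * (1 - m%:R * t) <= (1 - t) * (1 - t) ^+ m.
  by rewrite ler_wpM2l// subr_ge0.
have m0 : 0 <= m%:R * t * t by rewrite !mulr_ge0.
apply: le_trans h; nra.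
Qed.

Lemma bernoulli_le t m : 0 <= t <= 1 -> (1 - t) ^+ m * (1 + m%:R * t) <= 1.
Proof.
move=> /andP[t0 t1]; elim: m => [|m IH]; first by rewrite mul0r addr0 expr0 mulr1.
apply: le_trans IH; rewrite exprS [(1 - t) * _]mulrC -mulrA ler_wpM2l//.
  by rewrite exprn_ge0// subr_ge0.
have m0 : 0 <= m%:R * t * t by rewrite !mulr_ge0.
rewrite -natr1; nra.
Qed.

Lemma mulrn_expr_le r n : 0 < r < 1 -> n%:R * r ^+ n <= (r^-1 - 1)^-1.
Proof.
move=> /andP[r0 r1]; have ri : 0 < r^-1 - 1 by rewrite subr_gt0 invf_gt1.
rewrite -(ler_pM2r ri) mulVf ?gt_eqF//.
have : 1 + n%:R * (r^-1 - 1) <= r^-1 ^+ n.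
  elim: n => [|n IH]; first by rewrite mul0r addr0 expr0.
  have n0 : 0 <= n%:R * (r^-1 - 1) * (r^-1 - 1) by rewrite !mulr_ge0// ltW.
  have h : r^-1 * (1 + n%:R * (r^-1 - 1)) <= r^-1 * r^-1 ^+ n.
    by rewrite ler_pM2l ?invr_gt0.
  rewrite exprS -natr1; apply: le_trans h; nra.
move=> h; have : (1 + n%:R * (r^-1 - 1)) * r ^+ n <= r^-1 ^+ n * r ^+ n.
  by rewrite ler_pM2r// exprn_gt0.
rewrite -exprMn mulVf ?gt_eqF// expr1n.
have := exprn_ge0 n (ltW r0); nra.
Qed.

End bernoulli_bounds.

(** * A law on [-1, 1] is determined by its moments *)

Section moments_determine.
Context (R : realType).
Implicit Types P Q : probability (measurableTypeR R) R.

(** The polynomials [(1 - y ^+ n) ^+ K] with [K] about [n / s ^+ n] tend on [0, 1] to the indicator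
    of [y < s]. Indeed [K * y ^+ n] is at least [n] for [y >= s], and is about [n * (y / s) ^+ n],
    hence negligible, for [y < s]; the Bernoulli inequalities turn this into the two limits. *)
Let step_exp (s : R) n : nat := (Num.truncn (n%:R / s ^+ n)).+1.

Let step_exp_ge s n : 0 < s -> n%:R <= (step_exp s n)%:R * s ^+ n.
Proof.
move=> s0; rewrite -ler_pdivrMr ?exprn_gt0//; apply: ltW.
exact: truncnS_gt.
Qed.

Let step_exp_le s n : 0 < s -> (step_exp s n)%:R * s ^+ n <= n%:R + s ^+ n.
Proof.
move=> s0; rewrite -natr1 mulrDl mul1r lerD2r -ler_pdivlMr ?exprn_gt0//.
by rewrite truncn_le divr_ge0// exprn_ge0// ltW.
Qed.

Let step (s : R) n (y : R) := (1 - y ^+ n) ^+ step_exp s n.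

Let cvg_step (s y : R) : 0 < s <= 1 -> 0 <= y <= 1 ->
  (fun n => step s n y) @ \oo --> ((y < s)%R%:R : R).
Proof.
move=> /andP[s0 s1] /andP[y0 y1].
have yn n : 0 <= y ^+ n <= 1 by rewrite exprn_ge0// exprn_ile1.
have [ys|sy] := ltP y s; last first.
  apply: (@squeeze_cvgr _ _ _ _ (cst 0) (@harmonic R)).
  - apply: nearW => n; rewrite exprn_ge0 ?subr_ge0 ?exprn_ile1//=.
    have := bernoulli_le (step_exp s n) (yn n); rewrite -/(step s n y) => h.
    rewrite /harmonic -[leRHS]mul1r ler_pdivlMr ?ltr0n//; apply: le_trans h.
    rewrite ler_wpM2l ?exprn_ge0 ?subr_ge0 ?exprn_ile1// -natr1 addrC lerD2l.
    apply: (le_trans (step_exp_ge n s0)); rewrite ler_wpM2l//.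
    by apply: lerXn2r; rewrite ?nnegrE// ltW.
  - exact: cvg_cst.
  - exact: cvg_harmonic.
have [->|yn0] := eqVneq y 0.
  apply: (@cvg_trans _ (1 @[n --> \oo])); last exact: cvg_cst.
  apply: near_eq_cvg; near=> n.
  rewrite /step expr0n (_ : n == 0%N = false) ?subr0 ?expr1n//.
  by apply/negbTE; rewrite -lt0n; near: n; exists 1%N.
have {yn0}y0 : 0 < y by rewrite lt_neqAle eq_sym yn0.
pose r := y / s; have r0 : 0 < r by rewrite divr_gt0.
have r1 : r < 1 by rewrite ltr_pdivrMr// mul1r.
(* The square root leaves one geometric factor to spare: [n * r ^+ n = (n * w ^+ n) * w ^+ n], and
   the first factor is bounded. *)
pose w := Num.sqrt r.
have w0 : 0 < w by rewrite sqrtr_gt0.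
have w1 : w < 1 by rewrite -[ltRHS]sqrtr1 ltr_sqrt.
have w2 : w ^+ 2 = r by rewrite sqr_sqrtr// ltW.
pose c := (w^-1 - 1)^-1.
apply: (@squeeze_cvgr _ _ _ _ (fun n => 1 - (c * w ^+ n + r ^+ n)) (cst 1)).
- apply: nearW => n; apply/andP; split; last first.
    by rewrite exprn_ile1 ?subr_ge0 ?lerBlDr ?lerDl; case/andP: (yn n).
  apply: le_trans (bernoulli_ge (step_exp s n) (yn n)); rewrite lerD2l lerN2.
  have yE : y ^+ n = s ^+ n * r ^+ n by rewrite -exprMn /r mulrCA divff ?mulr1 ?gt_eqF.
  rewrite yE mulrA; apply: (@le_trans _ _ ((n%:R + s ^+ n) * r ^+ n)).
    by rewrite ler_wpM2r ?exprn_ge0 ?step_exp_le// ltW.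
  rewrite mulrDl lerD//.
    rewrite -w2 exprAC expr2 mulrA ler_wpM2r ?exprn_ge0 ?(ltW w0)//.
    by apply: mulrn_expr_le; rewrite w0 w1.
  by rewrite ler_piMl ?exprn_ge0 ?exprn_ile1 ?(ltW r0) ?(ltW s0).
- suff : (fun n => 1 - (c * w ^+ n + r ^+ n)) @ \oo --> (1 - (c * 0 + 0) : R).
    by rewrite mulr0 addr0 subr0.
  apply: cvgB; first exact: cvg_cst.
  apply: cvgD; last by apply: cvg_expr; rewrite gtr0_norm.
  by apply: cvgMr; apply: cvg_expr; rewrite gtr0_norm.
- exact: cvg_cst.
Unshelve. all: by end_near. Qed.

(** Equal moments give equal integrals of all polynomials. Polynomial approximations of the
    indicator of [x < s], rescaled by [(1 + x) / 2], and dominated convergence then identify the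
    distribution functions. *)
Lemma moments_determine P Q : P `[-1, 1]%classic = 1%E -> Q `[-1, 1]%classic = 1%E ->
  (forall m, (\int[P]_x (x ^+ m)%:E = \int[Q]_x (x ^+ m)%:E)%E) ->
  forall A, measurable A -> P A = Q A.
Proof.
move=> P1 Q1 PQ.
have m11 : measurable (`[-1, 1]%classic : set (measurableTypeR R)).
  exact: measurable_itv.
have supp (P0 : probability (measurableTypeR R) R) (B : set (measurableTypeR R)) :
    P0 `[-1, 1]%classic = 1%E -> (forall x : R, -1 <= x <= 1 -> B x) -> {ae P0, forall x, B x}.
  move=> P01 sB; exists (~` `[-1, 1]%classic); split => //; first exact: measurableC.
  - by rewrite probability_setC// P01 subee.
  - by move=> x nB /= xI; apply: nB; apply: sB; move: xI; rewrite in_itv.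
have intX P0 m : P0 `[-1, 1]%classic = 1%E ->
    P0.-integrable setT (EFin \o (fun x : measurableTypeR R => x ^+ m)).
  move=> P01; apply/integrableP; split.
    by apply/measurable_EFinP; exact: measurable_funX.
  apply: (@le_lt_trans _ _ (\int[P0]_x (cst 1 x))%E).
    apply: ae_ge0_le_integral => //.
    - by apply: measurableT_comp => //; apply/measurable_EFinP; exact: measurable_funX.
    - apply: (supp _ _ P01) => x x1 _ /=.
      by rewrite lee_fin normrX exprn_ile1// ler_norml.
  rewrite integral_cst// mul1e.
  by apply: (@le_lt_trans _ _ 1%E); [exact: probability_le1|exact: ltry].
have polyE (p : {poly R}) : (\int[P]_x (p.[x])%:E = \int[Q]_x (p.[x])%:E)%E.
  have aux (P0 : probability (measurableTypeR R) R) : P0 `[-1, 1]%classic = 1%E ->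
      (\int[P0]_x (p.[x])%:E = \sum_(i < size p) (p`_i)%:E * \int[P0]_x (x ^+ i)%:E)%E.
    move=> P01; under eq_integral do rewrite horner_coef -sumEFin.
    rewrite integral_sum//; last first.
      move=> i; under eq_fun do rewrite EFinM.
      by apply: integrableZl => //; exact: (intX _ i P01).
    apply: eq_bigr => i _; under eq_integral do rewrite EFinM.
    by rewrite integralZl//; exact: (intX _ i P01).
  by rewrite !aux//; apply: eq_bigr => i _; rewrite PQ.
pose aff : {poly R} := 2^-1 *: (1 + 'X).
have affE x : aff.[x] = (1 + x) / 2 by rewrite !hornerE mulrC.
clearbody aff.
have limE (P0 : probability (measurableTypeR R) R) s : P0 `[-1, 1]%classic = 1%E ->
    -1 < s <= 1 -> (fun n => \int[P0]_x (((1 - aff ^+ n) ^+ step_exp ((1 + s) / 2) n).[x])%:E)%E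
      @ \oo --> P0 [set x | x < s].
  move=> P01 /andP[s1 s11].
  have ms : measurable ([set x | x < s] : set (measurableTypeR R)).
    by rewrite -set_itvNyo; exact: measurable_itv.
  have indE : (fun x : measurableTypeR R => (x < s)%R%:R : R) = \1_[set x | x < s].
    apply/funext => x; rewrite indicE.
    by have [xs|/negP xs] := boolP (x < s)%R; [rewrite mem_set|rewrite memNset].
  have -> : P0 [set x | x < s] = (\int[P0]_x ((x < s)%R%:R : R)%:E)%E.
    rewrite -(setIT [set x | x < s]) -integral_indic// -indE.
    by apply: eq_integral.
  have h n x : ((1 - aff ^+ n) ^+ step_exp ((1 + s) / 2) n).[x] =
      step ((1 + s) / 2) n ((1 + x) / 2).
    by rewrite horner_exp !hornerE affE.
  have fE : (fun n => \int[P0]_x (((1 - aff ^+ n) ^+ step_exp ((1 + s) / 2) n).[x])%:E)%E =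
      (fun n => \int[P0]_x (step ((1 + s) / 2) n ((1 + x) / 2))%:E)%E.
    by apply/funext => n; apply: eq_integral => x _; rewrite h.
  rewrite fE.
  have mstep n : measurable_fun setT (fun x : measurableTypeR R =>
      (step ((1 + s) / 2) n ((1 + x) / 2))%:E).
    apply/measurable_EFinP; apply: measurable_funX; apply: measurable_funB => //.
    apply: measurable_funX; apply: measurable_funM => //.
    exact: measurable_funD.
  have [||||_ _ //] := @dominated_convergence _ _ _ P0 setT measurableT _
    (fun x => ((x < s)%R%:R : R)%:E) (cst 1%E) mstep.
  - by apply/measurable_EFinP; rewrite indE; exact: measurable_indic.
  - apply: (supp _ _ P01) => x x1 _; apply/cvg_EFin; first exact: nearW.
    have := @cvg_step ((1 + s) / 2) ((1 + x) / 2).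
    by rewrite ltr_pM2r ?invr_gt0// ltrD2l; apply; lra.
  - exact: finite_measure_integrable_cst.
  - apply: (supp _ _ P01) => x x1 n _; rewrite lee_fin /step.
    have y01 : 0 <= ((1 + x) / 2) ^+ n <= 1 by rewrite exprn_ge0 ?exprn_ile1//; lra.
    by rewrite ger0_norm ?exprn_ile1 ?exprn_ge0 ?subr_ge0 ?lerBlDr ?lerDl//; case/andP: y01.
have ltE s : P [set x | x < s] = Q [set x | x < s].
  have [s1|s1] := leP s (-1).
    have z (P0 : probability (measurableTypeR R) R) : P0 `[-1, 1]%classic = 1%E -> P0 [set x | x < s] = 0%E.
      move=> P01; have zC : P0 (~` `[-1, 1]%classic) = 0%E.
        by rewrite probability_setC// P01 subee.
      apply: (@subset_measure0 _ _ _ P0 _ (~` `[-1, 1]%classic)) => //.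
      - by rewrite -set_itvNyo; exact: measurable_itv.
      - exact: measurableC.
      - by move=> x /= xs; rewrite in_itv/= => /andP[]; lra.
    by rewrite !z.
  have [s1'|s1'] := leP s 1.
    have lP := limE P s P1; have lQ := limE Q s Q1.
    have s11 : -1 < s <= 1 by rewrite s1.
    rewrite -(cvg_lim _ (lP s11))// -(cvg_lim _ (lQ s11))//.
    congr (lim (_ @ \oo)); apply/funext => n; exact: polyE.
  have o (P0 : probability (measurableTypeR R) R) : P0 `[-1, 1]%classic = 1%E -> P0 [set x | x < s] = 1%E.
    move=> P01; apply/eqP; rewrite eq_le probability_le1//=; last first.
      by rewrite -set_itvNyo; exact: measurable_itv.
    rewrite -P01; apply: le_measure; [exact/mem_set|apply/mem_set|].
    - by rewrite -set_itvNyo; exact: measurable_itv.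
    - by move=> x /=; rewrite in_itv/= => /andP[_]; lra.
  by rewrite !o.
move=> A mA; apply: (@measure_unique _ R (measurableTypeR R) (@RGenCInfty.G R) (fun n => `[- n%:R, +oo[%classic) _ _ _ _ P Q) => //.
- exact: RGenCInfty.measurableE.
- move=> _ _ [x ->] [y ->]; exists (Num.max x y); apply/seteqP; split => z /=.
    by rewrite !in_itv/= !andbT ge_max => -[-> ->].
  by rewrite !in_itv/= !andbT ge_max => /andP[].
- by move=> n; exists (- n%:R).
- apply/seteqP; split => // x _; exists (Num.truncn (- x)).+1 => //=.
  by rewrite in_itv/= andbT lerNl ltW// truncnS_gt.
- have mx (x : R) : measurable ([set y | y < x] : set (measurableTypeR R)).
    by rewrite -set_itvNyo; exact: measurable_itv.
  move=> _ [x ->]; rewrite -setCitvl set_itvNyo.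
  apply: (etrans (probability_setC P (mx x))).
  by rewrite ltE; exact: (esym (probability_setC Q (mx x))).
- by move=> n; apply: le_lt_trans (probability_le1 P _) (ltry _).
Qed.

End moments_determine.

Section plane_reflection.
Context (R : realType) (n : nat) (j l : 'I_n) (b s : R).
Hypotheses (jl : j != l) (bs : b ^+ 2 + s ^+ 2 = 1).

(** A symmetric matrix of determinant -1 in the plane of [j] and [l], so that it is its own
    inverse. *)
Definition plane_refl : 'M[R]_n := \matrix_(i, k)
  if i == j then b * (k == j)%:R + s * (k == l)%:R else
  if i == l then s * (k == j)%:R - b * (k == l)%:R else (k == i)%:R.

Lemma plane_reflE p (G : 'M[R]_(n, p)) i k : (plane_refl *m G) i k =
  if i == j then b * G j k + s * G l k else
  if i == l then s * G j k - b * G l k else G i k.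
Proof.
rewrite mxE; under eq_bigr do rewrite mxE.
case: ifP => _.
  under eq_bigr do rewrite mulrDl -!mulrA ![_%:R * _]mulrC.
  by rewrite big_split/= -!mulr_sumr !sum_deltar.
case: ifP => _.
  under eq_bigr do rewrite mulrBl -!mulrA ![_%:R * _]mulrC.
  by rewrite sumrB/= -!mulr_sumr !sum_deltar.
by under eq_bigr do rewrite mulrC; rewrite sum_deltar.
Qed.

Lemma orthogonal_plane_refl : orthogonal_mx plane_refl.
Proof.
have lj : (l == j) = false by rewrite eq_sym; exact: negbTE.
rewrite /orthogonal_mx.
have -> : plane_refl^T = plane_refl.
  apply/matrixP => i k; rewrite !mxE.
  have [->|ij] := eqVneq i j; have [->|kj] := eqVneq k j => //.
  - by rewrite (negbTE jl); case: (k == l) => /=; ring.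
  - by rewrite (negbTE jl) (eq_sym j i) (negbTE ij); case: (i == l) => /=; ring.
  - case: (eqVneq i l) => il; case: (eqVneq k l) => kl //=.
    + by rewrite il eq_sym (negbTE kl) !mulr0 subrr.
    + by rewrite kl eq_sym (negbTE il) !mulr0 subrr.
    + by rewrite eq_sym.
apply/matrixP => i k; rewrite plane_reflE !mxE eqxx lj eqxx.
have [->|ij] := eqVneq i j.
  rewrite (eq_sym j); case: (k == j); case: (k == l) => /=; move: bs; rewrite ?expr2; lra.
have [->|il] := eqVneq i l.
  rewrite (eq_sym l); case: (k == j); case: (k == l) => /=; move: bs; rewrite ?expr2; lra.
by rewrite eq_sym.
Qed.

End plane_reflection.

(** A first-order expansion with a remainder uniform in [u] and [v], so that it can be integrated
    over O(n). *)
Lemma exprD1_remainder (R : realDomainType) (u v t : R) m :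
  `|u| <= 1 -> `|v| <= 1 -> `|t| <= 1 ->
  `|(u + t * v) ^+ m - u ^+ m - m%:R * u ^+ m.-1 * v * t| <= 4 ^+ m * t ^+ 2.
Proof.
move=> u1 v1 t1; have t2 : 0 <= t ^+ 2 by exact: sqr_ge0.
elim: m => [|m IH].
  by rewrite !expr0 subrr !mul0r subr0 normr0 mul1r.
set err := (X in `|X| <= _) in IH.
have -> : (u + t * v) ^+ m.+1 - u ^+ m.+1 - m.+1%:R * u ^+ m * v * t =
    (u + t * v) * err + m%:R * u ^+ m.-1 * v ^+ 2 * t ^+ 2.
  rewrite /err !exprS -natr1; case: m {IH err} => [|m] /=; first by ring.
  by rewrite !exprS; ring.
apply: (le_trans (ler_normD _ _)).
have utv : `|u + t * v| <= 2.
  apply: (le_trans (ler_normD _ _)); rewrite normrM.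
  have : `|t| * `|v| <= 1 by rewrite -[leRHS]mulr1; apply: ler_pM.
  by lra.
have h1 : `|(u + t * v) * err| <= 2 * (4 ^+ m * t ^+ 2).
  by rewrite normrM; apply: ler_pM.
have h2 : `|m%:R * u ^+ m.-1 * v ^+ 2 * t ^+ 2| <= m%:R * t ^+ 2.
  rewrite normrM [`|t ^+ 2|]ger0_norm// ler_wpM2r// 2!normrM normr_nat !normrX.
  rewrite -mulrA ler_piMr// mulr_ile1 ?exprn_ge0 ?exprn_ile1//.
have m4 : m%:R <= 4 ^+ m :> R.
  by rewrite -natrX ler_nat ltnW// ltn_expl.
have h3 : m%:R * t ^+ 2 <= 4 ^+ m * t ^+ 2 by rewrite ler_wpM2r.
have -> : 4 ^+ m.+1 * t ^+ 2 = 4 * (4 ^+ m * t ^+ 2) by rewrite [4 ^+ m.+1]exprS mulrA.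
have : 0 <= 4 ^+ m * t ^+ 2 by rewrite mulr_ge0// exprn_ge0.
lra.
Qed.

Section corner_moments.
Context (R : realType) (n : nat).
Variable h : probability ((n.+1 * n.+1).-tuple R) R.
Hypothesis Hh : is_haar_On h.
Notation MX := 'M[R]_n.+1.
Notation E := (haar_expect h).
Let U (M : MX) := M ord0 ord0.

Let bU m : bounded_mx (fun M => U M ^+ m).
Proof. by apply: bounded_mxX; exact: bounded_mx_entry. Qed.

(** Integration by parts along a rotation. Invariance of [U ^+ m * V] under a reflection of slope
    [t] says, up to normalisation, that [(U + t * V) ^+ m * (t * U - V)] has mean 0 for every [t];
    the coefficient of [t] is the claim. *)
Let moment_pair (l : 'I_n.+1) m : l != ord0 ->
  E (fun M => U M ^+ m.+1) = m%:R * E (fun M => U M ^+ m.-1 * M l ord0 ^+ 2).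
Proof.
move=> l0; have l0' : ord0 != l by rewrite eq_sym.
pose V (M : MX) := M l ord0.
have bV r : bounded_mx (fun M => V M ^+ r) by apply: bounded_mxX; exact: bounded_mx_entry.
have bV1 : bounded_mx V by exact: bounded_mx_entry.
have bU1 : bounded_mx U by exact: bounded_mx_entry.
have bUV r q : bounded_mx (fun M => U M ^+ r * V M ^+ q) by apply: bounded_mxM.
have bUV1 r : bounded_mx (fun M => U M ^+ r * V M) by apply: bounded_mxM.
(* The reflection with [b = 1] and [s = 0] changes the sign of [V] only. *)
have odd0 : E (fun M => U M ^+ m * V M) = 0.
  have o : orthogonal_mx (plane_refl ord0 l 1 0 : MX).
    by apply: orthogonal_plane_refl => //; rewrite expr1n expr0n addr0.
  have := haar_expect_left Hh o (bUV1 m).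
  have -> : (fun M => U (plane_refl ord0 l 1 0 *m M) ^+ m * V (plane_refl ord0 l 1 0 *m M)) =
      (fun M => -1 * (U M ^+ m * V M)).
    apply/funext => M; rewrite /U /V !plane_reflE// eqxx (negbTE l0) eqxx.
    by rewrite !mul0r addr0 !mul1r add0r mulN1r mulrN.
  by rewrite haar_expectZ//; lra.
pose W t M := (U M + t * V M) ^+ m * (t * U M - V M).
have bW t : bounded_mx (W t).
  apply: bounded_mxM.
    by apply: bounded_mxX; apply: bounded_mxD => //; exact: bounded_mxZ.
  by apply: bounded_mxB => //; exact: bounded_mxZ.
have EW t : E (W t) = 0.
  pose c := (Num.sqrt (1 + t ^+ 2))^-1.
  have t2 : 0 < 1 + t ^+ 2 by rewrite ltr_wpDr// sqr_ge0.
  have c0 : 0 < c by rewrite invr_gt0 sqrtr_gt0.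
  have c2 : c ^+ 2 * (1 + t ^+ 2) = 1.
    by rewrite exprVn sqr_sqrtr ?(ltW t2)// mulVf ?gt_eqF.
  have o : orthogonal_mx (plane_refl ord0 l c (t * c) : MX).
    by apply: orthogonal_plane_refl => //; rewrite -c2; ring.
  have := haar_expect_left Hh o (bUV1 m).
  rewrite odd0.
  have -> : (fun M => U (plane_refl ord0 l c (t * c) *m M) ^+ m * V (plane_refl ord0 l c (t * c) *m M)) =
      (fun M => c ^+ m.+1 * W t M).
    apply/funext => M; rewrite /W /U /V !plane_reflE// eqxx (negbTE l0) eqxx.
    rewrite (_ : c * _ + _ = c * (M ord0 ord0 + t * M l ord0)); last by ring.
    by rewrite exprMn exprS; ring.
  rewrite haar_expectZ// => /eqP; rewrite mulf_eq0 expf_eq0 (gt_eqF c0) andbF /=.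
  by move/eqP.
pose q := E (fun M => U M ^+ m.+1) - m%:R * E (fun M => U M ^+ m.-1 * V M ^+ 2).
apply/eqP; rewrite -subr_eq0 -/q; apply/negPn/negP => q0.
(* Bound on the second-order part: [m] from the product of the linear terms, and the remainder
   [4 ^+ m] times [|t * U - V| <= 2]. A nonzero [q] would contradict [|q| <= C * t] for small
   [t]. *)
pose C : R := m%:R + 2 * 4 ^+ m.
have C0 : 0 < C by rewrite ltr_wpDl// mulr_gt0// exprn_gt0.
have qt t : 0 < t <= 1 -> `|q| <= C * t.
  move=> /andP[t0 t1].
  pose A M := W t M + U M ^+ m * V M - t * (U M ^+ m.+1 - m%:R * (U M ^+ m.-1 * V M ^+ 2)).
  have bq : bounded_mx (fun M => U M ^+ m.+1 - m%:R * (U M ^+ m.-1 * V M ^+ 2)).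
    by apply: bounded_mxB => //; exact: bounded_mxZ.
  have bA : bounded_mx A.
    by apply: bounded_mxB; [exact: bounded_mxD|exact: bounded_mxZ].
  have EA : E A = - (t * q).
    rewrite haar_expectB//; [|exact: bounded_mxD|exact: bounded_mxZ].
    rewrite haar_expectD// EW odd0 addr0 sub0r haar_expectZ//.
    rewrite haar_expectB//; last exact: bounded_mxZ.
    by rewrite haar_expectZ.
  have AC M : orthogonal_mx M -> `|A M| <= C * t ^+ 2.
    move=> oM; have U1 : `|U M| <= 1 by exact: orthogonal_mx_le1.
    have V1 : `|V M| <= 1 by exact: orthogonal_mx_le1.
    have T1 : `|t| <= 1 by rewrite gtr0_norm.
    have := exprD1_remainder m U1 V1 T1; set e := (X in `|X| <= _) => eC.
    have -> : A M = m%:R * (U M ^+ m.-1 * U M) * V M * t ^+ 2 + e * (t * U M - V M).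
      rewrite /A /W /e exprS; ring.
    apply: (le_trans (ler_normD _ _)); rewrite /C [leRHS]mulrDl; apply: lerD.
      rewrite normrM [`|t ^+ 2|]ger0_norm ?sqr_ge0// ler_wpM2r ?sqr_ge0//.
      rewrite 3!normrM normr_nat normrX -mulrA ler_piMr// mulr_ile1 ?mulr_ge0 ?exprn_ge0//.
      by rewrite mulr_ile1 ?exprn_ge0 ?exprn_ile1.
    rewrite normrM -mulrA [leRHS]mulrC; apply: ler_pM => //.
    apply: (le_trans (ler_normB _ _)); rewrite normrM.
    have : `|t| * `|U M| <= 1 by rewrite mulr_ile1.
    by lra.
  have : `|E A| <= C * t ^+ 2.
    rewrite ler_norml; apply/andP; split.
      rewrite -(haar_expect_cst h (- (C * t ^+ 2))); apply: le_haar_expect => //.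
        exact: bounded_mx_cst.
      by move=> M /AC; rewrite ler_norml => /andP[].
    rewrite -(haar_expect_cst h (C * t ^+ 2)); apply: le_haar_expect => //.
      exact: bounded_mx_cst.
    by move=> M /AC; rewrite ler_norml => /andP[].
  rewrite EA normrN normrM gtr0_norm// expr2 mulrA [C * t]mulrC -mulrA.
  by rewrite ler_pM2l// [t * C]mulrC.
have q1 : 0 < `|q| by rewrite normr_gt0.
pose D := C + `|q|.
have D0 : 0 < D by rewrite addr_gt0.
have t01 : 0 < `|q| / D <= 1.
  by apply/andP; split; [exact: divr_gt0|rewrite ler_pdivrMr// mul1r lerDr ltW].
have := qt _ t01; rewrite mulrA ler_pdivlMr// leNgt => /negP; apply.
by rewrite [ltLHS]mulrC ltr_pM2l// /D ltrDl.
Qed.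

(** Insert the unit norm of the first column into the expectation: the term [l = 0] gives [m] times
    the higher moment, and by [moment_pair] each of the other [n] terms gives it once. For
    [n = k + 2] this is the recursion of [cocos_moment]. *)
Lemma haar_corner_moment_rec m :
  m%:R * E (fun M => U M ^+ m.-1) = (m + n)%:R * E (fun M => U M ^+ m.+1).
Proof.
have bUV r (l : 'I_n.+1) : bounded_mx (fun M => U M ^+ r * M l ord0 ^+ 2).
  by apply: bounded_mxM => //; apply: bounded_mxX; exact: bounded_mx_entry.
have -> : E (fun M => U M ^+ m.-1) = \sum_l E (fun M => U M ^+ m.-1 * M l ord0 ^+ 2).
  rewrite -haar_expect_sum//; apply: eq_haar_expect => //.
    exact: bounded_mx_sum.
  move=> M oM; rewrite -mulr_sumr; under eq_bigr do rewrite expr2.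
  by rewrite orthogonal_mx_cols// eqxx mulr1.
rewrite (bigD1 ord0)//= mulrDr mulr_sumr natrD mulrDl; congr (_ + _).
  case: m => [|m]; first by rewrite !mul0r.
  by congr (_ * _); congr haar_expect; apply/funext => M; rewrite /U -exprD addn2.
under eq_bigr => l l0 do rewrite -moment_pair//.
by rewrite sumr_const cardC1 card_ord mulr_natl.
Qed.

End corner_moments.

Section semicircle_law.
Context (R : realType) (k : nat).
Notation leb := (@lebesgue_measure R).
Notation Z := (cocos_moment R 0 k).

(* The density of one entry of a Haar orthogonal matrix of size [k.+3]. *)
Definition semicircle_pdf (t : R) : R := if `|t| < 1 then cocos t ^+ k / Z else 0.

Lemma cocos_moment_gt0 : 0 < Z.
Proof.
have := cocos_moment_sqr_ge R k; have := cocos_moment_ge0 R k.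
rewrite le_eqVlt => /predU1P[<-|//]; rewrite expr0n/= leNgt.
by rewrite divr_gt0 ?mulr_gt0 ?pi_gt0// ltr0n addn2.
Qed.

Lemma semicircle_pdf_ge0 t : 0 <= semicircle_pdf t.
Proof.
rewrite /semicircle_pdf; case: ifP => // _.
by rewrite divr_ge0 ?exprn_ge0 ?cocos_ge0// ltW// cocos_moment_gt0.
Qed.

Lemma measurable_semicircle_pdf : measurable_fun setT semicircle_pdf.
Proof.
apply: measurable_fun_ifT => //.
  by apply: measurable_fun_ltr => //; exact: measurableT_comp.
by apply: measurable_funM => //; apply: measurable_funX; exact: measurable_cocos.
Qed.

Lemma integral_semicircle_pdf m :
  (\int[leb]_t (t ^+ m * semicircle_pdf t)%:E = (cocos_moment R m k / Z)%:E)%E.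
Proof.
have cf : continuous (fun t : R => t ^+ m * cocos t ^+ k).
  move=> t; apply: cvgM; first exact: exprn_continuous.
  apply: (@continuous_comp _ _ _ (@cocos R) (fun x => x ^+ k)).
    exact: continuous_cocos.
  exact: exprn_continuous.
have mf : measurable_fun setT (fun t : R => t ^+ m * cocos t ^+ k).
  exact: continuous_measurable_fun.
have ic : leb.-integrable `[(-1 : R)%R, 1%R] (EFin \o (fun t => t ^+ m * cocos t ^+ k)).
  apply: continuous_compact_integrable; first exact: segment_compact.
  exact: continuous_subspaceT.
transitivity (\int[leb]_(t in `](-1)%R, 1%R[) (Z^-1 * (t ^+ m * cocos t ^+ k))%:E)%E.
  rewrite [RHS]integral_mkcond; apply: eq_integral => t _; rewrite /patch /semicircle_pdf.
  have tI : (t \in `](-1)%R, 1%R[%classic) = (`|t| < 1).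
    by apply/idP/idP => [/set_mem/=|t1]; [|apply/mem_set => /=]; rewrite in_itv/= -ltr_norml.
  by rewrite tI; case: ifP => _; rewrite ?mulr0// mulrA mulrC mulrA.
rewrite integral_itv_bndo_bndc; last first.
  apply/measurable_EFinP; apply: measurable_funTS; exact: measurable_funM.
rewrite integral_itv_obnd_cbnd; last first.
  apply/measurable_EFinP; apply: measurable_funTS; exact: measurable_funM.
under eq_integral do rewrite EFinM.
rewrite integralZl//; rewrite mulrC EFinM; congr (_ * _)%E.
by rewrite /cocos_moment /Rintegral fineK//; apply: integrable_fin_num.
Qed.

Definition semicircle (A : set (measurableTypeR R)) : \bar R :=
  (\int[leb]_(t in A) (semicircle_pdf t)%:E)%E.

Let semicircle_setT : semicircle setT = 1%E.
Proof.
rewrite /semicircle.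
transitivity (\int[leb]_t (t ^+ 0 * semicircle_pdf t)%:E)%E.
  by apply: eq_integral => t _; rewrite expr0 mul1r.
by rewrite integral_semicircle_pdf divff// gt_eqF// cocos_moment_gt0.
Qed.

Let integrable_semicircle : leb.-integrable setT (EFin \o semicircle_pdf).
Proof.
apply/integrableP; split; first by apply/measurable_EFinP; exact: measurable_semicircle_pdf.
under eq_integral do rewrite gee0_abs ?lee_fin ?semicircle_pdf_ge0//.
by rewrite -/(semicircle setT) semicircle_setT ltry.
Qed.

Let semicircle0 : semicircle set0 = 0%E.
Proof. by rewrite /semicircle integral_set0. Qed.

Let semicircle_ge0 A : (0 <= semicircle A)%E.
Proof. by apply: integral_ge0 => x _; rewrite lee_fin semicircle_pdf_ge0. Qed.

Let semicircle_sigma_additive : semi_sigma_additive semicircle.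
Proof.
move=> /= A mA tA mUA; rewrite /semicircle/= integral_bigcup//=; last first.
  exact: (integrableS _ _ (subsetT _)).
apply: is_cvg_ereal_nneg_natsum_cond => n _ _.
by apply: integral_ge0 => /= x ?; rewrite lee_fin semicircle_pdf_ge0.
Qed.

HB.instance Definition _ := isMeasure.Build _ _ _
  semicircle semicircle0 semicircle_ge0 semicircle_sigma_additive.

HB.instance Definition _ :=
  @Measure_isProbability.Build _ _ R semicircle semicircle_setT.

Lemma ge0_integral_semicircle (f : measurableTypeR R -> \bar R) :
  measurable_fun setT f -> (forall x, 0 <= f x)%E ->
  (\int[semicircle]_x f x = \int[leb]_x (f x * (semicircle_pdf x)%:E))%E.
Proof.
move=> mf f0; apply: (@ge0_integral_density _ _ R semicircle leb semicircle_pdf) => //.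
- exact: measurable_semicircle_pdf.
- exact: semicircle_pdf_ge0.
Qed.

Lemma semicircle_supp : semicircle `[-1, 1]%classic = 1%E.
Proof.
rewrite -semicircle_setT /semicircle [LHS]integral_mkcond.
apply: eq_integral => t _; rewrite /patch /semicircle_pdf; case: ifP => // tI.
case: ifP => // t1; move: tI => /negP; case; apply/mem_set => /=.
by rewrite in_itv/= -ler_norml ltW.
Qed.

Lemma semicircle_moment m :
  (\int[semicircle]_x (x ^+ m)%:E = (cocos_moment R m k / Z)%:E)%E.
Proof.
have mX : measurable_fun setT (fun x : measurableTypeR R => x ^+ m) by exact: measurable_funX.
have mXE : measurable_fun setT (fun x : measurableTypeR R => (x ^+ m)%:E) by exact/measurable_EFinP.
rewrite -integral_semicircle_pdf [LHS]integralE [RHS]integralE.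
rewrite !ge0_integral_semicircle//; [|exact: measurable_funeneg|exact: measurable_funepos].
congr (_ - _)%E; apply: eq_integral => x _.
  by rewrite !funeposE EFinM muleC [in RHS]muleC maxe_pMr ?mule0// lee_fin semicircle_pdf_ge0.
rewrite !funenegE EFinM muleC maxe_pMr ?mule0 ?lee_fin ?semicircle_pdf_ge0//.
by rewrite muleN [in RHS]muleC.
Qed.

End semicircle_law.

Section corner_law.
Context (R : realType) (k : nat).
Variable h : probability ((k.+3 * k.+3).-tuple R) R.
Hypothesis Hh : is_haar_On h.
Let mxt := @mx_of_tuple R k.+3.

Let corner (t : (k.+3 * k.+3).-tuple R) : measurableTypeR R := mxt t ord0 ord0.

Let measurable_corner : measurable_fun setT corner.
Proof. exact: mxmeasurable_mx_of_tuple. Qed.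

Let P : probability (measurableTypeR R) R := image_probability measurable_corner h.

Let integral_P (f : measurableTypeR R -> \bar R) : measurable_fun setT f ->
  (\int[P]_x f x = \int[h]_t f (corner t))%E.
Proof. by move=> mf; apply: integral_map. Qed.

Let P_moment m : (\int[P]_x (x ^+ m)%:E = (cocos_moment R m k / cocos_moment R 0 k)%:E)%E.
Proof.
have bU r : bounded_mx (fun M : 'M[R]_k.+3 => M ord0 ord0 ^+ r).
  by apply: bounded_mxX; exact: bounded_mx_entry.
rewrite integral_P; last by apply/measurable_EFinP; exact: measurable_funX.
rewrite (haar_expectE Hh (bU m)); congr EFin.
have Z0 := cocos_moment_gt0 R k.
(* The recursion links orders two apart, so two consecutive moments go through the induction. *)
suff : forall r, haar_expect h (fun M => M ord0 ord0 ^+ r) = cocos_moment R r k / cocos_moment R 0 k /\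
   haar_expect h (fun M => M ord0 ord0 ^+ r.+1) = cocos_moment R r.+1 k / cocos_moment R 0 k.
  by move=> /(_ m)[].
elim=> [|r [IH1 IH2]].
  split; first by rewrite (haar_expect_cst h 1) divff ?gt_eqF.
  have := haar_corner_moment_rec Hh 0; have := cocos_moment_rec R 0 k.
  rewrite !mul0r => /esym/eqP; rewrite mulf_eq0 pnatr_eq0 addn2/= => /eqP ->.
  by move=> /esym/eqP; rewrite mulf_eq0 pnatr_eq0/= mul0r => /eqP.
split => //.
have := haar_corner_moment_rec Hh r.+1; have := cocos_moment_rec R r.+1 k.
rewrite !succnK => C H.
have n0 : (r.+1 + k + 2)%:R != 0 :> R by rewrite pnatr_eq0 addn2.
apply: (mulfI n0); rewrite mulrA -C -addnA addn2 -H IH1 mulrA//.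
Qed.

(** The corner entry and [semicircle] live on [-1, 1], and their moments satisfy the same recursion
    and start alike. *)
Lemma haar_corner_law (f : R -> \bar R) : measurable_fun setT f ->
  (forall x, 0 <= f x)%E ->
  (\int[h]_t f (mxt t ord0 ord0) = \int[@lebR R]_x (f x * (semicircle_pdf k x)%:E))%E.
Proof.
move=> mf f0.
rewrite ge0_integral_lebR; last 2 first.
- apply: emeasurable_funM => //; apply/measurable_EFinP.
  exact: measurable_semicircle_pdf.
- by move=> x; rewrite mule_ge0// lee_fin semicircle_pdf_ge0.
rewrite -ge0_integral_semicircle// -[LHS](integral_P mf).
apply: eq_measure_integral => A mA _.
apply: moments_determine mA; last by move=> m; rewrite P_moment semicircle_moment.
  have mI : measurable (`[-1, 1]%classic : set (measurableTypeR R)).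
    exact: measurable_itv.
  have m1I : measurable_fun setT (fun x : measurableTypeR R => (\1_`[-1, 1] x : R)%:E).
    by apply/measurable_EFinP; exact: measurable_indic.
  transitivity (\int[P]_x (\1_`[(-1 : R), 1] x : R)%:E)%E.
    by rewrite integral_indic// setIT.
  rewrite integral_P// (@ae_eq_integral _ _ _ _ _ (cst 1%E))//.
  - by rewrite integral_cst// mul1e; exact: (@probability_setT _ _ _ h).
  - exact: measurableT_comp m1I measurable_corner.
  - have := haar_orthogonal Hh; apply: filterS => t ot _ /=.
    rewrite indicE mem_set//= in_itv/= -ler_norml.
    exact: orthogonal_mx_le1.
exact: semicircle_supp.
Qed.

End corner_law.

(** * Cartan decomposition of the Haar measure *)

Lemma sum_sqr_eq0 (R : realDomainType) (I : finType) (F : I -> R) i :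
  \sum_j F j ^+ 2 = 0 -> F i = 0.
Proof.
move=> s0; apply/eqP; rewrite -sqrf_eq0 eq_le sqr_ge0 andbT -s0.
by rewrite (bigD1 i)//= lerDl sumr_ge0// => j _; exact: sqr_ge0.
Qed.

Section householder.
Context (R : realType) (n : nat).

(** The Householder reflection along [v - e], whose squared norm is [2 * (1 - v ord0 ord0)]. When
    this vanishes, [v = e] and the identity serves. *)
Lemma ex_orthogonal_col (v : 'cV[R]_n.+1) : v^T *m v = 1%:M ->
  exists2 V : 'M[R]_n.+1, orthogonal_mx V & col ord0 V = v.
Proof.
move=> v1; pose e : 'cV[R]_n.+1 := delta_mx ord0 ord0.
have ee : e^T *m e = 1%:M.
  by rewrite trmx_delta mul_delta_mx; apply/matrixP => i j; rewrite !ord1 !mxE.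
have ve : v^T *m e = (v ord0 ord0)%:M.
  rewrite -colE; apply/matrixP => i j; rewrite !ord1 !mxE eqxx mulr1n//.
have ev : e^T *m v = (v ord0 ord0)%:M by rewrite -[LHS]trmxK trmx_mul trmxK ve tr_scalar_mx.
have wT : (v - e)^T = v^T - e^T by apply/matrixP => i j; rewrite !mxE.
have [v01|v01] := eqVneq (v ord0 ord0) 1.
  exists 1%:M; first exact: orthogonal_mx1.
  have w0 : (v - e)^T *m (v - e) = 0.
    by rewrite wT mulmxBl !mulmxBr v1 ve ev ee v01 subrr.
  have sum0 : \sum_i (v - e) i ord0 ^+ 2 = 0.
    move/matrixP: w0 => /(_ ord0 ord0); rewrite !mxE => w0; rewrite -[RHS]w0.
    by apply: eq_bigr => i _; rewrite !mxE expr2.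
  apply/colP => i; rewrite col1 -/e.
  have /eqP := sum_sqr_eq0 i sum0.
  by rewrite !mxE subr_eq0 => /eqP ->.
pose c := (1 - v ord0 ord0)^-1.
have c0 : 1 - v ord0 ord0 != 0 by rewrite subr_eq0 eq_sym.
pose w := v - e.
have ww : w^T *m w = (2 * (1 - v ord0 ord0))%:M.
  rewrite wT mulmxBl !mulmxBr v1 ve ev ee.
  by rewrite -!raddfB/=; congr _%:M; ring.
exists (1%:M - c *: (w *m w^T)).
  have VT : (1%:M - c *: (w *m w^T))^T = 1%:M - c *: (w *m w^T).
    have wwT : (w *m w^T)^T = w *m w^T by rewrite trmx_mul trmxK.
    rewrite -[in RHS]wwT; apply/matrixP => i j; rewrite !mxE eq_sym//.
  rewrite /orthogonal_mx VT.
  rewrite mulmxBl mul1mx !mulmxBr mulmx1 -scalemxAl -scalemxAr.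
  rewrite -mulmxA (mulmxA w^T) ww mul_scalar_mx -scalemxAr !scalerA.
  rewrite (_ : c * (c * (2 * (1 - v ord0 ord0))) = c + c); last by rewrite /c; field.
  rewrite scalerDl; set Y := c *: (_ *m _).
  have -> : Y - (Y + Y) = - Y by rewrite opprD addrA subrr add0r.
  by rewrite opprK subrK.
have we : w^T *m e = (v ord0 ord0 - 1)%:M by rewrite wT mulmxBl ve ee -raddfB.
rewrite colE -/e mulmxBl mul1mx -scalemxAl -mulmxA we.
rewrite mul_mx_scalar scalerA -[_ *: w]opprK -scaleNr.
rewrite (_ : - (c * _) = 1); last by rewrite /c; field.
by rewrite scale1r opprK addrC subrK.
Qed.

End householder.

Section lift0.
Context (R : realType).

Lemma lift0_mxM n (A B : 'M[R]_n) :
  lift0_mx (A *m B) = lift0_mx A *m lift0_mx B :> 'M[R]_(1 + n).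
Proof.
by rewrite /lift0_mx mulmx_block !(mulmx0, mul0mx, addr0, add0r) mulmx1.
Qed.

Lemma lift0_mxE n (A : 'M[R]_n) :
  [/\ (lift0_mx A : 'M[R]_(1 + n)) ord0 ord0 = 1,
      (forall j, (lift0_mx A : 'M[R]_(1 + n)) ord0 (lift ord0 j) = 0),
      (forall i, (lift0_mx A : 'M[R]_(1 + n)) (lift ord0 i) ord0 = 0) &
      (forall i j, (lift0_mx A : 'M[R]_(1 + n)) (lift ord0 i) (lift ord0 j) = A i j)].
Proof.
have o0 : (ord0 : 'I_(1 + n)) = lshift n ord0 by apply/val_inj.
have oS (i : 'I_n) : (lift ord0 i : 'I_(1 + n)) = rshift 1 i by apply/val_inj.
split => [|j|i|i j]; rewrite ?oS ?o0 /lift0_mx.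
- by rewrite block_mxEul mxE.
- by rewrite block_mxEur mxE.
- by rewrite block_mxEdl mxE.
- by rewrite block_mxEdr.
Qed.

Lemma lift0_mx_mulE n p (A : 'M[R]_n) (G : 'M[R]_(1 + n, p)) :
  (forall j, ((lift0_mx A : 'M[R]_(1 + n)) *m G) ord0 j = G ord0 j) /\
  (forall i j, ((lift0_mx A : 'M[R]_(1 + n)) *m G) (lift ord0 i) j = (A *m dsubmx G) i j).
Proof.
have [A00 A0l Al0 All] := lift0_mxE A.
split => [j|i j]; rewrite !mxE big_ord_recl/=.
  by rewrite A00 mul1r big1 ?addr0// => l _; rewrite A0l mul0r.
rewrite Al0 mul0r add0r; apply: eq_bigr => l _; rewrite All mxE; congr (_ * G _ _).
by apply/val_inj.
Qed.

(** The first row has norm 1 and starts with 1, so its other entries vanish. *)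
Lemma ex_lift0_mx n (M : 'M[R]_n.+1) : orthogonal_mx M ->
  M ord0 ord0 = 1 -> (forall i, M (lift ord0 i) ord0 = 0) ->
  exists2 W : 'M[R]_n, orthogonal_mx W & M = lift0_mx W.
Proof.
move=> oM M00 Ml0.
have s0 : \sum_(i < n) M ord0 (lift ord0 i) ^+ 2 = 0.
  have := orthogonal_mx_rows ord0 ord0 oM; rewrite eqxx big_ord_recl M00 mulr1.
  move=> /(congr1 (fun x => x - 1)); rewrite addrAC subrr add0r => {2}<-.
  by apply: eq_bigr => i _; rewrite expr2.
have M0l (j : 'I_n) : M ord0 (lift ord0 j) = 0.
  exact: (sum_sqr_eq0 (F := fun i => M ord0 (lift ord0 i)) j s0).
pose W : 'M[R]_n := \matrix_(i, j) M (lift ord0 i) (lift ord0 j).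
exists W.
  apply/matrixP => i j; rewrite !mxE.
  have := orthogonal_mx_rows (lift ord0 i) (lift ord0 j) oM.
  rewrite big_ord_recl !Ml0 mul0r add0r (inj_eq lift_inj) => <-.
  by apply: eq_bigr => k _; rewrite !mxE.
have [W00 W0l Wl0 Wll] := lift0_mxE W.
apply/matrixP => i j.
case: (unliftP ord0 i) => [i'|] ->; case: (unliftP ord0 j) => [j'|] ->.
- by rewrite Wll mxE.
- by rewrite Wl0 Ml0.
- by rewrite W0l M0l.
- by rewrite W00 M00.
Qed.

End lift0.

Section cartan.
Context (R : realType) (n : nat).
Let j0 : 'I_n.+2 := ord0.
Let j1 : 'I_n.+2 := lift ord0 ord0.

Definition refl01 (b : R) : 'M[R]_n.+2 := plane_refl j0 j1 b (cocos b).

Lemma orthogonal_refl01 b : `|b| <= 1 -> orthogonal_mx (refl01 b).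
Proof.
by move=> b1; apply: orthogonal_plane_refl => //; rewrite sqr_cocos// addrC subrK.
Qed.

(** Below the corner [b] the first column has norm [cocos b]; take for [V] an orthogonal matrix
    whose first column is its normalisation, or any matrix if the norm is 0. Undoing [V] and the
    reflection then fixes the first basis vector. *)
Lemma ex_cartan (M : 'M[R]_n.+2) : orthogonal_mx M ->
  exists2 V : 'M[R]_n.+1, orthogonal_mx V & exists2 W : 'M[R]_n.+1, orthogonal_mx W &
  M = lift0_mx V *m refl01 (M ord0 ord0) *m lift0_mx W.
Proof.
move=> oM; set b := M ord0 ord0; set s := cocos b.
have b1 : `|b| <= 1 by exact: orthogonal_mx_le1.
have s2 : \sum_(i < n.+1) M (lift ord0 i) ord0 ^+ 2 = s ^+ 2.
  rewrite sqr_cocos//; have := orthogonal_mx_cols ord0 ord0 oM.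
  rewrite eqxx big_ord_recl -/b -expr2 => /(congr1 (fun x => x - b ^+ 2)) <-.
  rewrite addrAC subrr add0r.
  by apply: eq_bigr => i _; rewrite expr2.
have [V oV Vs] : exists2 V : 'M[R]_n.+1, orthogonal_mx V &
    forall i, s * V i ord0 = M (lift ord0 i) ord0.
  have [s0|s0] := eqVneq s 0.
    exists 1%:M; first exact: orthogonal_mx1.
    move=> i; rewrite s0 mul0r; move: s2; rewrite s0 expr0n/= => s2.
    by rewrite (sum_sqr_eq0 (F := fun i => M (lift ord0 i) ord0) i s2).
  pose v : 'cV[R]_n.+1 := \col_i (s^-1 * M (lift ord0 i) ord0).
  have v1 : v^T *m v = 1%:M.
    apply/matrixP => i j; rewrite !ord1 !mxE eqxx mulr1n.
    transitivity (s ^- 2 * s ^+ 2); last by rewrite mulVf// expf_neq0.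
    rewrite -[X in _ = _ * X]s2 mulr_sumr; apply: eq_bigr => k _; rewrite !mxE -exprVn; ring.
  have [V oV Vv] := ex_orthogonal_col v1; exists V => // i.
  move/colP: Vv => /(_ i); rewrite !mxE => ->.
  by rewrite mulrA divff ?mul1r.
exists V => //.
have oK := orthogonal_mxM (orthogonal_mx_tr (orthogonal_refl01 b1))
  (orthogonal_mxM (orthogonal_mx_tr (orthogonal_mx_lift0 oV)) oM).
set K := _ *m (_ *m M) in oK.
have MK : M = lift0_mx V *m refl01 b *m K.
  rewrite /K -!mulmxA (mulmxA (refl01 b)) (orthogonal_refl01 b1) mul1mx.
  by rewrite mulmxA (orthogonal_mx_lift0 oV) mul1mx.
have Kc i : K i ord0 = (i == ord0)%:R.
  pose e : 'cV[R]_n.+2 := delta_mx ord0 ord0.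
  have cM : col ord0 M = lift0_mx V *m (refl01 b *m e).
    have [h0 hS] := lift0_mx_mulE V (refl01 b *m e : 'M[R]_(1 + n.+1, 1)).
    apply/colP => r; rewrite mxE.
    case: (unliftP ord0 r) => [r'|] ->.
      rewrite hS mxE (bigD1 ord0)//= big1 ?addr0.
        rewrite mxE (_ : rshift 1 ord0 = j1); last exact/val_inj.
        by rewrite plane_reflE !mxE/= !mulr1 mulr0 subr0 -Vs mulrC.
      move=> l l0; rewrite mxE plane_reflE !mxE.
      rewrite (_ : rshift 1 l == j0 = false)// (_ : rshift 1 l == j1 = false) ?mulr0//.
      by apply/negbTE; apply: contra l0 => /eqP/(congr1 val) /= [] e0; apply/eqP/val_inj.
    by rewrite h0 plane_reflE !mxE/= mulr1 mulr0 addr0.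
  have : col ord0 K = e.
    move: cM; rewrite !colE => cM; rewrite /K -!mulmxA cM.
    rewrite (mulmxA _ (lift0_mx V)) (orthogonal_mxC (orthogonal_mx_lift0 oV)) mul1mx.
    by rewrite mulmxA (orthogonal_mxC (orthogonal_refl01 b1)) mul1mx.
  by move/colP => /(_ i); rewrite !mxE andbT.
have [W oW KW] := ex_lift0_mx oK (Kc ord0) (fun i => Kc (lift ord0 i)).
by exists W; rewrite // -KW.
Qed.

End cartan.

Section iterated_integrals.
Context d1 d2 (X : measurableType d1) (Y : measurableType d2) (R : realType).
Local Open Scope ereal_scope.

Lemma measurable_integral_fst (m : {sigma_finite_measure set Y -> \bar R})
    (G : X -> Y -> \bar R) : measurable_fun setT (fun z => G z.1 z.2) ->
  (forall x y, 0 <= G x y) -> measurable_fun setT (fun x => \int[m]_y G x y).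
Proof.
move=> mG G0.
exact: (@measurable_fun_fubini_tonelli_F _ _ X Y R m (fun z => G z.1 z.2)).
Qed.

Lemma integral_swap (m1 : {sigma_finite_measure set X -> \bar R})
    (m2 : {sigma_finite_measure set Y -> \bar R})
    (G : X -> Y -> \bar R) : measurable_fun setT (fun z => G z.1 z.2) ->
  (forall x y, 0 <= G x y) ->
  \int[m1]_x \int[m2]_y G x y = \int[m2]_y \int[m1]_x G x y.
Proof.
move=> mG G0.
exact: (@fubini_tonelli _ _ X Y R m1 m2 (fun z => G z.1 z.2) mG (fun z => G0 z.1 z.2)).
Qed.

End iterated_integrals.

Section cartan_law.
Context (R : realType) (hh : forall n, probability ((n.+1 * n.+1).-tuple R) R).
Hypothesis Hh : forall n, is_haar_On (hh n).
Notation mxt := (@mx_of_tuple R _).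
Local Open Scope ereal_scope.

Lemma eq_integral_orthogonal n (f g : (n.+1 * n.+1).-tuple R -> \bar R) :
  measurable_fun setT f -> measurable_fun setT g ->
  (forall t, orthogonal_mx (mxt t : 'M[R]_n.+1) -> f t = g t) ->
  \int[hh n]_t f t = \int[hh n]_t g t.
Proof.
move=> mf mg fg; apply: ae_eq_integral => //.
by have := haar_orthogonal (Hh n); apply: filterS => t ot _; rewrite fg.
Qed.

Lemma integral_haar_cst n (f : (n.+1 * n.+1).-tuple R -> \bar R) (c : \bar R) :
  measurable_fun setT f -> (forall t, 0 <= f t) ->
  (forall t, orthogonal_mx (mxt t : 'M[R]_n.+1) -> f t = c) ->
  \int[hh n]_t f t = c.
Proof.
move=> mf f0 fc.
have c0 : 0 <= c.
  rewrite -(fc (tuple_of_mx 1%:M)) ?f0// tuple_of_mxK; exact: orthogonal_mx1.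
rewrite (@eq_integral_orthogonal _ f (cst c))//.
by apply: (etrans (integral_cst _ _ _)) => //; rewrite -[RHS]mule1; congr (_ * _);
  exact: (@probability_setT _ _ _ (hh n)).
Qed.

Lemma mxmeasurable_refl01 d (X : measurableType d) n (f : X -> R) :
  measurable_fun setT f -> mxmeasurable (fun x => refl01 n (f x)).
Proof.
move=> mf i j; rewrite /refl01 /plane_refl.
have mc : measurable_fun setT (fun x => cocos (f x)).
  exact: measurableT_comp (@measurable_cocos R) mf.
apply: (@eq_measurable_fun _ _ _ _ _ (fun x => (if i == ord0 then
  f x * (j == ord0)%:R + cocos (f x) * (j == lift ord0 ord0)%:R else
  if i == lift ord0 ord0 then cocos (f x) * (j == ord0)%:R - f x * (j == lift ord0 ord0)%:R
  else (j == i)%:R : R)%R)).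
  move=> x _; rewrite [RHS]mxE.
  by case: (i == ord0) => //; case: (i == lift ord0 ord0).
case: (i == ord0); first by apply: measurable_funD; exact: measurable_funM.
case: (i == _); last exact: measurable_cst.
by apply: measurable_funB; exact: measurable_funM.
Qed.

(** Evaluate in two ways the average of [F ((1 + V) M (1 + W))] over independent Haar [M], [V], [W].
    For fixed [V] and [W], invariance of [M] removes both factors. For fixed [M], the Cartan factors
    of [M] are absorbed by [V] and [W], so that only the corner of [M] remains, and its law is
    known. *)
Lemma haar_cartan k (F : 'M[R]_k.+3 -> \bar R) : measurable_mx F ->
  (forall M, 0 <= F M) ->
  \int[hh k.+2]_t F (mxt t) =
  \int[@lebR R]_b ((\int[hh k.+1]_w \int[hh k.+1]_v
    F (lift0_mx (mxt v) *m refl01 k.+1 b *m lift0_mx (mxt w))) * (semicircle_pdf k b)%:E).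
Proof.
move=> mF F0.
pose T := ((k.+2 * k.+2).-tuple R)%type.
pose T3 := ((k.+3 * k.+3).-tuple R)%type.
have mT : mxmeasurable (@mx_of_tuple R k.+2) := @mxmeasurable_mx_of_tuple R k.+1.
have mT3 : mxmeasurable (@mx_of_tuple R k.+3) := @mxmeasurable_mx_of_tuple R k.+2.
have mK d (X : measurableType d) (V W : X -> 'M[R]_k.+2) (K : X -> 'M[R]_k.+3) :
    mxmeasurable V -> mxmeasurable K -> mxmeasurable W ->
    measurable_fun setT (fun x => F (lift0_mx (V x) *m K x *m lift0_mx (W x))).
  move=> mV mK mW; apply: (measurable_mx_comp mF).
  by apply: mxmeasurable_mul; [apply: mxmeasurable_mul => //|];
    exact: mxmeasurable_lift0.
pose H (b : R) := \int[hh k.+1]_w \int[hh k.+1]_v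
    F (lift0_mx (mxt v) *m refl01 k.+1 b *m lift0_mx (mxt w)).
have mH : measurable_fun setT H.
  apply: measurable_integral_fst; last by move=> b w; exact: integral_ge0.
  apply: (@measurable_integral_fst _ _ (R * T)%type) => //.
  apply: mK; first exact: (mxmeasurable_comp mT).
    by apply: mxmeasurable_refl01; exact: measurableT_comp.
  by apply: (mxmeasurable_comp mT); exact: measurableT_comp.
have H0 b : 0 <= H b by apply: integral_ge0 => v _; exact: integral_ge0.
rewrite -(haar_corner_law (Hh k.+2) mH H0).
transitivity (\int[hh k.+2]_t \int[hh k.+1]_w \int[hh k.+1]_v
    F (lift0_mx (mxt v) *m mxt t *m lift0_mx (mxt w))); last first.
  apply: eq_integral_orthogonal.
  - apply: measurable_integral_fst; last by move=> b w; exact: integral_ge0.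
    apply: (@measurable_integral_fst _ _ (T3 * T)%type) => //.
    apply: mK; first exact: (mxmeasurable_comp mT).
      by apply: (mxmeasurable_comp mT3); exact: measurableT_comp.
    by apply: (mxmeasurable_comp mT); exact: measurableT_comp.
  - exact: measurableT_comp mH (measurable_mx_comp (@measurable_mx_entry R k.+2 ord0 ord0) mT3).
  move=> t ot; rewrite /H.
  have [V oV [W oW tE]] := ex_cartan ot.
  move: tE; set b := mxt t ord0 ord0 => tE; rewrite tE {tE}.
  transitivity (\int[hh k.+1]_w \int[hh k.+1]_v
      F (lift0_mx (mxt v) *m refl01 k.+1 b *m lift0_mx (W *m mxt w))).
    apply: eq_integral => w _.
    pose f M := F (lift0_mx M *m refl01 k.+1 b *m lift0_mx (W *m mxt w)).
    have mf : measurable_mx f.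
      apply: mK; [exact: mT|exact: mxmeasurable_cst|exact: mxmeasurable_cst].
    rewrite -[RHS](haar_right (Hh k.+1) oV mf).
    by apply: eq_integral => v _; rewrite /f !lift0_mxM !mulmxA.
  pose f M := \int[hh k.+1]_v F (lift0_mx (mxt v) *m refl01 k.+1 b *m lift0_mx M).
  have mf : measurable_mx f.
    apply: measurable_integral_fst => //.
    apply: mK; [|exact: mxmeasurable_cst|]; exact: (mxmeasurable_comp mT).
  exact: (haar_left (Hh k.+1) oW mf).
rewrite integral_swap; first last.
  - by move=> *; exact: integral_ge0.
  - apply: (@measurable_integral_fst _ _ (T3 * T)%type) => //.
    apply: mK; first exact: (mxmeasurable_comp mT).
      by apply: (mxmeasurable_comp mT3); exact: measurableT_comp.
    by apply: (mxmeasurable_comp mT); exact: measurableT_comp.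
have sw w : \int[hh k.+2]_t \int[hh k.+1]_v F (lift0_mx (mxt v) *m mxt t *m lift0_mx (mxt w)) =
    \int[hh k.+1]_v \int[hh k.+2]_t F (lift0_mx (mxt v) *m mxt t *m lift0_mx (mxt w)).
  apply: integral_swap => //; apply: mK; last exact: mxmeasurable_cst.
    exact: (mxmeasurable_comp mT).
  exact: (mxmeasurable_comp mT3).
under [RHS]eq_integral do rewrite sw.
apply/esym/integral_haar_cst.
- apply: measurable_integral_fst; last by move=> *; exact: integral_ge0.
  apply: (@measurable_integral_fst _ _ (T * T)%type) => //.
  apply: mK; last by apply: (mxmeasurable_comp mT); exact: measurableT_comp.
    by apply: (mxmeasurable_comp mT); exact: measurableT_comp.
  exact: (mxmeasurable_comp mT3).
- by move=> w; apply: integral_ge0 => v _; exact: integral_ge0.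
move=> w ow; apply: integral_haar_cst.
- apply: measurable_integral_fst => //.
  apply: mK; [exact: (mxmeasurable_comp mT)|exact: (mxmeasurable_comp mT3)|].
  exact: mxmeasurable_cst.
- by move=> v; exact: integral_ge0.
move=> v ov.
pose f M := F (M *m lift0_mx (mxt w)).
have mf : measurable_mx f.
  by apply: (measurable_mx_comp mF); apply: mxmeasurable_mul => //; exact: mxmeasurable_cst.
rewrite (haar_left (Hh k.+2) (orthogonal_mx_lift0 ov) mf).
exact: (haar_right (Hh k.+2) (orthogonal_mx_lift0 ow) mF).
Qed.

End cartan_law.

Section tuple_maps.
Context (R : realType).

Lemma tnth_tcons0 d (T : measurableType d) n (z : T * n.-tuple T) : tnth (tcons z) ord0 = z.1.
Proof. by rewrite (tnth_nth z.1). Qed.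

Lemma tnth_tconsS d (T : measurableType d) n (z : T * n.-tuple T) i : tnth (tcons z) (lift ord0 i) = tnth z.2 i.
Proof. by rewrite !(tnth_nth z.1). Qed.

Lemma thead_tcons d (T : measurableType d) n (z : T * n.-tuple T) : thead (tcons z) = z.1.
Proof. by have [] := tconsK z. Qed.

Lemma tbehead_tcons d (T : measurableType d) n (z : T * n.-tuple T) :
  tbehead (tcons z) = z.2.
Proof. by have [] := tconsK z. Qed.

Definition taxpy n (a : R) (x y : n.-tuple R) : n.-tuple R :=
  [tuple a * tnth x i + tnth y i | i < n].

Lemma measurable_tmap2 d (X : measurableType d) n (a : X -> R) (x : X -> n.-tuple R) :
  measurable_fun setT a -> measurable_fun setT x ->
  measurable_fun setT (fun z => map_tuple ( *%R (a z)) (x z)).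
Proof.
move=> ma mx; apply/measurable_fun_tnthP => i.
apply: (@eq_measurable_fun _ _ _ _ _ (fun z => a z * tnth (x z) i)).
  by move=> z _ /=; rewrite tnth_map.
by apply: measurable_funM => //; move/measurable_fun_tnthP : mx; exact.
Qed.

Lemma measurable_taxpy d (X : measurableType d) n (a : X -> R) (x y : X -> n.-tuple R) :
  measurable_fun setT a -> measurable_fun setT x -> measurable_fun setT y ->
  measurable_fun setT (fun z => taxpy (a z) (x z) (y z)).
Proof.
move=> ma mx my; apply/measurable_fun_tnthP => i.
apply: (@eq_measurable_fun _ _ _ _ _ (fun z => a z * tnth (x z) i + tnth (y z) i)).
  by move=> z _ /=; rewrite tnth_mktuple.
apply: measurable_funD; last by move/measurable_fun_tnthP : my; exact.
by apply: measurable_funM => //; move/measurable_fun_tnthP : mx; exact.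
Qed.

Lemma measurable_tcons_fun d (X : measurableType d) d' (T : measurableType d') n
    (a : X -> T) (x : X -> n.-tuple T) :
  measurable_fun setT a -> measurable_fun setT x ->
  measurable_fun setT (fun z => tcons (a z, x z)).
Proof.
by move=> ma mx; apply: (measurableT_comp (@measurable_tcons _ T n)); exact: measurable_fun_pair.
Qed.

End tuple_maps.

Section column_coordinates.
Context (R : realType).

(* Iterating the Cartan decomposition, the top [p] rows of a Haar matrix are those of
   [rowT t *m (1 + W)] with [W] Haar and [t] having independent coordinates: the first
   column is [colX t] and [colL t] acts on the remaining ones (see [rowT_mulE]). *)
Fixpoint colX p : p.-tuple R -> p.-tuple R :=
  match p with
  | 0%N => id
  | p'.+1 => fun t => tcons (thead t, map_tuple ( *%R (cocos (thead t))) (colX (tbehead t)))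
  end.

Fixpoint colL p : p.-tuple R -> p.-tuple R -> p.-tuple R :=
  match p with
  | 0%N => fun _ y => y
  | p'.+1 => fun t y => tcons (cocos (thead t) * thead y,
      taxpy (- (thead t * thead y)) (colX (tbehead t)) (colL (tbehead t) (tbehead y)))
  end.

Lemma measurable_colX p : measurable_fun setT (@colX p).
Proof.
elim: p => [|p IH]; first exact: measurable_id.
apply: measurable_tcons_fun; first exact: measurable_thead.
apply: measurable_tmap2.
  by apply: (measurableT_comp (@measurable_cocos R)); exact: measurable_thead.
by apply: (measurableT_comp IH); exact: measurable_tbehead.
Qed.

Lemma measurable_colL d (X : measurableType d) p (f g : X -> p.-tuple R) :
  measurable_fun setT f -> measurable_fun setT g ->
  measurable_fun setT (fun z => colL (f z) (g z)).
Proof.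
elim: p f g => [//|p IH] f g mf mg.
have mf0 : measurable_fun setT (fun z => thead (f z)).
  by apply: measurableT_comp mf; exact: measurable_thead.
have mg0 : measurable_fun setT (fun z => thead (g z)).
  by apply: measurableT_comp mg; exact: measurable_thead.
have mf1 : measurable_fun setT (fun z => tbehead (f z)).
  by apply: measurableT_comp mf; exact: measurable_tbehead.
have mg1 : measurable_fun setT (fun z => tbehead (g z)).
  by apply: measurableT_comp mg; exact: measurable_tbehead.
apply: measurable_tcons_fun.
  by apply: measurable_funM => //; exact: (measurableT_comp (@measurable_cocos R)).
apply: measurable_taxpy; last exact: IH.
  by apply: measurableT_comp; [exact: oppr_measurable|exact: measurable_funM].
exact: measurableT_comp (@measurable_colX p) mf1.
Qed.

Lemma colL0 p (t y : p.-tuple R) : (forall i, tnth y i = 0) ->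
  forall i, tnth (colL t y) i = 0.
Proof.
elim: p t y => [|p IH] t y y0 i; first by case: i.
case: (unliftP ord0 i) => [i'|] ->.
  rewrite tnth_tconsS tnth_mktuple IH ?addr0; last first.
    by move=> l; rewrite -(y0 (lift ord0 l)) [in RHS](tcons_eta y) tnth_tconsS.
  by rewrite -[thead y]/(tnth y ord0) y0 mulr0 oppr0 mul0r.
by rewrite tnth_tcons0 /= -[thead y]/(tnth y ord0) y0 mulr0.
Qed.

(** A product of reflections in the planes (0,1), (1,2), and so on, the first of them acting first
    on column vectors. The branch [n = 0] is a junk value, excluded by [p <= n] in its use. *)
Fixpoint rowT p : p.-tuple R -> forall n, 'M[R]_n.+1 :=
  match p with
  | 0%N => fun _ n => 1%:M
  | p'.+1 => fun t n => match n with
     | 0%N => 1%:M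
     | n'.+1 => (lift0_mx (rowT (tbehead t) n') : 'M[R]_(1 + n'.+1)) *m refl01 n' (thead t)
     end
  end.

Lemma inordS n i : (i <= n)%N -> inord i.+1 = lift ord0 (inord i : 'I_n.+1) :> 'I_n.+2.
Proof. by move=> ni; apply/val_inj; rewrite /= !inordK ?ltnS. Qed.

Lemma inord0 n : inord 0 = ord0 :> 'I_n.+1.
Proof. by apply/val_inj; rewrite /= inordK. Qed.

(** Each reflection mixes two neighbouring rows, so row [i] of the product depends on the rows of
    [G] up to [i + 1] only; row 0 enters through [colX], the next [p] rows through [colL]. *)
Lemma rowT_mulE p (t : p.-tuple R) n m (G : 'M[R]_(n.+1, m)) j (i : 'I_p) : (p <= n)%N ->
  (rowT t n *m G) (inord i) j =
  tnth (colX t) i * G ord0 j + tnth (colL t [tuple G (inord l.+1) j | l < p]) i.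
Proof.
elim: p t n m G j i => [|p IH] t n m G j i; first by case: i.
case: n G => [//|n] G pn; set G' := refl01 n (thead t) *m G.
have [h0 hS] := lift0_mx_mulE (rowT (tbehead t) n) (G' : 'M[R]_(1 + n.+1, m)).
have G'E := @plane_reflE R n.+2 ord0 (lift ord0 ord0) (thead t) (cocos (thead t)) m G.
rewrite [rowT t n.+1]/= -mulmxA -/G'.
have y0 : thead [tuple G (inord l.+1) j | l < p.+1] = G (lift ord0 ord0) j.
  by rewrite /thead tnth_mktuple (inordS (leq0n n)) inord0.
case: (unliftP ord0 i) => [i'|] ->; last first.
  rewrite [nat_of_ord ord0]/= inord0 h0 G'E eqxx !tnth_tcons0 [(_, _).1]/= y0.
  by [].
have i'n : (i' <= n)%N by exact: leq_trans (ltnW (ltn_ord i')) pn.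
rewrite [nat_of_ord (lift _ _)]lift0 inordS// hS IH// !tnth_tconsS tnth_map tnth_mktuple y0.
rewrite -[X in tnth X i' * _]/(colX (tbehead t)) mxE.
rewrite (_ : rshift 1 ord0 = lift ord0 ord0); last exact/val_inj.
rewrite G'E/=.
set y1 := [tuple dsubmx _ _ _ | _ < _]; set y2 := tbehead [tuple _ | _ < _].
have -> : y1 = y2.
  apply: eq_from_tnth => l; rewrite tnth_mktuple mxE.
  have -> : rshift 1 (inord l.+1 : 'I_n.+1) = inord l.+2 :> 'I_n.+2.
    apply/val_inj; rewrite /= !inordK// ltnS//.
      exact: leq_trans (ltn_ord l) pn.
    exact: leq_ltn_trans (ltn_ord l) pn.
  rewrite G'E.
  have l2 : (inord l.+2 : 'I_n.+2) = l.+2 :> nat.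
    by rewrite inordK// ltnS; exact: leq_ltn_trans (ltn_ord l) pn.
  rewrite (_ : _ == ord0 = false); last by apply/negP => /eqP/(congr1 val); rewrite /= l2.
  rewrite (_ : _ == lift _ _ = false); last by apply/negP => /eqP/(congr1 val); rewrite /= l2.
  have -> : tnth y2 l = tnth [tuple G (inord l.+1) j | l < p.+1] (lift ord0 l).
    by rewrite [in RHS](tcons_eta [tuple _ | _ < _]) tnth_tconsS.
  by rewrite tnth_mktuple lift0.
ring.
Qed.

End column_coordinates.

Section refl01_commutation.
Context (R : realType) (n : nat).

(** The two factors act on disjoint sets of coordinates. *)
Lemma lift0_lift0_refl01 (V : 'M[R]_n.+1) b :
  (lift0_mx (lift0_mx V : 'M[R]_n.+2) : 'M[R]_n.+3) *m refl01 n.+1 b =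
  refl01 n.+1 b *m (lift0_mx (lift0_mx V : 'M[R]_n.+2) : 'M[R]_n.+3).
Proof.
have [a00 a0l al0 all] := lift0_mxE V.
have [A00 A0l Al0 All] := lift0_mxE (lift0_mx V : 'M[R]_n.+2).
have l10 : (lift ord0 ord0 == ord0 :> 'I_n.+3) = false by [].
have ll0 l : (lift ord0 (lift ord0 l) == ord0 :> 'I_n.+3) = false by [].
have ll1 l : (lift ord0 (lift ord0 l) == lift ord0 ord0 :> 'I_n.+3) = false by [].
have r0 j : refl01 n.+1 b ord0 j = b * (j == ord0)%:R + cocos b * (j == lift ord0 ord0)%:R.
  by rewrite mxE.
have r1 j : refl01 n.+1 b (lift ord0 ord0) j =
    cocos b * (j == ord0)%:R - b * (j == lift ord0 ord0)%:R by rewrite mxE.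
have rl l j : refl01 n.+1 b (lift ord0 (lift ord0 l)) j = (j == lift ord0 (lift ord0 l))%:R.
  by rewrite mxE.
apply/matrixP => i j; rewrite plane_reflE mxE big_ord_recl big_ord_recl r0 r1.
case: (unliftP ord0 i) => [i1|] ->; last first.
  rewrite A00 A0l mul0r add0r mul1r big1 ?addr0; last by move=> l _; rewrite A0l mul0r.
  case: (unliftP ord0 j) => [j1|] ->.
    rewrite A0l All; case: (unliftP ord0 j1) => [j2|] ->; first by rewrite a0l ll0 ll1 !mulr0.
    by rewrite a00.
  by rewrite A00 Al0.
case: (unliftP ord0 i1) => [i2|] ->; last first.
  rewrite eqxx l10 Al0 mul0r add0r All a00 mul1r big1 ?addr0; last first.
    by move=> l _; rewrite All a0l mul0r.
  case: (unliftP ord0 j) => [j1|] ->.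
    rewrite A0l !All; case: (unliftP ord0 j1) => [j2|] ->; first by rewrite a0l ll0 ll1 !mulr0.
    by rewrite a00.
  by rewrite A00 Al0.
rewrite ll0 ll1 Al0 All al0 !mul0r !add0r.
under eq_bigr do rewrite All all rl.
case: (unliftP ord0 j) => [j1|] ->; last by rewrite Al0 big1// => l _; rewrite mulr0.
rewrite All; case: (unliftP ord0 j1) => [j2|] ->.
  rewrite all -[RHS](sum_deltar (fun l => V i2 l)).
  by apply: eq_bigr => l _; rewrite !(inj_eq lift_inj) eq_sym.
by rewrite al0 big1// => l _; rewrite mulr0.
Qed.

End refl01_commutation.

Section haar_rows.
Context (R : realType) (hh : forall n, probability ((n.+1 * n.+1).-tuple R) R).
Hypothesis Hh : forall n, is_haar_On (hh n).
Notation mxt := (@mx_of_tuple R _).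
Local Open Scope ereal_scope.

(* [n - 2] is meant for a matrix of size [n.+1]; it is a junk value for [n < 2]. *)
Fixpoint colpdf p : p.-tuple R -> nat -> R :=
  match p with
  | 0%N => fun _ _ => 1%R
  | p'.+1 => fun t n => (semicircle_pdf (n - 2) (thead t) * colpdf (tbehead t) n.-1)%R
  end.

Lemma colpdf_ge0 p (t : p.-tuple R) n : (0 <= colpdf t n)%R.
Proof. by elim: p t n => //= p IH t n; rewrite mulr_ge0// semicircle_pdf_ge0. Qed.

Lemma measurable_colpdf p n : measurable_fun setT (fun t : p.-tuple R => colpdf t n).
Proof.
elim: p n => [|p IH] n; first exact: measurable_cst.
apply: measurable_funM.
  apply: measurableT_comp; first exact: measurable_semicircle_pdf.
  exact: measurable_thead.
by apply: (measurableT_comp (IH n.-1)); exact: measurable_tbehead.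
Qed.

Lemma mxmeasurable_rowT d (X : measurableType d) p n (f : X -> p.-tuple R) :
  measurable_fun setT f -> mxmeasurable (fun x => rowT (f x) n).
Proof.
elim: p n f => [|p IH] [|n] f mf; try exact: mxmeasurable_cst.
apply: mxmeasurable_mul.
  apply: mxmeasurable_lift0; apply: IH; apply: measurableT_comp mf.
  exact: measurable_tbehead.
by apply: mxmeasurable_refl01; apply: measurableT_comp mf; exact: measurable_thead.
Qed.

Definition depends_on_rows p n (F : 'M[R]_n.+1 -> \bar R) :=
  forall M N : 'M[R]_n.+1, (forall i j : 'I_n.+1, (i < p)%N -> M i j = N i j) -> F M = F N.

(** In [(1 + V) A(b) (1 + W)] the first rows of the product see only the first rows of [V], so the
    induction hypothesis replaces [V] by [rowT bs (1 + V')]. The factor [1 + (1 + V')] commutes with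
    [A(b)] and is absorbed by left invariance of [W]. *)
Lemma haar_rowT p n (F : 'M[R]_n.+2 -> \bar R) : (p <= n)%N ->
  measurable_mx F -> (forall M, 0 <= F M) -> depends_on_rows p F ->
  \int[hh n.+1]_t F (mxt t) =
  \int[@lebt R p]_bs ((\int[hh n]_w F (rowT bs n.+1 *m lift0_mx (mxt w))) *
                     (colpdf bs n.+1)%:E).
Proof.
elim: p n F => [|p IH] n F pn mF F0 depF.
  rewrite ge0_integral_powm0//; last first.
    exact: (@measurable_cst _ _ _ _ _
      (\int[hh n]_w F (1%:M *m lift0_mx (mxt w)) * 1%:E)).
  rewrite mule1.
  have Fc M N : F M = F N by exact: depF.
  rewrite (@integral_haar_cst _ _ Hh _ _ (F 1%:M)); first last.
  - by move=> t _; exact: Fc.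
  - by move=> t; exact: F0.
  - exact: (measurable_mx_comp mF (@mxmeasurable_mx_of_tuple R n.+1)).
  apply/esym/integral_haar_cst => //.
    apply: (measurable_mx_comp mF); apply: mxmeasurable_mul; first exact: mxmeasurable_cst.
    exact: (mxmeasurable_lift0 (@mxmeasurable_mx_of_tuple R n)).
case: n F pn mF F0 depF => [//|n] F pn mF F0 depF.
have mT : mxmeasurable (@mx_of_tuple R n.+2) := @mxmeasurable_mx_of_tuple R n.+1.
have mT1 : mxmeasurable (@mx_of_tuple R n.+1) := @mxmeasurable_mx_of_tuple R n.
have mP d (X : measurableType d) (f : X -> p.+1.-tuple R) (w : X -> 'M[R]_n.+2) :
    measurable_fun setT f -> mxmeasurable w ->
    measurable_fun setT (fun x => F (rowT (f x) n.+2 *m lift0_mx (w x))).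
  move=> mf mw; apply: (measurable_mx_comp mF); apply: mxmeasurable_mul.
    exact: mxmeasurable_rowT.
  exact: mxmeasurable_lift0.
pose P (bs : p.+1.-tuple R) := \int[hh n.+1]_w F (rowT bs n.+2 *m lift0_mx (mxt w)).
have mPi : measurable_fun setT P.
  apply: measurable_integral_fst => //.
  apply: mP; first exact: measurable_fst.
  exact: (mxmeasurable_comp mT).
have P0 bs : 0 <= P bs by exact: integral_ge0.
have mQ : measurable_fun setT (fun bs : p.+1.-tuple R => P bs * (colpdf bs n.+2)%:E).
  apply: emeasurable_funM => //; apply/measurable_EFinP; exact: measurable_colpdf.
have Q0 bs : 0 <= P bs * (colpdf bs n.+2)%:E by rewrite mule_ge0// lee_fin colpdf_ge0.
rewrite ge0_integral_powmS// (haar_cartan Hh mF F0).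
apply: eq_integral => b _.
have c0 : (0 <= semicircle_pdf n b)%R by exact: semicircle_pdf_ge0.
transitivity ((\int[@lebt R p]_bs (P (tcons (b, bs)) * (colpdf bs n.+1)%:E)) *
    (semicircle_pdf n b)%:E); last first.
  rewrite -ge0_integralZr//; first last.
  - by move=> bs _; rewrite mule_ge0// lee_fin colpdf_ge0.
  - apply: emeasurable_funM; first exact: (measurableT_comp mPi (measurable_tcons2 _ _)).
    apply/measurable_EFinP; exact: measurable_colpdf.
  apply: eq_integral => bs _.
  have -> : colpdf (tcons (b, bs)) n.+2 = (semicircle_pdf n b * colpdf bs n.+1)%R.
    by rewrite [LHS]/= thead_tcons tbehead_tcons subn2.
  by rewrite -muleA -EFinM [(colpdf _ _ * _)%R]mulrC.
congr (_ * _).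
pose f w (V : 'M[R]_n.+2) := F (lift0_mx V *m refl01 n.+1 b *m lift0_mx w).
have mf d (X : measurableType d) (w V : X -> 'M[R]_n.+2) :
    mxmeasurable w -> mxmeasurable V -> measurable_fun setT (fun x => f (w x) (V x)).
  move=> mw mV; apply: (measurable_mx_comp mF); apply: mxmeasurable_mul.
    by apply: mxmeasurable_mul; [exact: mxmeasurable_lift0|exact: mxmeasurable_cst].
  exact: mxmeasurable_lift0.
have f0 w V : 0 <= f w V by exact: F0.
transitivity (\int[hh n.+1]_w \int[@lebt R p]_bs
    ((\int[hh n]_v f (mxt w) (rowT bs n.+1 *m lift0_mx (mxt v))) * (colpdf bs n.+1)%:E)).
  apply: eq_integral => w _; apply: (IH n (f (mxt w))) => //.
    by apply: mf; [exact: mxmeasurable_cst|exact: mT].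
  move=> M N MN; apply: depF => i j ip; rewrite -!mulmxA.
  set K := refl01 _ _ *m _.
  have [M0 MS] := lift0_mx_mulE M K; have [N0 NS] := lift0_mx_mulE N K.
  case: (unliftP ord0 i) ip => [i'|] -> ip; last by rewrite M0 N0.
  rewrite MS NS !mxE; apply: eq_bigr => l _; congr (_ * _)%R; apply: MN.
  by move: ip; rewrite lift0.
have mrow d (X : measurableType d) (bs : X -> p.-tuple R) (v : X -> 'M[R]_n.+1) :
    measurable_fun setT bs -> mxmeasurable v ->
    mxmeasurable (fun x => rowT (bs x) n.+1 *m lift0_mx (v x)).
  move=> mbs mv; apply: mxmeasurable_mul; first exact: mxmeasurable_rowT.
  exact: mxmeasurable_lift0.
have mcp : measurable_fun setT (fun bs : p.-tuple R => (colpdf bs n.+1)%:E : \bar R).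
  apply/measurable_EFinP; exact: measurable_colpdf.
rewrite integral_swap; first last.
- by move=> w bs; rewrite mule_ge0// ?lee_fin ?colpdf_ge0// integral_ge0.
- apply: emeasurable_funM; last exact: measurableT_comp mcp measurable_snd.
  apply: (@measurable_integral_fst _ _ (((n.+2 * n.+2).-tuple R) * (p.-tuple R))%type) => //.
  apply: mf; first by apply: (mxmeasurable_comp mT); exact: measurableT_comp.
  apply: mrow; first exact: measurableT_comp.
  exact: (mxmeasurable_comp mT1).
apply: eq_integral => bs _.
rewrite ge0_integralZr//; first last.
- by rewrite lee_fin colpdf_ge0.
- by move=> w _; exact: integral_ge0.
- apply: measurable_integral_fst => //.
  apply: mf; first exact: (mxmeasurable_comp mT).
  by apply: mrow; [exact: measurable_cst|exact: (mxmeasurable_comp mT1)].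
congr (_ * _).
rewrite integral_swap//; last first.
  apply: mf; first exact: (mxmeasurable_comp mT).
  by apply: mrow; [exact: measurable_cst|exact: (mxmeasurable_comp mT1)].
apply: integral_haar_cst => //.
- apply: measurable_integral_fst => //.
  apply: mf; last by apply: mrow; [exact: measurable_cst|exact: (mxmeasurable_comp mT1)].
  exact: (mxmeasurable_comp mT).
- by move=> v; exact: integral_ge0.
move=> v ov.
pose g M := F (rowT (tcons (b, bs)) n.+2 *m lift0_mx M).
have mg : measurable_mx g by apply: mP; [exact: measurable_cst|exact: mT].
rewrite -[RHS](haar_left (Hh n.+1) (orthogonal_mx_lift0 ov) mg).
have rE : rowT (tcons (b, bs)) n.+2 =
    (lift0_mx (rowT bs n.+1) : 'M[R]_n.+3) *m refl01 n.+1 b.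
  by rewrite [LHS]/= thead_tcons tbehead_tcons.
apply: eq_integral => w _; rewrite /g /f rE; congr F.
rewrite (lift0_mxM (rowT bs n.+1)) -!mulmxA; congr (lift0_mx (rowT bs n.+1) *m _).
by rewrite mulmxA lift0_lift0_refl01 -mulmxA -lift0_mxM.
Qed.

End haar_rows.

(** * Independent coordinates of a block *)

Section block_coordinates.
Context (R : realType).

Definition mxblk p q n (M : 'M[R]_n.+1) : q.-tuple (p.-tuple R) :=
  [tuple [tuple M (inord i) (inord j) | i < p] | j < q].

(** The map from independent coordinates to the block: the head gives the first column, and its
    linear map [colL] acts on the block built from the tail. *)
Fixpoint blkX p q : q.-tuple (p.-tuple R) -> q.-tuple (p.-tuple R) :=
  match q with
  | 0%N => id
  | q'.+1 => fun B => tcons (colX (thead B), map_tuple (colL (thead B)) (blkX (tbehead B)))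
  end.

Fixpoint blkpdf p q : q.-tuple (p.-tuple R) -> nat -> R :=
  match q with
  | 0%N => fun _ _ => 1%R
  | q'.+1 => fun B n => colpdf (thead B) n * blkpdf (tbehead B) n.-1
  end.

Lemma measurable_map_colL d (X : measurableType d) p q (f : X -> p.-tuple R)
    (g : X -> q.-tuple (p.-tuple R)) : measurable_fun setT f -> measurable_fun setT g ->
  measurable_fun setT (fun x => map_tuple (colL (f x)) (g x)).
Proof.
move=> mf mg; apply/measurable_fun_tnthP => i.
apply: (@eq_measurable_fun _ _ _ _ _ (fun z => colL (f z) (tnth (g z) i))).
  by move=> z _ /=; rewrite tnth_map.
by apply: measurable_colL => //; move/measurable_fun_tnthP : mg; exact.
Qed.

Lemma measurable_blkX p q : measurable_fun setT (@blkX p q).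
Proof.
elim: q => [|q IH]; first exact: measurable_id.
apply: measurable_tcons_fun.
  by apply: (measurableT_comp (@measurable_colX R p)); exact: measurable_thead.
apply: measurable_map_colL; first exact: measurable_thead.
by apply: (measurableT_comp IH); exact: measurable_tbehead.
Qed.

Lemma blkpdf_ge0 p q (B : q.-tuple (p.-tuple R)) n : 0 <= blkpdf B n.
Proof. by elim: q B n => //= q IH B n; rewrite mulr_ge0// colpdf_ge0. Qed.

Lemma measurable_blkpdf p q n : measurable_fun setT (fun B : q.-tuple (p.-tuple R) => blkpdf B n).
Proof.
elim: q n => [|q IH] n; first exact: measurable_cst.
apply: measurable_funM.
  by apply: (measurableT_comp (@measurable_colpdf R p n)); exact: measurable_thead.
by apply: (measurableT_comp (IH n.-1)); exact: measurable_tbehead.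
Qed.

Lemma measurable_mxblk d (X : measurableType d) p q n (F : X -> 'M[R]_n.+1) :
  mxmeasurable F -> measurable_fun setT (fun x => mxblk p q (F x)).
Proof.
move=> mF; apply/measurable_fun_tnthP => j.
apply: (@eq_measurable_fun _ _ _ _ _
  (fun x => [tuple F x (inord i) (inord j) | i < p] : p.-tuple R)).
  by move=> z _ /=; rewrite tnth_mktuple.
apply/measurable_fun_tnthP => i.
apply: (@eq_measurable_fun _ _ _ _ _ (fun x => F x (inord i) (inord j))).
  by move=> z _ /=; rewrite tnth_mktuple.
exact: mF.
Qed.

Lemma mxblk_rowT p q n (t : p.-tuple R) (W : 'M[R]_n.+1) : (p <= n)%N -> (q <= n)%N ->
  mxblk p q.+1 (rowT t n.+1 *m lift0_mx W) =
  tcons (colX t, map_tuple (colL t) (mxblk p q W)).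
Proof.
move=> pn qn; have [W00 W0l Wl0 Wll] := lift0_mxE W.
apply: eq_from_tnth => j; apply: eq_from_tnth => i; rewrite !tnth_mktuple.
rewrite rowT_mulE; last exact: leqW.
case: (unliftP ord0 j) => [j'|] ->.
  have j'n : (j' <= n)%N by exact: leq_trans (ltnW (ltn_ord j')) qn.
  rewrite lift0 inordS// tnth_tconsS W0l mulr0 add0r tnth_map tnth_mktuple.
  congr (tnth (colL t _) i); apply: eq_from_tnth => l; rewrite !tnth_mktuple inordS ?Wll//.
  exact: leq_trans (ltnW (ltn_ord l)) pn.
rewrite [nat_of_ord ord0]/= inord0 W00 mulr1 tnth_tcons0 colL0 ?addr0// => l.
rewrite tnth_mktuple inordS ?Wl0//.
exact: leq_trans (ltnW (ltn_ord l)) pn.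
Qed.

End block_coordinates.

Section block_law.
Context (R : realType) (hh : forall n, probability ((n.+1 * n.+1).-tuple R) R).
Hypothesis Hh : forall n, is_haar_On (hh n).
Notation mxt := (@mx_of_tuple R _).
Local Open Scope ereal_scope.

(** After [haar_rowT] the remaining columns are [colL t] applied to a block of a Haar matrix one
    size smaller, under a law that does not involve [t], and the induction on [q] goes on with that
    block. *)
Lemma haar_block p q n (F : q.-tuple (p.-tuple R) -> \bar R) : (p + q <= n)%N ->
  measurable_fun setT F -> (forall B, 0 <= F B) ->
  \int[hh n]_t F (mxblk p q (mxt t)) =
  \int[@lebtt R p q]_B (F (blkX B) * (blkpdf B n)%:E).
Proof.
elim: q n F => [|q IH] n F pqn mF F0.
  rewrite ge0_integral_powm0; last first.
    apply: emeasurable_funM; first exact: (measurableT_comp mF (@measurable_blkX R p 0)).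
    by apply/measurable_EFinP; exact: measurable_blkpdf.
  rewrite mule1; apply: (integral_haar_cst Hh) => //.
    apply: (measurableT_comp mF); apply: measurable_mxblk; exact: mxmeasurable_mx_of_tuple.
  by move=> t _; rewrite [mxblk _ _ _]tuple0.
case: n pqn => [|n]; first by rewrite addnS.
rewrite addnS ltnS => pqn.
have pn : (p <= n)%N by exact: leq_trans (leq_addr _ _) pqn.
have qn : (q <= n)%N by exact: leq_trans (leq_addl _ _) pqn.
have mQ : measurable_fun setT (fun B : q.+1.-tuple (p.-tuple R) =>
    F (blkX B) * (blkpdf B n.+1)%:E).
  apply: emeasurable_funM; first exact: (measurableT_comp mF (@measurable_blkX R p q.+1)).
  by apply/measurable_EFinP; exact: measurable_blkpdf.
have Q0 (B : q.+1.-tuple (p.-tuple R)) : 0 <= F (blkX B) * (blkpdf B n.+1)%:E.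
  by rewrite mule_ge0// lee_fin blkpdf_ge0.
rewrite ge0_integral_powmS// (haar_rowT Hh (F := fun M => F (mxblk p q.+1 M)) pn)//; first last.
- move=> M N MN; congr F; apply: eq_from_tnth => j; apply: eq_from_tnth => i.
  rewrite !tnth_mktuple MN// inordK// !ltnS.
  exact: leq_trans (ltnW (ltn_ord i)) (leqW pn).
- apply: (measurableT_comp mF); apply: measurable_mxblk; exact: mxmeasurable_mx_of_tuple.
apply: eq_integral => t _.
under eq_integral do rewrite mxblk_rowT//.
pose G B := F (tcons (colX t, map_tuple (colL t) B)).
have mG : measurable_fun setT G.
  apply: measurableT_comp => //; apply: measurable_tcons_fun => //.
  by apply: measurable_map_colL.
transitivity (\int[@lebtt R p q]_B (G (blkX B) * (blkpdf B n)%:E) * (colpdf t n.+1)%:E).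
  by congr (_ * _); exact: (IH n G pqn mG (fun=> F0 _)).
rewrite -ge0_integralZr//; first last.
- by rewrite lee_fin colpdf_ge0.
- by move=> B _; apply: mule_ge0; [exact: F0|rewrite lee_fin blkpdf_ge0].
- apply: emeasurable_funM; first exact: (measurableT_comp mG (@measurable_blkX R p q)).
  by apply/measurable_EFinP; exact: measurable_blkpdf.
apply: eq_integral => B _.
by rewrite /G/= thead_tcons tbehead_tcons -muleA -EFinM [(blkpdf _ _ * _)%R]mulrC.
Qed.

End block_law.

Section jacobian.
Context (R : realType).
Local Open Scope ereal_scope.

(** The Jacobian determinant of the triangular linear map [colL t]. *)
Fixpoint coldet p : p.-tuple R -> R :=
  match p with
  | 0%N => fun=> 1%R
  | p'.+1 => fun t => (cocos (thead t) * coldet (tbehead t))%R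
  end.

Fixpoint colin p : p.-tuple R -> bool :=
  match p with
  | 0%N => fun=> true
  | p'.+1 => fun t => (`|thead t| < 1)%R && colin (tbehead t)
  end.

(* [jacw t q] is the Jacobian of [colX] times the [q]-th power of that of [colL t]. *)
Fixpoint jacw p : p.-tuple R -> nat -> R :=
  match p with
  | 0%N => fun _ _ => 1%R
  | p'.+1 => fun t q =>
     ((if (`|thead t| < 1)%R then cocos (thead t) ^+ (p' + q) else 0) * jacw (tbehead t) q)%R
  end.

Fixpoint blkjac p q : q.-tuple (p.-tuple R) -> R :=
  match q with
  | 0%N => fun=> 1%R
  | q'.+1 => fun B => (jacw (thead B) q' * blkjac (tbehead B))%R
  end.

Lemma jacw_ge0 p (t : p.-tuple R) q : (0 <= jacw t q)%R.
Proof.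
elim: p t => //= p IH t; rewrite mulr_ge0//.
by case: ifP => // _; rewrite exprn_ge0// cocos_ge0.
Qed.

Lemma blkjac_ge0 p q (B : q.-tuple (p.-tuple R)) : (0 <= blkjac B)%R.
Proof. by elim: q B => //= q IH B; rewrite mulr_ge0// jacw_ge0. Qed.

Lemma jacw0 p (t : p.-tuple R) q : ~~ colin t -> jacw t q = 0%R.
Proof.
elim: p t => //= p IH t; rewrite negb_and => /orP[/negbTE->|/IH ->]; first by rewrite mul0r.
by rewrite mulr0.
Qed.

Lemma jacwE p (t : p.-tuple R) q : jacw t q = (coldet t ^+ q * jacw t 0)%R.
Proof.
elim: p t => /= [t|p IH t]; first by rewrite expr1n mul1r.
rewrite IH addn0; case: ifP => _; last by rewrite !mul0r mulr0.
by rewrite exprD exprMn_comm; [ring|exact: mulrC].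
Qed.

Lemma coldet_gt0 p (t : p.-tuple R) : colin t -> (0 < coldet t)%R.
Proof. by elim: p t => //= p IH t /andP[t1 /IH]; apply: mulr_gt0; exact: cocos_gt0. Qed.

Lemma measurable_jacw p q : measurable_fun setT (fun t : p.-tuple R => jacw t q).
Proof.
elim: p => [|p IH]; first exact: measurable_cst.
apply: measurable_funM; last by apply: (measurableT_comp IH); exact: measurable_tbehead.
apply: measurable_fun_if => //.
- apply: measurable_fun_ltr => //.
  by apply: measurableT_comp => //; exact: measurable_thead.
- apply: measurable_funTS; apply: measurable_funX.
  by apply: (measurableT_comp (@measurable_cocos R)); exact: measurable_thead.
Qed.

Lemma measurable_blkjac p q : measurable_fun setT (fun B : q.-tuple (p.-tuple R) => blkjac B).
Proof.
elim: q => [|q IH]; first exact: measurable_cst.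
apply: measurable_funM; last by apply: (measurableT_comp IH); exact: measurable_tbehead.
by apply: (measurableT_comp (@measurable_jacw p q)); exact: measurable_thead.
Qed.

Lemma ge0_integral_taxpy p (a : R) (x : p.-tuple R) (f : p.-tuple R -> \bar R) :
  measurable_fun setT f -> (forall y, 0 <= f y) ->
  \int[@lebt R p]_y f (taxpy a x y) = \int[@lebt R p]_y f y.
Proof.
elim: p x f => [|p IH] x f mf f0.
  apply: eq_integral => y _; congr f; apply: eq_from_tnth; case=> //.
have mt : measurable_fun setT (fun y : p.+1.-tuple R => f (taxpy a x y)).
  by apply: (measurableT_comp mf); exact: measurable_taxpy.
rewrite !ge0_integral_powmS//.
pose g (y0 : R) := \int[@lebt R p]_y f (@tcons _ R p (y0, y)).
transitivity (\int[@lebR R]_y0 g (a * thead x + 1 * y0)%R).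
  apply: eq_integral => y0 _.
  rewrite /g -(IH (tbehead x) (fun y => f (tcons ((a * thead x + 1 * y0)%R, y))))//; last first.
    exact: (measurableT_comp mf (measurable_tcons2 _ _)).
  apply: eq_integral => y _; congr f; apply: eq_from_tnth => i.
  rewrite tnth_mktuple [in LHS](tcons_eta x).
  by case: (unliftP ord0 i) => [i'|] ->; rewrite ?tnth_tconsS ?tnth_tcons0 ?tnth_mktuple//= mul1r.
rewrite (ge0_integral_lebR_affine _ (f := g))//.
- by rewrite invr1 mul1e.
- apply: measurable_integral_fst => //.
  by apply: (measurableT_comp mf); exact: measurable_tcons.
- by move=> y0; exact: integral_ge0.
Qed.

(** One coordinate is scaled by [cocos (thead t)]; for each of its values the others undergo the
    smaller map followed by a translation. *)
Lemma ge0_integral_colL p (t : p.-tuple R) (f : p.-tuple R -> \bar R) : colin t ->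
  measurable_fun setT f -> (forall y, 0 <= f y) ->
  \int[@lebt R p]_y f (colL t y) = (coldet t)^-1%:E * \int[@lebt R p]_y f y.
Proof.
elim: p t f => [|p IH] t f; first by rewrite /= invr1 mul1e.
move=> /= /andP[t1 tin] mf f0.
have mt : measurable_fun setT (fun y : p.+1.-tuple R => f (colL t y)).
  by apply: (measurableT_comp mf); exact: measurable_colL.
have s0 := cocos_gt0 t1.
rewrite !ge0_integral_powmS//.
pose g (y0 : R) := \int[@lebt R p]_y f (@tcons _ R p (y0, y)).
have mg : measurable_fun setT g.
  apply: measurable_integral_fst => //.
  by apply: (measurableT_comp mf); exact: measurable_tcons.
have g0 y0 : 0 <= g y0 by exact: integral_ge0.
have d0 : (0 <= (coldet (tbehead t))^-1)%R by rewrite invr_ge0 ltW// coldet_gt0.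
transitivity (\int[@lebR R]_y0 ((coldet (tbehead t))^-1%:E *
    g (0 + cocos (thead t) * y0)%R)).
  apply: eq_integral => y0 _.
  pose h y := f (tcons ((cocos (thead t) * y0)%R,
    taxpy (- (thead t * y0)) (colX (tbehead t)) y)).
  have mh : measurable_fun setT h.
    by apply: (measurableT_comp mf); apply: measurable_tcons_fun => //; exact: measurable_taxpy.
  transitivity (\int[@lebt R p]_y h (colL (tbehead t) y)).
    by apply: eq_integral => y _; rewrite /h/= thead_tcons tbehead_tcons.
  rewrite (IH (tbehead t) h tin mh (fun=> f0 _)); congr (_ * _).
  rewrite add0r /g -(ge0_integral_taxpy (- (thead t * y0)) (colX (tbehead t))
    (f := fun y => f (tcons ((cocos (thead t) * y0)%R, y))))//.
  exact: (measurableT_comp mf (measurable_tcons2 _ _)).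
have mgs : measurable_fun setT (fun y0 : R => g (0 + cocos (thead t) * y0)%R).
  by apply: (measurableT_comp mg); apply: measurable_funD => //; exact: measurable_funM.
rewrite (ge0_integralZl (@lebR R) measurableT mgs (fun y _ => g0 _)); last by rewrite lee_fin.
by rewrite (ge0_integral_lebR_affine _ s0 mg g0) muleA -EFinM invfM mulrC.
Qed.

(** Given a first entry [b] with [|b| < 1], the other entries are scaled by [cocos b], and the
    weight compensates the Jacobian. Only an inequality holds: the values of [b] outside ]-1, 1[ are
    lost. *)
Lemma integral_colX_le p (f : p.-tuple R -> \bar R) :
  measurable_fun setT f -> (forall y, 0 <= f y) ->
  \int[@lebt R p]_t (f (colX t) * (jacw t 0)%:E) <= \int[@lebt R p]_y f y.
Proof.
elim: p f => [|p IH] f mf f0.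
  by rewrite le_eqVlt; apply/orP; left; apply/eqP; apply: eq_integral => t _; rewrite mule1.
have mt : measurable_fun setT (fun t : p.+1.-tuple R => f (colX t) * (jacw t 0)%:E).
  apply: emeasurable_funM; first exact: (measurableT_comp mf (@measurable_colX R p.+1)).
  by apply/measurable_EFinP; exact: measurable_jacw.
rewrite !ge0_integral_powmS//; last by move=> t; rewrite mule_ge0// lee_fin jacw_ge0.
have mg : measurable_fun setT (fun z : R * p.-tuple R => f (tcons z)).
  by apply: (measurableT_comp mf); exact: measurable_tcons.
apply: ge0_le_integral => //.
- move=> b _; apply: integral_ge0 => t _; rewrite mule_ge0// lee_fin jacw_ge0//.
- apply: measurable_integral_fst.
    by apply: (measurableT_comp mt); exact: measurable_tcons.
  by move=> b t; rewrite mule_ge0// lee_fin jacw_ge0.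
- exact: measurable_integral_fst.
move=> b _; pose s := cocos b.
pose h y := f (tcons (b, map_tuple ( *%R s) y)).
have mh : measurable_fun setT h.
  by apply: (measurableT_comp mf); apply: measurable_tcons_fun => //; exact: measurable_tmap2.
pose w := (if (`|b| < 1)%R then s ^+ p else 0)%R.
have w0 : (0 <= w)%R by rewrite /w; case: ifP => // _; rewrite exprn_ge0// cocos_ge0.
have -> : \int[@lebt R p]_t (f (colX (tcons (b, t))) * (jacw (tcons (b, t)) 0)%:E) =
    w%:E * \int[@lebt R p]_t (h (colX t) * (jacw t 0)%:E).
  rewrite -ge0_integralZl//; first last.
  - by move=> t _; apply: mule_ge0; [exact: f0|rewrite lee_fin jacw_ge0].
  - apply: emeasurable_funM; first exact: (measurableT_comp mh (@measurable_colX R p)).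
    by apply/measurable_EFinP; exact: measurable_jacw.
  apply: eq_integral => t _.
  by rewrite /h/= thead_tcons tbehead_tcons/= addn0 muleCA -EFinM.
apply: (le_trans (lee_wpmul2l _ (IH h mh (fun=> f0 _)))) => //.
rewrite /w; case: ifPn => b1; last by rewrite mul0e integral_ge0.
have s0 : (0 < s)%R by exact: cocos_gt0.
rewrite (@ge0_integral_powm_map _ _ _ (@lebR R) ( *%R s) (s^-1) _ _ _ p
  (fun y => f (tcons (b, y))))//.
- by rewrite muleA -EFinM exprVn mulfV ?mul1e// expf_neq0// gt_eqF.
- by rewrite invr_ge0 ltW.
- move=> g mg' g0; rewrite -(ge0_integral_lebR_affine 0 s0 mg' g0).
  by apply: eq_integral => x _; rewrite add0r.
- exact: (measurableT_comp mf (measurable_tcons2 _ _)).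
Qed.

(** The linear map [colL t] acts on each of the [q] remaining columns, which accounts for the factor
    [coldet t ^+ q] in [jacw t q]. *)
Lemma integral_blkX_le p q (F : q.-tuple (p.-tuple R) -> \bar R) :
  measurable_fun setT F -> (forall B, 0 <= F B) ->
  \int[@lebtt R p q]_B (F (blkX B) * (blkjac B)%:E) <= \int[@lebtt R p q]_B F B.
Proof.
elim: q F => [|q IH] F mF F0.
  by rewrite le_eqVlt; apply/orP; left; apply/eqP; apply: eq_integral => t _; rewrite mule1.
have mt : measurable_fun setT (fun B : q.+1.-tuple (p.-tuple R) => F (blkX B) * (blkjac B)%:E).
  apply: emeasurable_funM; first exact: (measurableT_comp mF (@measurable_blkX R p q.+1)).
  by apply/measurable_EFinP; exact: measurable_blkjac.
have t0 (B : q.+1.-tuple (p.-tuple R)) : 0 <= F (blkX B) * (blkjac B)%:E.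
  by rewrite mule_ge0// lee_fin blkjac_ge0.
rewrite !ge0_integral_powmS//.
pose G t := \int[@lebtt R p q]_B F (tcons (t, B)).
have mG : measurable_fun setT G.
  apply: measurable_integral_fst => //.
  by apply: (measurableT_comp mF); exact: measurable_tcons.
have G0 t : 0 <= G t by exact: integral_ge0.
apply: (@le_trans _ _ (\int[@lebt R p]_t (G (colX t) * (jacw t 0)%:E))); last first.
  exact: integral_colX_le.
apply: ge0_le_integral => //.
- by move=> b _; exact: integral_ge0.
- apply: measurable_integral_fst => //.
  by apply: (measurableT_comp mt); exact: measurable_tcons.
- apply: emeasurable_funM; first exact: (measurableT_comp mG (@measurable_colX R p)).
  by apply/measurable_EFinP; exact: measurable_jacw.
move=> t _; pose h B := F (tcons (colX t, map_tuple (colL t) B)).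
have mh : measurable_fun setT h.
  by apply: (measurableT_comp mF); apply: measurable_tcons_fun => //; exact: measurable_map_colL.
have -> : \int[@lebtt R p q]_B (F (blkX (tcons (t, B))) * (blkjac (tcons (t, B)))%:E) =
    (jacw t q)%:E * \int[@lebtt R p q]_B (h (blkX B) * (blkjac B)%:E).
  rewrite -ge0_integralZl//; first last.
  - by rewrite lee_fin jacw_ge0.
  - by move=> B _; apply: mule_ge0; [exact: F0|rewrite lee_fin blkjac_ge0].
  - apply: emeasurable_funM; first exact: (measurableT_comp mh (@measurable_blkX R p q)).
    by apply/measurable_EFinP; exact: measurable_blkjac.
  apply: eq_integral => B _.
  by rewrite /h/= thead_tcons tbehead_tcons/= muleCA -EFinM.
apply: (le_trans (lee_wpmul2l _ (IH h mh (fun=> F0 _)))) => //; first by rewrite lee_fin jacw_ge0.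
have [tin|tout] := boolP (colin t); last first.
  by rewrite jacw0// mul0e mule_ge0// lee_fin jacw_ge0.
have d0 := coldet_gt0 tin.
rewrite (@ge0_integral_powm_map _ _ _ (@lebt R p) (colL t) ((coldet t)^-1) _ _ _ q
  (fun B => F (tcons (colX t, B))))//.
- rewrite -[G (colX t)]/(\int[powm (@lebt R p) q]_z F (tcons (colX t, z))).
  rewrite muleA -EFinM [X in _ <= X]muleC.
  have -> : (jacw t q * (coldet t)^-1 ^+ q = jacw t 0)%R; last exact: lexx.
  by rewrite jacwE exprVn mulrAC mulfV ?mul1r// expf_neq0// gt_eqF.
- by rewrite invr_ge0 ltW.
- exact: measurable_colL.
- by move=> g mg g0; exact: ge0_integral_colL.
- exact: (measurableT_comp mF (measurable_tcons2 _ _)).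
Qed.

End jacobian.

(** * Upper bound on the relative entropy *)

Section KL_density.
Context (R : realType) (d : measure_display) (T : measurableType d).
Variables mu nu : probability T R.
Local Open Scope ereal_scope.

Lemma KL_div_density : mu `<< nu -> exists w : T -> R,
  [/\ measurable_fun setT w, forall x, (0 <= w x)%R,
    (forall f, measurable_fun setT f -> (forall x, 0 <= f x) ->
      \int[mu]_x f x = \int[nu]_x (f x * (w x)%:E)) &
    KL_div mu nu = \int[nu]_x (w x * ln (w x))%:E].
Proof.
move=> munu; exists (fun x => fine (Radon_Nikodym_SigmaFinite.f mu nu x)).
set w := fun _ => _.
have wE x : (w x)%:E = Radon_Nikodym_SigmaFinite.f mu nu x.
  by rewrite fineK//; exact: Radon_Nikodym_SigmaFinite.f_fin_num munu _.
have w0 x : (0 <= w x)%R.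
  by rewrite -lee_fin wE; exact: Radon_Nikodym_SigmaFinite.f_ge0 munu _.
have mw : measurable_fun setT w.
  apply/measurable_EFinP.
  rewrite (_ : EFin \o w = Radon_Nikodym_SigmaFinite.f mu nu).
    exact: (measurable_int _ (Radon_Nikodym_SigmaFinite.f_integrable munu)).
  by apply/funext => x; exact: wE.
split => //.
  move=> f mf f0; rewrite -(Radon_Nikodym_SigmaFinite.change_of_variables munu f0)//.
  by apply: eq_integral => x _; rewrite wE.
rewrite /KL_div; case: pselect => // munu'.
have hw := ae_eq_Radon_Nikodym_SigmaFinite munu measurableT.
apply: ae_eq_integral => //; last first.
- by apply: filterS hw => x hw _ /=; rewrite /w hw.
- apply/measurable_EFinP; apply: measurable_funM => //.
  by apply: measurableT_comp => //; exact: measurable_ln.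
- apply/measurable_EFinP.
  have m1 : measurable_fun setT
     (fun x => fine (Radon_Nikodym (charge_of_finite_measure mu) nu x)).
    exact: measurableT_comp.
  by apply: measurable_funM => //; exact: measurableT_comp.
Qed.

End KL_density.

(* Integrated against the base measure, this is the variational bound
   KL(mu | nu) <= mu[g], where [rho <= tau * exp g] bounds the density of mu. *)
Lemma mul_ln_le (R : realType) (psi rho tau g : R) : 0 < psi -> 0 <= rho -> 0 <= tau ->
  rho <= tau * expR g -> rho * ln psi + rho <= rho * g + psi * tau.
Proof.
move=> psi0; rewrite le_eqVlt => /orP[/eqP <- t0 _|r0 t0 rt].
  by rewrite !mul0r !add0r mulr_ge0// ltW.
have {}t0 : 0 < tau.
  rewrite lt_neqAle t0 andbT; apply: contraTneq rt => <-; rewrite mul0r -ltNge//.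
have y0 : 0 < psi * tau / rho by rewrite !(divr_gt0, mulr_gt0).
have ly : ln (psi * tau / rho) <= psi * tau / rho - 1.
  have := @le_ln1Dx R (psi * tau / rho - 1); rewrite addrCA subrr addr0; apply.
  by rewrite ltrBDl subrr.
have lg : ln (rho / tau) <= g.
  rewrite -[leRHS]expRK ler_ln ?posrE ?divr_gt0 ?expR_gt0//.
  by rewrite ler_pdivrMr// mulrC.
have -> : ln psi = ln (psi * tau / rho) + ln (rho / tau).
  rewrite -lnM ?posrE ?divr_gt0 ?mulr_gt0//; congr ln; field.
  by rewrite !gt_eqF.
rewrite -lerBrDr; apply: (le_trans (ler_wpM2l (ltW r0) (lerD ly lg))).
have -> : rho * (psi * tau / rho - 1 + g) = rho * g + psi * tau - rho.
  by field; rewrite gt_eqF.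
exact: lexx.
Qed.

Section KL_upper_bound.
Context (R : realType) d (T : measurableType d) d' (S : measurableType d').
Variables (mu nu : probability T R) (lam : {measure set S -> \bar R}).
Variables (Phi : S -> T) (rho tau g1 g2 : S -> R) (k1 k2 : R).
Local Open Scope ereal_scope.
Hypotheses (mPhi : measurable_fun setT Phi) (mrho : measurable_fun setT rho)
  (mtau : measurable_fun setT tau) (mg1 : measurable_fun setT g1)
  (mg2 : measurable_fun setT g2).
Hypotheses (rho0 : forall x, (0 <= rho x)%R) (tau0 : forall x, (0 <= tau x)%R)
  (g10 : forall x, (0 <= g1 x)%R) (g20 : forall x, (0 <= g2 x)%R).
Hypothesis rhoE : forall f, measurable_fun setT f -> (forall x, 0 <= f x) ->
  \int[mu]_x f x = \int[lam]_y (f (Phi y) * (rho y)%:E).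
Hypothesis tauE : forall f, measurable_fun setT f -> (forall x, 0 <= f x) ->
  \int[lam]_y (f (Phi y) * (tau y)%:E) <= \int[nu]_x f x.
Hypothesis rhotau : forall y, (rho y <= tau y * expR (g1 y - g2 y))%R.
Hypothesis k1E : \int[lam]_y ((g1 y)%:E * (rho y)%:E) = k1%:E.
Hypothesis k2E : \int[lam]_y ((g2 y)%:E * (rho y)%:E) = k2%:E.

Let mM (f : S -> \bar R) (g : S -> R) : measurable_fun setT f -> measurable_fun setT g ->
  measurable_fun setT (fun y => f y * (g y)%:E).
Proof. by move=> mf mg; apply: emeasurable_funM => //; exact/measurable_EFinP. Qed.

(** On the preimage of a [nu]-null set [tau] vanishes almost everywhere, hence so does [rho], which
    is at most a multiple of it. *)
Lemma dominates_change_of_variables : mu `<< nu.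
Proof.
apply/null_content_dominatesP => A mA nuA.
have mI : measurable_fun setT (fun x => (\1_A x)%:E : \bar R) by exact/measurable_EFinP.
have I0 x : 0 <= (\1_A x)%:E :> \bar R by rewrite lee_fin.
have mIP : measurable_fun setT (fun y => (\1_A (Phi y))%:E : \bar R).
  exact: (measurableT_comp mI mPhi).
have tauA : \int[lam]_y `| (\1_A (Phi y))%:E * (tau y)%:E | = 0.
  apply/eqP; rewrite eq_le integral_ge0// andbT.
  under eq_integral do rewrite gee0_abs ?mule_ge0 ?lee_fin//.
  apply: (le_trans (tauE mI I0)).
  by rewrite integral_indic// setIT nuA.
have -> : mu A = \int[mu]_x (\1_A x)%:E by rewrite integral_indic// setIT.
rewrite (rhoE mI I0); apply/eqP; rewrite eq_le; apply/andP; split; last first.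
  by apply: integral_ge0 => y _; rewrite mule_ge0// lee_fin.
rewrite -[leRHS](integral0 lam setT).
apply: ae_ge0_le_integral => //.
- by move=> y _; rewrite mule_ge0// lee_fin.
- exact: mM.
have /(ae_eq_integral_abs _ _ (mM mIP mtau)) := tauA => /(_ measurableT).
apply: filterS => y /(_ I) /=; rewrite -!EFinM => -[t0] _.
rewrite lee_fin; apply: (@le_trans _ _ (\1_A (Phi y) * (tau y * expR (g1 y - g2 y))))%R.
  by rewrite ler_wpM2l.
by rewrite mulrA t0 mul0r.
Qed.

(** Integrate [mul_ln_le] with [psi = w (Phi y)]. The term [rho * ln psi] gives the divergence,
    [rho] gives 1, and [psi * tau] is at most the integral of [w] against [nu], again 1. The
    exponent comes as a difference [g1 - g2] of nonnegative functions, so that nothing is subtracted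
    under an integral. *)
Lemma KL_div_le_change_of_variables : KL_div mu nu <= (k1 - k2)%:E.
Proof.
have [w [mw w0 wE ->]] := KL_div_density dominates_change_of_variables.
pose lp x := Num.max (ln (w x)) 0%R.
(* the value [+oo] at [w x = 0], a mu-null set, makes the pointwise bound hold there *)
pose ln0 x := if w x == 0%R then +oo else (Num.max (- ln (w x)) 0%R)%:E.
have mlnw : measurable_fun setT (fun x => ln (w x)).
  by apply: measurableT_comp => //; exact: measurable_ln.
have mlp : measurable_fun setT lp by exact: measurable_maxr.
have mlpE : measurable_fun setT (EFin \o lp) by exact/measurable_EFinP.
have mln0 : measurable_fun setT ln0.
  apply: measurable_fun_if => //.
  - exact: measurable_fun_eqr.
  - apply: measurable_funTS; apply/measurable_EFinP; apply: measurable_maxr => //.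
    exact: measurable_funN.
have lp0 x : (0 <= lp x)%R by rewrite /lp le_max lexx orbT.
have ln00 x : 0 <= ln0 x.
  by rewrite /ln0; case: ifP => // _; rewrite lee_fin le_max lexx orbT.
pose A := \int[mu]_x (lp x)%:E; pose B := \int[mu]_x ln0 x.
have KLE : \int[nu]_x (w x * ln (w x))%:E = A - B.
  rewrite integralE; congr (_ - _).
    rewrite /A wE//; apply: eq_integral => x _; rewrite funeposE -EFin_max; congr EFin.
    by rewrite /lp maxr_pMl// mul0r mulrC.
  rewrite /B wE//; apply: eq_integral => x _; rewrite funenegE -EFinN -EFin_max.
  rewrite /ln0; case: eqVneq => [->|wx]; first by rewrite mule0 mul0r oppr0 maxxx.
  by rewrite -EFinM; congr EFin; rewrite maxr_pMl// mul0r mulNr mulrC.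
(* The negative part of the entropy is always finite, because [w * (- ln w) <= 1]; hence [A - B]
   makes sense even if [A] is infinite. *)
have B1 : B <= 1.
  have -> : 1 = \int[nu]_x (cst 1 x).
    by rewrite integral_cst// mul1e; apply/esym; exact: (@probability_setT _ _ _ nu).
  rewrite /B wE//; apply: ge0_le_integral => //.
  - by move=> x _; rewrite mule_ge0// lee_fin.
  - by apply: emeasurable_funM => //; exact/measurable_EFinP.
  move=> x _; rewrite /ln0; case: eqVneq => [->|wx]; first by rewrite mule0.
  have wx0 : (0 < w x)%R by rewrite lt_neqAle eq_sym wx w0.
  rewrite -EFinM lee_fin maxr_pMl// mul0r ge_max ler01 andbT.
  rewrite -lnV ?posrE//.
  have : (ln (w x)^-1 <= (w x)^-1)%R by rewrite ltW// ln_sublinear// invr_gt0.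
  move=> /(ler_wpM2r (w0 x)) /le_trans; apply.
  by rewrite mulVf.
have B0 : 0 <= B by exact: integral_ge0.
have Bfin : B \is a fin_num by rewrite ge0_fin_numE// (le_lt_trans B1) ?ltry.
have mr : measurable_fun setT (EFin \o rho) by exact/measurable_EFinP.
have rho1 : \int[lam]_y (rho y)%:E = 1.
  have := rhoE (@measurable_cst _ _ T (\bar R) setT 1) (fun=> lee01).
  rewrite integral_cst// mul1e => h.
  have -> : \int[lam]_y (rho y)%:E = \int[lam]_y (cst 1 (Phi y) * (rho y)%:E).
    by apply: eq_integral => y _; rewrite mul1e.
  by rewrite -h; exact: (@probability_setT _ _ _ mu).
have w1 : \int[nu]_x (w x)%:E = 1.
  have := wE (cst 1) (@measurable_cst _ _ T (\bar R) setT 1) (fun=> lee01).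
  rewrite integral_cst// mul1e => h.
  have -> : \int[nu]_x (w x)%:E = \int[nu]_x (cst 1 x * (w x)%:E).
    by apply: eq_integral => y _; rewrite mul1e.
  by rewrite -h; exact: (@probability_setT _ _ _ mu).
have mlpP : measurable_fun setT (fun y => (lp (Phi y))%:E) by exact: (measurableT_comp mlpE mPhi).
have mlnP : measurable_fun setT (fun y => ln0 (Phi y)) by exact: (measurableT_comp mln0 mPhi).
have mwP : measurable_fun setT (fun y => (w (Phi y))%:E).
  by apply/measurable_EFinP; exact: (measurableT_comp mw mPhi).
have mg1E : measurable_fun setT (EFin \o g1) by exact/measurable_EFinP.
have mg2E : measurable_fun setT (EFin \o g2) by exact/measurable_EFinP.
have AE : A = \int[lam]_y ((lp (Phi y))%:E * (rho y)%:E).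
  by rewrite /A (rhoE mlpE) // => x; rewrite lee_fin.
have BE : B = \int[lam]_y (ln0 (Phi y) * (rho y)%:E) by rewrite /B (rhoE mln0).
(* The variational bound with every negative term moved to the other side. *)
have main : A + 1 + k2%:E <= B + k1%:E + 1.
  apply: (@le_trans _ _ (B + k1%:E + \int[lam]_y ((w (Phi y))%:E * (tau y)%:E))); last first.
    rewrite leeD2l// -w1; apply: (tauE (f := EFin \o w)); last by move=> x; rewrite lee_fin.
    exact/measurable_EFinP.
  rewrite AE BE -rho1 -k1E -k2E.
  have nn (f : S -> \bar R) (g : S -> R) : (forall y, 0 <= f y) -> (forall y, (0 <= g y)%R) ->
      forall y, setT y -> 0 <= f y * (g y)%:E.
    by move=> f0 gg0 y _; rewrite mule_ge0// lee_fin.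
  have nE (f : S -> R) : (forall y, (0 <= f y)%R) -> forall y, 0 <= (f y)%:E.
    by move=> f0 y; rewrite lee_fin.
  have lpP0 y : 0 <= (lp (Phi y))%:E by rewrite lee_fin.
  have wP0 y : 0 <= (w (Phi y))%:E by rewrite lee_fin.
  rewrite -!ge0_integralD//; do ?[exact: mM | by apply: nn => // y; rewrite ?lee_fin |
    by move=> y _; rewrite ?adde_ge0 ?mule_ge0 ?lee_fin |
    by apply: emeasurable_funD => //; exact: mM].
  apply: ge0_le_integral => //.
  - by move=> y _; rewrite !adde_ge0 ?mule_ge0 ?lee_fin.
  - by apply: emeasurable_funD; [apply: emeasurable_funD => //|]; exact: mM.
  - by apply: emeasurable_funD; [apply: emeasurable_funD => //|]; exact: mM.
  move=> y _; rewrite /ln0; case: eqVneq => wy.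
    have [r0|r0] := eqVneq (rho y) 0%R.
      by rewrite r0 !mule0 !add0e mule_ge0 ?lee_fin.
    have r1 : (0 < rho y)%R by rewrite lt_neqAle eq_sym r0 rho0.
    by rewrite gt0_mulye ?lte_fin// -!EFinM !addye// leey.
  have wy0 : (0 < w (Phi y))%R by rewrite lt_neqAle eq_sym wy w0.
  rewrite -!EFinM -!EFinD lee_fin.
  have := mul_ln_le wy0 (rho0 y) (tau0 y) (rhotau y).
  rewrite /lp; set L := ln _.
  have -> : (Num.max L 0 = L + Num.max (- L) 0)%R by rewrite addr_maxr subrr addr0 maxC.
  by lra.
rewrite KLE leeBlDr//.
rewrite -(fineK Bfin) -!EFinD in main *.
move: main; generalize A => -[a||]//= main; last by rewrite leNye.
move: main; rewrite -!EFinD !lee_fin; lra.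
Qed.

End KL_upper_bound.

Section independent_sum.
Context d1 d2 (X : measurableType d1) (Y : measurableType d2) (R : realType).
Variables (m1 : {measure set X -> \bar R}) (m2 : {measure set Y -> \bar R}).
Variables (f r : X -> R) (g s : Y -> R) (a b : R).
Local Open Scope ereal_scope.
Hypotheses (mf : measurable_fun setT f) (mr : measurable_fun setT r)
  (mg : measurable_fun setT g) (ms : measurable_fun setT s).
Hypotheses (f0 : forall x, (0 <= f x)%R) (r0 : forall x, (0 <= r x)%R)
  (g0 : forall y, (0 <= g y)%R) (s0 : forall y, (0 <= s y)%R).
Hypotheses (r1 : \int[m1]_x (r x)%:E = 1) (s1 : \int[m2]_y (s y)%:E = 1).
Hypothesis fa : \int[m1]_x (f x * r x)%:E = a%:E.
Hypothesis gb : \int[m2]_y (g y * s y)%:E = b%:E.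

Let EZ d (Z : measurableType d) (m : {measure set Z -> \bar R}) (h : Z -> R) (c : R) :
  measurable_fun setT h -> (forall x, (0 <= h x)%R) -> (0 <= c)%R ->
  \int[m]_x (c * h x)%:E = c%:E * \int[m]_x (h x)%:E.
Proof.
move=> mh h0 c0; under eq_integral do rewrite EFinM.
by rewrite ge0_integralZl// => [|x _]; [exact/measurable_EFinP|rewrite lee_fin].
Qed.

Let ED d (Z : measurableType d) (m : {measure set Z -> \bar R}) (h k : Z -> R) :
  measurable_fun setT h -> measurable_fun setT k ->
  (forall x, (0 <= h x)%R) -> (forall x, (0 <= k x)%R) ->
  \int[m]_x (h x + k x)%:E = \int[m]_x (h x)%:E + \int[m]_x (k x)%:E.
Proof.
move=> mh mk h0 k0; under eq_integral do rewrite EFinD.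
by rewrite ge0_integralD//; try exact/measurable_EFinP; move=> x _; rewrite lee_fin.
Qed.

Lemma integral_indep_mul : \int[m1]_x \int[m2]_y (r x * s y)%:E = 1.
Proof. by rewrite -r1; apply: eq_integral => x _; rewrite EZ// s1 mule1. Qed.

Lemma integral_indep_sum :
  \int[m1]_x \int[m2]_y ((f x + g y) * (r x * s y))%:E = (a + b)%:E.
Proof.
have b0 : (0 <= b)%R.
  by rewrite -lee_fin -gb; apply: integral_ge0 => y _; rewrite lee_fin mulr_ge0.
transitivity (\int[m1]_x (f x * r x + b * r x)%:E).
  apply: eq_integral => x _.
  transitivity (\int[m2]_y ((f x * r x) * s y + r x * (g y * s y))%:E).
    by apply: eq_integral => y _; congr EFin; ring.
  rewrite ED//; first last.
  - by move=> y; rewrite !mulr_ge0.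
  - by move=> y; rewrite !mulr_ge0.
  - by apply: measurable_funM => //; exact: measurable_funM.
  - exact: measurable_funM.
  rewrite EZ ?mulr_ge0// EZ//; first last.
  - by move=> y; rewrite mulr_ge0.
  - exact: measurable_funM.
  by rewrite s1 gb mule1 -EFinM -EFinD [(r x * b)%R]mulrC.
rewrite ED//; first last.
- by move=> y; rewrite !mulr_ge0.
- by move=> y; rewrite !mulr_ge0.
- exact: measurable_funM.
- exact: measurable_funM.
by rewrite EZ// fa r1 mule1.
Qed.

End independent_sum.

Section log_ratio.
Context (R : realType).
Local Open Scope ereal_scope.

(** The constant part of a bound for the logarithm of [semicircle_pdf (n - 2)] once all but [k]
    factors [cocos] are divided out; the part quadratic in the coordinate is collected in [colG]. *)
Definition logcst (k n : nat) : R :=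
  (- ln (cocos_moment R 0 (n - 2)) + k%:R / 2 * (ln (n%:R / n.+1%:R) + n%:R^-1))%R.

Fixpoint colG (k p : nat) : p.-tuple R -> nat -> R :=
  match p with
  | 0%N => fun _ _ => 0%R
  | p'.+1 => fun t n =>
     (k%:R / 2 * (n.+1%:R / n%:R) * thead t ^+ 2 + colG k (tbehead t) n.-1)%R
  end.

Fixpoint blkG (k p q : nat) : q.-tuple (p.-tuple R) -> nat -> R :=
  match q with
  | 0%N => fun _ _ => 0%R
  | q'.+1 => fun B n => (colG k (thead B) n + blkG k (tbehead B) n.-1)%R
  end.

Lemma colG_ge0 k p (t : p.-tuple R) n : (0 <= colG k t n)%R.
Proof.
elim: p t n => //= p IH t n.
apply: addr_ge0 => //; apply: mulr_ge0; last exact: sqr_ge0.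
by apply: mulr_ge0; apply: divr_ge0.
Qed.

Lemma blkG_ge0 k p q (B : q.-tuple (p.-tuple R)) n : (0 <= blkG k B n)%R.
Proof. by elim: q B n => //= q IH B n; rewrite addr_ge0// colG_ge0. Qed.

Lemma measurable_colG k p n : measurable_fun setT (fun t : p.-tuple R => colG k t n).
Proof.
elim: p n => [|p IH] n; first exact: measurable_cst.
apply: measurable_funD.
  by apply: measurable_funM => //; apply: measurable_funX; exact: measurable_thead.
by apply: (measurableT_comp (IH n.-1)); exact: measurable_tbehead.
Qed.

Lemma measurable_blkG k p q n :
  measurable_fun setT (fun B : q.-tuple (p.-tuple R) => blkG k B n).
Proof.
elim: q n => [|q IH] n; first exact: measurable_cst.
apply: measurable_funD.
  pose f (t : p.-tuple R) := colG k t n.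
  have mf : measurable_fun setT f := @measurable_colG k p n.
  by apply: (measurableT_comp mf); exact: measurable_thead.
by apply: (measurableT_comp (IH n.-1)); exact: measurable_tbehead.
Qed.

(* [n / n.+1] is the mean of [1 - b ^+ 2]: the tangent of [ln] at this point makes
   the estimate sharp to first order. *)
Lemma cocos_exp_le (k n : nat) (b : R) : (0 < n)%N -> (`|b| <= 1)%R ->
  (cocos b ^+ k <= expR (k%:R / 2 * (ln (n%:R / n.+1%:R) + n%:R^-1)
    - k%:R / 2 * (n.+1%:R / n%:R) * b ^+ 2))%R.
Proof.
move=> n_gt0 b1; have n0 : (0 < n%:R :> R)%R by rewrite ltr0n.
have n10 : (0 < n.+1%:R :> R)%R by rewrite ltr0n.
set L := (ln (n%:R / n.+1%:R) + n%:R^-1 - n.+1%:R / n%:R * b ^+ 2)%R.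
have -> : (k%:R / 2 * (ln (n%:R / n.+1%:R) + n%:R^-1) -
    k%:R / 2 * (n.+1%:R / n%:R) * b ^+ 2 = k%:R * (L / 2))%R by rewrite /L; ring.
rewrite expRM_natl; apply: lerXn2r; rewrite ?nnegrE ?cocos_ge0 ?expR_ge0//.
rewrite -(@ler_pXn2r _ 2) ?nnegrE ?cocos_ge0 ?expR_ge0// sqr_cocos//.
rewrite -expRM_natl (_ : 2%:R * (L / 2) = L)%R; last by field.
rewrite /L -addrA expRD lnK ?posrE ?divr_gt0//.
have : (n%:R / n.+1%:R * (1 + (n%:R^-1 - n.+1%:R / n%:R * b ^+ 2)) <=
        n%:R / n.+1%:R * expR (n%:R^-1 - n.+1%:R / n%:R * b ^+ 2) :> R)%R.
  by rewrite ler_wpM2l ?expR_ge1Dx// divr_ge0// ltW.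
apply: le_trans; rewrite le_eqVlt; apply/orP; left; apply/eqP.
by rewrite -natr1; field; rewrite natr1 !gt_eqF.
Qed.

(** The exponent [n - 2] equals [p + q + k]: the power [p + q] is the Jacobian weight, and [k]
    factors are left for the exponential estimate. Along the recursion size and Jacobian power drop
    together, so [k] is the same at every coordinate. *)
Lemma semicircle_pdf_le (k p q n : nat) (b : R) : n = (k + p.+1 + q).+1 ->
  (semicircle_pdf (n - 2) b <= (if `|b| < 1 then cocos b ^+ (p + q) else 0) *
    expR (logcst k n - k%:R / 2 * (n.+1%:R / n%:R) * b ^+ 2))%R.
Proof.
move=> nE; rewrite /semicircle_pdf; case: ifPn => b1; last by rewrite mul0r.
have n0 : (0 < n)%N by rewrite nE.
have Z0 := cocos_moment_gt0 R (n - 2).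
have nE2 : (n - 2 = (p + q) + k)%N by rewrite nE; lia.
rewrite {1}nE2 exprD -mulrA ler_wpM2l ?exprn_ge0 ?cocos_ge0//.
rewrite /logcst -addrA expRD -lnV ?posrE// lnK ?posrE ?invr_gt0// mulrC.
rewrite ler_pM2l ?invr_gt0//.
by apply: cocos_exp_le => //; exact: ltW.
Qed.

Lemma colpdf_le (k p q n : nat) (t : p.-tuple R) : n = (k + p + q).+1 ->
  (colpdf t n <= jacw t q * expR (\sum_(i < p) logcst k (n - i) - colG k t n))%R.
Proof.
elim: p n t => [|p IH] n t nE /=; first by rewrite big_ord0 subr0 expR0 mul1r.
rewrite big_ord_recl subn0.
have -> : (\sum_(i < p) logcst k (n - lift ord0 i) = \sum_(i < p) logcst k (n.-1 - i))%R.
  by apply: eq_bigr => i _; congr logcst; rewrite lift0; lia.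
rewrite opprD addrACA expRD mulrACA.
apply: ler_pM; [exact: semicircle_pdf_ge0|exact: colpdf_ge0|exact: semicircle_pdf_le|].
by apply: IH; rewrite nE; lia.
Qed.

Lemma blkpdf_le (k p q n : nat) (B : q.-tuple (p.-tuple R)) : n = (k + p + q)%N ->
  (blkpdf B n <= blkjac B *
    expR (\sum_(j < q) \sum_(i < p) logcst k (n - j - i) - blkG k B n))%R.
Proof.
elim: q n B => [|q IH] n B nE /=; first by rewrite big_ord0 subr0 expR0 mul1r.
rewrite big_ord_recl subn0.
have -> : (\sum_(j < q) \sum_(i < p) logcst k (n - lift ord0 j - i) =
    \sum_(j < q) \sum_(i < p) logcst k (n.-1 - j - i))%R.
  by apply: eq_bigr => j _; apply: eq_bigr => i _; congr logcst; rewrite lift0; lia.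
rewrite opprD addrACA expRD mulrACA.
apply: ler_pM; [exact: colpdf_ge0|exact: blkpdf_ge0|apply: colpdf_le|apply: IH];
  by rewrite nE; lia.
Qed.

Lemma integral_semicircle_pdf1 k : \int[@lebR R]_b (semicircle_pdf k b)%:E = 1.
Proof.
rewrite ge0_integral_lebR; last by move=> x; rewrite lee_fin semicircle_pdf_ge0.
  have := integral_semicircle_pdf R k 0; under eq_integral do rewrite expr0 mul1r.
  by move=> ->; rewrite divff// gt_eqF// cocos_moment_gt0.
by apply/measurable_EFinP; exact: measurable_semicircle_pdf.
Qed.

Lemma integral_semicircle_pdf_sqr k :
  \int[@lebR R]_b (b ^+ 2 * semicircle_pdf k b)%:E = (k.+3%:R^-1)%:E.
Proof.
rewrite ge0_integral_lebR; last by move=> x; rewrite lee_fin mulr_ge0 ?sqr_ge0 ?semicircle_pdf_ge0.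
  rewrite integral_semicircle_pdf; congr EFin.
  have := cocos_moment_rec R 1 k; rewrite mul1r [cocos_moment R 1.-1 k]/= => ->.
  have : (cocos_moment R 2 k != 0)%R.
    apply: contraTneq (cocos_moment_gt0 R k) => M0.
    have := cocos_moment_rec R 1 k; rewrite mul1r [cocos_moment R 1.-1 k]/= M0 mulr0 => ->.
    by rewrite ltxx.
  move=> M0; rewrite invfM mulrCA divff// mulr1; congr (_ %:R^-1)%R; lia.
apply/measurable_EFinP; apply: measurable_funM; first exact: measurable_funX.
exact: measurable_semicircle_pdf.
Qed.

Lemma integral_colpdf p n : \int[@lebt R p]_t (colpdf t n)%:E = 1.
Proof.
elim: p n => [|p IH] n.
  rewrite ge0_integral_powm0//; apply/measurable_EFinP; exact: (@measurable_colpdf R 0 n).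
rewrite ge0_integral_powmS; last by move=> t; rewrite lee_fin colpdf_ge0.
  rewrite -[RHS](integral_indep_mul
    (@measurable_colpdf R p n.-1) (@semicircle_pdf_ge0 R (n - 2))
    (fun t => colpdf_ge0 t n.-1) (integral_semicircle_pdf1 (n - 2)) (IH n.-1)).
  apply: eq_integral => b _; apply: eq_integral => t _ /=.
  by rewrite thead_tcons tbehead_tcons.
by apply/measurable_EFinP; exact: measurable_colpdf.
Qed.

Lemma integral_blkpdf p q n : \int[@lebtt R p q]_B (blkpdf B n)%:E = 1.
Proof.
elim: q n => [|q IH] n.
  rewrite ge0_integral_powm0//; apply/measurable_EFinP; exact: (@measurable_blkpdf R p 0 n).
rewrite ge0_integral_powmS; last by move=> t; rewrite lee_fin blkpdf_ge0.
  rewrite -[RHS](integral_indep_mul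
    (@measurable_blkpdf R p q n.-1) (fun t => colpdf_ge0 t n)
    (fun t => blkpdf_ge0 t n.-1) (integral_colpdf p n) (IH n.-1)).
  apply: eq_integral => b _; apply: eq_integral => t _ /=.
  by rewrite thead_tcons tbehead_tcons.
by apply/measurable_EFinP; exact: measurable_blkpdf.
Qed.

(** The square of a coordinate has mean [n.+1%:R^-1], so each term contributes [k / (2 * n)], the
    amount that [logcst] adds to the tangent of the logarithm. *)
Lemma integral_colG k p n : (p < n)%N ->
  \int[@lebt R p]_t (colG k t n * colpdf t n)%:E =
  (\sum_(i < p) k%:R / 2 / (n - i)%:R)%:E.
Proof.
elim: p n => [|p IH] n pn.
  rewrite ge0_integral_powm0 ?big_ord0 ?mul0r//; apply/measurable_EFinP.
  by apply: measurable_funM; [exact: measurable_colG|exact: measurable_colpdf].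
have n0 : (0 < n%:R :> R)%R by rewrite ltr0n; exact: leq_ltn_trans pn.
have c0 : (0 <= k%:R / 2 * (n.+1%:R / n%:R) :> R)%R by rewrite !mulr_ge0 ?invr_ge0.
rewrite ge0_integral_powmS; last first.
- by move=> t; rewrite lee_fin mulr_ge0 ?colG_ge0 ?colpdf_ge0.
- apply/measurable_EFinP; apply: measurable_funM; first exact: measurable_colG.
  exact: measurable_colpdf.
have fa : \int[@lebR R]_b ((k%:R / 2 * (n.+1%:R / n%:R) * b ^+ 2) *
    semicircle_pdf (n - 2) b)%:E = (k%:R / 2 / n%:R)%:E.
  under eq_integral do rewrite -mulrA EFinM.
  rewrite ge0_integralZl//; first last.
  - by move=> b _; rewrite lee_fin mulr_ge0 ?sqr_ge0 ?semicircle_pdf_ge0.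
  - apply/measurable_EFinP; apply: measurable_funM; first exact: measurable_funX.
    exact: measurable_semicircle_pdf.
  rewrite integral_semicircle_pdf_sqr -EFinM; congr EFin.
  have -> : (n - 2).+3 = n.+1 by lia.
  by rewrite [(n.+1%:R / _)%R]mulrC mulrA mulfK// pnatr_eq0.
have pn1 : (p < n.-1)%N by lia.
have mf : measurable_fun setT (fun b : R => k%:R / 2 * (n.+1%:R / n%:R) * b ^+ 2)%R.
  by apply: measurable_funM => //; exact: measurable_funX.
have f0 (b : R) : (0 <= k%:R / 2 * (n.+1%:R / n%:R) * b ^+ 2)%R.
  by rewrite mulr_ge0// sqr_ge0.
rewrite big_ord_recl subn0.
have -> : (\sum_(i < p) k%:R / 2 / (n - lift ord0 i)%:R =
    \sum_(i < p) k%:R / 2 / (n.-1 - i)%:R :> R)%R.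
  by apply: eq_bigr => i _; congr (_ / _%:R)%R; rewrite lift0; lia.
rewrite -(integral_indep_sum mf (@measurable_semicircle_pdf R (n - 2))
  (@measurable_colG k p n.-1) (@measurable_colpdf R p n.-1) f0 (@semicircle_pdf_ge0 R (n - 2))
  (fun t => colG_ge0 k t n.-1) (fun t => colpdf_ge0 t n.-1)
  (integral_semicircle_pdf1 (n - 2)) (integral_colpdf p n.-1) fa (IH n.-1 pn1)).
apply: eq_integral => b _; apply: eq_integral => t _ /=.
by rewrite thead_tcons tbehead_tcons.
Qed.

Lemma integral_blkG k p q n : (p + q <= n)%N ->
  \int[@lebtt R p q]_B ((blkG k B n)%:E * (blkpdf B n)%:E) =
  (\sum_(j < q) \sum_(i < p) k%:R / 2 / (n - j - i)%:R)%:E.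
Proof.
under eq_integral do rewrite -EFinM.
elim: q n => [|q IH] n pn.
  rewrite ge0_integral_powm0 ?big_ord0 ?mul0r//; apply/measurable_EFinP.
  by apply: measurable_funM; [exact: measurable_blkG|exact: measurable_blkpdf].
rewrite ge0_integral_powmS; last first.
- by move=> t; rewrite lee_fin mulr_ge0 ?blkG_ge0 ?blkpdf_ge0.
- apply/measurable_EFinP; apply: measurable_funM; first exact: measurable_blkG.
  exact: measurable_blkpdf.
have pn0 : (p < n)%N by lia.
have pn1 : (p + q <= n.-1)%N by lia.
rewrite big_ord_recl subn0.
have -> : (\sum_(j < q) \sum_(i < p) k%:R / 2 / (n - lift ord0 j - i)%:R =
    \sum_(j < q) \sum_(i < p) k%:R / 2 / (n.-1 - j - i)%:R :> R)%R.
  by apply: eq_bigr => j _; apply: eq_bigr => i _; congr (_ / _%:R)%R; rewrite lift0; lia.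
rewrite -(integral_indep_sum (@measurable_colG k p n) (@measurable_colpdf R p n)
  (@measurable_blkG k p q n.-1) (@measurable_blkpdf R p q n.-1) (fun t => colG_ge0 k t n)
  (fun t => colpdf_ge0 t n) (fun t => blkG_ge0 k t n.-1) (fun t => blkpdf_ge0 t n.-1)
  (integral_colpdf p n) (integral_blkpdf p q n.-1) (integral_colG k pn0) (IH n.-1 pn1)).
apply: eq_integral => b _; apply: eq_integral => t _ /=.
by rewrite thead_tcons tbehead_tcons.
Qed.

End log_ratio.

Section powm_product.
Context d (T : measurableType d) (R : realType).

Lemma powm_rect (m : {sigma_finite_measure set T -> \bar R}) n (A : 'I_n -> set T) :
  (forall i, measurable (A i)) ->
  powm m n [set t | forall i, A i (tnth t i)] = (\big[*%E/1%E]_(i < n) m (A i))%E.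
Proof.
elim: n A => [|n IH] A mA.
  rewrite big_ord0 /= diracE mem_set// => i; by case: i.
rewrite big_ord_recl -IH; last by move=> i; exact: mA.
have mB : measurable [set t : n.-tuple T | forall i, A (lift ord0 i) (tnth t i)].
  rewrite (_ : [set _ | _] = \bigcap_(i in setT)
      ((fun t : n.-tuple T => tnth t i) @^-1` A (lift ord0 i))); last first.
    by apply/seteqP; split => [t tA i _|t tA i]; [exact: tA|exact: (tA i I)].
  apply: fin_bigcap_measurable => // i _.
  by rewrite -[X in measurable X]setTI; exact: measurable_tnth.
rewrite -(product_measure1E m (powm m n))//=; congr ((m \x powm m n)%E _).
apply/seteqP; split => [[x t] /= tA|[x t] [/= xA tA] i].
  split=> [|i]; first by have := tA ord0; rewrite tnth_tcons0.
  by have := tA (lift ord0 i); rewrite tnth_tconsS.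
by case: (unliftP ord0 i) => [i'|] ->; rewrite ?tnth_tconsS ?tnth_tcons0//; exact: tA.
Qed.

Lemma ge0_integral_powm_density (m1 m2 : {sigma_finite_measure set T -> \bar R})
    (phi : T -> T) (g : T -> R) : measurable_fun setT phi -> measurable_fun setT g ->
  (forall x, 0 <= g x) ->
  (forall f : T -> \bar R, measurable_fun setT f -> (forall x, 0 <= f x)%E ->
    (\int[m1]_x f x = \int[m2]_x (f (phi x) * (g x)%:E))%E) ->
  forall n (f : n.-tuple T -> \bar R), measurable_fun setT f -> (forall x, 0 <= f x)%E ->
    (\int[powm m1 n]_z f z =
     \int[powm m2 n]_z (f (map_tuple phi z) * (\prod_(i < n) g (tnth z i))%:E))%E.
Proof.
move=> mphi mg g0 phiE; elim=> [|n IH] f mf f0.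
  rewrite !ge0_integral_powm0//.
    by rewrite big_ord0 mule1; congr f; apply/val_inj.
  apply: emeasurable_funM; first by apply: (measurableT_comp mf); exact: measurable_tmap.
  by apply: (@eq_measurable_fun _ _ _ _ _ (cst 1%E)) => // z _; rewrite big_ord0.
have mprod k : measurable_fun setT (fun z : k.-tuple T => \prod_(i < k) g (tnth z i)).
  apply: measurable_prod => i _; apply: (measurableT_comp mg); exact: measurable_tnth.
have prod0 k (z : k.-tuple T) : 0 <= \prod_(i < k) g (tnth z i) by exact: prodr_ge0.
rewrite !ge0_integral_powmS//; last first.
- by move=> z; rewrite mule_ge0// lee_fin.
- apply: emeasurable_funM; last by apply/measurable_EFinP; exact: mprod.
  by apply: (measurableT_comp mf); exact: measurable_tmap.
rewrite phiE; first last.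
- by move=> x; exact: integral_ge0.
- apply: measurable_integral_fst => //.
  by apply: (measurableT_comp mf); exact: measurable_tcons.
apply: eq_integral => x _.
have mfx : measurable_fun setT (fun y => f (tcons (phi x, y))).
  by apply: (measurableT_comp mf); exact: measurable_tcons2.
rewrite (IH _ mfx)// -ge0_integralZr//; first last.
- by rewrite lee_fin.
- by move=> z _; rewrite mule_ge0// lee_fin.
- apply: emeasurable_funM; last by apply/measurable_EFinP; exact: mprod.
  by apply: (measurableT_comp mfx); exact: measurable_tmap.
apply: eq_integral => z _; rewrite big_ord_recl tnth_tcons0 -muleA -EFinM mulrC.
congr (f _ * _%:E)%E; first exact/val_inj.
by congr (_ * _); apply: eq_bigr => i _; rewrite tnth_tconsS.
Qed.

End powm_product.

Section gaussian_block.
Context (R : realType).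
Local Open Scope ereal_scope.

Let measurable_idR : measurable_fun setT (idfun : measurableTypeR R -> R).
Proof. exact: measurable_id. Qed.

Definition gaussR : probability R R := image_probability measurable_idR (normal_prob 0 1).

(** The density of a standard normal variable divided by [s]; with [s ^+ 2] the matrix size this
    brings the Gaussian entries to the scale of the unscaled block. *)
Definition scaled_pdf (s z : R) : R := (s * normal_pdf 0 1 (s * z))%R.

Lemma scaled_pdf_ge0 s z : (0 < s)%R -> (0 <= scaled_pdf s z)%R.
Proof. by move=> s0; rewrite mulr_ge0 ?ltW// std_normal_pdf_gt0. Qed.

Lemma measurable_scaled_pdf s : measurable_fun setT (scaled_pdf s).
Proof.
apply: measurable_funM => //; apply: measurableT_comp; first exact: measurable_normal_pdf.
exact: measurable_funM.
Qed.

Lemma scaled_pdfE s z : (0 < s)%R ->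
  scaled_pdf s z = expR (ln (s ^+ 2 / (2 * pi)) / 2 - s ^+ 2 / 2 * z ^+ 2).
Proof.
move=> s0; have p0 : (0 < 2 * pi :> R)%R by rewrite mulr_gt0// pi_gt0.
rewrite /scaled_pdf std_normal_pdfE mulrA expRD; congr (_ * expR _)%R; last by field.
rewrite /normal_peak expr1n mul1r -mulr_natl.
rewrite -[LHS]lnK ?posrE ?mulr_gt0 ?invr_gt0 ?sqrtr_gt0//; congr expR.
rewrite -[in RHS](@sqr_sqrtr _ (2 * pi)) ?ltW// -expr_div_n lnXn ?divr_gt0 ?sqrtr_gt0//.
by rewrite -[(ln _ *+ 2)%R]mulr_natr mulfK// pnatr_eq0.
Qed.

Lemma ge0_integral_gaussR (s : R) (f : R -> \bar R) : (0 < s)%R ->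
  measurable_fun setT f -> (forall x, 0 <= f x) ->
  \int[gaussR]_x f x = \int[@lebR R]_z (f (s * z)%R * (scaled_pdf s z)%:E).
Proof.
move=> s0 mf f0.
have mp : measurable_fun setT (fun x : R => (s * normal_pdf 0 1 x)%:E : \bar R).
  apply/measurable_EFinP; apply: measurable_funM => //; exact: measurable_normal_pdf.
have p0 (x : R) : (0 <= s * normal_pdf 0 1 x)%R by rewrite mulr_ge0 ?ltW// std_normal_pdf_gt0.
pose F (x : R) := f x * (s * normal_pdf 0 1 x)%:E.
have mF : measurable_fun setT F by exact: emeasurable_funM.
have F0 x : 0 <= F x by rewrite mule_ge0// lee_fin.
transitivity (\int[@lebR R]_z F (0 + s * z)%R); last first.
  by apply: eq_integral => z _; rewrite /F add0r.
rewrite (ge0_integral_lebR_affine _ s0 mF F0) -ge0_integralZl//; last first.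
  by rewrite lee_fin invr_ge0 ltW.
rewrite (@ge0_integral_map _ _ _ _ _ _ (normal_prob 0 1) gaussR measurable_idR)//.
rewrite (ge0_integral_normal mf)// ge0_integral_lebR; last first.
- by move=> x; rewrite mule_ge0// lee_fin invr_ge0 ltW.
- by apply: emeasurable_funM.
by apply: eq_integral => z _; rewrite /F muleCA -EFinM mulKf// gt_eqF.
Qed.

Definition gausstt p q : {sigma_finite_measure set (q.-tuple (p.-tuple R)) -> \bar R} :=
  powm (powm gaussR p) q.

Lemma gausstt_setT p q : gausstt p q setT = 1.
Proof.
have powT d (T : measurableType d) (m : {sigma_finite_measure set T -> \bar R}) n :
    m setT = 1 -> powm m n setT = 1.
  move=> m1; rewrite (_ : setT = [set t : n.-tuple T | forall i, setT (tnth t i)]).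
    by rewrite (powm_rect m (A := fun=> setT))// big1.
  by apply/seteqP; split.
by apply: (powT); apply: (powT); exact: (@probability_setT _ _ _ gaussR).
Qed.

Section flatten.
Variables p q : nat.

Let flat_col_subproof (k : 'I_(p * q)) : (k %% q < q)%N.
Proof. by rewrite ltn_mod; case: q k => [|//]; rewrite muln0 => -[]. Qed.

Let flat_row_subproof (k : 'I_(p * q)) : (k %/ q < p)%N.
Proof.
by rewrite ltn_divLR ?ltn_ord//; case: q k => [|//]; rewrite muln0 => -[].
Qed.

Definition flat_col (k : 'I_(p * q)) : 'I_q := Ordinal (flat_col_subproof k).
Definition flat_row (k : 'I_(p * q)) : 'I_p := Ordinal (flat_row_subproof k).

(* The columns of the block are the entries of [B]; the laws of the theorem are row-major. *)
Definition flat (B : q.-tuple (p.-tuple R)) : (p * q).-tuple R :=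
  [tuple tnth (tnth B (flat_col k)) (flat_row k) | k < p * q].

Let flat_index_subproof (i : 'I_p) (j : 'I_q) : (i * q + j < p * q)%N.
Proof.
apply: (@leq_trans (i.+1 * q)); last by rewrite leq_mul2r ltn_ord orbT.
by rewrite mulSn addnC ltn_add2r.
Qed.

Definition flat_index (i : 'I_p) (j : 'I_q) : 'I_(p * q) := Ordinal (flat_index_subproof i j).

Lemma flat_indexK i j : flat_row (flat_index i j) = i /\ flat_col (flat_index i j) = j.
Proof.
have q0 : (0 < q)%N by exact: leq_ltn_trans (ltn_ord j).
by split; apply/val_inj => /=; rewrite ?modnMDl ?modn_small// divnMDl// divn_small ?addn0.
Qed.

Lemma flat_row_colK k : flat_index (flat_row k) (flat_col k) = k.
Proof. by apply/val_inj; rewrite /= -divn_eq. Qed.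

Lemma measurable_flat : measurable_fun setT flat.
Proof.
apply/measurable_fun_tnthP => k.
apply: (@eq_measurable_fun _ _ _ _ _
  (fun B : q.-tuple (p.-tuple R) => tnth (tnth B (flat_col k)) (flat_row k))).
  by move=> z _ /=; rewrite tnth_mktuple.
by apply: (measurableT_comp (@measurable_tnth _ R p _)); exact: measurable_tnth.
Qed.

Definition flat_law : set ((p * q).-tuple R) -> \bar R :=
  image_measure (gausstt p q) measurable_flat.

HB.instance Definition _ := Measure.copy flat_law (image_measure (gausstt p q) measurable_flat).

Let flat_law_setT : flat_law setT = 1.
Proof. by rewrite /flat_law /image_measure preimage_setT; exact: gausstt_setT. Qed.

HB.instance Definition _ := Measure_isProbability.Build _ _ _ flat_law flat_law_setT.

Lemma gaussian_flat (nu : probability ((p * q).-tuple R) R) : is_std_gaussian nu ->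
  forall A, measurable A -> nu A = gausstt p q (flat @^-1` A).
Proof.
move=> Hnu A mA; apply: (@tuple_measure_unique _ _ _ _ nu flat_law) => // {A mA}.
move=> A mA; rewrite Hnu//.
pose C i j := A (flat_index i j).
have mD j : measurable [set t : p.-tuple R | forall i, C i j (tnth t i)].
  rewrite (_ : [set _ | _] = \bigcap_(i in setT)
      ((fun t : p.-tuple R => tnth t i) @^-1` C i j)); last first.
    by apply/seteqP; split => [t tA i _|t tA i]; [exact: tA|exact: (tA i I)].
  apply: fin_bigcap_measurable => // i _.
  by rewrite -[X in measurable X]setTI; apply: measurable_tnth => //; exact: mA.
have fE : gausstt p q (flat @^-1` [set t | forall i, A i (tnth t i)]) =
    powm (powm gaussR p) q [set B | forall j, [set t : p.-tuple R |
      forall i, C i j (tnth t i)] (tnth B j)].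
  rewrite /gausstt; congr (powm (powm gaussR p) q _).
  apply/seteqP; split => B /= BA => [j i|k].
    by have := BA (flat_index i j); rewrite tnth_mktuple (flat_indexK i j).1 (flat_indexK i j).2.
  by rewrite tnth_mktuple -{1}[k]flat_row_colK; exact: BA.
apply: etrans; last exact: (esym fE).
rewrite (powm_rect (powm gaussR p) mD).
transitivity (\prod_(j < q) \prod_(i < p) gaussR (C i j)); last first.
  apply: eq_bigr => j _; apply/esym.
  by apply: (powm_rect gaussR (A := fun i => C i j)) => i; exact: mA.
rewrite pair_bigA/= (reindex (fun ji : 'I_q * 'I_p => flat_index ji.2 ji.1))//=.
exists (fun k => (flat_col k, flat_row k)) => [[j i] _|k _] /=; last exact: flat_row_colK.
by have [-> ->] := flat_indexK i j.
Qed.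

Lemma ge0_integral_gaussian_flat (nu : probability ((p * q).-tuple R) R) (s : R)
    (f : (p * q).-tuple R -> \bar R) : is_std_gaussian nu -> (0 < s)%R ->
  measurable_fun setT f -> (forall x, 0 <= f x) ->
  \int[nu]_x f x = \int[@lebtt R p q]_B
    (f (flat (map_tuple (map_tuple ( *%R s)) B)) *
     (\prod_(j < q) \prod_(i < p) scaled_pdf s (tnth (tnth B j) i))%:E).
Proof.
move=> Hnu s0 mf f0.
have mff : measurable_fun setT (fun B => f (flat B)).
  exact: (measurableT_comp mf measurable_flat).
rewrite (@ge0_integral_map _ _ _ _ _ flat (gausstt p q) nu measurable_flat (gaussian_flat Hnu))//.
have mphi : measurable_fun setT ( *%R s : R -> R) by exact: measurable_funM.
have g1 := ge0_integral_powm_density mphi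
  (measurable_scaled_pdf s) (fun x => scaled_pdf_ge0 x s0)
  (fun f mf f0 => ge0_integral_gaussR s0 mf f0).
pose g (t : p.-tuple R) := (\prod_(i < p) scaled_pdf s (tnth t i))%R.
have mg : measurable_fun setT g.
  apply: measurable_prod => i _.
  by apply: (measurableT_comp (measurable_scaled_pdf s)); exact: measurable_tnth.
have g0 t : (0 <= g t)%R by apply: prodr_ge0 => i _; exact: scaled_pdf_ge0.
have E := ge0_integral_powm_density (@measurable_tmap _ _ _ _ p _ mphi) mg g0 (g1 p)
  (n := q) mff (fun=> f0 _).
exact: E.
Qed.

Lemma scaled_block_flat n (t : (n.+1 * n.+1).-tuple R) : (p <= n.+1)%N -> (q <= n.+1)%N ->
  scaled_block p q t =
  flat (map_tuple (map_tuple ( *%R (Num.sqrt n.+1%:R))) (mxblk p q (mx_of_tuple t))).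
Proof.
move=> pn qn; apply: eq_from_tnth => k; rewrite !tnth_mktuple !tnth_map /mxblk.
rewrite !tnth_ord_tuple mxE !inordK//.
- exact: leq_trans (ltn_ord (flat_col k)) qn.
- exact: leq_trans (ltn_ord (flat_row k)) pn.
Qed.

End flatten.

End gaussian_block.

Section entry_second_moment.
Context (R : realType) (n : nat).
Variable h : probability ((n.+1 * n.+1).-tuple R) R.
Hypothesis Hh : is_haar_On h.

Lemma haar_expect_entry_sqr i j : haar_expect h (fun M => M i j ^+ 2) = n.+1%:R^-1.
Proof.
have b l : bounded_mx (fun M : 'M[R]_n.+1 => M l j ^+ 2).
  by apply: bounded_mxX; exact: bounded_mx_entry.
have eqE l : haar_expect h (fun M => M l j ^+ 2) = haar_expect h (fun M => M i j ^+ 2).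
  rewrite -(haar_expect_left Hh (orthogonal_mx_perm R (tperm i l)))//.
  by congr haar_expect; apply/funext => M; rewrite -row_permE mxE tpermR.
have : \sum_l haar_expect h (fun M => M l j ^+ 2) = 1.
  rewrite -(haar_expect_sum Hh)// -(haar_expect_cst h 1).
  apply: (eq_haar_expect Hh) => //.
  - exact: bounded_mx_sum.
  - exact: bounded_mx_cst.
  move=> M oM; have := orthogonal_mx_cols j j oM; rewrite eqxx => E; apply: etrans E.
  by apply: eq_bigr => l _; rewrite expr2.
rewrite (eq_bigr (fun=> haar_expect h (fun M => M i j ^+ 2))); last by move=> l _; exact: eqE.
rewrite sumr_const card_ord => h1.
have n0 : n.+1%:R != 0 :> R by rewrite pnatr_eq0.
by rewrite -[LHS](mulfK n0) mulr_natr h1 div1r.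
Qed.

End entry_second_moment.

Section KL_block.
Context (R : realType) (hh : forall n, probability ((n.+1 * n.+1).-tuple R) R).
Hypothesis Hh : forall n, is_haar_On (hh n).
Variables (n p q : nat) (mu nu : probability ((p * q).-tuple R) R).
Hypotheses (pqn : (p + q <= n)%N) (Hmu : is_law_of_scaled_block (hh n) mu)
  (Hnu : is_std_gaussian nu).
Notation mxt := (@mx_of_tuple R _).
Notation N := (n.+1%:R : R).
Notation k := (n - p - q)%N.
Local Open Scope ereal_scope.

Let sumsq (z : q.-tuple (p.-tuple R)) : R :=
  (\sum_(j < q) \sum_(i < p) tnth (tnth z j) i ^+ 2)%R.

Let sumsq_ge0 z : (0 <= sumsq z)%R.
Proof. by apply: sumr_ge0 => j _; apply: sumr_ge0 => i _; exact: sqr_ge0. Qed.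

Let measurable_sumsq : measurable_fun setT sumsq.
Proof.
apply: measurable_sum => j; apply: measurable_sum => i; apply: measurable_funX.
by apply: (measurableT_comp (@measurable_tnth _ R p i)); exact: measurable_tnth.
Qed.

Let mean_sumsq : \int[@lebtt R p q]_B ((N / 2 * sumsq (blkX B))%:E * (blkpdf B n)%:E) =
  ((p * q)%:R / 2)%:E.
Proof.
have mF : measurable_fun setT (fun z : q.-tuple (p.-tuple R) => (N / 2 * sumsq z)%:E : \bar R).
  by apply/measurable_EFinP; exact: measurable_funM.
have F0 z : 0 <= (N / 2 * sumsq z)%:E :> \bar R by rewrite lee_fin mulr_ge0.
rewrite -(haar_block Hh pqn mF F0).
have b (i j : nat) : bounded_mx (fun M : 'M[R]_n.+1 => M (inord i) (inord j) ^+ 2)%R.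
  by apply: bounded_mxX; exact: bounded_mx_entry.
transitivity (\int[hh n]_t (N / 2 * \sum_(j < q) \sum_(i < p)
    mxt t (inord i) (inord j) ^+ 2)%:E).
  apply: eq_integral => t _; congr (_ * _)%:E.
  by apply: eq_bigr => j _; apply: eq_bigr => i _; rewrite !tnth_mktuple.
have bs : bounded_mx (fun M : 'M[R]_n.+1 =>
    \sum_(j < q) \sum_(i < p) M (inord i) (inord j) ^+ 2)%R.
  by apply: bounded_mx_sum => j; exact: bounded_mx_sum.
rewrite (haar_expectE (Hh n) (F := fun M => (N / 2 * \sum_(j < q) \sum_(i < p)
    M (inord i) (inord j) ^+ 2)%R)); last exact: bounded_mxZ.
rewrite (haar_expectZ (Hh n))// (haar_expect_sum (Hh n)); last by move=> j; exact: bounded_mx_sum.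
under eq_bigr => j _ do rewrite (haar_expect_sum (Hh n))//.
under eq_bigr => j _ do under eq_bigr => i _ do rewrite (haar_expect_entry_sqr (Hh n)).
rewrite !sumr_const !card_ord -mulrnA -[(N^-1 *+ _)%R]mulr_natl; congr EFin.
by field; rewrite nat1r pnatr_eq0.
Qed.

(** The four terms are the mean of the Gaussian exponent [N / 2 * sumsq], where each squared entry
    has mean [N^-1], the constants of the Haar density, the normalisation of the Gaussian density,
    and the mean of the quadratic terms in [blkG]. *)
Lemma KL_div_scaled_block_le : KL_div mu nu <=
  ((p * q)%:R / 2 + \sum_(j < q) \sum_(i < p) logcst R k (n - j - i)
   - (p * q)%:R * (ln (N / (2 * pi)) / 2)
   - \sum_(j < q) \sum_(i < p) k%:R / 2 / (n - j - i)%:R)%:E.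
Proof.
set K := (\sum_(j < q) \sum_(i < p) logcst R k _)%R; set k2 := (\sum_(j < q) _)%R.
set c := (ln (N / (2 * pi)) / 2)%R; pose K' := (K - (p * q)%:R * c)%R.
pose s := Num.sqrt N.
have s0 : (0 < s)%R by rewrite sqrtr_gt0 ltr0n.
have s2 : (s ^+ 2 = N)%R by rewrite sqr_sqrtr.
pose sc (z : q.-tuple (p.-tuple R)) := map_tuple (map_tuple ( *%R s)) z.
have msc : measurable_fun setT sc.
  by apply: measurable_tmap; apply: measurable_tmap; exact: measurable_funM.
pose Phi B := flat (sc (@blkX R p q B)).
have mPhi0 : measurable_fun setT (fun z => flat (sc z)).
  exact: (measurableT_comp (@measurable_flat R p q) msc).
have mPhi : measurable_fun setT Phi := measurableT_comp mPhi0 (@measurable_blkX R p q).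
pose gam (z : q.-tuple (p.-tuple R)) : R :=
  (\prod_(j < q) \prod_(i < p) scaled_pdf s (tnth (tnth z j) i))%R.
have gamE z : gam z = expR ((p * q)%:R * c - N / 2 * sumsq z).
  rewrite /gam; under eq_bigr => j _ do under eq_bigr => i _ do rewrite scaled_pdfE// s2 -/c.
  under eq_bigr => j _ do rewrite -expR_sum.
  rewrite -expR_sum; congr expR.
  under eq_bigr => j _ do rewrite sumrB sumr_const card_ord -mulr_sumr.
  by rewrite sumrB sumr_const card_ord -mulr_sumr -mulrnA mulr_natl.
have mgam : measurable_fun setT gam.
  rewrite (_ : gam = fun z => expR ((p * q)%:R * c - N / 2 * sumsq z)); last exact/funext.
  apply: measurableT_comp; first exact: measurable_expR.
  by apply: measurable_funB => //; exact: measurable_funM.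
have gam0 z : (0 <= gam z)%R by rewrite gamE expR_ge0.
pose tau (B : q.-tuple (p.-tuple R)) := (blkjac B * gam (blkX B))%R.
(* The sign of the constant [K'] is unknown, so its positive part goes into [g1] and its negative
   part into [g2]. *)
pose g1 (B : q.-tuple (p.-tuple R)) := (N / 2 * sumsq (blkX B) + Num.max K' 0)%R.
pose g2 (B : q.-tuple (p.-tuple R)) := (blkG k B n + Num.max (- K') 0)%R.
have max0 (x : R) : (0 <= Num.max x 0)%R by rewrite le_max lexx orbT.
have mS : measurable_fun setT (fun B : q.-tuple (p.-tuple R) => N / 2 * sumsq (blkX B))%R.
  by apply: measurable_funM => //; exact: (measurableT_comp measurable_sumsq (@measurable_blkX R p q)).
have mG : measurable_fun setT (fun B : q.-tuple (p.-tuple R) => blkG k B n).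
  exact: measurable_blkG.
have split_max (f : q.-tuple (p.-tuple R) -> R) (a x : R) : measurable_fun setT f ->
    (forall B, (0 <= f B)%R) -> (0 <= x)%R ->
    \int[@lebtt R p q]_B ((f B)%:E * (blkpdf B n)%:E) = a%:E ->
    \int[@lebtt R p q]_B ((f B + x)%:E * (blkpdf B n)%:E) = (a + x)%:E.
  move=> mf f0 x0 fa.
  under eq_integral do rewrite EFinD ge0_muleDl ?lee_fin//.
  rewrite ge0_integralD//; first last.
  - by apply: emeasurable_funM => //; apply/measurable_EFinP; exact: measurable_blkpdf.
  - by move=> B _; rewrite mule_ge0 ?lee_fin ?blkpdf_ge0.
  - by apply: emeasurable_funM; apply/measurable_EFinP => //; exact: measurable_blkpdf.
  - by move=> B _; rewrite mule_ge0 ?lee_fin ?blkpdf_ge0.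
  rewrite fa ge0_integralZl//; first last.
  - by move=> B _; rewrite lee_fin blkpdf_ge0.
  - by apply/measurable_EFinP; exact: measurable_blkpdf.
  by rewrite integral_blkpdf mule1 EFinD.
have k1E := split_max _ _ _ mS (fun B => mulr_ge0 (divr_ge0 (ler0n _ _) (ler0n _ _)) (sumsq_ge0 _))
  (max0 K') mean_sumsq.
have k2E := split_max _ _ _ mG (fun B => blkG_ge0 k B n) (max0 (- K')%R) (integral_blkG R k pqn).
have -> : ((p * q)%:R / 2 + K - (p * q)%:R * c - k2 =
    ((p * q)%:R / 2 + Num.max K' 0) - (k2 + Num.max (- K') 0))%R.
  have : (Num.max K' 0 = K' + Num.max (- K') 0)%R by rewrite addr_maxr subrr addr0 maxC.
  by rewrite /K'; lra.
apply: (@KL_div_le_change_of_variables _ _ _ _ _ mu nu (@lebtt R p q) Phi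
  (fun B => blkpdf B n) tau g1 g2 ((p * q)%:R / 2 + Num.max K' 0)%R (k2 + Num.max (- K') 0)%R
  mPhi (@measurable_blkpdf R p q n)) => //.
- apply: measurable_funM; first exact: measurable_blkjac.
  exact: (measurableT_comp mgam (@measurable_blkX R p q)).
- exact: measurable_funD.
- exact: measurable_funD.
- by move=> B; exact: blkpdf_ge0.
- by move=> B; rewrite mulr_ge0 ?blkjac_ge0.
- by move=> B; rewrite addr_ge0 ?mulr_ge0.
- by move=> B; rewrite addr_ge0 ?blkG_ge0.
- move=> f mf f0.
  rewrite (@ge0_integral_map _ _ _ _ _ (@scaled_block R n.+1 p q) (hh n) mu
    (@measurable_scaled_block R n p q) Hmu)//.
  rewrite -(haar_block Hh pqn (measurableT_comp mf mPhi0) (fun z => f0 _)).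
  apply: eq_integral => t _; rewrite /= scaled_block_flat//; apply: leqW; lia.
- move=> f mf f0; rewrite (ge0_integral_gaussian_flat Hnu s0 mf f0).
  pose F z := f (flat (sc z)) * (gam z)%:E.
  have mF : measurable_fun setT F.
    apply: emeasurable_funM; last exact/measurable_EFinP.
    exact: (measurableT_comp mf mPhi0).
  apply: le_trans (integral_blkX_le mF _); last by move=> z; rewrite mule_ge0// lee_fin.
  rewrite le_eqVlt; apply/orP; left; apply/eqP; apply: eq_integral => B _.
  by rewrite /F /tau -muleA -EFinM [(gam _ * _)%R]mulrC.
- move=> B; have nE : n = (k + p + q)%N by lia.
  apply: le_trans (blkpdf_le B nE) _.
  rewrite /tau -mulrA gamE -expRD ler_wpM2l ?blkjac_ge0// ler_expR -/K /g1 /g2.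
  have : (Num.max K' 0 = K' + Num.max (- K') 0)%R by rewrite addr_maxr subrr addr0 maxC.
  by rewrite /K'; lra.
Qed.

End KL_block.

(** * The rate of convergence *)

Section log_sums.
Context (R : realType).
Implicit Types (f : R -> R) (a x : R).

Lemma telescope_sub f a q :
  \sum_(j < q) (f (a - j%:R) - f (a - j%:R - 1)) = f a - f (a - q%:R).
Proof.
elim: q => [|q IH]; first by rewrite big_ord0 subr0 subrr.
have -> : a - q.+1%:R = a - q%:R - 1 by rewrite -natr1 opprD addrA.
by rewrite big_ord_recr/= IH; ring.
Qed.

Definition dln x : R := ln x - ln (x - 1).

Lemma dln_ge x : 1 < x -> x^-1 <= dln x.
Proof.
move=> x1; have x0 : 0 < x by lra.
rewrite /dln -ln_div ?posrE//; last lra.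
rewrite -[leLHS]opprK -[leRHS]opprK lerN2 -lnV ?posrE ?divr_gt0//; last lra.
rewrite (_ : (x / (x - 1))^-1 = 1 + - x^-1); last by field; rewrite !gt_eqF//; lra.
by rewrite le_ln1Dx// ltrN2 invf_lt1.
Qed.

Lemma dln_le x : 1 < x -> dln x <= (x - 1)^-1.
Proof.
move=> x1; have x0 : 0 < x by lra.
rewrite /dln -ln_div ?posrE//; last lra.
rewrite (_ : x / (x - 1) = 1 + (x - 1)^-1); last by field; rewrite !gt_eqF//; lra.
have : 0 < (x - 1)^-1 by rewrite invr_gt0; lra.
by move=> ?; rewrite le_ln1Dx//; lra.
Qed.

Lemma dlnB_le x y : 0 <= y -> y + 1 < x -> dln (x - y) - dln x <= y / ((x - y - 1) * x).
Proof.
move=> y0 yx; have x0 : 0 < x by lra.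
have [e1 e2 e3] : [/\ 0 < x - y, 0 < x - y - 1 & 0 < x - 1] by split; lra.
have -> : dln (x - y) - dln x = ln (1 + y / ((x - y - 1) * x)).
  rewrite (_ : 1 + _ = ((x - y) / (x - y - 1)) / (x / (x - 1))); last first.
    by field; rewrite !gt_eqF.
  by rewrite /dln !ln_div ?posrE ?divr_gt0.
have : 0 <= y / ((x - y - 1) * x) by apply: divr_ge0 => //; apply: mulr_ge0; exact: ltW.
by move=> ?; rewrite le_ln1Dx//; lra.
Qed.

(** Abel summation: [dln (x - i)] is counted once for every later index. *)
Lemma sum_ln_by_parts x r :
  \sum_(i < r) (ln (x - i%:R) - ln x) = - \sum_(i < r) (r%:R - 1 - i%:R) * dln (x - i%:R).
Proof.
elim: r => [|r IH]; first by rewrite !big_ord0 oppr0.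
rewrite big_ord_recr [in RHS]big_ord_recr/= IH -natr1 addrK subrr mul0r addr0.
have -> : \sum_(i < r) (r%:R - i%:R) * dln (x - i%:R) =
    \sum_(i < r) (r%:R - 1 - i%:R) * dln (x - i%:R) + \sum_(i < r) dln (x - i%:R).
  by rewrite -big_split; apply: eq_bigr => i _ /=; ring.
by rewrite (telescope_sub (@ln R)); ring.
Qed.

(** Telescoping in [j] leaves [p + 1 - i] times a sum of [dln] and a sum of [ln (N - i) - ln N].
    Summing the latter by parts gives [dln (N - i)] with weight [p - 1 - i], so only differences of
    [dln], of order [q / N ^+ 2], and twice a sum of [dln], of order [1 / N], survive. *)
Lemma sum_log_ratio_le (N : R) (p q : nat) : 0 < N -> 2 * (p + q)%:R <= N ->
  \sum_(j < q) \sum_(i < p) (1 + ln (N - i%:R - j%:R - 1) - ln N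
     - (N - 1 - p%:R - q%:R) * dln (N - i%:R - j%:R)) <=
  4 * ((p * q)%:R / N) ^+ 2 + 4 * ((p * q)%:R / N).
Proof.
move=> N0; rewrite natrD => pqN; set k := N - 1 - p%:R - q%:R.
have ip (i : 'I_p) : i%:R + 1 <= p%:R :> R by rewrite natr1 ler_nat ltn_ord.
have jq (j : 'I_q) : j%:R + 1 <= q%:R :> R by rewrite natr1 ler_nat ltn_ord.
have i0 (i : nat) : 0 <= i%:R :> R by [].
(* A discrete primitive: since [M * dln M >= 1], the summand is at most an increment of [g] minus
   [ln N]. *)
pose g x := x * ln x - k * ln x.
rewrite exchange_big/=.
have step1 (i : 'I_p) (j : 'I_q) : 1 + ln (N - i%:R - j%:R - 1) - ln N -
    k * dln (N - i%:R - j%:R) <=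
    g (N - i%:R - j%:R) - g (N - i%:R - j%:R - 1) - ln N.
  have := ip i; have := jq j; have := i0 i; have := i0 j => *.
  set M := N - i%:R - j%:R; have M1 : 1 < M by rewrite /M; lra.
  have := dln_ge M1; rewrite -[M^-1]mul1r ler_pdivrMr; last lra.
  rewrite /g /dln; clearbody k M; move: (ln M) (ln (M - 1)) (ln N) => A B C; nra.
(* The weight [p + 1 - i] is written as [(p - 1 - i) + 2], the first part being matched by the
   summation by parts. *)
apply: (@le_trans _ _ (\sum_(i < p) \sum_(j < q)
   ((p%:R - 1 - i%:R) * (dln (N - i%:R - j%:R) - dln (N - i%:R)) + 2 * dln (N - i%:R - j%:R)))).
  apply: (@le_trans _ _ (\sum_(i < p) \sum_(j < q)
      (g (N - i%:R - j%:R) - g (N - i%:R - j%:R - 1) - ln N))).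
    by apply: ler_sum => i _; apply: ler_sum => j _; exact: step1.
  rewrite le_eqVlt; apply/orP; left; apply/eqP.
  transitivity (\sum_(i < p) ((p%:R + 1 - i%:R) * \sum_(j < q) dln (N - i%:R - j%:R)
      + q%:R * (ln (N - i%:R) - ln N))).
    apply: eq_bigr => i _; rewrite sumrB telescope_sub (telescope_sub (@ln R)).
    rewrite sumr_const card_ord -[_ *+ q]mulr_natl /g /k; ring.
  rewrite big_split/= -mulr_sumr sum_ln_by_parts mulrN mulr_sumr -sumrB.
  apply: eq_bigr => i _.
  rewrite [RHS]big_split/= -!mulr_sumr [X in _ = _ * X + _]sumrB sumr_const card_ord.
  by rewrite -[_ *+ q]mulr_natl; ring.
apply: (@le_trans _ _ (\sum_(i < p) \sum_(j < q) (4 * (p * q)%:R / N ^+ 2 + 4 / N))); last first.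
  rewrite !sumr_const !card_ord -mulrnA -mulr_natl mulnC [(q * p)%N]mulnC.
  rewrite le_eqVlt; apply/orP; left; apply/eqP; field; exact: lt0r_neq0.
apply: ler_sum => i _; apply: ler_sum => j _.
have := ip i; have := jq j; have := i0 i; have := i0 j => j0' i0' jq' ip'.
have x1 : 1 < N - i%:R - j%:R by lra.
have h1 : 2 * dln (N - i%:R - j%:R) <= 4 / N.
  have := dln_le x1; have : (N - i%:R - j%:R - 1)^-1 <= (N / 2)^-1.
    by rewrite lef_pV2 ?posrE//; lra.
  by rewrite invf_div; lra.
have h2 : (p%:R - 1 - i%:R) * (dln (N - i%:R - j%:R) - dln (N - i%:R)) <=
    4 * (p * q)%:R / N ^+ 2.
  have y1 : j%:R + 1 < N - i%:R by lra.
  apply: (@le_trans _ _ (p%:R * (q%:R * ((N / 2) * (N / 2))^-1))); last first.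
    by rewrite natrM le_eqVlt; apply/orP; left; apply/eqP; field; exact: lt0r_neq0.
  apply: (@le_trans _ _ ((p%:R - 1 - i%:R) * (j%:R / ((N - i%:R - j%:R - 1) * (N - i%:R))))).
    by rewrite ler_wpM2l ?dlnB_le//; lra.
  apply: ler_pM; [lra| | lra |].
    by rewrite divr_ge0// mulr_ge0; lra.
  apply: ler_pM => //; [rewrite invr_ge0 mulr_ge0; lra|lra|].
  rewrite lef_pV2 ?posrE ?mulr_gt0//; try lra.
  by apply: ler_pM; lra.
by apply: lerD.
Qed.

End log_sums.

Section KL_rate.
Context (R : realType) (hh : forall n, probability ((n.+1 * n.+1).-tuple R) R).
Hypothesis Hh : forall n, is_haar_On (hh n).

(** The Wallis bound [2 * pi / m] on the squared normalising constant enters here. Its [2 * pi]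
    cancels the one of the Gaussian density. *)
Lemma logcst_le (k m : nat) : (1 < m)%N ->
  logcst R k m <= 2^-1 * (ln m%:R - ln (2 * pi)) + k%:R / 2 * (ln m%:R - ln m.+1%:R)
    + k%:R / 2 / m%:R.
Proof.
move=> m1; have m0 : 0 < m%:R :> R by rewrite ltr0n; exact: ltnW.
have p0 : 0 < 2 * pi :> R by rewrite mulr_gt0// pi_gt0.
have Z0 := cocos_moment_gt0 R (m - 2).
have := cocos_moment_sqr_ge R (m - 2); rewrite subnK// => Zge.
have : ln (2 * pi / m%:R) <= ln (cocos_moment R 0 (m - 2) ^+ 2).
  by rewrite ler_ln ?posrE ?divr_gt0 ?exprn_gt0.
rewrite lnXn// ln_div ?posrE// -mulr_natr => lnZ.
rewrite /logcst ln_div ?posrE//; lra.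
Qed.

Lemma KL_div_scaled_block_rate n p q (mu nu : probability ((p * q).-tuple R) R) :
  (2 * (p + q) <= n.+1)%N -> (0 < p)%N -> (0 < q)%N ->
  is_law_of_scaled_block (hh n) mu -> is_std_gaussian nu ->
  (KL_div mu nu <= (2 * ((p * q)%:R / n.+1%:R) ^+ 2 + 2 * ((p * q)%:R / n.+1%:R))%:E)%E.
Proof.
move=> pqn p0 q0 Hmu Hnu.
have pqn1 : (p + q <= n)%N by lia.
apply: le_trans (KL_div_scaled_block_le Hh pqn1 Hmu Hnu) _; rewrite lee_fin.
set N : R := n.+1%:R; set k := (n - p - q)%N.
have N0 : 0 < N by rewrite ltr0n.
have pi0 : 0 < 2 * pi :> R by rewrite mulr_gt0// pi_gt0.
have pqN : 2 * (p + q)%:R <= N by rewrite -natrM ler_nat.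
have := sum_log_ratio_le N0 pqN.
have kE : k%:R = N - 1 - p%:R - q%:R :> R.
  by rewrite /k -subnDA natrB// natrD /N -natr1; ring.
set S := (X in X <= _ -> _) => Sle.
(* Entry by entry the bound of [logcst_le] with [m = N - i - j - 1] equals the summand on the right.
   Halving the estimate of [sum_log_ratio_le] then produces the constants 2. *)
have main : \sum_(j < q) \sum_(i < p) logcst R k (n - j - i)
    <= \sum_(j < q) \sum_(i < p) (k%:R / 2 / (n - j - i)%:R) + S / 2
       + (p * q)%:R * (ln (N / (2 * pi)) / 2) - (p * q)%:R / 2.
  rewrite -[leRHS]addrA.
  have -> : (p * q)%:R * (ln (N / (2 * pi)) / 2) - (p * q)%:R / 2 =
      \sum_(j < q) \sum_(i < p) (ln (N / (2 * pi)) / 2 - 2^-1).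
    rewrite !sumr_const !card_ord -mulrnA -[RHS]mulr_natl; ring.
  rewrite /S mulr_suml -!big_split/=; apply: ler_sum => j _.
  rewrite mulr_suml -!big_split/=; apply: ler_sum => i _.
  have ij : (i + j < n)%N by have := ltn_ord i; have := ltn_ord j; lia.
  have m1 : (1 < n - j - i)%N by have := ltn_ord i; have := ltn_ord j; lia.
  apply: le_trans (logcst_le k m1) _.
  have mE : (n - j - i)%:R = N - i%:R - j%:R - 1 :> R.
    by rewrite -subnDA natrB ?natrD 1?addnC 1?ltnW// /N -natr1; ring.
  have mE1 : (n - j - i).+1%:R = N - i%:R - j%:R by rewrite -[LHS]natr1 mE subrK.
  rewrite mE1 mE ln_div ?posrE// kE /dln.
  move: (ln (N - i%:R - j%:R - 1)) (ln (N - i%:R - j%:R)) (ln N) (ln (2 * pi))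
    ((N - i%:R - j%:R - 1)^-1) => A B C D E.
  by lra.
move: main Sle; move: S (\sum_(j < q) \sum_(i < p) logcst R k (n - j - i))
  (\sum_(j < q) \sum_(i < p) k%:R / 2 / (n - j - i)%:R) ((p * q)%:R * (ln (N / (2 * pi)) / 2))
  (((p * q)%:R / N) ^+ 2) ((p * q)%:R / N) ((p * q)%:R / 2) => S A B C D E F.
by lra.
Qed.

End KL_rate.

Lemma sqr_add_cvg0 (R : realType) (s : nat -> R) : s @ \oo --> (0 : R) ->
  (fun n => 2 * s n ^+ 2 + 2 * s n) @ \oo --> (0 : R).
Proof.
move=> s0; rewrite -[X in _ --> X](_ : 2 * (0 * 0) + 2 * 0 = 0 :> R); last by ring.
apply: cvgD; last by apply: cvgMr.
apply: cvgMr; under eq_fun do rewrite expr2.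
exact: cvgM.
Qed.

Lemma cvg_prob_dist0 (R : realType) (p q : nat -> nat)
  (Hpq : forall n : nat, (0 < n)%N -> (1 <= p n <= n)%N /\ (1 <= q n <= n)%N)
  (h : forall n : nat, probability ((n * n).-tuple R) R)
  (Hh : forall n : nat, (0 < n)%N -> is_haar_On (h n))
  (mu : forall n : nat, probability ((p n * q n).-tuple R) R)
  (Hmu : forall n : nat, (0 < n)%N -> is_law_of_scaled_block (h n) (mu n))
  (nu : forall n : nat, probability ((p n * q n).-tuple R) R)
  (Hnu : forall n : nat, (0 < n)%N -> is_std_gaussian (nu n))
  (k : dist_kind) :
  (fun n : nat => ((p n * q n)%:R / n%:R : R)) @ \oo --> (0 : R) ->
  (fun n : nat => prob_dist k (mu n) (nu n)) @ \oo --> 0%E.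
Proof.
move=> s0; pose s n : R := (p n * q n)%:R / n%:R.
have KLN N P Q (mun nun : probability ((P * Q).-tuple R) R) : (0 < N)%N ->
    is_law_of_scaled_block (h N) mun -> is_std_gaussian nun ->
    (2 * (P + Q) <= N)%N -> (0 < P)%N -> (0 < Q)%N ->
    (KL_div mun nun <= (2 * ((P * Q)%:R / N%:R) ^+ 2 + 2 * ((P * Q)%:R / N%:R))%:E)%E.
  case: N => // N _ Hmun Hnun PQ P0 Q0.
  exact: (@KL_div_scaled_block_rate R (fun n => h n.+1) (fun n => Hh n.+1 isT)
    N P Q mun nun PQ P0 Q0 Hmun Hnun).
have KL n : (0 < n)%N -> (2 * (p n + q n) <= n)%N ->
    (prob_dist k (mu n) (nu n) <= (dist_upper k (2 * s n ^+ 2 + 2 * s n))%:E)%E.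
  move=> n_gt0 pqn; apply: prob_dist_le.
  have [/andP[p0 _] /andP[q0 _]] := Hpq _ n_gt0.
  by apply: KLN => //; [exact: Hmu|exact: Hnu].
have up0 : (fun n => (dist_upper k (2 * s n ^+ 2 + 2 * s n))%:E) @ \oo --> 0%E.
  by apply: cvg_EFin; [exact: nearW|exact: dist_upper_cvg0 (sqr_add_cvg0 s0)].
apply: (squeeze_cvge _ (@cvg_cst _ _ _ _ _) up0).
near=> n; rewrite prob_dist_ge0/=.
have n8 : (8 <= n)%N by near: n; exists 8%N.
have n0 : (0 < n)%N by exact: leq_trans n8.
apply: KL => //.
have s4 : s n < 4^-1 by near: n; apply: (cvgr_lt _ s0); rewrite invr_gt0.
have [/andP[p0 _] /andP[q0 _]] := Hpq _ n0.
(* Since [p] and [q] are at least 1, [p + q <= p * q + 1]; this inequality and [n >= 8] then give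
   [2 * (p + q) <= n]. *)
have : (4 * (p n * q n) < n)%N.
  rewrite -(ltr_nat R) natrM; move: s4; rewrite /s ltr_pdivrMr ?ltr0n//; lra.
nia.
Unshelve. all: by end_near. Qed.

Theorem theorem1p1 (R : realType) (p q : nat -> nat)
  (Hpq : forall n : nat, (0 < n)%N ->
           (1 <= p n <= n)%N /\ (1 <= q n <= n)%N)
  (h : forall n : nat, probability ((n * n).-tuple R) R)
  (Hh : forall n : nat, (0 < n)%N -> is_haar_On (h n))
  (mu : forall n : nat, probability ((p n * q n).-tuple R) R)
  (Hmu : forall n : nat, (0 < n)%N -> is_law_of_scaled_block (h n) (mu n))
  (nu : forall n : nat, probability ((p n * q n).-tuple R) R)
  (Hnu : forall n : nat, (0 < n)%N -> is_std_gaussian (nu n))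
  (k : dist_kind) :
  ((fun n : nat => ((p n * q n)%:R / n%:R : R)) @ \oo --> 0 ->
     (fun n : nat => prob_dist k (mu n) (nu n)) @ \oo --> 0%E)
  /\
  (forall sigma : R, 0 < sigma ->
     (fun n : nat => ((p n * q n)%:R / n%:R : R)) @ \oo --> (sigma : R^o) ->
     (0 < limn_einf (fun n : nat => prob_dist k (mu n) (nu n)))%E).
Proof.
split=> [s0|sigma sigma0 ssigma].
  exact: (cvg_prob_dist0 Hpq Hh Hmu Hnu k s0).
exact: (liminf_prob_dist_gt0 Hpq Hh Hmu Hnu k sigma0 ssigma).
Qed.
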